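(* Let $I=(n,m,X_1,\ldots,X_m,\tau)$ be an instance of WPPSG and let $\Pi_0,\Pi'_1,\Pi_1,\ldots,\Pi'_m,\Pi_m$ be the sets computed by REDUCE-EXPAND on $X_1,\ldots,X_m$. Each of the following can be done in time $O(mn)$: (1) Given $I$, either report that $I$ is not nice or, if $I$ is nice, compute PQ-trees $T_0,T'_1,T_1,\ldots,T'_m,T_m$ over $[n]$ such that $\mathrm{CONSISTENT}^{-1}(T'_j)=\Pi'_j$ and $\mathrm{CONSISTENT}^{-1}(T_j)=\Pi_j$. (2) Given (nice) $I$ and $T_1,T'_2,T_2,\ldots,T'_m,T_m$ as in (1), compute the description $(\pi_1,\sigma_1,\ldots,\sigma_{m-1})$ of an ascending chain that starts at $I$ and ends at some instance of WPPSG$_0$. (3) Given $I$ and such a description $(\pi_1,\sigma_1,\ldots,\sigma_{m-1})$, compute the instance $I_m$ defined by $I_1=I^{\pi_1}$ and $I_{j+1}=I_j[j,\sigma_j]$ for $j=1,\ldots,m-1$. (4) Decide whether $I_m$ is a YES-instance.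
   Context: $\mathcal{S}_n$ is the symmetric group on $[n]=\{1,\ldots,n\}$, $i\sigma$ is the image of $i$, products are composed left to right, $X\sigma=\{i\sigma:i\in X\}$, $\mathcal{S}_X$ is the subgroup fixing every element outside $X$, and $\sigma$ is identified with $(1\sigma,\ldots,n\sigma)$. An instance of WPPSG is $I=(n,m,X_1,\ldots,X_m,\tau)$ with $X_j\subseteq[n]$, $\tau\in\mathcal{S}_n$; it is a YES-instance iff $\tau=\sigma_1\cdots\sigma_m$ for some $\sigma_j\in\mathcal{S}_{X_j}$. WPPSG$_0$: all $X_j$ are sets of consecutive integers. $I^\pi=(n,m,X_1\pi,\ldots,X_m\pi,\pi^{-1}\tau\pi)$; for $j'\in[m]$, $I[j',\varphi]=(n,m,X'_1,\ldots,X'_m,\tau\varphi)$ with $X'_j=X_j$ for $j\le j'$, $X'_j=X_j\varphi$ for $j>j'$; $X_0=[n]$ and $I[0,\varphi]=I^\varphi$; this is a valid elementary transformation when $\varphi\in\mathcal{S}_{X_{j'}}$ (sets of the current instance). $I$ is nice if a chain of valid elementary transformations leads from $I$ to an instance of WPPSG$_0$. An ascending chain with description $(\pi_1,\sigma_1,\ldots,\sigma_{m-1})$ is $I\to I_1=I^{\pi_1}\to I_2=I_1[1,\sigma_1]\to\cdots\to I_m=I_{m-1}[m-1,\sigma_{m-1}]$ in which every step is a valid elementary transformation (i.e. $\sigma_j\in\mathcal{S}_{Y}$ where $Y$ is the $j$-th set of $I_j$). REDUCE-EXPAND: $\Pi_0=\mathcal{S}_n$; for $j=1,\ldots,m$,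 $\Pi'_j=\{\pi\sigma:\pi\in\Pi_{j-1},\sigma\in\mathcal{S}_{X_{j-1}\pi}\}$ and $\Pi_j=\{\pi\in\Pi'_j:X_j\pi\text{ is a set of consecutive integers}\}$. PQ-trees: a (proper) PQ-tree over $[n]$ is a rooted ordered tree with leaves exactly the elements of $[n]$, each once, and internal nodes labelled P (at least 2 children) or Q (at least 3 children). Equivalent trees arise by permuting children of P-nodes arbitrarily and reversing children of Q-nodes; $\mathrm{CONSISTENT}(T)$ is the set of left-to-right leaf sequences (as permutations) of trees equivalent to $T$, and $\mathrm{CONSISTENT}^{-1}(T)=\{\pi:\pi^{-1}\in\mathrm{CONSISTENT}(T)\}$. *)

(* Defs.v *)
From Stdlib Require Import Permutation.
From mathcomp Require Import all_boot all_fingroup.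

Set Implicit Arguments.
Unset Strict Implicit.
Unset Printing Implicit Defensive.

(* The ground set [n] is 'I_n, i.e. {0, .., n-1}. MathComp permutations
   compose from left to right, [(s * t) i = t (s i)], and [perm_on X s] says
   that s fixes every element outside X. *)

Record instance (n m : nat) := Instance {
  sets : m.-tuple {set 'I_n};
  target : 'S_n
}.

Section Instances.
Variables n m : nat.
Implicit Types (I : instance n m) (X : {set 'I_n}) (phi : 'S_n).

(* X_j, where j = 1, .., m counts from 1 and X_0 is the whole ground set. *)
Definition wset I (j : nat) : {set 'I_n} := nth set0 (setT :: sets I) j.

Definition yes_instance I : Prop :=
  exists2 sigma : 'I_m -> 'S_n,
    forall j, perm_on (tnth (sets I) j) (sigma j) &
    target I = (\prod_(j < m) sigma j)%g.

(* The empty set counts as a set of consecutive integers. *)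
Definition consecutive X : bool :=
  [exists a : 'I_n.+1, exists b : 'I_n.+1, X == [set i : 'I_n | a <= i < b]].

Definition wppsg0 I : Prop := forall j, consecutive (tnth (sets I) j).

Definition conj_instance I phi : instance n m :=
  Instance [tuple phi @: tnth (sets I) i | i < m] (phi^-1 * target I * phi)%g.

(* I[j, phi]; the position i : 'I_m holds the set X_(i+1), hence the strict
   inequality. *)
Definition transform I (j : nat) phi : instance n m :=
  if j is 0 then conj_instance I phi
  else Instance [tuple if i < j then tnth (sets I) i
                       else phi @: tnth (sets I) i | i < m]
                (target I * phi)%g.

Definition valid_step I (j : nat) phi : bool :=
  (j <= m) && perm_on (wset I j) phi.

Inductive nice I : Prop :=
| nice_done of wppsg0 I
| nice_step j phi of valid_step I j phi & nice (transform I j phi).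

(* The description (pi_1, sigma_1, .., sigma_(m-1)) of an ascending chain is
   one m-tuple d: since I[0, phi] = I^phi, its j-th step, j = 0, .., m-1, is
   I_(j+1) = I_j[j, d_j] with I_0 = I. *)
Fixpoint chain_instance I (d : m.-tuple 'S_n) (j : nat) : instance n m :=
  if j is k.+1 then transform (chain_instance I d k) k (nth 1%g d k) else I.

Definition ascending_chain I (d : m.-tuple 'S_n) : Prop :=
  forall j, j < m -> valid_step (chain_instance I d j) j (nth 1%g d j).

Definition ascending_to_wppsg0 I (d : m.-tuple 'S_n) : Prop :=
  ascending_chain I d /\ wppsg0 (chain_instance I d m).

Definition expand X (Pi : {set 'S_n}) : {set 'S_n} :=
  [set (p * s)%g | p in Pi, s in [pred s | perm_on (p @: X) s]].

Fixpoint Pi_ I (j : nat) : {set 'S_n} :=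
  if j is k.+1 then
    [set p in expand (wset I k) (Pi_ I k) | consecutive (p @: wset I k.+1)]
  else setT.

(* Pi'_j, meaningful for j >= 1. *)
Definition Pi'_ I (j : nat) : {set 'S_n} :=
  expand (wset I j.-1) (Pi_ I j.-1).

End Instances.

Inductive pqtree (n : nat) :=
| Leaf of 'I_n
| PNode of seq (pqtree n)
| QNode of seq (pqtree n).

Arguments Leaf {n}.
Arguments PNode {n}.
Arguments QNode {n}.

Section PQTrees.
Variable n : nat.
Implicit Types (t u : pqtree n) (ts us : seq (pqtree n)).

Fixpoint frontier t : seq 'I_n :=
  match t with
  | Leaf i => [:: i]
  | PNode ts | QNode ts => flatten (map frontier ts)
  end.

Fixpoint proper_arities t : bool :=
  match t with
  | Leaf _ => true
  | PNode ts => (2 <= size ts) && all proper_arities ts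
  | QNode ts => (3 <= size ts) && all proper_arities ts
  end.

Definition pqtree_over t : bool :=
  proper_arities t && perm_eq (frontier t) (enum 'I_n).

Inductive pq_equiv : pqtree n -> pqtree n -> Prop :=
| pq_refl t : pq_equiv t t
| pq_trans t1 t2 t3 : pq_equiv t1 t2 -> pq_equiv t2 t3 -> pq_equiv t1 t3
| pq_permute ts us : Permutation ts us -> pq_equiv (PNode ts) (PNode us)
| pq_reverse ts : pq_equiv (QNode ts) (QNode (rev ts))
| pq_inP ts t u us : pq_equiv t u ->
    pq_equiv (PNode (ts ++ t :: us)) (PNode (ts ++ u :: us))
| pq_inQ ts t u us : pq_equiv t u ->
    pq_equiv (QNode (ts ++ t :: us)) (QNode (ts ++ u :: us)).

Definition consistent t (p : 'S_n) : Prop :=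
  exists2 u, pq_equiv t u & frontier u = [seq p i | i <- enum 'I_n].

Definition consistent_inv t (p : 'S_n) : Prop := consistent t p^-1%g.

Definition represents t (Pi : {set 'S_n}) : Prop :=
  pqtree_over t /\ forall p : 'S_n, consistent_inv t p <-> p \in Pi.

End PQTrees.

(* Machine model: a word RAM with w-bit words, programmed by while-programs.
   Addition is modulo 2^w, subtraction is truncated at 0. Every expression
   node and every executed command or test costs one time unit. *)

Inductive expr :=
| ECst of nat
| EReg of nat
| EMem of expr
| EAdd of expr & expr
| ESub of expr & expr.

Inductive cmd :=
| Skip
| Assign of nat & expr
| Store of expr & expr
| Then of cmd & cmd
| If of expr & cmd & cmd
| While of expr & cmd.

Record state := State { register : nat -> nat; memory : nat -> nat }.

Definition update (f : nat -> nat) (a v : nat) : nat -> nat :=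
  fun b => if b == a then v else f b.

Fixpoint ecost (e : expr) : nat :=
  match e with
  | ECst _ | EReg _ => 1
  | EMem e1 => (ecost e1).+1
  | EAdd e1 e2 | ESub e1 e2 => (ecost e1 + ecost e2).+1
  end.

Fixpoint eval (w : nat) (s : state) (e : expr) : nat :=
  match e with
  | ECst k => k %% 2 ^ w
  | EReg x => register s x
  | EMem e1 => memory s (eval w s e1)
  | EAdd e1 e2 => (eval w s e1 + eval w s e2) %% 2 ^ w
  | ESub e1 e2 => eval w s e1 - eval w s e2
  end.

(* [exec w c s t s']: started in s, c halts in s' after t time units. *)
Inductive exec (w : nat) : cmd -> state -> nat -> state -> Prop :=
| exec_skip s : exec w Skip s 1 s
| exec_assign x e s :
    exec w (Assign x e) s (ecost e).+1
         (State (update (register s) x (eval w s e)) (memory s))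
| exec_store a e s :
    exec w (Store a e) s (ecost a + ecost e).+1
         (State (register s) (update (memory s) (eval w s a) (eval w s e)))
| exec_then c1 c2 s1 s2 s3 t1 t2 :
    exec w c1 s1 t1 s2 -> exec w c2 s2 t2 s3 ->
    exec w (Then c1 c2) s1 (t1 + t2) s3
| exec_if_true e c1 c2 s s' t :
    eval w s e <> 0 -> exec w c1 s t s' ->
    exec w (If e c1 c2) s ((ecost e).+1 + t) s'
| exec_if_false e c1 c2 s s' t :
    eval w s e = 0 -> exec w c2 s t s' ->
    exec w (If e c1 c2) s ((ecost e).+1 + t) s'
| exec_while_true e c s1 s2 s3 t1 t2 :
    eval w s1 e <> 0 -> exec w c s1 t1 s2 -> exec w (While e c) s2 t2 s3 ->
    exec w (While e c) s1 ((ecost e).+1 + t1 + t2) s3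
| exec_while_false e c s :
    eval w s e = 0 -> exec w (While e c) s (ecost e).+1 s.

Definition init_state (inp : seq nat) : state :=
  State (fun _ => 0) (fun a => nth 0 inp a).

(* The output starts at the address held by register 0. *)
Definition has_output (s : state) (out : seq nat) : Prop :=
  forall i, i < size out -> memory s (register s 0 + i) = nth 0 out i.

(* One program c and one constant C serve all inputs, and the program has to
   work for every word length w >= log2 N + log2 C; this includes words of
   only log2 N + O(1) bits. *)
Definition runs_within (c : cmd) (C N : nat) (inp : seq nat)
    (post : seq nat -> Prop) : Prop :=
  forall w, C * N <= 2 ^ w ->
  exists t s' out,
    [/\ exec w c (init_state inp) t s', t <= C * N, has_output s' out
      & post out].

Definition enc_set n (X : {set 'I_n}) : seq nat :=
  [seq nat_of_bool (i \in X) | i <- enum 'I_n].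

Definition enc_perm n (p : 'S_n) : seq nat :=
  [seq nat_of_ord (p i) | i <- enum 'I_n].

Definition enc_instance n m (I : instance n m) : seq nat :=
  [:: n; m] ++ flatten [seq enc_set X | X <- sets I] ++ enc_perm (target I).

Definition enc_description n m (d : m.-tuple 'S_n) : seq nat :=
  flatten [seq enc_perm p | p <- d].

(* Preorder listing: a tag, then the leaf or the number of children. *)
Fixpoint enc_tree n (t : pqtree n) : seq nat :=
  match t with
  | Leaf i => [:: 0; nat_of_ord i]
  | PNode ts => [:: 1, size ts & flatten (map (@enc_tree n) ts)]
  | QNode ts => [:: 2, size ts & flatten (map (@enc_tree n) ts)]
  end.

(* The trees T_k, T'_(k+1), T_(k+1), .., T'_m, T_m. *)
Definition enc_trees n (T' T : nat -> pqtree n) (k m : nat) : seq nat :=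
  enc_tree (T k) ++
  flatten [seq enc_tree (T' j) ++ enc_tree (T j) | j <- index_iota k.+1 m.+1].

(* Main.v *)
(** Programs are written in a small language whose registers hold pairs and
    numbers; it is compiled to the word RAM once and for all, with constant
    overhead, the heap and the arrays lying behind the input.

    A PQ-tree is identified with the language of its frontiers, so that
    reducing a tree by a colour class X means intersecting the language with
    the words in which X is contiguous.  The reduction is computed bottom-up:
    every subtree is empty, full or partial, a partial one with a list of its
    empty trees followed by its full trees.  At the root of the pertinent part
    the children read E F E' with the full trees F in the middle; replacing F
    by one P-node over the leaves of X gives the expanded tree.  As proper
    trees with n leaves have O(n) nodes, every round takes O(n) steps.

    Conversely a word of the expanded tree is turned into a word of the reduced
    one by rewriting the block of X in the order of the frontier of F or its
    reverse, which one being decided by the position of one leaf of E or E'.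
    Going from a word of the last tree back to the first yields permutations
    pi_1, .., pi_m, and the quotients pi_j^-1 pi_(j+1) describe an ascending
    chain. An instance with consecutive sets is decided greedily. *)

Require Import Defs.
From Stdlib Require Import Permutation.
From mathcomp Require Import all_boot all_fingroup zify.

Set Implicit Arguments.
Unset Strict Implicit.
Unset Printing Implicit Defensive.

(** * A while-language over cons cells, compiled to the word RAM *)

(** Multiplying [pi] by permutations of [X_j pi] rearranges the block of [X_j] in the word of [pi]
    and nothing else. In a reduced tree the inner order of the block is tied to its surroundings by
    the core alone, and only through a common reversal. Forgetting the inner order therefore leaves
    a PQ-tree, and a single leaf beside the block is enough to undo the loss.

    Niceness admits steps in any order. A step at [j] moves only the sets behind [j] and is absorbed
    into the permutations attached to them; so each chain yields one permutation per set, which is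
    the content of an ascending chain.

    The greedy decision is correct because products of interval subgroups are closed downwards in
    Bruhat order: sorting the tokens of the first interval never destroys a solution.

    Words may have only log2 of [m * n] plus [O(1)] bits, and the machine cannot multiply. Numbers
    and memory must hence stay linear in the running time, which dictates the cost model of the
    auxiliary language and lets row offsets advance by increments only. *)

Inductive datum := VN of nat | VP of datum & datum.

(* [XArr a e f] and [XIn e f] read cell e + f of array a and of the input:
   sums are only formed inside addresses, so that the numbers stored in
   registers grow by at most one per time unit. *)
Inductive xp :=
| XC of nat
| XR of nat
| XFst of xp
| XSnd of xp
| XInc of xp
| XSub of xp & xp
| XArr of nat & xp & xp
| XIn of xp & xp.

Inductive hc :=
| HSkip
| HSet of nat & xp
| HCons of nat & xp & xp
| HPut of nat & xp & xp & xp
| HSeq of hc & hc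
| HIf of xp & hc & hc
| HWhile of xp & hc.

Record hst := HSt { hr : nat -> datum; ha : nat -> nat -> nat }.

(* The cost of a constant is its value, hence values are bounded by time. *)
Fixpoint xcost (e : xp) : nat :=
  match e with
  | XC k => k.+1
  | XR _ => 1
  | XFst e | XSnd e | XInc e => (xcost e).+1
  | XSub e f | XIn e f => (xcost e + xcost f).+1
  | XArr a e f => (a + xcost e + xcost f).+1
  end.

Definition vadd (u v : option datum) : option nat :=
  match u, v with Some (VN a), Some (VN b) => Some (a + b) | _, _ => None end.

Definition truthy (v : datum) : bool := if v is VN 0 then false else true.

Section HighLevel.
Variable inp : seq nat.

(** A component of a number and arithmetic on a pair are undefined. An execution is thereby a
    certificate that the compiled code never follows a number as a heap address and never computes
    with a heap address. *)
Fixpoint xeval (s : hst) (e : xp) : option datum :=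
  match e with
  | XC k => Some (VN k)
  | XR x => Some (hr s x)
  | XFst e => if xeval s e is Some (VP u _) then Some u else None
  | XSnd e => if xeval s e is Some (VP _ v) then Some v else None
  | XInc e => if xeval s e is Some (VN k) then Some (VN k.+1) else None
  | XSub e f =>
      match xeval s e, xeval s f with
      | Some (VN a), Some (VN b) => Some (VN (a - b))
      | _, _ => None
      end
  | XArr a e f =>
      if vadd (xeval s e) (xeval s f) is Some i then Some (VN (ha s a i))
      else None
  | XIn e f =>
      if vadd (xeval s e) (xeval s f) is Some i then Some (VN (nth 0 inp i))
      else None
  end.

Definition upd (T : Type) (f : nat -> T) (a : nat) (v : T) : nat -> T :=
  fun b => if b == a then v else f b.

Inductive hexec : hc -> hst -> nat -> hst -> Prop :=
| hexec_skip s : hexec HSkip s 1 s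
| hexec_set x e s v : xeval s e = Some v ->
    hexec (HSet x e) s (xcost e).+1 (HSt (upd (hr s) x v) (ha s))
| hexec_cons x e f s u v : xeval s e = Some u -> xeval s f = Some v ->
    hexec (HCons x e f) s (xcost e + xcost f).+1
      (HSt (upd (hr s) x (VP u v)) (ha s))
| hexec_put a e f g s i v :
    vadd (xeval s e) (xeval s f) = Some i -> xeval s g = Some (VN v) ->
    hexec (HPut a e f g) s (a + xcost e + xcost f + xcost g).+1
      (HSt (hr s) (upd (ha s) a (upd (ha s a) i v)))
| hexec_seq c d s1 s2 s3 t1 t2 :
    hexec c s1 t1 s2 -> hexec d s2 t2 s3 -> hexec (HSeq c d) s1 (t1 + t2) s3
| hexec_if e c d s s' t v : xeval s e = Some v ->
    hexec (if truthy v then c else d) s t s' ->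
    hexec (HIf e c d) s ((xcost e).+1 + t) s'
| hexec_while_true e c s1 s2 s3 t1 t2 v : xeval s1 e = Some v -> truthy v ->
    hexec c s1 t1 s2 -> hexec (HWhile e c) s2 t2 s3 ->
    hexec (HWhile e c) s1 ((xcost e).+1 + t1 + t2) s3
| hexec_while_false e c s : xeval s e = Some (VN 0) ->
    hexec (HWhile e c) s (xcost e).+1 s.

End HighLevel.

(** * The compiler and its simulation invariant *)

Fixpoint xwf (A : nat) (e : xp) : bool :=
  match e with
  | XC _ | XR _ => true
  | XFst e | XSnd e | XInc e => xwf A e
  | XSub e f | XIn e f => xwf A e && xwf A f
  | XArr a e f => [&& a < A, xwf A e & xwf A f]
  end.

Fixpoint hwf (A : nat) (c : hc) : bool :=
  match c with
  | HSkip => true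
  | HSet _ e => xwf A e
  | HCons _ e f => xwf A e && xwf A f
  | HPut a e f g => [&& a < A, xwf A e, xwf A f & xwf A g]
  | HSeq c d => hwf A c && hwf A d
  | HIf e c d => [&& xwf A e, hwf A c & hwf A d]
  | HWhile e c => xwf A e && hwf A c
  end.

(** Multiplication by the constant [k + 1] through repeated addition; applied to register 0 it gives
    the base address of an array. *)
Fixpoint copies (k : nat) (e : expr) : expr :=
  if k is j.+1 then EAdd e (copies j e) else e.

(* RAM register 0 holds the length B of a region, register 1 the first free
   heap cell. The input occupies region 0, array a region a + 1. *)
Fixpoint xcomp (e : xp) : expr :=
  match e with
  | XC k => ECst k
  | XR x => EReg x.+2
  | XFst e => EMem (xcomp e)
  | XSnd e => EMem (EAdd (xcomp e) (ECst 1))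
  | XInc e => EAdd (xcomp e) (ECst 1)
  | XSub e f => ESub (xcomp e) (xcomp f)
  | XArr a e f => EMem (EAdd (copies a (EReg 0)) (EAdd (xcomp e) (xcomp f)))
  | XIn e f => EMem (EAdd (xcomp e) (xcomp f))
  end.

Fixpoint hcomp (c : hc) : cmd :=
  match c with
  | HSkip => Skip
  | HSet x e => Assign x.+2 (xcomp e)
  | HCons x e f =>
      Then (Store (EReg 1) (xcomp e))
     (Then (Store (EAdd (EReg 1) (ECst 1)) (xcomp f))
     (Then (Assign x.+2 (EReg 1)) (Assign 1 (EAdd (EReg 1) (ECst 2)))))
  | HPut a e f g =>
      Store (EAdd (copies a (EReg 0)) (EAdd (xcomp e) (xcomp f))) (xcomp g)
  | HSeq c d => Then (hcomp c) (hcomp d)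
  | HIf e c d => If (xcomp e) (hcomp c) (hcomp d)
  | HWhile e c => While (xcomp e) (hcomp c)
  end.

(** A pair is two consecutive cells of the heap between [lo] and [hi]. Nothing is said about
    separation: heap cells are never overwritten, so values may share them, and the relation
    survives writes elsewhere and allocation at the end. *)
Fixpoint rep (lo hi : nat) (mem : nat -> nat) (v : datum) (a : nat) : Prop :=
  match v with
  | VN k => a = k
  | VP u v => [/\ lo <= a, a.+1 < hi, rep lo hi mem u (mem a)
                & rep lo hi mem v (mem a.+1)]
  end.

Fixpoint vbound (b : nat) (v : datum) : bool :=
  match v with VN k => k <= b | VP u v => vbound b u && vbound b v end.

Lemma vboundW b b' v : b <= b' -> vbound b v -> vbound b' v.
Proof.
move=> le_bb'; elim: v => [k|u IHu v IHv] /=; first by move=> /leq_trans; apply.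
by case/andP=> /IHu-> /IHv->.
Qed.

Lemma rep_frame lo hi hi' mem mem' v a : hi <= hi' ->
  (forall i, lo <= i < hi -> mem' i = mem i) ->
  rep lo hi mem v a -> rep lo hi' mem' v a.
Proof.
move=> le_hi eq_mem; elim: v a => [//|u IHu v IHv] a /= [lo_a a_hi ru rv].
split; [by []|by lia| |].
  by rewrite eq_mem ?lo_a /=; [apply: IHu|lia].
by rewrite eq_mem; [apply: IHv|lia].
Qed.

Lemma ecost_copies k e : ecost (copies k e) = k * (ecost e).+1 + ecost e.
Proof. by elim: k => [|k IHk] //=; rewrite IHk; lia. Qed.

Lemma eval_copies w s k e :
  k.+1 * eval w s e < 2 ^ w -> eval w s (copies k e) = k.+1 * eval w s e.
Proof.
elim: k => [|k IHk] lt_w /=; first by rewrite mul1n.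
rewrite IHk; last by apply: leq_ltn_trans lt_w; rewrite leq_mul2r leqnSn orbT.
by rewrite modn_small -?mulSn.
Qed.

Lemma ecost_xcomp e : ecost (xcomp e) <= 4 * xcost e.
Proof. by elim: e => /=; intros; rewrite ?ecost_copies /=; lia. Qed.

Section Compile.
Variables (inp : seq nat) (A B V0 Tm w : nat).
Hypothesis inp_bound : all (fun k => k <= V0) inp.
(** Numbers never exceed [V0] plus the elapsed time; an offset is a sum of two numbers, whence the
    factor 2. In the bound on words, [2 * Tm] is the room for the heap, which receives at most two
    cells per time unit. *)
Hypothesis region_large : 2 * (V0 + Tm) < B.
Hypothesis word_large : A.+1 * B + 2 * Tm + 2 < 2 ^ w.

Let hb := A.+1 * B.

(** The time [t] of the high-level run is a parameter because it bounds the two quantities that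
    could outgrow a word, the heap pointer and the stored numbers. *)
Record sim (t : nat) (s : hst) (r : state) : Prop := Sim {
  sim_base : register r 0 = B;
  sim_heap : hb <= register r 1 <= hb + 2 * t;
  sim_rep x : rep hb (register r 1) (memory r) (hr s x) (register r x.+2);
  sim_val x : vbound (V0 + t) (hr s x);
  sim_arr a i : a < A -> i < B -> memory r (a.+1 * B + i) = ha s a i;
  sim_arrval a i : a < A -> ha s a i <= V0 + t;
  sim_inp i : i < B -> memory r i = nth 0 inp i
}.

Lemma nth_inp i : nth 0 inp i <= V0.
Proof.
case: (ltnP i (size inp)) => [lt_i|le_i]; last by rewrite nth_default.
by move/allP: inp_bound; apply; apply: mem_nth.
Qed.

Lemma array_in_heap a i : a < A -> i < B -> a.+1 * B + i < hb.
Proof.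
move=> aA iB; rewrite /hb; have : a.+2 * B <= A.+1 * B by rewrite leq_mul2r ltnS aA orbT.
lia.
Qed.

Lemma xeval_sim t s r e v : sim t s r -> xwf A e -> t + xcost e <= Tm ->
  xeval inp s e = Some v ->
  rep hb (register r 1) (memory r) v (eval w r (xcomp e)) /\
  vbound (V0 + t + xcost e) v.
Proof.
move=> S; have V_B: V0 + Tm < B by lia.
have B_hb : B <= hb by rewrite /hb mulSn leq_addr.
have nat_w k : k <= 2 * (V0 + Tm) -> k %% 2 ^ w = k.
  by move=> le_k; rewrite modn_small //; move: word_large; rewrite -/hb; lia.
have heapT : register r 1 <= hb + 2 * t by case/andP: (sim_heap S).
elim: e v => [k|x|e IHe|e IHe|e IHe|e IHe f IHf|a e IHe f IHf|e IHe f IHf] v /=.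
- by move=> _ le_t [<-] /=; rewrite nat_w; [split|]; lia.
- move=> _ _ [<-]; split; first exact: (sim_rep S).
  by apply: vboundW (sim_val S x); lia.
- move=> wf_e le_t; case E: (xeval inp s e) => [[//|u v']|//] [<-].
  have [|[_ _ ru _] /andP[bu _]] := IHe _ wf_e _ E; first lia.
  by split=> //; apply: vboundW bu; lia.
- move=> wf_e le_t; case E: (xeval inp s e) => [[//|u v']|//] [<-].
  have [|[lo hi _ rv] /andP[_ bv]] := IHe _ wf_e _ E; first lia.
  split; last by apply: vboundW bv; lia.
  have -> : 1 %% 2 ^ w = 1 by rewrite modn_small //; move: word_large; lia.
  by rewrite modn_small ?addn1 //; move: word_large; rewrite -/hb; lia.
- move=> wf_e le_t; case E: (xeval inp s e) => [[k|//]|//] [<-].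
  have [|/= -> bk] := IHe _ wf_e _ E; first lia.
  have -> : 1 %% 2 ^ w = 1 by rewrite modn_small //; move: word_large; lia.
  by rewrite nat_w /=; lia.
- case/andP=> wf_e wf_f le_t.
  case E: (xeval inp s e) => [[k|//]|//]; case F: (xeval inp s f) => [[l|//]|//] [<-].
  have [|/= -> bk] := IHe _ wf_e _ E; first lia.
  have [|/= -> bl] := IHf _ wf_f _ F; first lia.
  by split=> //=; lia.
- case/and3P=> aA wf_e wf_f le_t.
  case E: (xeval inp s e) => [[k|//]|//]; case F: (xeval inp s f) => [[l|//]|//] [<-].
  have [|/= -> bk] := IHe _ wf_e _ E; first lia.
  have [|/= -> bl] := IHf _ wf_f _ F; first lia.
  have := array_in_heap aA (_ : k + l < B); rewrite eval_copies /=; last first.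
    rewrite (sim_base S); have := array_in_heap (i := 0) aA; move: word_large.
    rewrite -/hb; lia.
  rewrite (sim_base S) => lt_hb; rewrite (nat_w (k + l)); last lia.
  rewrite modn_small; last by move: word_large; rewrite -/hb; lia.
  rewrite (sim_arr S) //; last lia.
  by split=> //; apply: leq_trans (sim_arrval S _ aA) _; lia.
- case/andP=> wf_e wf_f le_t.
  case E: (xeval inp s e) => [[k|//]|//]; case F: (xeval inp s f) => [[l|//]|//] [<-].
  have [|/= -> bk] := IHe _ wf_e _ E; first lia.
  have [|/= -> bl] := IHf _ wf_f _ F; first lia.
  rewrite nat_w; last lia.
  by rewrite (sim_inp S) /=; [split=> //; have := nth_inp (k + l)|]; lia.
Qed.

(** The heap starts at the positive address [hb], so a pair is nonzero on the machine and the zero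
    test there agrees with [truthy]. *)
Lemma truthy_sim t r v a : hb <= register r 1 <= hb + 2 * t ->
  rep hb (register r 1) (memory r) v a -> (a == 0) = ~~ truthy v.
Proof.
case: v => [[|k] _ ->|u v] //= _ [lo _ _ _].
by apply/eqP=> a0; move: lo region_large; rewrite a0 /hb; nia.
Qed.

Lemma hexec_sim c s t s' : hexec inp c s t s' -> forall t0 r, hwf A c ->
  sim t0 s r -> t0 + t <= Tm ->
  exists t' r', [/\ exec w (hcomp c) r t' r', t' <= 20 * t & sim (t0 + t) s' r'].
Proof.
elim=> {c s t s'} /=.
- move=> s t0 r _ [? ? ? hv ? hav ?] _; exists 1, r; split=> //; first exact: exec_skip.
  by split=> // *; [lia|apply: vboundW (hv _); lia|apply: leq_trans (hav _ _ _) _ => //; lia].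
- move=> x e s v ev t0 r wf S le_t.
  have [|rv bv] := xeval_sim S wf _ ev; first lia.
  exists (ecost (xcomp e)).+1.
  exists (State (update (register r) x.+2 (eval w r (xcomp e))) (memory r)).
  split; [exact: exec_assign|by have := ecost_xcomp e; lia|].
  case: S => sb sh sr sv sa sav si; split=> //=.
  + by rewrite /update /=; lia.
  + by move=> y; rewrite /update /upd /= !eqSS; case: ifP => // _; apply: sr.
  + move=> y; rewrite /upd; case: ifP => _; first by apply: vboundW bv; lia.
    by apply: vboundW (sv y); lia.
  + by move=> a i aA; apply: leq_trans (sav a i aA) _; lia.
- move=> x e f s u v eu ev t0 r /andP[wfe wff] S le_t.
  have [|ru bu] := xeval_sim S wfe _ eu; first lia.
  set m1 := update (memory r) (register r 1) (eval w r (xcomp e)).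
  have [sb /andP[sh1 sh2] sr sv sa sav si] := S.
  have B_hb : B <= hb by rewrite /hb mulSn leq_addr.
  have hpw : hb + 2 * t0 + 2 < 2 ^ w by move: word_large; rewrite -/hb; lia.
  have one_w : 1 %% 2 ^ w = 1 by rewrite modn_small //; lia.
  have two_w : 2 %% 2 ^ w = 2 by rewrite modn_small //; lia.
  (* The first store hits the free cell, which belongs to no represented value; the invariant
     survives it, so the second component may be evaluated after the store. *)
  have S1 : sim t0 s (State (register r) m1).
    have neq i : i < hb -> (i == register r 1) = false by lia.
    split=> //=; first by lia.
    + move=> y; apply: rep_frame (sr y) => // i /andP[_ lt_i].
      by rewrite /m1 /update ltn_eqF.
    + by move=> a i aA iB; rewrite /m1 /update neq ?sa ?array_in_heap.
    + by move=> i iB; rewrite /m1 /update neq ?si //; lia.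
  have [|rv bv] := xeval_sim S1 wff _ ev; first lia.
  set m2 := update m1 (register r 1).+1 (eval w (State (register r) m1) (xcomp f)).
  exists ((ecost (EReg 1) + ecost (xcomp e)).+1 + ((ecost (EAdd (EReg 1) (ECst 1)) +
    ecost (xcomp f)).+1 + ((ecost (EReg 1)).+1 + (ecost (EAdd (EReg 1) (ECst 2))).+1))).
  exists (State (update (update (register r) x.+2 (register r 1)) 1 (register r 1).+2) m2).
  split.
  + apply: exec_then; first exact: exec_store.
    apply: exec_then; first exact: exec_store.
    apply: exec_then; first exact: exec_assign.
    rewrite /= one_w (modn_small (_ : _ + 1 < _)); last lia.
    rewrite addn1 -/m1 -/m2.
    have := exec_assign w 1 (EAdd (EReg 1) (ECst 2))
      (State (update (register r) x.+2 (register r 1)) m2).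
    by rewrite /= /update /= two_w modn_small ?addn2 //; lia.
  + by have := ecost_xcomp e; have := ecost_xcomp f; rewrite /=; lia.
  have frame i : hb <= i < register r 1 -> m2 i = memory r i.
    by move=> /andP[_ lt_i]; rewrite /m2 /m1 /update !ltn_eqF //; lia.
  have out i : i < hb -> m2 i = memory r i.
    by move=> lt_i; rewrite /m2 /m1 /update !ltn_eqF //; lia.
  have grow v' a : rep hb (register r 1) (memory r) v' a ->
    rep hb (register r 1).+2 m2 v' a by apply: rep_frame => //; lia.
  split=> /=.
  + by rewrite /update.
  + by rewrite /update /=; lia.
  + move=> y; rewrite /upd /update /= !eqSS; case: ifP => _; last exact: grow.
    have E1 : m2 (register r 1) = eval w r (xcomp e).
      by rewrite /m2 /m1 /update (ltn_eqF (ltnSn _)) eqxx.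
    have E2 : m2 (register r 1).+1 = eval w (State (register r) m1) (xcomp f).
      by rewrite /m2 /update eqxx.
    split=> //; first by rewrite E1; apply: grow.
    rewrite E2; apply: (rep_frame _ _ rv) => //= [|i /andP[_ lt_i]]; first by lia.
    by rewrite /m2 /update ltn_eqF //; lia.
  + move=> y; rewrite /upd; case: ifP => _ /=; last by apply: vboundW (sv y); lia.
    by rewrite (vboundW _ bu) ?(vboundW _ bv) //; lia.
  + by move=> a i aA iB; rewrite out ?sa ?array_in_heap.
  + by move=> a i aA; apply: leq_trans (sav a i aA) _; lia.
  + by move=> i iB; rewrite out ?si //; lia.
- move=> a e f g s i v eadd eg t0 r /and4P[aA wfe wff wfg] S le_t.
  move: eadd; case E: (xeval inp s e) => [[k|//]|//].
  case F: (xeval inp s f) => [[l|//]|//] /= [<-{i}].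
  have [|/= ek bk] := xeval_sim S wfe _ E; first lia.
  have [|/= el bl] := xeval_sim S wff _ F; first lia.
  have [|/= ev bv] := xeval_sim S wfg _ eg; first lia.
  have [sb sh sr sv sa sav si] := S.
  have B_hb : B <= hb by rewrite /hb mulSn leq_addr.
  have klB : k + l < B by lia.
  have lt_hb := array_in_heap aA klB.
  have addr : eval w r (EAdd (copies a (EReg 0)) (EAdd (xcomp e) (xcomp f)))
    = a.+1 * B + (k + l).
    rewrite /= ek el eval_copies /= sb; last by move: word_large; rewrite -/hb; lia.
    by rewrite (modn_small (_ : k + l < _)) ?modn_small //;
      move: word_large; rewrite -/hb; lia.
  exists (ecost (EAdd (copies a (EReg 0)) (EAdd (xcomp e) (xcomp f))) +
    ecost (xcomp g)).+1.
  exists (State (register r) (update (memory r) (a.+1 * B + (k + l)) v)).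
  split.
  + by rewrite -addr -ev; apply: exec_store.
  + have := ecost_xcomp e; have := ecost_xcomp f; have := ecost_xcomp g.
    by rewrite /= ecost_copies /=; lia.
  split=> //=; first by lia.
  + move=> x; apply: rep_frame (sr x) => // j /andP[le_j _].
    by rewrite /update gtn_eqF //; lia.
  + by move=> x; apply: vboundW (sv x); lia.
  + move=> b j bA jB; rewrite /update /upd.
    have [->|neq] := eqVneq b a.
      by rewrite eqn_add2l; case: ifP => // _; apply: sa.
    rewrite ifN ?sa //; apply: contraNneq neq => eq_addr; apply/eqP.
    (* Both offsets are below [B], so the quotient by [B] recovers the array from the address. *)
    have := congr1 (fun z => z %/ B) eq_addr.
    by rewrite !divnMDl ?(divn_small jB) ?(divn_small klB); lia.
  + move=> b j bA; have := sav b j bA; have := sav a j aA; rewrite /upd.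
    by case: eqP => [->|_]; [case: eqP => _|]; lia.
  + by move=> j jB; rewrite /update ltn_eqF ?si //; lia.
- move=> c d s1 s2 s3 t1 t2 _ IHc _ IHd t0 r /andP[wfc wfd] S le_t.
  have [|t1' [r1 [x1 c1 S1]]] := IHc t0 r wfc S; first lia.
  have [|t2' [r2 [x2 c2 S2]]] := IHd _ _ wfd S1; first lia.
  exists (t1' + t2'), r2; split; [exact: exec_then x1 x2|lia|by rewrite addnA].
- move=> e c d s s' t v ev _ IH t0 r /and3P[wfe wfc wfd] S le_t.
  have [|rv bv] := xeval_sim S wfe _ ev; first lia.
  have tv := truthy_sim (sim_heap S) rv.
  have wf' : hwf A (if truthy v then c else d) by case: ifP.
  have S' : sim (t0 + (xcost e).+1) s r.
    case: S => sb sh sr sv sa sav si; split=> //; [lia| |] => *.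
      by apply: vboundW (sv _); lia.
    by apply: leq_trans (sav _ _ _) _ => //; lia.
  have [|t1 [r1 [x1 c1 S1]]] := IH _ _ wf' S'; first lia.
  exists ((ecost (xcomp e)).+1 + t1), r1; rewrite addnA; split=> //.
    move: x1 tv; case: (truthy v) => x1 /= tv.
      by apply: exec_if_true => //; apply/eqP; rewrite tv.
    by apply: exec_if_false => //; apply/eqP; rewrite tv.
  by have := ecost_xcomp e; lia.
- move=> e c s1 s2 s3 t1 t2 v ev tr _ IHc _ IHw t0 r /andP[wfe wfc] S le_t.
  have [|rv bv] := xeval_sim S wfe _ ev; first lia.
  have tv := truthy_sim (sim_heap S) rv.
  have S' : sim (t0 + (xcost e).+1) s1 r.
    case: S => sb sh sr sv sa sav si; split=> //; [lia| |] => *.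
      by apply: vboundW (sv _); lia.
    by apply: leq_trans (sav _ _ _) _ => //; lia.
  have [|t1' [r1 [x1 c1 S1]]] := IHc _ _ wfc S'; first lia.
  have [||t2' [r2 [x2 c2 S2]]] := IHw _ _ _ S1; [by rewrite wfe|lia|].
  exists ((ecost (xcomp e)).+1 + t1' + t2'), r2; rewrite !addnA in S2 *; split=> //.
    by apply: exec_while_true x1 x2; apply/eqP; rewrite tv tr.
  by have := ecost_xcomp e; lia.
- move=> e c s ev t0 r /andP[wfe wfc] S le_t.
  have [|rv bv] := xeval_sim S wfe _ ev; first lia.
  exists (ecost (xcomp e)).+1, r; split=> //; first exact: exec_while_false.
    by have := ecost_xcomp e; lia.
  case: S => sb sh sr sv sa sav si; split=> //; [lia| |] => *.
    by apply: vboundW (sv _); lia.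
  by apply: leq_trans (sav _ _ _) _ => //; lia.
Qed.

End Compile.

(** * Memory layout and the transfer of time bounds *)

Definition hinit : hst := HSt (fun _ => VN 0) (fun _ _ => 0).

Definition product_loop : cmd :=
  While (EReg 2) (Then (Assign 1 (EAdd (EReg 1) (EReg 3)))
                       (Assign 2 (ESub (EReg 2) (ECst 1)))).

(** RAM registers 2 and 3 are the first two registers of the high-level language, which have to
    start at 0: the loop leaves 0 in register 2, and the last assignment clears register 3.
    Multiplying by repeated addition takes [O(m)] steps, which the bound affords. *)
Definition prelude (K A : nat) : cmd :=
  Then (Assign 2 (EMem (ECst 1)))
 (Then (Assign 3 (EMem (ECst 0)))
 (Then product_loop
 (Then (Assign 0 (copies K (EReg 1)))
 (Then (Assign 1 (copies A (EReg 0)))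
       (Assign 3 (ECst 0)))))).

Lemma exec_product_loop w k r : 1 < 2 ^ w -> register r 2 = k ->
  register r 1 + k * register r 3 < 2 ^ w ->
  exists t r', [/\ exec w product_loop r t r', t <= 20 * k + 2,
    register r' 1 = register r 1 + k * register r 3 /\ register r' 2 = 0,
    (forall x, x != 1 -> x != 2 -> register r' x = register r x)
    & memory r' = memory r].
Proof.
move=> w1; have one_w : 1 %% 2 ^ w = 1 by rewrite modn_small.
elim: k r => [|k IHk] r r2 lt_w.
  exists 2, r; split=> //; first by apply: exec_while_false.
  by rewrite mul0n addn0.
have step : exec w (Then (Assign 1 (EAdd (EReg 1) (EReg 3)))
    (Assign 2 (ESub (EReg 2) (ECst 1)))) r (4 + 4)
    (State (update (update (register r) 1 (register r 1 + register r 3)) 2 k) (memory r)).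
  apply: exec_then; first exact: exec_assign.
  have := exec_assign w 2 (ESub (EReg 2) (ECst 1))
    (State (update (register r) 1 (register r 1 + register r 3)) (memory r)).
  rewrite /= (_ : update _ _ _ 2 = k.+1) // one_w subn1 modn_small //.
  by move: lt_w; rewrite mulSn; lia.
have [||t [r' [ex le_t [e1 e2] fr em]]] :=
  IHk (State (update (update (register r) 1 (register r 1 + register r 3)) 2 k) (memory r)).
- by [].
- by rewrite /= /update /=; move: lt_w; rewrite mulSn; lia.
exists (2 + (4 + 4) + t), r'; split.
- by apply: exec_while_true step ex; rewrite /= r2.
- by lia.
- by rewrite e2 e1 /= /update /= mulSn; lia.
- by move=> x x1 x2; rewrite fr //= /update (negbTE x1) (negbTE x2).
- by [].
Qed.

(** Numbers of a run are at most [(D + K) * (m * n)], hence regions of length [(k + 1) * (m * n)]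
    with [k = 2 * (D + K)] exceed every sum of two of them. *)
Lemma compile_runs (c : hc) (A K D : nat) : hwf A c ->
  exists C, forall n m inp s' T out (post : seq nat -> Prop),
    nth 0 inp 0 = n -> nth 0 inp 1 = m -> 0 < m * n ->
    all (fun k => k <= D * (m * n)) inp -> size inp <= D * (m * n) ->
    hexec inp c hinit T s' -> T <= K * (m * n) ->
    size out <= K * (m * n) ->
    (forall i, i < size out -> ha s' 0 i = nth 0 out i) -> 0 < A ->
    post out ->
    runs_within (Then (prelude (2 * (D + K)) A) (hcomp c)) C (m * n) inp post.
Proof.
move=> wf; set k := 2 * (D + K).
(* The first two summands make a word hold all regions and the heap; the others leave some slack and
   pay for the prelude and for the factor 20 of the simulation. *)
exists (A.+1 * k.+1 + 2 * K + 100 + 20 * K + 20 * k + 20 * A).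
move=> n m inp s' T out post en em N0; set N := m * n in N0 *.
move=> vals sz ex leT szo ho A0 po w; set C := (X in X * N <= _) => lt_w.
have CN : C * N = (A.+1 * (k.+1 * N) + 2 * (K * N)) + (98 + 20 * K + 20 * k + 20 * A) * N + 2 * N.
  by rewrite /C; lia.
have word : A.+1 * (k.+1 * N) + 2 * (K * N) + 2 < 2 ^ w by move: lt_w; rewrite CN; lia.
have w1 : 1 < 2 ^ w by lia.
have one_w : 1 %% 2 ^ w = 1 by rewrite modn_small.
have zero_w : 0 %% 2 ^ w = 0 by rewrite mod0n.
have mN : m <= N by rewrite /N leq_pmulr //; move: N0; rewrite /N; case: (n); lia.
pose r0 := State (update (update (fun _ => 0) 2 m) 3 n) (fun a => nth 0 inp a).
have NkN : N <= k.+1 * N by rewrite leq_pmull.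
have kA : k.+1 * N <= A.+1 * (k.+1 * N) by rewrite leq_pmull.
have [||t1 [r1 [ex1 lt1 [e11 e12] fr1 em1]]] := @exec_product_loop w m r0 w1.
- by [].
- by rewrite /= /update /= add0n -/N; lia.
move: e11; rewrite /= {2}/update /= {1}/update /= add0n -/N => e11.
pose r2 := State (update (update (update (register r1) 0 (k.+1 * N)) 1 (A.+1 * (k.+1 * N))) 3 0)
  (memory r1).
have pre : exec w (prelude k A) (init_state inp)
    (3 + (3 + (t1 + ((ecost (copies k (EReg 1))).+1 + ((ecost (copies A (EReg 0))).+1 + 2))))) r2.
  apply: exec_then; first exact: exec_assign.
  apply: exec_then; first exact: exec_assign.
  rewrite /= zero_w one_w en em.
  apply: exec_then; first exact: ex1.
  apply: exec_then; first exact: exec_assign.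
  rewrite eval_copies /= e11; last by lia.
  apply: exec_then; first exact: exec_assign.
  rewrite eval_copies /= /update /=; last by lia.
  have := exec_assign w 3 (ECst 0) (State (update (update (register r1) 0 (k.+1 * N)) 1
    (A.+1 * (k.+1 * N))) (memory r1)).
  by rewrite /= zero_w.
have S0 : sim inp A (k.+1 * N) (D * N) 0 hinit r2.
  have out_inp i : k.+1 * N <= i -> memory r1 i = 0.
    move=> le_i; rewrite em1 /= nth_default //; apply: leq_trans sz _; apply: leq_trans le_i.
    by rewrite leq_mul2r; apply/orP; right; rewrite /k; clear; lia.
  split=> //=.
  - by rewrite /update /=; lia.
  - by case=> [|[|x]] //=; rewrite /update /= ?e12 // fr1.
  - by move=> a i aA iB; rewrite out_inp // mulSn -addnA leq_addr.
  - by move=> i iB; rewrite em1.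
have region : 2 * (D * N + K * N) < k.+1 * N by rewrite /k; nia.
have [|t2 [r3 [ex3 lt3 S3]]] := hexec_sim vals region word ex wf S0; first by rewrite add0n.
exists (3 + (3 + (t1 + ((ecost (copies k (EReg 1))).+1 + ((ecost (copies A (EReg 0))).+1 + 2)))) + t2).
exists r3, out; split=> //.
- exact: exec_then pre ex3.
- have le_k : k <= k * N by rewrite leq_pmulr.
  have le_A : A <= A * N by rewrite leq_pmulr.
  by rewrite CN !ecost_copies /= !mulnDl; lia.
(* Array 0 is region 1, so it begins at the address [B] held by register 0, where the output is
   expected. *)
- move=> i lt_i; rewrite (sim_base S3) -(ho _ lt_i).
  have := sim_arr S3 (i := i) A0; rewrite mul1n; apply.
  by apply: leq_trans lt_i _; apply: leq_trans szo _; rewrite /k; nia.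
Qed.

(** * Weakest preconditions *)

Section Wp.
Variable inp : seq nat.
Implicit Types (c d : hc) (s : hst) (t : nat) (Q : hst -> nat -> Prop).

(** The postcondition receives the accumulated time, so that cost and effect are proved in one pass;
    being existential, the predicate includes termination. *)
Definition wp c s t Q : Prop :=
  exists t' s', hexec inp c s t' s' /\ Q s' (t + t').

Lemma wp_skip s t Q : Q s t.+1 -> wp HSkip s t Q.
Proof. by exists 1, s; rewrite addn1; split; first exact: hexec_skip. Qed.

Lemma wp_set x e s t Q v : xeval inp s e = Some v ->
  Q (HSt (upd (hr s) x v) (ha s)) (t + (xcost e).+1) -> wp (HSet x e) s t Q.
Proof. by move=> ev q; do 2!eexists; split; first exact: hexec_set ev. Qed.

Lemma wp_cons x e f s t Q u v : xeval inp s e = Some u -> xeval inp s f = Some v ->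
  Q (HSt (upd (hr s) x (VP u v)) (ha s)) (t + (xcost e + xcost f).+1) ->
  wp (HCons x e f) s t Q.
Proof. by move=> eu ev q; do 2!eexists; split; first exact: hexec_cons eu ev. Qed.

Lemma wp_put a e f g s t Q i v :
  vadd (xeval inp s e) (xeval inp s f) = Some i -> xeval inp s g = Some (VN v) ->
  Q (HSt (hr s) (upd (ha s) a (upd (ha s a) i v)))
    (t + (a + xcost e + xcost f + xcost g).+1) ->
  wp (HPut a e f g) s t Q.
Proof. by move=> ei ev q; do 2!eexists; split; first exact: hexec_put ei ev. Qed.

Lemma wp_seq c d s t Q :
  wp c s t (fun s' t' => wp d s' t' Q) -> wp (HSeq c d) s t Q.
Proof.
case=> t1 [s1 [ex1 [t2 [s2 [ex2 q]]]]]; exists (t1 + t2), s2; rewrite addnA.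
by split=> //; apply: hexec_seq ex1 ex2.
Qed.

Lemma wp_if e c d s t Q v : xeval inp s e = Some v ->
  wp (if truthy v then c else d) s (t + (xcost e).+1) Q -> wp (HIf e c d) s t Q.
Proof.
move=> ev [t1 [s1 [ex1 q]]]; exists ((xcost e).+1 + t1), s1; rewrite addnA.
by split=> //; apply: hexec_if ev ex1.
Qed.

Lemma wp_while_true e c s t Q v : xeval inp s e = Some v -> truthy v ->
  wp c s (t + (xcost e).+1) (fun s' t' => wp (HWhile e c) s' t' Q) ->
  wp (HWhile e c) s t Q.
Proof.
move=> ev tr [t1 [s1 [ex1 [t2 [s2 [ex2 q]]]]]].
exists ((xcost e).+1 + t1 + t2), s2; rewrite !addnA in q *.
by split=> //; apply: hexec_while_true ev tr ex1 ex2.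
Qed.

Lemma wp_while_false e c s t Q : xeval inp s e = Some (VN 0) ->
  Q s (t + (xcost e).+1) -> wp (HWhile e c) s t Q.
Proof. by move=> ev q; do 2!eexists; split; first exact: hexec_while_false. Qed.

Lemma wp_conseq c s t Q R : wp c s t Q -> (forall s' t', Q s' t' -> R s' t') ->
  wp c s t R.
Proof. by move=> [t1 [s1 [ex1 q]]] QR; exists t1, s1; split; last exact: QR. Qed.

End Wp.

Definition same (mods : seq nat) (s s' : hst) : Prop :=
  forall x, x \notin mods -> hr s' x = hr s x.

(** * Factorisations over interval subgroups *)

(** The rearrangement inequality for two terms: removing an inversion raises the sum [mass] used in
    [factorable_sort]. *)
Lemma rearrangement a b c d : a < b -> d < c -> a * c + b * d < a * d + b * c.
Proof.
move=> /subnKC<- /subnKC<-; move: (b - _) (c - _) => p q.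
by rewrite !(mulnDl, mulnDr); lia.
Qed.

Section Factorisation.
Variable n : nat.
Implicit Types (X : {set 'I_n}) (w u s g : 'S_n) (i k : 'I_n).
Local Open Scope group_scope.

Fixpoint factorable (Xs : seq {set 'I_n}) : {set 'S_n} :=
  if Xs is X :: Xs' then [set s | perm_on X s] * factorable Xs' else [set 1].

Lemma factorableP (Xs : seq {set 'I_n}) w :
  reflect (exists2 sg : nat -> 'S_n,
             forall j, j < size Xs -> perm_on (nth set0 Xs j) (sg j) &
             w = \prod_(0 <= j < size Xs) sg j)
          (w \in factorable Xs).
Proof.
elim: Xs w => [|X Xs IH] w /=.
  rewrite inE; apply: (iffP eqP) => [->|[sg _ ->]]; last by rewrite big_nil.
  by exists (fun=> 1); rewrite ?big_nil.
apply: (iffP mulsgP) => [[s w' sX /IH[sg sgX ->] ->]|[sg sgX ->]].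
  exists (fun j => if j is j'.+1 then sg j' else s); last by rewrite big_nat_recl.
  by case=> [|j] lt_j; [rewrite inE in sX|apply: sgX].
exists (sg 0) (\prod_(0 <= j < size Xs) sg j.+1).
- by rewrite inE; apply: (sgX 0).
- by apply/IH; exists (fun j => sg j.+1) => // j lt_j; apply: (sgX j.+1).
- by rewrite big_nat_recl.
Qed.

Lemma yes_factorable m (I : instance n m) :
  yes_instance I <-> target I \in factorable (sets I).
Proof.
split=> [[sg sgX ->]|/factorableP[sg]].
  apply/factorableP; rewrite size_tuple.
  exists (fun j => if insub j is Some o then sg o else 1) => [j lt_j|].
    by rewrite insubT -[nth _ _ j](tnth_nth _ _ (Ordinal lt_j)).
  rewrite big_mkord; apply: eq_bigr => j _.
  by case: insubP => [o _ /val_inj->|]; rewrite ?ltn_ord.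
rewrite size_tuple => sgX tgt; exists (fun j : 'I_m => sg j).
  by move=> j; rewrite (tnth_nth set0); apply: sgX.
by rewrite tgt big_mkord.
Qed.

Definition interval (a b : nat) : {set 'I_n} := [set i : 'I_n | a <= i < b].

Lemma consecutiveP X : reflect (exists a b : nat, X = interval a b) (consecutive X).
Proof.
apply: (iffP existsP) => [[a /existsP[b /eqP->]]|[a [b ->]]].
  by exists a, b.
have nS (c : nat) : minn c n < n.+1 by rewrite ltnS geq_minr.
exists (Ordinal (nS a)); apply/existsP; exists (Ordinal (nS b)); apply/eqP/setP=> i.
by rewrite !inE /=; have := ltn_ord i; lia.
Qed.

(* Closure under un-inverting transpositions, i.e. downwards in Bruhat order.
   Conjugating (i k) by s in S_X keeps i and k in order unless both lie in
   the interval X, and in that case the transposition is absorbed by S_X. *)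
Lemma factorable_uninvert Xs w i k : all (@consecutive n) Xs ->
  w \in factorable Xs -> i < k -> w k < w i -> tperm i k * w \in factorable Xs.
Proof.
elim: Xs w i k => [|X Xs IH] w i k /=.
  by move=> _ /set1P-> lt_ik; rewrite !perm1 ltnNge ltnW.
case/andP=> /consecutiveP[a [b defX]] conXs /mulsgP[s w' ]; rewrite inE => sX w'A ->.
rewrite !permM => lt_ik lt_w.
have inX x : (s x \in X) = (x \in X) by rewrite (perm_closed _ sX).
have nX x : x \notin X -> s x = x by apply: out_perm.
case: (boolP ((i \in X) && (k \in X))) => [/andP[iX kX]|notX].
  rewrite mulgA mem_mulg //= inE; apply: perm_onM => //; apply/subsetP=> x.
  by rewrite inE; case: tpermP => [->|->|]; rewrite ?eqxx.
have -> : tperm i k * (s * w') = s * (tperm (s i) (s k) * w').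
  by rewrite -tpermJ conjgE !mulgA mulgV mul1g.
apply: mem_mulg; first by rewrite inE.
apply: IH => //; move: notX (inX i) (inX k) (nX i) (nX k).
rewrite defX !inE.
case: (boolP (a <= i < b)) => iX; case: (boolP (a <= k < b)) => kX //=.
- by move=> _ si _ _ /(_ isT)->; lia.
- by move=> _ _ sk /(_ isT)-> _; lia.
by move=> _ _ _ /(_ isT)-> /(_ isT)->.
Qed.

Definition increasing_on X w : Prop :=
  forall i k, i \in X -> k \in X -> i < k -> w i < w k.

(** At the least point [i] moved by [u], both [u i] and the preimage of [i] lie to the right of [i];
    then [u * w] increasing forces [w (u i) < w i], and [w] increasing forces the opposite. *)
Lemma increasing_on_uniq X u w : perm_on X u -> increasing_on X w ->
  increasing_on X (u * w) -> u = 1.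
Proof.
move=> uX incw incu; apply/permP=> i; rewrite perm1.
have [j] := ubnP (i : nat); elim: j i => // j IH i /ltnSE le_ij.
apply/eqP/contraT=> ui; have iX : i \in X by apply: contraR ui => /(out_perm uX)->.
have fix_lt k : k < i -> u k = k by move=> lt_k; apply: IH; lia.
have gt_ui : i < u i.
  rewrite ltn_neqAle eq_sym ui /= leqNgt; apply/negP=> lt_ui.
  by move/perm_inj: (fix_lt _ lt_ui) => eq_i; rewrite eq_i ltnn in lt_ui.
pose k := u^-1 i; have uk : u k = i by rewrite permKV.
have kX : k \in X by rewrite -(perm_closed _ uX) uk.
have lt_ik : i < k.
  rewrite ltn_neqAle; apply/andP; split.
    by apply: contraNneq ui => /val_inj eq_ik; rewrite {1}eq_ik uk.
  by rewrite leqNgt; apply/negP=> lt_ki; have := congr1 val (fix_lt _ lt_ki); rewrite uk /=; lia.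
have := incu i k iX kX lt_ik; rewrite !permM uk => lt_w.
by have := incw i (u i) iX (_ : u i \in X) gt_ui; rewrite (perm_closed _ uX) => /(_ iX); lia.
Qed.

(** Among the factorable permutations that differ from [w] by an element acting on [X], one of
    maximal [mass] has no inversion left inside [X], because un-inverting stays factorable and
    raises [mass]. The increasing representative is unique, so it is [u * w]. *)
Lemma factorable_sort X Xs u w : all (@consecutive n) (X :: Xs) ->
  perm_on X u -> w \in factorable Xs -> increasing_on X (u * w) ->
  u * w \in factorable Xs.
Proof.
case/andP=> conX conXs uX wA inc.
pose mass (v : 'S_n) := \sum_(i : 'I_n) i * v i.
pose good (v : 'S_n) := (v \in factorable Xs) && perm_on X (v * w^-1).
have good_w : good w by rewrite /good wA mulgV; apply/subsetP=> i; rewrite inE perm1 eqxx.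
case: (arg_maxnP mass good_w) => v /andP[vA vX] max_v.
suff inc_v : increasing_on X v.
  have X' : perm_on X (u * w * v^-1).
    by rewrite -mulgA perm_onM // -[_ * v^-1]invgK invMg invgK perm_onV.
  have := increasing_on_uniq X' inc_v; rewrite mulgKV => /(_ inc)/(congr1 (mulg^~ v)).
  by rewrite mulgKV mul1g => ->.
move=> i k iX kX lt_ik; rewrite ltnNge; apply/negP=> le_v.
have lt_v : v k < v i.
  by rewrite ltn_neqAle le_v andbT; apply/eqP=> /val_inj/perm_inj eq_ki; rewrite eq_ki ltnn in lt_ik.
have tX : perm_on X (tperm i k).
  by apply/subsetP=> x; rewrite inE; case: tpermP => [->|->|]; rewrite ?eqxx.
have good_t : good (tperm i k * v).
  by rewrite /good factorable_uninvert //= -mulgA perm_onM.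
have ki : k != i by apply/eqP=> eq_ki; rewrite eq_ki ltnn in lt_ik.
have massE z : mass z = i * z i + (k * z k +
    \sum_(j < n | (j != i) && (j != k)) j * z j).
  by rewrite /mass (bigD1 i) //= (bigD1 k).
have := max_v _ good_t; rewrite /= !massE !permM tpermL tpermR (eq_bigr (fun j : 'I_n => j * v j)%N) => [|j /andP[ji jk]]; last first.
  by rewrite permM tpermD // eq_sym.
rewrite /geq /=; move: (\sum_(_ < n | _) _) (i : nat) (k : nat) (v i : nat) (v k : nat) lt_ik lt_v.
move=> S a b c d lt_ab lt_dc; rewrite !addnA leq_add2r.
by have := rearrangement lt_ab lt_dc; rewrite ltnNge => /negP.
Qed.

Lemma card_interval a b : #|interval a b| = minn b n - a.
Proof.
rewrite -sum1dep_card -(big_mkord (fun i : nat => a <= i < b) (fun=> 1%N)).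
elim: n => [|k IHk]; first by rewrite big_nil; lia.
by rewrite big_mkcond big_nat_recr //= -big_mkcond /= IHk; case: ifP; lia.
Qed.

Definition before X (g : 'S_n) (v : nat) : {set 'I_n} :=
  [set x : 'I_n | (x < v) && (g x \in X)].

Lemma before_lt X g (v : 'I_n) (v' : nat) : g v \in X -> v < v' ->
  #|before X g v| < #|before X g v'|.
Proof.
move=> gvX lt_v; apply: proper_card; apply/properP; split.
  by apply/subsetP=> x; rewrite !inE => /andP[lt_x ->]; rewrite andbT; lia.
by exists v; rewrite !inE gvX ?lt_v // ltnn.
Qed.

Lemma before_card X g (v : 'I_n) : g v \in X -> #|before X g v| < #|X|.
Proof.
move=> gvX; apply: leq_trans (before_lt gvX (ltn_ord v)) _.
rewrite -(card_imset _ (@perm_inj _ g)); apply: subset_leq_card.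
by apply/subsetP=> _ /imsetP[x xB ->]; move: xB; rewrite inE => /andP[].
Qed.

(* The permutation of the interval X that puts the elements of g^-1 X, in
   increasing order, on the positions a, a + 1, .. of X. *)
Lemma sorting_perm X (a b : nat) (g : 'S_n) : X = interval a b ->
  exists2 s : 'S_n, perm_on X s &
    forall v, (s (g v) : nat) =
      if g v \in X then a + #|before X g v| else g v.
Proof.
move=> defX.
have lt_n (v : 'I_n) : g v \in X -> a + #|before X g v| < minn b n.
  by move/before_card; rewrite {2}defX card_interval; lia.
pose f (x : 'I_n) : 'I_n :=
  if x \in X then insubd x (a + #|before X g (g^-1 x)|) else x.
have fE (v : 'I_n) : (f (g v) : nat) = if g v \in X then a + #|before X g v| else g v.
  rewrite /f permK; case: ifP => // gvX.
  by rewrite val_insubd ifT //; have := lt_n v gvX; lia.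
have fX (v : 'I_n) : (f (g v) \in X) = (g v \in X).
  case: (boolP (g v \in X)) => gvX; last by rewrite /f (negbTE gvX) (negbTE gvX).
  by rewrite {1}defX inE fE gvX; have := lt_n v gvX; lia.
have f_inj : injective f.
  move=> x y; rewrite -(permKV g x) -(permKV g y).
  move: (g^-1 x) (g^-1 y) => v v' eq_f; congr (g _).
  have := congr1 val eq_f; rewrite /= !fE -!fX eq_f fX.
  case: ifP => gX; last by move/val_inj/perm_inj.
  have gX' : g v \in X by rewrite -fX eq_f fX.
  move/eqP; rewrite eqn_add2l => /eqP eq_c; apply: val_inj.
  case: (ltngtP v v') => // lt_v.
    by have := before_lt gX' lt_v; rewrite eq_c ltnn.
  by have := before_lt gX lt_v; rewrite eq_c ltnn.
exists (perm f_inj) => [|v]; last by rewrite permE.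
apply/subsetP=> x; rewrite inE permE; apply: contraR => xX.
by rewrite /f (negbTE xX).
Qed.

(** Here [g] maps a goal to the position of its token. Any solution starts with some [u] on [X];
    replacing [u] by the sorting [s] turns the remainder into its increasing rearrangement on [X],
    and this stays factorable by [factorable_sort]. *)
Lemma factorable_greedy X Xs (g s : 'S_n) (a : nat) :
  all (@consecutive n) (X :: Xs) -> perm_on X s ->
  (forall v, g v \in X -> (s (g v) : nat) = a + #|before X g v|) ->
  (g^-1 \in factorable (X :: Xs)) = ((g * s)^-1 \in factorable Xs).
Proof.
move=> con sX sE; rewrite invMg; apply/idP/idP=> [/mulsgP[u w]|w_in].
  rewrite inE => uX wA eq_g.
  rewrite eq_g mulgA; apply: (factorable_sort con) => //.
    by rewrite perm_onM ?perm_onV.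
  rewrite -mulgA -eq_g -invMg => i k iX kX lt_ik.
  rewrite ltnNge; apply/negP=> le_v.
  pose v : 'I_n := (g * s)^-1 i; pose v' : 'I_n := (g * s)^-1 k.
  have iv : s (g v) = i by rewrite /v -permM permKV.
  have kv' : s (g v') = k by rewrite /v' -permM permKV.
  have gvX : g v \in X by rewrite -(perm_closed _ sX) iv.
  have gvX' : g v' \in X by rewrite -(perm_closed _ sX) kv'.
  have := sE v gvX; have := sE v' gvX'; rewrite iv kv' => ek ei.
  move: le_v; rewrite -/v -/v' leq_eqVlt => /orP[/eqP/val_inj eq_v|lt_v].
    by move: lt_ik; rewrite ei ek eq_v ltnn.
  by have := before_lt gvX' lt_v; lia.
rewrite -[g^-1](mulKVg s) /=.
by apply: mem_mulg; rewrite // inE.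
Qed.

End Factorisation.

Notation "c ;; d" := (HSeq c d) (at level 60, right associativity).

(** * Symbolic execution and counting loops *)

Ltac hread := repeat (rewrite /upd /=;
  match goal with
  | H : hr ?s ?k = _ |- context [hr ?s ?k] => rewrite H
  | H : ha ?s = _ |- context [ha ?s] => rewrite H
  | H : same _ ?s ?s' |- context [hr ?s' ?k] => rewrite (H k isT)
  end).

Ltac hval := solve [hread; reflexivity].

Ltac hstep :=
  cbv beta;
  match goal with
  | |- wp _ (HSeq _ _) _ _ _ => apply: wp_seq
  | |- wp _ HSkip _ _ _ => apply: wp_skip
  | |- wp _ (HSet _ _) _ _ _ => eapply wp_set; [hval|cbv beta; cbn [xcost hr ha]]
  | |- wp _ (HCons _ _ _) _ _ _ => eapply wp_cons; [hval|hval|cbv beta; cbn [xcost hr ha]]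
  | |- wp _ (HPut _ _ _ _) _ _ _ => eapply wp_put; [hval|hval|cbv beta; cbn [xcost hr ha]]
  | |- wp _ (HIf _ _ _) _ _ _ => eapply wp_if; [hval|cbn [truthy xcost]]
  end.

Definition down (x : nat) (c : hc) : hc :=
  HWhile (XR x) (HSet x (XSub (XR x) (XC 1)) ;; c).

(** The invariant is indexed by the iterations still to come. The 7 units are the test and the
    decrement, charged before the body runs. *)
Lemma wp_down inp x c (Inv : nat -> hst -> nat -> Prop) k s t Q :
  hr s x = VN k -> Inv k s t ->
  (forall j s t, j < k -> hr s x = VN j.+1 -> Inv j.+1 s t ->
     wp inp c (HSt (upd (hr s) x (VN j)) (ha s)) (t + 7)
       (fun s' t' => hr s' x = VN j /\ Inv j s' t')) ->
  (forall s t, hr s x = VN 0 -> Inv 0 s t -> Q s (t + 2)) ->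
  wp inp (down x c) s t Q.
Proof.
move=> xk Ik step fin.
elim: k s t xk Ik step => [|k IH] s t xk Ik step.
  by apply: wp_while_false; [rewrite /= xk|apply: fin].
eapply wp_while_true; [by rewrite /= xk|by []|].
do 2!hstep; rewrite subn1 /=.
have := step k s t (ltnSn k) xk Ik.
rewrite -!addnA => /wp_conseq; apply=> s' t' [xk' Ik'].
by apply: IH => // j s2 t2 lt_j; apply: step; apply: ltnW.
Qed.

Lemma same_upd m s f x v a : x \in m -> same m s (HSt f a) ->
  same m s (HSt (upd f x v) a).
Proof.
move=> xm ss y ym; rewrite /= /upd; case: eqP => [eq_yx|_]; last exact: (ss y ym).
by rewrite eq_yx xm in ym.
Qed.

Lemma same_step m m1 s s1 s2 : same m1 s1 s2 -> all (mem m) m1 -> same m s s1 ->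
  same m s s2.
Proof.
move=> ss /allP sub ss1 y ym; rewrite ss ?ss1 //.
by apply: contra ym => /sub.
Qed.

Lemma same_step_arr m m1 s s1 s2 a : same m1 s1 s2 -> all (mem m) m1 -> same m s s1 ->
  same m s (HSt (hr s2) a).
Proof. exact: same_step. Qed.

Ltac hsame :=
  cbn [hr ha]; repeat (apply: same_upd; first by []);
  match goal with
  | |- same _ ?s ?s => move=> ? _; reflexivity
  | |- same _ ?s (HSt (hr ?s) _) => move=> ? _; reflexivity
  | H : same _ ?s1 ?s2 |- same _ _ ?s2 => eapply same_step; [exact: H|by []|hsame]
  | H : same _ ?s1 ?s2 |- same _ _ (HSt (hr ?s2) _) =>
      eapply same_step_arr; [exact: H|by []|hsame]
  end.

(** Adds [n] by single increments: a stored number may grow only by one per time unit. One such walk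
    per row costs [O(m * n)] altogether. *)
Definition bump (r : nat) : hc := HSet 3 (XR 0) ;; down 3 (HSet r (XInc (XR r))).

Lemma wp_bump inp s t n b r : r \in [:: 2; 4] -> hr s 0 = VN n -> hr s r = VN b ->
  wp inp (bump r) s t (fun s' t' => [/\ same [:: r; 3] s s', hr s' r = VN (b + n),
    ha s' = ha s & t' <= t + 10 * n + 4]).
Proof.
rewrite !inE => r24 r0 rb; pose Inv x j s' t' := [/\ same [:: x; 3] s s',
  hr s' x = VN (b + (n - j)), ha s' = ha s, j <= n & t' <= t + 2 + 10 * (n - j)].
(* The register is made concrete before the symbolic execution, which compares register numbers by
   computation. *)
case/orP: r24 rb => /eqP-> rb; rewrite /bump; do 2!hstep;
  [apply: (wp_down (k := n) (Inv := Inv 2))|apply: (wp_down (k := n) (Inv := Inv 4))];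
  rewrite /Inv.
1,5: by hread.
1,4: by rewrite subnn addn0; split=> //; [hsame|lia].
1,3: move=> j s1 t1 lt_j r3 [fr r2' ea _ le_t]; hstep; (split; first by hread);
  by split; [hsame|hread; congr VN; lia|hread|lia|lia].
1,2: by move=> s1 t1 _ [fr r2' ea _ le_t]; split=> //; [rewrite r2' subn0|lia].
Qed.

Notation advance := (bump 2).

Lemma wp_advance inp s t n b : hr s 0 = VN n -> hr s 2 = VN b ->
  wp inp advance s t (fun s' t' => [/\ same [:: 2; 3] s s', hr s' 2 = VN (b + n),
    ha s' = ha s & t' <= t + 10 * n + 4]).
Proof. exact: wp_bump. Qed.

Lemma nth_flatten_rows (T : eqType) (x0 : T) (f : T -> seq nat) (s : seq T) n j i :
  {in s, forall x, size (f x) = n} -> j < size s -> i < n ->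
  nth 0 (flatten [seq f x | x <- s]) (j * n + i) = nth 0 (f (nth x0 s j)) i.
Proof.
move=> sz; elim: s j sz => // x s IH [|j] sz /= lt_j lt_i; rewrite nth_cat sz ?mem_head //.
  by rewrite lt_i.
rewrite ifF; last by lia.
rewrite -IH //; last by move=> y ys; apply: sz; rewrite inE ys orbT.
by congr nth; lia.
Qed.

Lemma size_flatten_rows (T : eqType) (f : T -> seq nat) (s : seq T) n :
  {in s, forall x, size (f x) = n} -> size (flatten [seq f x | x <- s]) = size s * n.
Proof.
elim: s => // x s IH sz /=; rewrite size_cat sz ?mem_head // IH // => y ys.
by apply: sz; rewrite inE ys orbT.
Qed.

(** * Addresses inside an encoded instance *)

Section Encoding.
Variables (n m : nat).
Implicit Types (I : instance n m) (X : {set 'I_n}) (p : 'S_n).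

Lemma size_enc_set X : size (enc_set X) = n.
Proof. by rewrite size_map size_enum_ord. Qed.

Lemma size_enc_perm p : size (enc_perm p) = n.
Proof. by rewrite size_map size_enum_ord. Qed.

Lemma nth_enc_set X (i : 'I_n) : nth 0 (enc_set X) i = (i \in X).
Proof. by rewrite (nth_map i) ?size_enum_ord // nth_ord_enum. Qed.

Lemma nth_enc_perm p (i : 'I_n) : nth 0 (enc_perm p) i = p i.
Proof. by rewrite (nth_map i) ?size_enum_ord // nth_ord_enum. Qed.

Definition inst_sets I : seq nat := flatten [seq enc_set X | X <- sets I].

Lemma size_inst_sets I : size (inst_sets I) = m * n.
Proof. by rewrite (@size_flatten_rows _ _ _ n) ?size_tuple // => X _; apply: size_enc_set. Qed.

Lemma inp_set I rest (j : 'I_m) (i : 'I_n) :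
  nth 0 (enc_instance I ++ rest) (2 + j * n + i) = (i \in tnth (sets I) j).
Proof.
rewrite /enc_instance -/(inst_sets I) -addnA nth_cat ifT; last first.
  rewrite /= size_cat size_inst_sets size_enc_perm /=.
  have : j.+1 * n <= m * n by rewrite leq_mul2r ltn_ord orbT.
  by have := ltn_ord i; lia.
rewrite /= nth_cat size_inst_sets ifT; last first.
  have : j.+1 * n <= m * n by rewrite leq_mul2r ltn_ord orbT.
  by have := ltn_ord i; lia.
rewrite (nth_flatten_rows set0) ?size_tuple //; last by move=> X _; apply: size_enc_set.
by rewrite nth_enc_set (tnth_nth set0).
Qed.

Lemma inp_target I rest (i : 'I_n) :
  nth 0 (enc_instance I ++ rest) (2 + m * n + i) = target I i.
Proof.
rewrite /enc_instance -/(inst_sets I) -addnA nth_cat ifT; last first.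
  by rewrite /= size_cat size_inst_sets size_enc_perm /=; have := ltn_ord i; lia.
by rewrite /= nth_cat size_inst_sets add0n ltnNge leq_addr /= addKn nth_enc_perm.
Qed.

Lemma size_enc_instance I : size (enc_instance I) = 2 + m * n + n.
Proof. by rewrite /enc_instance -/(inst_sets I) /= size_cat size_inst_sets size_enc_perm. Qed.

Lemma enc_perm_bound p : all (fun k => k <= n) (enc_perm p).
Proof. by apply/allP=> _ /mapP[i _ ->]; rewrite ltnW. Qed.

Lemma enc_instance_bound I : 0 < m * n ->
  all (fun k => k <= m * n) (enc_instance I).
Proof.
move=> N0; have [m0 n0] : 0 < m /\ 0 < n by apply/andP; rewrite -muln_gt0.
rewrite /enc_instance -/(inst_sets I) /= all_cat leq_pmull // leq_pmulr //=.
apply/andP; split; last first.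
  apply: sub_all (enc_perm_bound _) => k /leq_trans; apply; exact: leq_pmull.
apply/allP=> k /flattenP[_ /mapP[X _ ->] /mapP[i _ ->]].
by apply: leq_trans N0; case: (_ \in _).
Qed.

End Encoding.

(** * Deciding interval instances *)

(* Array 1 holds, for every goal v, the position of the token with goal v. *)
Definition first_loop : hc :=
  HSet 4 (XC 0) ;; HSet 3 (XR 0) ;;
  down 3 (HIf (XIn (XR 2) (XR 3)) (HSet 4 (XR 3)) HSkip).

(** Register 5 visits the goals in increasing order while register 3 counts the rounds; each token
    found in the interval takes the next position from register 4. This is the permutation of
    [sorting_perm] in one pass. *)
Definition greedy_loop : hc :=
  HSet 5 (XC 0) ;; HSet 3 (XR 0) ;;
  down 3 (HIf (XIn (XR 2) (XArr 1 (XC 0) (XR 5)))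
            (HPut 1 (XC 0) (XR 5) (XR 4) ;; HSet 4 (XInc (XR 4))) HSkip ;;
          HSet 5 (XInc (XR 5))).

(** Two truncated subtractions, one in each direction, decide equality. *)
Definition test_loop : hc :=
  HSet 4 (XC 1) ;; HSet 3 (XR 0) ;;
  down 3 (HIf (XSub (XArr 1 (XC 0) (XR 3)) (XR 3)) (HSet 4 (XC 0))
         (HIf (XSub (XR 3) (XArr 1 (XC 0) (XR 3))) (HSet 4 (XC 0)) HSkip)).

Definition load_sizes : hc :=
  HSet 0 (XIn (XC 0) (XC 0)) ;; HSet 1 (XIn (XC 0) (XC 1)) ;; HSet 2 (XC 2).

(** The first loop only carries register 2 over the rows of the sets to the row of the target, from
    which array 1 is filled with the inverse of the target. *)
Definition decide_prog : hc :=
  load_sizes ;; HSet 6 (XR 1) ;; down 6 advance ;;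
  HSet 3 (XR 0) ;; down 3 (HPut 1 (XIn (XR 2) (XR 3)) (XC 0) (XR 3)) ;;
  HSet 2 (XC 2) ;; HSet 6 (XR 1) ;;
  down 6 (first_loop ;; greedy_loop ;; advance) ;;
  test_loop ;; HPut 0 (XC 0) (XC 0) (XR 4).

Section Decide.
Variable inp : seq nat.

Lemma wp_first_loop s t n b (X : pred nat) : hr s 0 = VN n -> hr s 2 = VN b ->
  (forall i, i < n -> nth 0 inp (b + i) = X i) ->
  wp inp first_loop s t (fun s' t' => [/\ same [:: 3; 4] s s', ha s' = ha s,
    exists a, hr s' 4 = VN a /\ (forall i, i < n -> X i -> a <= i /\ X a)
    & t' <= t + 13 * n + 7]).
Proof.
move=> r0 r2 inX; rewrite /first_loop; do 4!hstep.
apply: (wp_down (k := n) (Inv := fun j s' t' => [/\ same [:: 3; 4] s s', ha s' = ha s,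
  exists a, hr s' 4 = VN a /\ (forall i, j <= i < n -> X i -> a <= i /\ X a)
  & t' <= t + 5 + 13 * (n - j)])).
- by hread.
- split=> //; [hsame| |lia]; exists 0; split=> // i; lia.
- move=> j s1 t1 lt_j r3 [fr ea [a [r4 aX]] le_t]; hstep; rewrite inX //.
  case Xj: (X j); cbn [truthy nat_of_bool]; hstep.
  + split; first by hread.
    split=> //; [hsame| |lia]; exists j; split; first by hread.
    by move=> i /andP[]; lia.
  + split; first by hread.
    split=> //; [hsame| |lia]; exists a; split; first by hread.
    move=> i /andP[le_j lt_i] Xi; apply: aX => //; rewrite lt_i andbT ltn_neqAle le_j andbT.
    by apply: contraFneq Xj => ->.
- move=> s1 t1 _ [fr ea [a [r4 aX]] le_t]; split=> //; [|lia].
  by exists a; split=> // i lt_i; apply: aX.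
Qed.

Lemma wp_greedy_loop s t n b a (X : pred nat) (g : nat -> nat) :
  hr s 0 = VN n -> hr s 2 = VN b -> hr s 4 = VN a -> 
  (forall i, i < n -> nth 0 inp (b + i) = X i) ->
  (forall v, v < n -> ha s 1 v = g v /\ g v < n) ->
  wp inp greedy_loop s t (fun s' t' => [/\ same [:: 3; 4; 5] s s',
    forall v, v < n -> ha s' 1 v =
      if X (g v) then a + count (X \o g) (iota 0 v) else g v
    & t' <= t + 30 * n + 7]).
Proof.
move=> r0 r2 r4 inX ag; rewrite /greedy_loop; do 4!hstep.
apply: (wp_down (k := n) (Inv := fun j s' t' => [/\ same [:: 3; 4; 5] s s',
  hr s' 4 = VN (a + count (X \o g) (iota 0 (n - j))) /\ hr s' 5 = VN (n - j),
  forall v, v < n -> ha s' 1 v =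
    if (v < n - j) && X (g v) then a + count (X \o g) (iota 0 v) else g v
  & t' <= t + 5 + 30 * (n - j)])).
- by hread.
- rewrite subnn addn0; split=> //; [hsame| |lia].
  by move=> v lt_v /=; have [-> _] := ag v lt_v.
- move=> j s1 t1 lt_j r3 [fr [r4' r5] ga le_t].
  have lt_v : n - j.+1 < n by lia.
  have -> : n - j = (n - j.+1).+1 by lia.
  have gv := ga _ lt_v; rewrite ltnn /= in gv; have [_ lt_g] := ag _ lt_v.
  hstep; eapply wp_if; first by hread; rewrite gv inX.
  have cnt : count (X \o g) (iota 0 (n - j.+1).+1) =
    count (X \o g) (iota 0 (n - j.+1)) + X (g (n - j.+1)).
    by rewrite -addn1 iotaD count_cat /= addn0.
  case Xg: (X (g (n - j.+1))); cbn [truthy nat_of_bool]; do !hstep.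
  + split; first by hread.
    split; [hsame|split; [rewrite cnt Xg; hread; congr VN; lia|by hread]| |cbn [xcost]; lia].
    move=> v lt_vn; rewrite /= /upd /= ltnS leq_eqVlt.
    by case: eqP => [->|_] /=; [rewrite Xg|exact: ga].
  + split; first by hread.
    split; [hsame|split; [by rewrite cnt Xg addn0; hread|by hread]| |cbn [xcost]; lia].
    move=> v lt_vn; rewrite /= ga // ltnS [v <= _]leq_eqVlt.
    by case: eqP => [->|_] //=; rewrite Xg andbF.
- move=> s1 t1 _ [fr _ ga le_t]; split=> //; last by lia.
  by move=> v lt_v; rewrite ga // subn0 lt_v.
Qed.

Lemma wp_test_loop s t n (g : nat -> nat) :
  hr s 0 = VN n -> (forall v, v < n -> ha s 1 v = g v) ->
  wp inp test_loop s t (fun s' t' => [/\ same [:: 3; 4] s s', ha s' = ha s,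
    hr s' 4 = VN (all (fun v => g v == v) (iota 0 n)) & t' <= t + 40 * n + 8]).
Proof.
move=> r0 ag; rewrite /test_loop; do 4!hstep.
apply: (wp_down (k := n) (Inv := fun j s' t' => [/\ same [:: 3; 4] s s', ha s' = ha s,
  hr s' 4 = VN (all (fun v => g v == v) (iota j (n - j)))
  & t' <= t + 6 + 40 * (n - j)])).
- by hread.
- rewrite subnn; split=> //; [hsame|lia].
- move=> j s1 t1 lt_j r3 [fr ea r4 le_t].
  have -> : n - j = (n - j.+1).+1 by lia.
  hstep; rewrite ag //= eqn_leq -!subn_eq0; case E1: (g j - j) => [|d]; cbn [truthy]; hstep;
    last by split; [hread|split=> //; [hsame|lia]].
  rewrite ag //; case E2: (j - g j) => [|d]; cbn [truthy]; hstep.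
    by split; [hread|split=> //; [hsame|lia]].
  by split; [hread|split=> //; [hsame|lia]].
- by move=> s1 t1 _ [fr ea r4 le_t]; split=> //; [rewrite r4 subn0|lia].
Qed.

End Decide.

Lemma card_ord_prefix n (Q : pred 'I_n) (P : pred nat) (v : nat) :
  (forall x : 'I_n, P x = Q x) -> v <= n ->
  #|[set x : 'I_n | (x < v) && Q x]| = count P (iota 0 v).
Proof.
move=> PQ le_vn; rewrite -sum1dep_card.
under eq_bigl => x do rewrite -PQ.
rewrite -(big_mkord (fun i : nat => (i < v) && P i) (fun=> 1)) sum1_count /index_iota subn0.
rewrite -{1}(subnKC le_vn) iotaD count_cat add0n.
rewrite (@eq_in_count _ _ P (iota 0 v)); last by move=> i; rewrite mem_iota => /= ->.
rewrite (@eq_in_count _ _ pred0 (iota v _)) ?count_pred0 ?addn0 // => i.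
by rewrite mem_iota => /andP[le_v _]; rewrite ltnNge le_v.
Qed.

Lemma wp_load_sizes inp s t n m : nth 0 inp 0 = n -> nth 0 inp 1 = m ->
  wp inp load_sizes s t (fun s' t' => [/\ same [:: 0; 1; 2] s s', ha s' = ha s,
    hr s' 0 = VN n /\ hr s' 1 = VN m, hr s' 2 = VN 2 & t' = t + 13]).
Proof.
move=> en em; rewrite /load_sizes; do !hstep.
by split=> //; [hsame|hread; rewrite add0n en em|lia].
Qed.

Section DecideCorrect.
Variables (n m : nat) (J : instance n m).
Hypotheses (n0 : 0 < n) (m0 : 0 < m) (intJ : wppsg0 J).

Let inp := enc_instance J.

Lemma inp_setE (j : 'I_m) (i : 'I_n) :
  nth 0 inp (2 + j * n + i) = (i \in tnth (sets J) j).
Proof. by rewrite -[inp]cats0 inp_set. Qed.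

(** The scan yields the least element, not the length. For an empty set the end 0 gives the empty
    interval whatever [a] is. *)
Lemma interval_from (X : {set 'I_n}) (a : nat) : consecutive X ->
  (forall i : 'I_n, i \in X -> a <= i /\ exists2 x : 'I_n, x \in X & a = x) ->
  exists b, X = interval n a b.
Proof.
move=> /consecutiveP[c [d defX]] aX.
have [->|[i iX]] := set_0Vmem X.
  by exists 0; apply/setP=> i; rewrite !inE; lia.
exists d; have [_ [x xX ax]] := aX i iX; apply/setP=> y.
case: (boolP (y \in X)) => [yX|]; move: xX.
  by have [le_ay _] := aX y yX; move: yX; rewrite defX !inE; lia.
by rewrite defX !inE ax => /andP[? ?] /negP yN; apply/esym/negP; lia.
Qed.

Definition decide_inv (j : nat) (s : hst) (t : nat) : Prop :=
  [/\ [/\ hr s 0 = VN n, hr s 2 = VN (2 + (m - j) * n) & j <= m],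
      exists2 g : 'S_n, (forall v : 'I_n, ha s 1 v = g v) &
        (target J \in factorable (sets J)) = (g^-1%g \in factorable (drop (m - j) (sets J)))
    & t <= 60 * m * n + 60 * n + 100 * (m - j) * n].

Lemma wp_decide : wp inp decide_prog hinit 0 (fun s' t' =>
  ha s' 0 0 = (target J \in factorable (sets J)) /\ t' <= 1000 * (m * n)).
Proof.
have mn : m <= m * n /\ n <= m * n by rewrite leq_pmulr ?leq_pmull.
rewrite /decide_prog; hstep; apply: (wp_conseq (wp_load_sizes (n := n) (m := m) _ _ _ _)) => //.
move=> s1 t1 [fr1 ea1 [r0 r1] r2 et1]; do 3!hstep.
apply: (wp_down (k := m) (Inv := fun j s t => [/\ hr s 0 = VN n, hr s 1 = VN m,
  hr s 2 = VN (2 + (m - j) * n), ha s = ha hinit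
  & t <= 16 + (m - j) * (10 * n + 20)])).
- by hread.
- by split; rewrite ?subnn ?mul0n; [hread..|lia].
- move=> j s t lt_j r6 [r0' r1' r2' ea le_t].
  apply: (wp_conseq (wp_advance (n := n) (b := 2 + (m - j.+1) * n) _ _ _ _)); [by hread..|].
  move=> s' t' [fr r2s ea' le_t']; split; first by hread.
  have mj : m - j = (m - j.+1).+1 by lia.
  split; [by hread|by hread| |by rewrite ea' -ea|rewrite mj mulSn; lia].
  by rewrite r2s mj mulSn; congr VN; lia.
move=> s2 t2 r6 [r0' r1' r2' ea2 le_t2]; rewrite subn0 in r2' le_t2; do 3!hstep.
pose g := ((target J)^-1)%g.
apply: (wp_down (k := n) (Inv := fun j s t => [/\ hr s 0 = VN n, hr s 1 = VN m,
  hr s 2 = VN (2 + m * n),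
  forall x : 'I_n, j <= x -> ha s 1 (target J x) = x
  & t <= 20 + m * (10 * n + 20) + (n - j) * 20])).
- by hread.
- split; try (by hread); last by lia.
  by move=> x; rewrite leqNgt ltn_ord.
- move=> j s t lt_j r3 [r0s r1s r2s gx le_t].
  have tj : nth 0 inp (2 + m * n + j) = target J (Ordinal lt_j).
    by rewrite -[inp]cats0 -[j]/(nat_of_ord (Ordinal lt_j)) inp_target.
  eapply wp_put; [by hread; rewrite tj|by hread|cbv beta; cbn [xcost hr ha]].
  split; first by hread.
  split; [by hread..| |by lia] => x le_jx; rewrite /upd /= addn0.
  case: eqP => [/val_inj/perm_inj->//|ne]; apply: gx.
  rewrite ltn_neqAle le_jx andbT; apply: contra_not_neq ne => eq_j.
  by congr (nat_of_ord (target J _)); apply: val_inj; rewrite /= eq_j.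
move=> s3 t3 r3 [r0s r1s r2s gx le_t3]; do 5!hstep.
apply: (wp_down (k := m) (Inv := decide_inv)).
- by hread.
- split; last by nia.
    by split; rewrite ?subnn ?mul0n; hread.
  exists g; last by rewrite subnn drop0 /g invgK.
  by move=> v; rewrite /= -{1}(permKV (target J) v) gx.
- move=> j s t lt_j r6' [[r0j r2j _] [g' ag' fact] le_t].
  have lt_k : m - j.+1 < m by lia.
  pose jj := Ordinal lt_k; pose X := tnth (sets J) jj.
  pose Xn i := nth 0 inp (2 + (m - j.+1) * n + i) != 0.
  have XnE (i : 'I_n) : Xn i = (i \in X) by rewrite /Xn (inp_setE jj i) eqb0 negbK.
  have inpX i : i < n -> nth 0 inp (2 + (m - j.+1) * n + i) = Xn i.
    move=> lt_i; rewrite -[i]/(nat_of_ord (Ordinal lt_i)) XnE; exact: (inp_setE jj).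
  hstep; apply: (wp_conseq (wp_first_loop (n := n) (b := 2 + (m - j.+1) * n) (X := Xn) _ _ _ _));
    [by hread..|by []|].
  move=> s4 t4 [fr4 ea4 [a [r4 aX]] le_t4].
  have ag4 v : v < n -> ha s4 1 v = ha s4 1 v /\ ha s4 1 v < n.
    by move=> lt_v; split=> //; rewrite ea4 /= (ag' (Ordinal lt_v)).
  hstep; apply: (wp_conseq (wp_greedy_loop (n := n) (b := 2 + (m - j.+1) * n) (a := a) (X := Xn)
     (g := ha s4 1) _ _ _ _ _ _)); [by hread..|by []|by []|].
  move=> s5 t5 [fr5 ag5 le_t5].
  apply: (wp_conseq (wp_advance (n := n) (b := 2 + (m - j.+1) * n) _ _ _ _)); [by hread..|].
  move=> s6 t6 [fr6 r26 ea6 le_t6]; split; first by hread.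
  have mj : m - j = (m - j.+1).+1 by lia.
  have [b defX] : exists b, X = interval n a b.
    apply: interval_from; first exact: intJ.
    move=> i iX; have Xni : Xn i by rewrite XnE.
    have [le_a Xa] := aX i (ltn_ord i) Xni.
    split=> //; have lt_a : a < n by have := ltn_ord i; lia.
    by exists (Ordinal lt_a); rewrite // -XnE.
  (* The machine has just carried out this permutation: its count along the array and the
     cardinality of [before] coincide by [card_ord_prefix]. *)
  have [sg sgX sgE] := sorting_perm g' defX.
  have e4 v : ha s4 1 (v : 'I_n) = g' v by rewrite ea4 ag'.
  split; [by split; [hread|rewrite r26 mj mulSn; congr VN; lia|lia]| |].
    exists (g' * sg)%g => [v|].
      rewrite ea6 ag5 // permM sgE e4 XnE; case: ifP => // _; congr (_ + _).
      rewrite /before; apply/esym/card_ord_prefix; last exact: ltnW.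
      by move=> x /=; rewrite e4 XnE.
    rewrite fact mj -(@factorable_greedy _ X _ g' sg a) //.
    + congr (_ \in factorable _); rewrite (drop_nth set0) ?size_tuple //.
      by rewrite /X (tnth_nth set0).
    + rewrite /= intJ /=; apply/allP=> Y /mem_drop /tnthP[i ->]; exact: intJ.
    + by move=> v gvX; rewrite sgE gvX.
  by move: le_t; rewrite mj -!mulnA mulSn; lia.
move=> s7 t7 _ [[r07 _ _] [g' ag' fact] le_t7].
hstep; apply: (wp_conseq (wp_test_loop (n := n) (g := ha s7 1) _ _ _ _)); [by hread|by []|].
move=> s8 t8 [fr8 ea8 r48 le_t8]; hstep.
split; last by cbn [xcost]; rewrite subn0 in le_t7; nia.
rewrite /upd /= fact subn0 drop_oversize ?size_tuple //= inE; congr nat_of_bool.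
rewrite -(inj_eq invg_inj) invgK invg1; apply/allP/eqP=> [id_g|g1 v].
  apply/permP=> v; apply: val_inj; rewrite /= perm1 -ag'; apply/eqP/id_g.
  by rewrite mem_iota /=.
by rewrite mem_iota => /= lt_v; rewrite (ag' (Ordinal lt_v)) g1 perm1.
Qed.

End DecideCorrect.

Lemma decide_runs : exists (c : cmd) (C : nat), forall n m (J : instance n m),
  0 < n -> 0 < m -> wppsg0 J ->
  runs_within c C (m * n) (enc_instance J)
    (fun out => exists b : bool, (b <-> yes_instance J) /\ out = [:: nat_of_bool b]).
Proof.
(* Two arrays; time at most [1000 * (m * n)]; entries and length of the input at most
   [4 * (m * n)]. *)
have [C runs] := @compile_runs decide_prog 2 1000 4 isT.
exists (Then (prelude (2 * (4 + 1000)) 2) (hcomp decide_prog)), C.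
move=> n m J n0 m0 intJ; have N0 : 0 < m * n by rewrite muln_gt0 m0.
have [T [s' [ex [out le_T]]]] := wp_decide n0 m0 intJ.
apply: (runs n m _ s' T [:: (target J \in factorable (sets J)) : nat]) => //.
- by apply: sub_all (enc_instance_bound J N0) => k; lia.
- by rewrite size_enc_instance; have := leq_pmull n m0; lia.
- by rewrite /= muln_gt0.
- by case=> // _; rewrite out.
- by exists (target J \in factorable (sets J)); split=> //; rewrite yes_factorable.
Qed.

(** * Following a chain *)

Section Chains.
Variables n m : nat.
Implicit Types (I : instance n m) (d : m.-tuple 'S_n).
Local Open Scope group_scope.

Definition cumul d (k : nat) : 'S_n := \prod_(0 <= i < k) nth 1 d i.

Lemma cumulS d k : cumul d k.+1 = cumul d k * nth 1 d k.
Proof. by rewrite /cumul big_nat_recr. Qed.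

Lemma imset_permM (s t : 'S_n) (X : {set 'I_n}) : (s * t) @: X = t @: (s @: X).
Proof. by rewrite -imset_comp; apply: eq_imset => x; rewrite /= permM. Qed.

Lemma imset_perm1 (X : {set 'I_n}) : (1 : 'S_n) @: X = X.
Proof. by rewrite -[RHS]imset_id; apply: eq_imset => x; rewrite perm1. Qed.

(** Step [j] moves the sets of 0-based index at least [j]. The set of index [i] thus feels the steps
    [0, .., i] and none later, which gives the minimum of [i + 1] and [k]. *)
Lemma chain_sets I d k i :
  tnth (sets (chain_instance I d k)) i = cumul d (minn i.+1 k) @: tnth (sets I) i.
Proof.
elim: k => [|k IHk] /=; first by rewrite minn0 /cumul big_nil imset_perm1.
have [lt_ik|le_ki] := ltnP i k.
  by case: k lt_ik IHk => // k lt_ik IHk; rewrite tnth_mktuple lt_ik IHk !(minn_idPl _) // leqW.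
rewrite (minn_idPr _) // cumulS imset_permM.
have -> : cumul d k @: tnth (sets I) i = tnth (sets (chain_instance I d k)) i.
  by rewrite IHk (minn_idPr _) // leqW.
by case: k le_ki {IHk} => [|k] le_ki; rewrite tnth_mktuple // ltnNge le_ki.
Qed.

(** Only the first step conjugates; it alone contributes a factor on the left. *)
Lemma chain_target I d k : 0 < k ->
  target (chain_instance I d k) = (nth 1 d 0)^-1 * target I * cumul d k.
Proof.
case: k => // k _; elim: k => [|k IHk]; first by rewrite /= /cumul big_nat1.
by rewrite cumulS mulgA -IHk.
Qed.

End Chains.

(** Array 1 holds the product of the permutations read so far. The current row of the output is
    still zero, so writing ones at the images of the elements produces the characteristic vector of
    the moved set. *)
Definition follow_step : hc :=
  HSet 3 (XR 0) ;;
  down 3 (HPut 1 (XR 3) (XC 0) (XIn (XR 4) (XArr 1 (XC 0) (XR 3)))) ;;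
  HSet 3 (XR 0) ;;
  down 3 (HIf (XIn (XR 2) (XR 3)) (HPut 0 (XR 2) (XArr 1 (XC 0) (XR 3)) (XC 1)) HSkip) ;;
  advance ;; bump 4.

(** Register 8 keeps the address of [pi_1]. The final target sends the image of [x] under [pi_1] to
    the image of the old target value under the whole product, so it is written by scattering along
    [pi_1], and no inverse has to be computed. *)
Definition follow_prog : hc :=
  load_sizes ;; HPut 0 (XC 0) (XC 0) (XR 0) ;; HPut 0 (XC 0) (XC 1) (XR 1) ;;
  HSet 6 (XR 1) ;; down 6 advance ;; advance ;;
  HSet 4 (XR 2) ;; HSet 8 (XR 2) ;; HSet 2 (XC 2) ;;
  HSet 3 (XR 0) ;; down 3 (HPut 1 (XR 3) (XC 0) (XR 3)) ;;
  HSet 6 (XR 1) ;; down 6 follow_step ;;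
  HSet 3 (XR 0) ;;
  down 3 (HPut 0 (XR 2) (XIn (XR 8) (XR 3)) (XArr 1 (XC 0) (XIn (XR 2) (XR 3)))).

Section Follow.
Variables (n m : nat) (I : instance n m) (d : m.-tuple 'S_n).
Hypotheses (n0 : 0 < n) (m0 : 0 < m).
Local Notation dk k := (nth 1%g d k).

Let inp := enc_instance I ++ enc_description d.

Lemma inp_desc k (i : 'I_n) : k < m -> nth 0 inp (2 + m * n + n + k * n + i) = dk k i.
Proof.
move=> lt_k; rewrite nth_cat size_enc_instance ifF; last by lia.
rewrite (_ : _ - _ = k * n + i); last by lia.
rewrite (nth_flatten_rows 1%g) ?size_tuple ?nth_enc_perm //.
by move=> p _; apply: size_enc_perm.
Qed.

Lemma inp_setI (j : 'I_m) (i : 'I_n) :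
  nth 0 inp (2 + j * n + i) = (i \in tnth (sets I) j).
Proof. exact: inp_set. Qed.

Lemma wp_compose s t k (p : 'S_n) : k < m ->
  hr s 0 = VN n -> hr s 4 = VN (2 + m * n + n + k * n) -> hr s 3 = VN n ->
  (forall x : 'I_n, ha s 1 x = p x) ->
  wp inp (down 3 (HPut 1 (XR 3) (XC 0) (XIn (XR 4) (XArr 1 (XC 0) (XR 3))))) s t
    (fun s' t' => [/\ same [:: 3] s s', forall i, ha s' 0 i = ha s 0 i,
      forall x : 'I_n, ha s' 1 x = (p * dk k)%g x & t' <= t + 25 * n + 2]).
Proof.
move=> lt_k r0 r4 r3 ap.
apply: (wp_down (k := n) (Inv := fun j s' t' => [/\ same [:: 3] s s',
  forall i, ha s' 0 i = ha s 0 i,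
  forall x : 'I_n, ha s' 1 x = if x < j then p x : nat else (p * dk k)%g x
  & t' <= t + 25 * (n - j)])) => //.
  by split=> //; [move=> x; rewrite ltn_ord|lia].
- move=> j s1 t1 lt_j r3' [fr ea0 ea1 le_t]; pose jo := Ordinal lt_j.
  have vj : ha s1 1 j = p jo by rewrite -[j]/(nat_of_ord jo) ea1 ltnSn.
  eapply wp_put; [by hread|by hread; rewrite vj inp_desc|cbv beta; cbn [xcost hr ha]].
  split; first by hread.
  split=> //; [hsame| |lia] => x; rewrite /= /upd /= addn0 permM.
  case: eqP => [eq_x|ne]; first by rewrite eq_x ltnn (_ : x = jo) //; apply: val_inj.
  by rewrite ea1 permM ltnS (_ : (x <= j) = (x < j)) //; lia.
- move=> s1 t1 _ [fr ea0 ea1 le_t]; split=> //; lia.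
Qed.

Lemma wp_scatter s t (k : 'I_m) (p : 'S_n) (f : nat -> nat) :
  hr s 0 = VN n -> hr s 2 = VN (2 + k * n) -> hr s 3 = VN n ->
  (forall x : 'I_n, ha s 1 x = p x) -> (forall i, i < n -> ha s 0 (2 + k * n + i) = 0) ->
  (forall i, i < 2 + k * n -> ha s 0 i = f i) ->
  wp inp (down 3 (HIf (XIn (XR 2) (XR 3))
                    (HPut 0 (XR 2) (XArr 1 (XC 0) (XR 3)) (XC 1)) HSkip)) s t
    (fun s' t' => [/\ same [:: 3] s s', ha s' 1 = ha s 1,
      forall x : 'I_n, ha s' 0 (2 + k * n + x) = (x \in p @: tnth (sets I) k),
      forall i, (i < 2 + k * n) || (2 + k.+1 * n <= i) -> ha s' 0 i = ha s 0 i
    & t' <= t + 25 * n + 2]).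
Proof.
move=> r0 r2 r3 ap z f0; set X := tnth (sets I) k.
apply: (wp_down (k := n) (Inv := fun j s' t' => [/\ same [:: 3] s s', ha s' 1 = ha s 1,
  forall x : 'I_n, ha s' 0 (2 + k * n + x) = (x \in p @: [set y in X | j <= y]),
  forall i, (i < 2 + k * n) || (2 + k.+1 * n <= i) -> ha s' 0 i = ha s 0 i
  & t' <= t + 25 * (n - j)])) => //.
- split=> //; [|lia] => x; rewrite z //.
  case: imsetP => // [[y]]; rewrite inE => /andP[_]; have := ltn_ord y; lia.
- move=> j s1 t1 lt_j r3' [fr ea1 bits rest le_t]; pose jo := Ordinal lt_j.
  have step x : (x \in p @: [set y in X | j <= y]) =
      (x == p jo) && (jo \in X) || (x \in p @: [set y in X | j < y]).
    apply/imsetP/orP=> [[y]|].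
      rewrite inE => /andP[yX]; rewrite leq_eqVlt => /orP[/eqP eq_j|lt_y] ->.
        by left; rewrite (_ : jo = y) ?eqxx ?yX //; apply: val_inj.
      by right; rewrite mem_imset ?inE ?yX //; apply: perm_inj.
    case=> [/andP[/eqP-> jX]|/imsetP[y]]; first by exists jo; rewrite // inE jX /=.
    by rewrite inE => /andP[yX lt_y] ->; exists y; rewrite // inE yX ltnW.
  have inpj : nth 0 inp (2 + k * n + j) = (jo \in X) := inp_setI k jo.
  hstep; rewrite inpj.
  case jX: (jo \in X); cbn [truthy nat_of_bool].
    have vj : ha s1 1 j = p jo by rewrite -[j]/(nat_of_ord jo) ea1 ap.
    eapply wp_put; [by hread; rewrite vj|by hread|cbv beta; cbn [xcost hr ha]].
    split; first by hread.
    split=> //; [hsame| | |lia] => i.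
      rewrite /= /upd /= step jX andbT eqn_add2l bits.
      by rewrite -[(i : nat) == _]/(i == p jo); case: eqP.
    move=> Hi; rewrite /= /upd /= ifN ?rest //; apply: contraTneq Hi => ->.
    by rewrite mulSn; have := ltn_ord (p jo); lia.
  hstep; split; first by hread.
  split=> //; [hsame| |lia] => x; rewrite /= bits step.
  by rewrite jX andbF.
- move=> s1 t1 _ [fr ea1 bits rest le_t]; split=> //; last by lia.
  have eqX : [set y in X | 0 <= y] = X by apply/setP=> y; rewrite inE andbT.
  by move=> x; rewrite bits eqX.
Qed.

Definition follow_inv (j : nat) (s : hst) : Prop :=
  [/\ [/\ hr s 0 = VN n, hr s 2 = VN (2 + (m - j) * n),
          hr s 4 = VN (2 + m * n + n + (m - j) * n) & hr s 8 = VN (2 + m * n + n)],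
      forall x : 'I_n, ha s 1 x = cumul d (m - j) x,
      forall i, i < 2 + (m - j) * n ->
        ha s 0 i = nth 0 (enc_instance (chain_instance I d m)) i
    & forall i, 2 + (m - j) * n <= i -> ha s 0 i = 0].

Lemma wp_follow_step j s t : j < m -> follow_inv j.+1 s -> hr s 6 = VN j ->
  wp inp follow_step s t (fun s' t' => [/\ hr s' 6 = VN j, follow_inv j s' & t' <= t + 70 * n + 20]).
Proof.
move=> lt_j [[r0 r2 r4 r8] cum bits zero] r6; rewrite /follow_step.
have lt_k : m - j.+1 < m by lia.
pose k := Ordinal lt_k; have mj : m - j = (m - j.+1).+1 by lia.
do 3!hstep.
apply: (wp_conseq (wp_compose (k := k) (p := cumul d k) _ _ _ _ _ _)); [by []|by hread..|by []|].
move=> s1 t1 [fr1 ea0 ea1 le_t1]; rewrite -cumulS in ea1; do 3!hstep.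
apply: (wp_conseq (wp_scatter (k := k) (p := cumul d k.+1) (f := ha s 0) _ _ _ _ _ _ _)).
- by hread.
- by hread.
- by hread.
- by [].
- by move=> i lt_i; rewrite /= ea0 /= zero //; lia.
- by move=> i _; rewrite /= ea0.
move=> s2 t2 [fr2 eb1 bits2 rest2 le_t2]; hstep.
apply: (wp_conseq (wp_advance (n := n) (b := 2 + k * n) _ _ _ _)); [by hread..|].
move=> s3 t3 [fr3 r23 ea3 le_t3].
apply: (wp_conseq (wp_bump (r := 4) (n := n) (b := 2 + m * n + n + k * n) _ _ _ _ _)); [by []|by hread..|].
move=> s4 t4 [fr4 r44 ea4 le_t4]; split; [by hread| |lia].
split.
- split; [by hread| |by rewrite r44 mj mulSn; congr VN; rewrite /k /=; lia|by hread].
  by rewrite (fr4 2 isT) r23 mj mulSn; congr VN; rewrite /k /=; lia.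
- by move=> x; rewrite ea4 ea3 eb1 ea1 mj.
- move=> i; rewrite mj mulSn => lt_i; rewrite ea4 ea3.
  have [lt_i2|le_i2] := ltnP i (2 + k * n).
    by rewrite rest2 ?lt_i2 //= ea0 bits.
  have lt_in : i - (2 + k * n) < n by rewrite /k /= in le_i2 *; lia.
  pose x := Ordinal lt_in; have -> : i = 2 + k * n + x by rewrite /= subnKC.
  rewrite bits2 -[enc_instance _]cats0 inp_set chain_sets.
  by rewrite (minn_idPl _) // /k /=; lia.
- move=> i; rewrite mj => le_i; rewrite ea4 ea3 rest2 /= ?ea0 /= ?zero //.
    by move: le_i; rewrite mulSn; lia.
  by rewrite le_i orbT.
Qed.

Lemma wp_follow : wp inp follow_prog hinit 0 (fun s' t' =>
  (forall i, i < size (enc_instance (chain_instance I d m)) ->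
     ha s' 0 i = nth 0 (enc_instance (chain_instance I d m)) i)
  /\ t' <= 1000 * (m * n)).
Proof.
have mn : m <= m * n /\ n <= m * n by rewrite leq_pmulr ?leq_pmull.
rewrite /follow_prog; hstep; apply: (wp_conseq (wp_load_sizes (n := n) (m := m) _ _ _ _)) => //.
move=> s1 t1 [fr1 ea1 [r0 r1] r2 et1]; do 7!hstep.
apply: (wp_down (k := m) (Inv := fun j s t => [/\ hr s 0 = VN n /\ hr s 1 = VN m,
  hr s 2 = VN (2 + (m - j) * n), ha s 1 = (fun=> 0),
  (forall i, ha s 0 i = if i == 1 then m else if i == 0 then n else 0)
  & t <= 30 + (m - j) * (10 * n + 20)])).
- by hread.
- split; rewrite ?subnn ?mul0n; [by hread|by hread|by rewrite /= ea1| |lia].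
  by case=> [|[|i]]; rewrite /upd /= ?ea1 //; rewrite /upd /=.
- move=> j s t lt_j r6 [[r0' r1'] r2' ea eb le_t].
  apply: (wp_conseq (wp_advance (n := n) (b := 2 + (m - j.+1) * n) _ _ _ _)); [by hread..|].
  move=> s' t' [fr r2s ea' le_t']; split; first by hread.
  have mj : m - j = (m - j.+1).+1 by lia.
  split; [by hread| |by rewrite ea'|by rewrite ea'|rewrite mj mulSn; lia].
  by rewrite r2s mj mulSn; congr VN; lia.
move=> s2 t2 r6 [[r0' r1'] r2' ea2 eb2 le_t2]; rewrite subn0 in r2' le_t2; hstep.
apply: (wp_conseq (wp_advance (n := n) (b := 2 + m * n) _ _ _ _)); [by hread..|].
move=> s3 t3 [fr3 r23 ea3 le_t3]; do 9!hstep.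
apply: (wp_down (k := n) (Inv := fun j s t => [/\ same [:: 2; 3; 4; 8] s3 s,
  [/\ hr s 2 = VN 2, hr s 4 = VN (2 + m * n + n) & hr s 8 = VN (2 + m * n + n)],
  forall i, ha s 0 i = ha s2 0 i, forall i, j <= i < n -> ha s 1 i = i
  & t <= t3 + 11 + (n - j) * 20])).
- by hread.
- split; [hsame|split; by hread|by move=> i; rewrite /= ea3| |lia].
  by move=> i; lia.
- move=> j s t lt_j r3 [fr [r2s r4s r8s] ha0 ha1 le_t]; hstep; split; first by hread.
  split; [hsame|split; by hread|by []| |lia].
  by move=> i lt_i; rewrite /= /upd /= addn0; case: eqP => // ne; apply: ha1; lia.
move=> s4 t4 _ [fr4 [r24 r44 r84] ha0 ha1 le_t4]; do 3!hstep.
apply: (wp_down (k := m) (Inv := fun j s t => follow_inv j s /\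
  t <= t4 + 10 + (m - j) * (70 * n + 40))).
- by hread.
- split; last by lia.
  split; rewrite ?subnn ?mul0n ?addn0.
  + by split; hread.
  + by move=> x; rewrite /= ha1 /cumul ?big_nil ?perm1 // ltn_ord.
  + by case=> [|[|i]] // _; rewrite /= ha0 eb2.
  + by case=> [|[|i]] // _; rewrite /= ha0 eb2.
- move=> j s t lt_j r6' [inv le_t].
  apply: (wp_conseq (wp_follow_step _ lt_j _ _)) => //.
  move=> s' t'' [r6s inv2 le_t2']; do 2!split=> //.
  have -> : m - j = (m - j.+1).+1 by lia.
  by rewrite mulSn; lia.
move=> s5 t5 _ [[[r05 r25 r45 r85] cum bits zero] le_t5].
rewrite !subn0 in r25 r45 cum bits zero le_t5; do 2!hstep.
have enc_lt i : i < n -> 2 + m * n + i < size (enc_instance (chain_instance I d m)).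
  by rewrite size_enc_instance; lia.
set out := enc_instance (chain_instance I d m) in bits enc_lt *.
apply: (wp_down (k := n) (Inv := fun j s t => [/\ same [:: 3] s5 s, ha s 1 = ha s5 1,
  forall i, i < 2 + m * n -> ha s 0 i = nth 0 out i,
  forall x : 'I_n, j <= x -> ha s 0 (2 + m * n + dk 0 x) = nth 0 out (2 + m * n + dk 0 x)
  & t <= t5 + 10 + (n - j) * 30])).
- by hread.
- split=> //; [hsame| |lia] => x; rewrite leqNgt ltn_ord //.
- move=> j s t lt_j r3 [fr ea1s lo hi le_t]; pose jo := Ordinal lt_j.
  have tj : nth 0 inp (2 + m * n + j) = target I jo := inp_target _ _ jo.
  have dj : nth 0 inp (2 + m * n + n + j) = dk 0 jo.
    by have := inp_desc jo m0; rewrite mul0n addn0.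
  eapply wp_put; [by hread; rewrite dj|by hread; rewrite tj ea1s cum|cbv beta; cbn [xcost hr ha]].
  split; first by hread.
  split=> //; [hsame| | |lia].
    by move=> i lt_i; rewrite /= /upd /= ifN ?lo //; lia.
  move=> x le_j; rewrite [LHS]/= /upd [LHS]/= eqn_add2l.
  case: eqP => [/val_inj/perm_inj->|ne].
    by rewrite -[out]cats0 inp_target chain_target // !permM permK.
  apply: hi; rewrite ltn_neqAle le_j andbT; apply: contra_not_neq ne => eq_j.
  by congr (nat_of_ord (dk 0 _)); apply: val_inj.
move=> s6 t6 _ [fr6 ea6 lo hi le_t6]; split; last by nia.
move=> i; rewrite size_enc_instance => lt_i.
have [lt_i2|le_i2] := ltnP i (2 + m * n); first exact: lo.
have lt_in : i - (2 + m * n) < n by lia.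
have -> : i = 2 + m * n + dk 0 ((dk 0)^-1%g (Ordinal lt_in)) by rewrite permKV /= subnKC.
exact: hi.
Qed.

Lemma enc_description_bound : all (fun k => k <= n) (enc_description d).
Proof.
apply/allP=> k /flattenP[_ /mapP[p _ ->]].
by move/allP: (enc_perm_bound p); apply.
Qed.

Lemma size_enc_description : size (enc_description d) = m * n.
Proof.
rewrite (@size_flatten_rows _ _ _ n) ?size_tuple // => p _; exact: size_enc_perm.
Qed.

End Follow.

Lemma follow_runs : exists (c : cmd) (C : nat), forall n m (I : instance n m)
    (d : m.-tuple 'S_n), 0 < n -> 0 < m ->
  runs_within c C (m * n) (enc_instance I ++ enc_description d)
    (fun out => out = enc_instance (chain_instance I d m)).
Proof.
have [C runs] := @compile_runs follow_prog 2 1000 5 isT.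
exists (Then (prelude (2 * (5 + 1000)) 2) (hcomp follow_prog)), C.
move=> n m I d n0 m0; have N0 : 0 < m * n by rewrite muln_gt0 m0.
have [T [s' [ex [out le_T]]]] := wp_follow I d n0 m0.
have nN := leq_pmull n m0.
apply: (runs n m _ s' T (enc_instance (chain_instance I d m))) => //.
- rewrite all_cat; apply/andP; split.
    by apply: sub_all (enc_instance_bound I N0) => k; lia.
  by apply: sub_all (enc_description_bound d) => k; lia.
- by rewrite size_cat size_enc_instance size_enc_description; lia.
- by rewrite size_enc_instance; lia.
Qed.

(** * Frontier languages of PQ-trees *)

(** The generated principle offers no hypothesis for children nested in sequences. Membership is
    [List.In], and reorderings are [Permutation], because trees are handled without a decidable
    equality. *)
Lemma pqtree_nested_ind n (P : pqtree n -> Prop) :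
  (forall i, P (Leaf i)) ->
  (forall ts, (forall t, List.In t ts -> P t) -> P (PNode ts)) ->
  (forall ts, (forall t, List.In t ts -> P t) -> P (QNode ts)) ->
  forall t, P t.
Proof.
move=> hl hp hq; refine (fix IH t : P t := _).
pose go := fix go ts u : List.In u ts -> P u :=
  match ts return List.In u ts -> P u with
  | [::] => fun u_in => match u_in with end
  | t' :: ts' => fun u_in =>
      match u_in with
      | or_introl eq_t => eq_ind t' P (IH t') u eq_t
      | or_intror u_in' => go ts' u u_in'
      end
  end.
exact: (match t return P t with
        | Leaf i => hl i | PNode ts => hp ts (go ts) | QNode ts => hq ts (go ts)
        end).
Qed.

Lemma perm_rev_seq (T : Type) (s : seq T) : Permutation (rev s) s.
Proof.
elim: s => [|x s IH]; first exact: Permutation.perm_nil.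
rewrite rev_cons -cats1; apply: Permutation_trans (Permutation_app_comm _ _) _ => /=.
exact: Permutation.perm_skip.
Qed.

Lemma perm_filter_seq (T : Type) (p : pred T) (s s' : seq T) :
  Permutation s s' -> Permutation (filter p s) (filter p s').
Proof.
elim=> {s s'} [|x s s' _ IH|x y s|s1 s2 s3 _ IH1 _ IH2] /=.
- exact: Permutation.perm_nil.
- by case: ifP => // _; apply: Permutation.perm_skip.
- by case: (p x); case: (p y); rewrite //; [exact: Permutation.perm_swap].
- exact: Permutation_trans IH1 IH2.
Qed.

Lemma perm_pmap_seq (T U : Type) (f : T -> option U) (s s' : seq T) :
  Permutation s s' -> Permutation (pmap f s) (pmap f s').
Proof.
elim=> {s s'} [|x s s' _ IH|x y s|s1 s2 s3 _ IH1 _ IH2] /=.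
- exact: Permutation.perm_nil.
- by case: (f x) => //= u; apply: Permutation.perm_skip.
- by case: (f x) => [u|]; case: (f y) => [v|] //=; apply: Permutation.perm_swap.
- exact: Permutation_trans IH1 IH2.
Qed.

Lemma perm_size_seq (T : Type) (s s' : seq T) : Permutation s s' -> size s = size s'.
Proof. by elim=> {s s'} //= [x s s' _ ->|s1 s2 s3 _ -> _ ->]. Qed.

Section Language.
Variable n : nat.
Implicit Types (t : pqtree n) (ts us : seq (pqtree n)) (w : seq 'I_n).

(** The words of all trees equivalent to the given one, described by splitting the word along the
    children instead of transforming the tree; see [consistentE]. Colour arguments then concern
    words only. *)
Inductive lang : pqtree n -> seq 'I_n -> Prop :=
| lang_leaf i : lang (Leaf i) [:: i]
| lang_P ts us w of Permutation ts us & langs us w : lang (PNode ts) w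
| lang_Q ts w of langs ts w : lang (QNode ts) w
| lang_Qr ts w of langs (rev ts) w : lang (QNode ts) w
with langs : seq (pqtree n) -> seq 'I_n -> Prop :=
| langs_nil : langs [::] [::]
| langs_cons t ts w w' of lang t w & langs ts w' : langs (t :: ts) (w ++ w').

Scheme lang_ind2 := Induction for lang Sort Prop
with langs_ind2 := Induction for langs Sort Prop.
Combined Scheme lang_langs_ind from lang_ind2, langs_ind2.

Lemma langs0 w : langs [::] w <-> w = [::].
Proof. by split=> [H|->]; [inversion H|exact: langs_nil]. Qed.

Lemma langs_consP t ts w :
  langs (t :: ts) w <-> exists u v, [/\ w = u ++ v, lang t u & langs ts v].
Proof.
split=> [H|[u [v [-> lu lv]]]]; last exact: langs_cons.
by inversion H as [|t' ts' u v lu lv]; subst; exists u, v.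
Qed.

Lemma langs1 t w : langs [:: t] w <-> lang t w.
Proof.
rewrite langs_consP; split=> [[u [v [-> lu /langs0->]]]|lw]; first by rewrite cats0.
by exists w, [::]; rewrite cats0; split=> //; apply: langs_nil.
Qed.

Lemma langs_cat ts us w :
  langs (ts ++ us) w <-> exists u v, [/\ w = u ++ v, langs ts u & langs us v].
Proof.
elim: ts w => [|t ts IH] w /=.
  split=> [lw|[u [v [-> /langs0-> //]]]].
  by exists [::], w; split=> //; apply: langs_nil.
rewrite langs_consP; split.
  case=> u [v [-> lu /IH[v1 [v2 [-> l1 l2]]]]].
  by exists (u ++ v1), v2; rewrite catA; split=> //; apply: langs_cons.
case=> u [v [-> /langs_consP[u1 [u2 [-> l1 l2]]] lv]].
by exists u1, (u2 ++ v); rewrite catA; split=> //; apply/IH; exists u2, v.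
Qed.

(** Reversal is absorbed at every node: a P-node admits each order of its children, a Q-node the
    opposite one. *)
Lemma lang_rev_langs_rev :
  (forall t w, lang t w -> lang t (rev w)) /\
  (forall ts w, langs ts w -> langs (rev ts) (rev w)).
Proof.
apply: lang_langs_ind => [i|ts us w tu _ IH|ts w _ IH|ts w _ IH||t ts u v _ IHt _ IHs].
- exact: lang_leaf.
- apply: lang_P IH; apply: Permutation_trans tu _; apply: Permutation_sym; exact: perm_rev_seq.
- exact: lang_Qr.
- by apply: lang_Q; rewrite revK in IH.
- exact: langs_nil.
- by rewrite rev_cons rev_cat -cats1 langs_cat; exists (rev v), (rev u); split=> //; apply/langs1.
Qed.

Lemma lang_rev t w : lang t w -> lang t (rev w).
Proof. exact: lang_rev_langs_rev.1. Qed.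

Lemma langs_rev ts w : langs (rev ts) w <-> langs ts (rev w).
Proof.
by split=> /lang_rev_langs_rev.2; rewrite revK.
Qed.

Lemma lang_PP ts w : lang (PNode ts) w <-> exists2 us, Permutation ts us & langs us w.
Proof.
split=> [H|[us tu lu]]; last exact: lang_P tu lu.
by inversion H as [|ts' us w' tu lu| |]; subst; exists us.
Qed.

Lemma lang_QP ts w : lang (QNode ts) w <-> langs ts w \/ langs (rev ts) w.
Proof.
split=> [H|[]]; [|exact: lang_Q|exact: lang_Qr].
by inversion H as [| |ts' w' lw|ts' w' lw]; subst; [left|right].
Qed.

Lemma lang_LeafP i w : lang (Leaf i) w <-> w = [:: i].
Proof. by split=> [H|->]; [inversion H|exact: lang_leaf]. Qed.

Lemma lang_frontier t : lang t (frontier t).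
Proof.
elim/pqtree_nested_ind: t => [i|ts IH|ts IH] /=; first exact: lang_leaf.
  apply: (lang_P (Permutation_refl ts)).
  elim: ts IH => [|t ts IHts] IH /=; first exact: langs_nil.
  by apply: langs_cons; [apply: IH; left|apply: IHts => u us; apply: IH; right].
apply: lang_Q; elim: ts IH => [|t ts IHts] IH /=; first exact: langs_nil.
by apply: langs_cons; [apply: IH; left|apply: IHts => u us; apply: IH; right].
Qed.

Definition frontiers ts : seq 'I_n := flatten (map (@frontier n) ts).

Lemma langs_frontiers ts : langs ts (frontiers ts).
Proof.
elim: ts => [|t ts IH]; first exact: langs_nil.
by apply: langs_cons => //; apply: lang_frontier.
Qed.

Lemma frontiers_cat ts us : frontiers (ts ++ us) = frontiers ts ++ frontiers us.
Proof. by rewrite /frontiers map_cat flatten_cat. Qed.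

Lemma perm_frontiers ts us : Permutation ts us -> perm_eq (frontiers ts) (frontiers us).
Proof.
elim=> {ts us} //= [t ts us _ IH|t u ts|ts us vs _ IH1 _ IH2].
- by rewrite /frontiers /= perm_cat2l.
- by rewrite /frontiers /= !catA perm_cat2r perm_catC.
- exact: seq.perm_trans IH1 IH2.
Qed.

Lemma lang_perm_langs_perm :
  (forall t w, lang t w -> perm_eq w (frontier t)) /\
  (forall ts w, langs ts w -> perm_eq w (frontiers ts)).
Proof.
apply: lang_langs_ind => [i|ts us w tu _ IH|ts w _ IH|ts w _ IH||t ts u v _ IHt _ IHs] //.
- by apply: seq.perm_trans IH _; rewrite perm_sym; apply: perm_frontiers.
- by apply: seq.perm_trans IH _; apply: perm_frontiers; apply: perm_rev_seq.
- by apply: perm_cat.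
Qed.

Lemma lang_perm t w : lang t w -> perm_eq w (frontier t).
Proof. exact: lang_perm_langs_perm.1. Qed.

Lemma langs_perm ts w : langs ts w -> perm_eq w (frontiers ts).
Proof. exact: lang_perm_langs_perm.2. Qed.

Lemma langs_subst ts t u us w : (forall w, lang u w -> lang t w) ->
  langs (ts ++ u :: us) w -> langs (ts ++ t :: us) w.
Proof.
move=> ut /langs_cat[x [y [-> lx /langs_consP[y1 [y2 [-> l1 l2]]]]]].
by apply/langs_cat; exists x, (y1 ++ y2); split=> //; apply: langs_cons => //; apply: ut.
Qed.

Lemma pq_equiv_lang t u : pq_equiv t u -> forall w, lang u w -> lang t w.
Proof.
elim=> {t u} //.
- by move=> t1 t2 t3 _ IH1 _ IH2 w /IH2/IH1.
- move=> ts us tu w /lang_PP[vs uv lv]; apply: lang_P lv; exact: Permutation_trans tu uv.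
- by move=> ts w /lang_QP; rewrite revK => -[]; [apply: lang_Qr|apply: lang_Q].
- move=> ts t u us _ IH w /lang_PP[vs tv lv].
  have /(@List.in_split _ _ _)[c [e def_vs]] : List.In u vs.
    by apply: Permutation_in tv _; apply: List.in_or_app; right; left.
  rewrite -[(c ++ _)%list]/(c ++ u :: e) in def_vs; subst vs.
  have := Permutation_app_inv _ _ _ _ _ tv => te.
  apply: lang_P (langs_subst IH lv).
  apply: Permutation_elt; exact: te.
- move=> ts t u us _ IH w /lang_QP[lw|]; first by apply: lang_Q; apply: langs_subst IH lw.
  rewrite rev_cat rev_cons cat_rcons => lw; apply: lang_Qr.
  by rewrite rev_cat rev_cons cat_rcons; apply: langs_subst IH lw.
Qed.

Lemma pq_equiv_inP_all vs ts us : List.Forall2 (@pq_equiv n) ts us ->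
  pq_equiv (PNode (vs ++ ts)) (PNode (vs ++ us)).
Proof.
move=> H; elim: H vs => {ts us} [|t u ts us tu _ IH] vs; first exact: pq_refl.
apply: pq_trans (pq_inP _ _ tu) _.
by have := IH (rcons vs u); rewrite -!cats1 -!catA.
Qed.

Lemma pq_equiv_inQ_all vs ts us : List.Forall2 (@pq_equiv n) ts us ->
  pq_equiv (QNode (vs ++ ts)) (QNode (vs ++ us)).
Proof.
move=> H; elim: H vs => {ts us} [|t u ts us tu _ IH] vs; first exact: pq_refl.
apply: pq_trans (pq_inQ _ _ tu) _.
by have := IH (rcons vs u); rewrite -!cats1 -!catA.
Qed.

(** Converse of [pq_equiv_lang]: first reorder the children of the root, then transform them one
    after the other. *)
Lemma lang_langs_equiv :
  (forall t w, lang t w -> exists2 u, pq_equiv t u & frontier u = w) /\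
  (forall ts w, langs ts w ->
     exists2 us, List.Forall2 (@pq_equiv n) ts us & frontiers us = w).
Proof.
apply: lang_langs_ind => [i|ts us w tu _ [vs uv <-]|ts w _ [vs uv <-]|ts w _ [vs uv <-]||
  t ts u v _ [x tx <-] _ [xs txs <-]].
- by exists (Leaf i); first exact: pq_refl.
- exists (PNode vs) => //; apply: pq_trans (pq_permute tu) _; exact: (pq_equiv_inP_all [::]).
- exists (QNode vs) => //; exact: (pq_equiv_inQ_all [::]).
- exists (QNode vs) => //; apply: pq_trans (pq_reverse ts) _; exact: (pq_equiv_inQ_all [::]).
- by exists [::]; first exact: List.Forall2_nil.
- by exists (x :: xs); first exact: List.Forall2_cons.
Qed.

Lemma consistentE t (p : 'S_n) : consistent t p <-> lang t [seq p i | i <- enum 'I_n].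
Proof.
split=> [[u tu <-]|/lang_langs_equiv.1[u tu fu]]; last by exists u.
by apply: pq_equiv_lang tu _ _; apply: lang_frontier.
Qed.

Definition mkP ts : pqtree n := if ts is [:: t] then t else PNode ts.

(** With two children both kinds of node allow exactly the two orders, so the label P respects the
    minimal arities without changing the language. *)
Definition mkQ ts : pqtree n :=
  match ts with [:: t] => t | [:: _; _] => PNode ts | _ => QNode ts end.

Lemma lang_mkP ts w : lang (mkP ts) w <-> lang (PNode ts) w.
Proof.
case: ts => [|t [|u ts]] /=; [by split| |by split].
rewrite lang_PP; split=> [lw|[us tu]].
  by exists [:: t] => //; rewrite langs1.
by rewrite (Permutation_length_1_inv tu) langs1.
Qed.

Lemma lang_mkQ ts w : lang (mkQ ts) w <-> lang (QNode ts) w.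
Proof.
case: ts => [|t [|u [|v ts]]] /=; [by split|by rewrite lang_QP /= !langs1; tauto| |by split].
rewrite lang_PP lang_QP; split=> [[us tu]|[|] lw].
- by have [->|->] := Permutation_length_2_inv tu; [left|right].
- by exists [:: t; u].
- by exists [:: u; t] => //; apply: Permutation.perm_swap.
Qed.

Lemma proper_mkP ts : 0 < size ts -> all (@proper_arities n) ts -> proper_arities (mkP ts).
Proof. by case: ts => [|t [|u ts]] //= _ /andP[]. Qed.

Lemma proper_mkQ ts : 0 < size ts -> all (@proper_arities n) ts -> proper_arities (mkQ ts).
Proof. by case: ts => [|t [|u [|v ts]]] //= _ /andP[]. Qed.

Lemma frontier_mkP ts : frontier (mkP ts) = frontiers ts.
Proof. by case: ts => [|t [|u ts]] //=; rewrite /frontiers /= cats0. Qed.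

Lemma frontier_mkQ ts : frontier (mkQ ts) = frontiers ts.
Proof. by case: ts => [|t [|u [|v ts]]] //=; rewrite /frontiers /= cats0. Qed.

Lemma frontier_gt0 t : proper_arities t -> 0 < size (frontier t).
Proof.
elim/pqtree_nested_ind: t => [//|ts IH|ts IH] /=;
  case: ts IH => [|t ts] // IH /andP[_ /andP[pt _]];
  by rewrite /= size_cat addn_gt0 IH //; left.
Qed.

Lemma lang_gt0 t w : proper_arities t -> lang t w -> 0 < size w.
Proof. by move=> pt /lang_perm/perm_size->; apply: frontier_gt0. Qed.

Lemma langs_size ts w : all (@proper_arities n) ts -> langs ts w -> size ts <= size w.
Proof.
elim: ts w => [|t ts IH] w //= /andP[pt pts] /langs_consP[u [v [-> lu lv]]].
by rewrite size_cat; have := lang_gt0 pt lu; have := IH _ pts lv; lia.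
Qed.

End Language.

(** * Reducing a PQ-tree *)

(* [Par t lin body] describes a subtree t with leaves inside and outside X.
   [lin = Some (es, rf)]: the children sequence es ++ rev rf describes the
   frontiers of t in which X comes last. [body = Some (frs, co)]: plugging the
   Q-node with children core_seq co into the frames frs describes the frontiers
   in which X is consecutive. Both lists of lin start with the outermost trees,
   so that a parent extends them without copying. *)
Record core n := Core {
  core_left : seq (pqtree n); core_full : seq (pqtree n);
  core_full' : seq (pqtree n); core_right : seq (pqtree n) }.

(** A node with a hole: [true] for a Q-node, then the trees on the left and on the right of the
    hole, both lists reversed. *)
Definition frame n := (bool * seq (pqtree n) * seq (pqtree n))%type.

(** The tree inside a partial item serves the specification; the machine value [vi] carries only the
    two forms. *)
Inductive item n :=
| Emp of pqtree n
| Ful of pqtree n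
| Par of pqtree n & option (seq (pqtree n) * seq (pqtree n))
       & option (seq (frame n) * core n).

(** A left-to-right pass over coloured siblings. [acc]: leading empty trees; [es1] and [rf]: the
    opened left partial item, continued by the full trees; [rfR] and [esR]: the opened right partial
    item in mirror image, continued by the trailing empty trees. [st] is the state of the colour
    automaton, and [bad] records failure. *)
Record scanner n := Scanner {
  acc : seq (pqtree n); es1 : seq (pqtree n); rf : seq (pqtree n);
  rfR : seq (pqtree n); esR : seq (pqtree n); st : nat; bad : bool }.

Section Items.
Variable n : nat.
Local Notation tree := (pqtree n).
Implicit Types (t : tree) (ts : seq tree) (x : item n) (s : seq (item n)) (c : scanner n).

Definition core_seq (co : core n) : seq tree :=
  core_left co ++ rev (core_full co) ++ core_full' co ++ rev (core_right co).

Definition node (q : bool) ts : tree := if q then QNode ts else PNode ts.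
Definition mk (q : bool) ts : tree := if q then mkQ ts else mkP ts.

Definition wrap (fr : frame n) t : tree :=
  let: (q, l, r) := fr in mk q (rev l ++ t :: rev r).

Definition plug (frs : seq (frame n)) t : tree := foldr wrap t frs.

Definition tree_of x : tree := match x with Emp t | Ful t | Par t _ _ => t end.
Definition empt x : option tree := if x is Emp t then Some t else None.
Definition fult x : option tree := if x is Ful t then Some t else None.
Definition is_par x : bool := if x is Par _ _ _ then true else false.

Definition emps s : seq tree := pmap empt s.
Definition fuls s : seq tree := pmap fult s.
Definition pars s : seq (item n) := filter is_par s.

(** A partial child is opened with its full end towards the block of full trees: it begins the block
    in state 0 and ends it in state 1. A colour block with empty letters on both sides inside one
    child is not covered; see [special]. *)
Definition scan_step c x : scanner n :=
  match x with
  | Emp t =>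
      if st c is 0 then Scanner (t :: acc c) (es1 c) (rf c) (rfR c) (esR c) 0 (bad c)
      else Scanner (acc c) (es1 c) (rf c) (rfR c) (t :: esR c) 2 (bad c)
  | Ful t =>
      if st c is 2 then Scanner (acc c) (es1 c) (rf c) (rfR c) (esR c) 2 true
      else Scanner (acc c) (es1 c) (t :: rf c) (rfR c) (esR c) 1 (bad c)
  | Par _ lin _ =>
      let: (e, r, b) := if lin is Some (e, r) then (e, r, bad c) else ([::], [::], true) in
      match st c with
      | 0 => Scanner (acc c) e r (rfR c) (esR c) 1 b
      | 1 => Scanner (acc c) (es1 c) (rf c) r e 2 b
      | _ => Scanner (acc c) (es1 c) (rf c) (rfR c) (esR c) 2 true
      end
  end.

Definition scan0 : scanner n := Scanner [::] [::] [::] [::] [::] 0 false.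
Definition scan s : scanner n := foldl scan_step scan0 s.
Definition scan_left c : seq tree := rev (acc c) ++ es1 c.
Definition scan_core c : core n := Core (scan_left c) (rf c) (rfR c) (esR c).

Definition full_item ts : seq (item n) := if nilp ts then [::] else [:: Ful (mkP ts)].
Definition empty_item ts : seq (item n) := if nilp ts then [::] else [:: Emp (mkP ts)].

(** At a P-node the children are free, so a canonical order is scanned: the full trees form one
    group between the first partial child and the others, and the empty ones are set aside. A third
    partial child makes the scan fail. *)
Definition root_list (q : bool) s : seq (item n) :=
  if q then s else take 1 (pars s) ++ full_item (fuls s) ++ behead (pars s).

(** The order in which the colour comes last, as a parent needs it. A Q-node has only its other
    orientation to try. At a P-node two partial children already rule it out, since the scan has to
    end in state 1. *)
Definition lin_list (q : bool) s : seq (item n) :=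
  if q then rev s else empty_item (emps s) ++ rev (pars s) ++ full_item (fuls s).

(** With one partial child and no full one the colour block lies inside that child, and the node
    becomes a frame around it. *)
Definition special s : bool := nilp (fuls s) && (size (pars s) == 1).

Definition comb_lin (q : bool) (ca cb : scanner n) :=
  if [&& q, st ca == 1 & ~~ bad ca] then Some (scan_left ca, rf ca)
  else if (st cb == 1) && ~~ bad cb then Some (scan_left cb, rf cb) else None.

Definition comb_body (q : bool) s (ca : scanner n) :=
  if special s then
    if pars s is Par _ _ (Some (frs, co)) :: _ then
      Some ((if q then (true, acc ca, esR ca) else (false, emps s, [::])) :: frs, co)
    else None
  else if bad ca then None
  else Some (if q || nilp (emps s) then [::] else [:: (false, emps s, [::])], scan_core ca).

Definition comb (q : bool) s : item n :=
  if nilp (fuls s) && nilp (pars s) then Emp (node q (emps s))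
  else if nilp (emps s) && nilp (pars s) then Ful (node q (fuls s))
  else let ca := scan (root_list q s) in
       Par (node q (map tree_of s)) (comb_lin q ca (scan (lin_list q s)))
           (comb_body q s ca).

(** The children appear in reverse because the machine pops them from a stack; neither kind of node
    distinguishes a list from its reverse. *)
Fixpoint red (X : pred 'I_n) t : item n :=
  match t with
  | Leaf i => if X i then Ful (Leaf i) else Emp (Leaf i)
  | PNode ts => comb false (rev (map (red X) ts))
  | QNode ts => comb true (rev (map (red X) ts))
  end.

Definition body_of x : option (seq (frame n) * core n) :=
  match x with
  | Emp t => Some ([::], Core [:: t] [::] [::] [::])
  | Ful t => Some ([::], Core [::] [:: t] [::] [::])
  | Par _ _ body => body
  end.

End Items.

Arguments Emp {n}.
Arguments Ful {n}.
Arguments Par {n}.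
Arguments scan0 {n}.

(** * The colour automaton and the invariant of the scanner *)

Section Colours.
Variables (n : nat) (X : pred 'I_n).
Local Notation tree := (pqtree n).
Implicit Types (t : tree) (ts : seq tree) (w u v : seq 'I_n).

(* The automaton of the pattern 0* 1* 0*, with dead state 3. *)
Definition delta (q : nat) (b : bool) : nat :=
  match q with 0 => b | 1 => if b then 1 else 2 | 2 => if b then 3 else 2 | _ => 3 end.

Definition aut (q : nat) w : nat := foldl (fun q i => delta q (X i)) q w.

Lemma aut_cat q u v : aut q (u ++ v) = aut (aut q u) v.
Proof. exact: foldl_cat. Qed.

Lemma aut3 w : aut 3 w = 3.
Proof. by elim: w. Qed.

Lemma aut2 w : aut 2 w = if has X w then 3 else 2.
Proof. by elim: w => //= i w IH; case: (X i); rewrite ?aut3. Qed.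

Lemma aut1_full w : (aut 1 w == 1) = all X w.
Proof.
elim: w => //= i w IH; case: (X i) => //=.
by rewrite aut2; case: ifP.
Qed.

Lemma aut0_empty w : (aut 0 w == 0) = ~~ has X w.
Proof.
elim: w => //= i w IH; case: (X i) => //=; apply/negbTE.
by elim: w {IH} => //= i' w; case: (X i') => // _; rewrite aut2; case: ifP.
Qed.

Lemma aut1_split w : aut 1 w != 3 ->
  exists u v, [/\ w = u ++ v, all X u & ~~ has X v].
Proof.
elim: w => [|i w IH] /=; first by exists [::], [::].
case Xi: (X i) => /=.
  by case/IH=> u [v [-> au av]]; exists (i :: u), v; rewrite /= Xi.
by rewrite aut2; case: ifP => // hw _; exists [::], (i :: w); rewrite /= Xi hw.
Qed.

Lemma aut0_split w : aut 0 w != 3 ->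
  exists u v z, [/\ w = u ++ v ++ z, ~~ has X u, all X v & ~~ has X z].
Proof.
elim: w => [|i w IH] /=; first by exists [::], [::], [::].
case Xi: (X i) => /=.
  by case/aut1_split=> u [v [-> au av]]; exists [::], (i :: u), v; rewrite /= Xi.
by case/IH=> u [v [z [-> hu av hz]]]; exists (i :: u), v, z; rewrite /= Xi.
Qed.

Lemma aut0_join u v z : ~~ has X u -> all X v -> ~~ has X z -> aut 0 (u ++ v ++ z) != 3.
Proof.
rewrite -aut0_empty => /eqP u0 av hz; rewrite !aut_cat u0.
case: v av => [_|i v /= /andP[Xi av]].
  by move: hz; rewrite -aut0_empty => /eqP->.
move: av; rewrite Xi /= -aut1_full => /eqP->.
by case: z hz => //= j z; rewrite negb_or => /andP[/negbTE-> hz] /=; rewrite aut2 (negbTE hz).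
Qed.

Lemma aut0_rev w : (aut 0 (rev w) == 3) = (aut 0 w == 3).
Proof.
have imp u : aut 0 u != 3 -> aut 0 (rev u) != 3.
  case/aut0_split=> a [b [c [-> ha ab hc]]]; rewrite !rev_cat -catA.
  by apply: aut0_join; rewrite ?has_rev ?all_rev.
by apply/idP/idP; apply: contraLR => /imp; rewrite ?revK.
Qed.

(** From state 1 a word survives if its coloured letters form a prefix, so its reverse has them at
    the end. This is how a partial child is used on the right of the block. *)
Lemma aut_mirror w : has X w -> (aut 1 w != 3) = (aut 0 (rev w) == 1).
Proof.
move=> hw; apply/idP/eqP=> [/aut1_split[u [v [defw au hv]]]|rw].
  have u0 : has X u by move: hw; rewrite defw has_cat (negbTE hv) orbF.
  move: hv; rewrite defw rev_cat aut_cat -has_rev -aut0_empty => /eqP->.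
  rewrite -has_rev in u0; rewrite -all_rev in au.
  case: (rev u) u0 au => //= i z _ /andP[-> az]; apply/eqP; by rewrite aut1_full.
have [|a [b [c [defr ha ab hc]]]] := @aut0_split (rev w); first by rewrite rw.
have c0 : c = [::].
  move: rw; rewrite defr !aut_cat; move: ha; rewrite -aut0_empty => /eqP->.
  case: b ab {defr} => [_|i b /= /andP[Xi ab]].
    by move: hc; rewrite -aut0_empty => /eqP->.
  move: ab; rewrite Xi -aut1_full => /eqP->; case: c hc => //= i' c.
  by rewrite negb_or => /andP[/negbTE-> hc]; rewrite /= aut2 (negbTE hc).
rewrite -[w]revK defr c0 cats0 rev_cat aut_cat.
move: ab; rewrite -all_rev -aut1_full => /eqP->.
rewrite -has_rev in ha; case: (rev a) ha => //= i z.
by rewrite negb_or => /andP[/negbTE-> hz]; rewrite /= aut2 (negbTE hz).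
Qed.

Lemma aut_pad u c v : ~~ has X u -> ~~ has X v -> (aut 0 (u ++ c ++ v) == 3) = (aut 0 c == 3).
Proof.
rewrite -{1}aut0_empty => /eqP u0 hv; rewrite !aut_cat u0.
have [->|ne] := eqVneq (aut 0 c) 3; first by rewrite aut3.
case: v hv => [_|i v hv]; first exact: negbTE.
have step q : q != 3 -> q <= 3 -> (aut q (i :: v) == 3) = false.
  move: hv; rewrite /= negb_or => /andP[/negbTE-> hv].
  case: q => [|[|[|[]]]] //= _ _; rewrite ?aut2 ?(negbTE hv) //.
  by have /eqP-> : aut 0 v == 0 by rewrite aut0_empty.
have le3 z q : q <= 3 -> aut q z <= 3.
  elim: z q => //= k z IH q le_q; apply: IH.
  by case: q le_q => [|[|[|q]]] //=; case: (X k).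
by rewrite step ?le3.
Qed.

Definition good_e t : bool := proper_arities t && ~~ has X (frontier t).
Definition good_f t : bool := proper_arities t && all X (frontier t).

Lemma perm_has w w' : perm_eq w w' -> has X w = has X w'.
Proof. by move=> /perm_mem/eq_has_r. Qed.

Lemma langs_good_e ts w : all good_e ts -> langs ts w -> ~~ has X w.
Proof.
move=> ge /langs_perm/perm_has->; elim: ts ge => //= t ts IH /andP[/andP[_ ht] gts].
by rewrite /frontiers /= has_cat negb_or ht IH.
Qed.

Lemma langs_good_f ts w : all good_f ts -> langs ts w -> all X w.
Proof.
move=> ge /langs_perm/(perm_all X)->; elim: ts ge => //= t ts IH /andP[/andP[_ ht] gts].
by rewrite /frontiers /= all_cat ht IH.
Qed.

Lemma good_e_proper ts : all good_e ts -> all (@proper_arities n) ts.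
Proof. by apply: sub_all => t /andP[]. Qed.

Lemma good_f_proper ts : all good_f ts -> all (@proper_arities n) ts.
Proof. by apply: sub_all => t /andP[]. Qed.

Lemma all_seq_perm (p : pred tree) ts us : Permutation ts us -> all p ts = all p us.
Proof.
elim=> {ts us} //= [t ts us _ ->|t t' ts|ts us vs _ -> _ ->] //.
by rewrite andbCA.
Qed.

Lemma has_frontiers (p : pred 'I_n) ts :
  has p (frontiers ts) = has (fun t => has p (frontier t)) ts.
Proof. by elim: ts => //= t ts IH; rewrite /frontiers /= has_cat -IH. Qed.

Lemma all_frontiers (p : pred 'I_n) ts :
  all p (frontiers ts) = all (fun t => all p (frontier t)) ts.
Proof. by elim: ts => //= t ts IH; rewrite /frontiers /= all_cat -IH. Qed.

Lemma good_e_mkP ts : ~~ nilp ts -> all good_e ts -> good_e (mkP ts).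
Proof.
move=> ts0 ge; rewrite /good_e proper_mkP ?lt0n //; last exact: good_e_proper.
by rewrite frontier_mkP (langs_good_e ge) //; apply: langs_frontiers.
Qed.

Lemma good_f_mkP ts : ~~ nilp ts -> all good_f ts -> good_f (mkP ts).
Proof.
move=> ts0 ge; rewrite /good_f proper_mkP ?lt0n //; last exact: good_f_proper.
by rewrite frontier_mkP (langs_good_f ge) //; apply: langs_frontiers.
Qed.

Definition frame_ok (fr : frame n) : bool :=
  let: (_, l, r) := fr in [&& 0 < size l + size r, all good_e l & all good_e r].

Definition core_ok (co : core n) : bool :=
  [&& all good_e (core_left co), all good_f (core_full co), all good_f (core_full' co),
      all good_e (core_right co) & ~~ nilp (core_seq co)].

(** Here and in [body_ok], [None] asserts impossibility and not a mere lack of information: the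
    report that an instance is not nice rests on it. *)
Definition lin_ok t (lin : option (seq tree * seq tree)) : Prop :=
  if lin is Some (e, r) then
    [/\ all good_e e, all good_f r
      & forall w, langs (e ++ rev r) w <-> lang t w /\ aut 0 w = 1]
  else forall w, lang t w -> aut 0 w <> 1.

Definition body_ok t (body : option (seq (frame n) * core n)) : Prop :=
  if body is Some (frs, co) then
    [/\ all frame_ok frs, core_ok co
      & forall w, lang (plug frs (mkQ (core_seq co))) w <-> lang t w /\ aut 0 w != 3]
  else forall w, lang t w -> aut 0 w = 3.

Definition wf_item (x : item n) : Prop :=
  match x with
  | Emp t => good_e t
  | Ful t => good_f t
  | Par t lin body =>
      [/\ proper_arities t, has X (frontier t) /\ ~~ all X (frontier t),
          lin_ok t lin & body_ok t body]
  end.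

Definition trees (s : seq (item n)) : seq tree := map (@tree_of n) s.

Lemma trees_cat (s s' : seq (item n)) : trees (s ++ s') = trees s ++ trees s'.
Proof. exact: map_cat. Qed.

Lemma trees_rev (s : seq (item n)) : trees (rev s) = rev (trees s).
Proof. exact: map_rev. Qed.

Lemma langs_rcons ts t w :
  langs (rcons ts t) w <-> exists u v, [/\ w = u ++ v, langs ts u & lang t v].
Proof.
rewrite -cats1 langs_cat; split=> [[u [v [-> lu /langs1 lv]]]|[u [v [-> lu lv]]]];
  by exists u, v; split=> //; apply/langs1.
Qed.

Lemma lang_good_e t w : good_e t -> lang t w -> ~~ has X w /\ 0 < size w.
Proof.
move=> gt lt; split; last by apply: lang_gt0 lt; case/andP: gt.
by apply: (@langs_good_e [:: t]); rewrite /= ?gt // langs1.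
Qed.

Lemma lang_good_f t w : good_f t -> lang t w -> all X w /\ 0 < size w.
Proof.
move=> gt lt; split; last by apply: lang_gt0 lt; case/andP: gt.
by apply: (@langs_good_f [:: t]); rewrite /= ?gt // langs1.
Qed.

Lemma lang_par t lin body w : wf_item (Par t lin body) -> lang t w -> has X w /\ ~~ all X w.
Proof. by case=> _ [hx hn] _ _ /lang_perm pw; rewrite (perm_has pw) (perm_all X pw). Qed.

Definition scan_out (c : scanner n) : seq tree :=
  rev (acc c) ++ es1 c ++ rev (rf c) ++ rfR c ++ rev (esR c).

(** Completeness has one exception: in a [special] list the colour may begin and end inside the only
    partial child. The automaton then stops in state 2, and opening the child does not describe such
    words. *)
Record scan_ok (s : seq (item n)) (c : scanner n) : Prop := ScanOk {
  scan_st : st c <= 2;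
  scan_e : all good_e (acc c ++ es1 c ++ esR c);
  scan_f : all good_f (rf c ++ rfR c);
  scan_st0 : st c = 0 -> [/\ es1 c = [::], rf c = [::], fuls s = [::] & pars s = [::]];
  scan_st1 : st c <= 1 -> rfR c = [::] /\ esR c = [::];
  scan_sound w : ~~ bad c -> langs (scan_out c) w -> langs (trees s) w /\ aut 0 w = st c;
  scan_complete w : langs (trees s) w -> aut 0 w != 3 ->
    [/\ ~~ bad c, aut 0 w = st c & langs (scan_out c) w] \/ special s /\ aut 0 w = 2
}.

Lemma fuls_rcons (s : seq (item n)) x : fuls (rcons s x) = fuls s ++ fuls [:: x].
Proof. by rewrite -cats1 /fuls pmap_cat. Qed.

Lemma pars_rcons (s : seq (item n)) x : pars (rcons s x) = pars s ++ pars [:: x].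
Proof. by rewrite -cats1 /pars filter_cat. Qed.

Lemma aut_e q w : ~~ has X w -> 0 < size w -> q <= 2 -> aut q w = if q is 0 then 0 else 2.
Proof.
case: w => //= i w; rewrite negb_or => /andP[/negbTE hi hw] _.
case: q => [|[|[]]] //= _; rewrite hi /= ?aut2 ?(negbTE hw) //.
by apply/eqP; rewrite aut0_empty.
Qed.

Lemma aut_f q w : all X w -> 0 < size w -> q <= 2 -> aut q w = if q is 2 then 3 else 1.
Proof.
case: w => //= i w /andP[hi hw] _.
by case: q => [|[|[]]] //= _; rewrite hi /= ?aut3 //; apply/eqP; rewrite aut1_full.
Qed.

Lemma aut_par1 w : has X w -> ~~ all X w -> aut 1 w != 3 -> aut 1 w = 2.
Proof.
move=> hw nw; case/aut1_split=> u [v [defw au hv]].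
rewrite defw aut_cat; have /eqP-> : aut 1 u == 1 by rewrite aut1_full.
have v0 : 0 < size v.
  by case: v defw hv => // defw _; move: nw; rewrite defw cats0 au.
by rewrite aut_e.
Qed.

Lemma scan_step_ok s c x : scan_ok s c -> wf_item x -> scan_ok (rcons s x) (scan_step c x).
Proof.
case=> s2 ge gf z0 z1 sound complete wx.
have split_w w : langs (trees (rcons s x)) w ->
    exists u v, [/\ w = u ++ v, langs (trees s) u & lang (tree_of x) v].
  by rewrite /trees map_rcons => /langs_rcons.
have join_w u v : langs (trees s) u -> lang (tree_of x) v ->
    langs (trees (rcons s x)) (u ++ v).
  by move=> lu lv; rewrite /trees map_rcons; apply/langs_rcons; exists u, v.
have alive u v : aut 0 (u ++ v) != 3 -> aut 0 u != 3.
  by apply: contra => /eqP u3; rewrite aut_cat u3 aut3.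
case: x wx split_w join_w => [t|t|t lin body] wx split_w join_w.
- have spec : special (rcons s (Emp t)) = special s.
    by rewrite /special fuls_rcons pars_rcons /= !cats0.
  have outE : scan_out (scan_step c (Emp t)) = rcons (scan_out c) t.
    rewrite /scan_out /=; case q: (st c) => [|q'] /=; last first.
      by rewrite rev_cons -!cats1 -!catA.
    have [-> -> _ _] := z0 q; have [|-> ->] := z1; first by rewrite q.
    by rewrite rev_cons /= !cats0.
  have stE : st (scan_step c (Emp t)) = if st c is 0 then 0 else 2.
    by rewrite /=; case: (st c).
  have badE : bad (scan_step c (Emp t)) = bad c by rewrite /=; case: (st c).
  split.
  + by rewrite stE; case: (st c).
  + move: ge; rewrite /= !all_cat; case: (st c) => [|q] /= /and3P[-> -> ->];
      by rewrite /= [good_e t]wx.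
  + by rewrite /=; case: (st c).
  + rewrite stE /=; case q: (st c) => // _; have [-> -> fs ps] := z0 q.
    by rewrite fuls_rcons pars_rcons fs ps.
  + by rewrite stE /=; case q: (st c) => //= _; apply: z1; rewrite q.
  + move=> w; rewrite badE outE => nb /langs_rcons[u [v [-> lu lv]]].
    have [hv v0] := lang_good_e wx lv; have [lu' su] := sound u nb lu.
    by split; [apply: join_w|rewrite stE aut_cat su aut_e].
  + move=> w /split_w[u [v [-> lu lv]]] ne; have [hv v0] := lang_good_e wx lv.
    case: (complete u lu (alive _ _ ne)) => [[nb su lo]|[sp u2]].
      by left; rewrite badE outE stE aut_cat su aut_e //; split=> //; apply/langs_rcons; exists u, v.
    by right; rewrite spec aut_cat u2 aut_e.
- have outE : st c != 2 -> scan_out (scan_step c (Ful t)) = rcons (scan_out c) t.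
    rewrite /scan_out /= => s2'; have [|-> ->] := z1; first by lia.
    by case: (st c) s2' => [|[|[]]] //= _; rewrite rev_cons -!cats1 /= ?cats0 -!catA.
  split.
  + by rewrite /=; case: (st c) s2 => [|[|[]]].
  + by rewrite /=; case: (st c) s2 => [|[|[]]].
  + by rewrite /=; case: (st c) s2 => [|[|[]]] //= _; rewrite [good_f t]wx.
  + by rewrite /=; case: (st c) s2 => [|[|[]]].
  + by rewrite /=; case: (st c) s2 z1 => [|[|[]]] //= _ z1 _; apply: z1.
  + move=> w; have [s2'|s2'] := eqVneq (st c) 2; first by rewrite /= s2'.
    rewrite outE // => nb /langs_rcons[u [v [-> lu lv]]].
    have nb' : ~~ bad c by move: nb; rewrite /=; case: (st c) s2 s2' => [|[|[]]].
    have [hv v0] := lang_good_f wx lv; have [lu' su] := sound u nb' lu.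
    split; first exact: join_w.
    by rewrite aut_cat su aut_f //=; case: (st c) s2 s2' => [|[|[]]].
  + move=> w /split_w[u [v [-> lu lv]]] ne; have [hv v0] := lang_good_f wx lv.
    case: (complete u lu (alive _ _ ne)) => [[nb su lo]|[sp u2]]; last first.
      by move: ne; rewrite aut_cat u2 aut_f.
    have s2' : st c != 2 by apply: contraNneq ne => s2'; rewrite aut_cat su s2' aut_f.
    left; rewrite outE // aut_cat su aut_f //.
    split; [| |by apply/langs_rcons; exists u, v]; by rewrite /=; case: (st c) s2 s2' => [|[|[]]].
- have [_ _ okl _] := wx.
  have parW v : lang t v -> has X v /\ ~~ all X v by apply: lang_par wx.
  have outE e r : lin = Some (e, r) -> st c != 2 ->
      scan_out (scan_step c (Par t lin body)) =
      scan_out c ++ (if st c is 0 then e ++ rev r else r ++ rev e).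
    move=> -> s2'; rewrite /scan_out /=; have [|-> ->] := z1; first by lia.
    case q: (st c) s2 s2' => [|[|[]]] //= _ _; rewrite ?cats0 -?catA //.
    by have [-> ->] := z0 q.
  split.
  + by rewrite /=; case: lin {okl outE wx split_w join_w} => [[e r]|]; case: (st c) s2 => [|[|[]]].
  + move: ge; rewrite /= !all_cat => /and3P[ga ge1 geR].
    have ee e r : lin = Some (e, r) -> all good_e e.
      by move=> el; move: okl; rewrite el => -[].
    case: lin ee {okl outE wx split_w join_w} => [[e r] /(_ e r erefl) ee|_];
      case: (st c) s2 => [|[|[]]] //= _; rewrite ?ga ?ge1 ?geR ?ee //.
  + move: gf; rewrite /= !all_cat => /andP[gr gR].
    have ee e r : lin = Some (e, r) -> all good_f r.
      by move=> el; move: okl; rewrite el => -[].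
    case: lin ee {okl outE wx split_w join_w} => [[e r] /(_ e r erefl) ee|_];
      case: (st c) s2 => [|[|[]]] //= _; rewrite ?gr ?gR ?ee //.
  + by rewrite /=; case: lin {okl outE wx split_w join_w} => [[e r]|]; case: (st c) s2 => [|[|[]]].
  + rewrite /=; case: lin {okl outE wx split_w join_w} => [[e r]|];
      by case: (st c) s2 z1 => [|[|[]]] //= _ z1 _; apply: z1.
  + move=> w nb; have [e [r el]] : exists e r, lin = Some (e, r).
      case: lin nb {okl outE wx split_w join_w} => [[e r]|] /=; first by exists e, r.
      by case: (st c) => [|[|q]].
    have s2' : st c != 2 by apply: contraNneq nb => s2'; rewrite /= el s2'.
    have nb' : ~~ bad c by move: nb; rewrite /= el; case: (st c) s2 s2' => [|[|[]]].
    rewrite (outE e r) // => /langs_cat[u [v [-> lu lv]]]; have [lu' su] := sound u nb' lu.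
    have [_ _ {}okl] : lin_ok t (Some (e, r)) by rewrite -el.
    rewrite aut_cat su; case q: (st c) s2 s2' lv => [|[|[]]] //= _ _ lv.
      by have [lt1 ->] := (okl v).1 lv; split; [exact: join_w|rewrite /= el q].
    (* On the right of the block the child is opened in mirror image, so the reverse of its word is
       the one described by [lin]. *)
    have [|ltr r1] := (okl (rev v)).1 _; first by apply/langs_rev; rewrite rev_cat revK.
    have ltv : lang t v by rewrite -[v]revK; apply: lang_rev.
    have [hv nv] := parW v ltv; split; first exact: join_w.
    by rewrite /= el q /=; apply: aut_par1 => //; rewrite aut_mirror // r1.
  + move=> w /split_w[u [v [-> lu lv]]] ne; rewrite /= in lv; have [hv nv] := parW v lv.
    case: (complete u lu (alive _ _ ne)) => [[nb su lo]|[sp u2]]; last first.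
      by move: ne; rewrite aut_cat u2 aut2 hv.
    have s2' : st c != 2 by apply: contraNneq ne => s2'; rewrite aut_cat su s2' aut2 hv.
    move: ne; rewrite aut_cat su; case q: (st c) s2 s2' => [|[|[]]] //= _ _ ne.
      (* The word of a first partial child either ends with the colour, and the child is opened, or
         goes on after it, which is the exceptional case. *)
      have [] : aut 0 v = 1 \/ aut 0 v = 2.
          have : aut 0 v != 0 by rewrite aut0_empty negbK.
          have : aut 0 v <= 3.
            have le3 z k : k <= 3 -> aut k z <= 3.
              elim: z k => //= y z IH k le_k; apply: IH.
              by case: k le_k => [|[|[|k]]] //=; case: (X y).
            exact: le3.
          by move: ne; case: (aut 0 v) => [|[|[|[|]]]] //; auto.
        move=> v1; left; have [e [r el]] : exists e r, lin = Some (e, r).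
          by case: lin okl {outE wx split_w join_w} => [[e r]|/(_ v lv)//]; exists e, r.
        have loe : langs (e ++ rev r) v by move: okl; rewrite el => -[_ _ okl]; apply/okl.
        split; [by rewrite /= el q|by rewrite /= el q|].
        by rewrite -/(scan_step c (Par t lin body)) (outE e r) ?q //; apply/langs_cat; exists u, v.
      move=> v2; right; split=> //; have [_ _ fs ps] := z0 q.
      by rewrite /special fuls_rcons pars_rcons fs ps.
    left; have r1 : aut 0 (rev v) = 1 by apply/eqP; rewrite -aut_mirror.
    have lrv := lang_rev lv.
    have [e [r el]] : exists e r, lin = Some (e, r).
      by case: lin okl {outE wx split_w join_w} => [[e r]|/(_ _ lrv)//]; exists e, r.
    have loe : langs (e ++ rev r) (rev v) by move: okl; rewrite el => -[_ _ okl]; apply/okl.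
    split; [by rewrite /= el q|by rewrite /= el q /= aut_par1|].
    rewrite -/(scan_step c (Par t lin body)) (outE e r) ?q //; apply/langs_cat; exists u, v.
    by split=> //; rewrite -[r]revK -rev_cat; apply/langs_rev.
Qed.

Lemma scan_okP s : List.Forall wf_item s -> scan_ok s (scan s).
Proof.
rewrite /scan => ws.
have gen s0 c0 : scan_ok s0 c0 -> scan_ok (s0 ++ s) (foldl (@scan_step n) c0 s).
  elim: ws s0 c0 => {s} [|x s wx _ IH] s0 c0 ok0 /=; first by rewrite cats0.
  by rewrite -cat_rcons; apply: IH; apply: scan_step_ok.
apply: (gen [::]); split=> //= w; first by move=> _ /langs0->; split=> //; apply: langs_nil.
by move/langs0=> -> _; left; split=> //; apply: langs_nil.
Qed.

End Colours.

(** * Reorderings of sequences without decidable equality *)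

Section PermutationCat.
Variable T : Type.
Implicit Types (x : T) (a b c s : seq T).

Lemma Perm_cons_cat x s a b : Permutation s (a ++ b) -> Permutation (x :: s) (a ++ x :: b).
Proof. exact: Permutation_cons_app. Qed.

Lemma Perm_cons_cat_inv x s a b : Permutation (x :: s) (a ++ x :: b) -> Permutation s (a ++ b).
Proof. exact: Permutation_cons_app_inv. Qed.

Lemma Perm_catC a b : Permutation (a ++ b) (b ++ a).
Proof. exact: Permutation_app_comm. Qed.

Lemma Perm_cat a b c s : Permutation a b -> Permutation c s -> Permutation (a ++ c) (b ++ s).
Proof. exact: Permutation_app. Qed.

Lemma Perm_catCA a b c : Permutation (a ++ b ++ c) (b ++ a ++ c).
Proof. exact: Permutation_app_swap_app. Qed.

Lemma in_split_cat x s : List.In x s -> exists a b, s = a ++ x :: b.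
Proof. exact: List.in_split. Qed.

Lemma Perm_map (U : Type) (f : T -> U) a b : Permutation a b -> Permutation (map f a) (map f b).
Proof. exact: Permutation_map. Qed.

Lemma Perm_map_inv (U : Type) (f : U -> T) a (u : seq U) : Permutation a (map f u) ->
  exists2 v, a = map f v & Permutation u v.
Proof. by case/Permutation_map_inv=> v [-> uv]; exists v. Qed.

End PermutationCat.

(** * Combining the coloured children of a node *)

Section Combination.
Variables (n : nat) (X : pred 'I_n).
Local Notation tree := (pqtree n).
Local Notation wf := (List.Forall (wf_item X)).
Implicit Types (t T : tree) (ts E F : seq tree) (x : item n) (s : seq (item n)) (w u v : seq 'I_n).

Lemma scan_rcons s x : scan (rcons s x) = scan_step (scan s) x.
Proof. by rewrite /scan foldl_rcons. Qed.

Lemma scan_st_le s : st (scan s) <= 2.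
Proof.
elim/last_ind: s => // s x IH; rewrite scan_rcons.
by case: x => [t|t|t [[e r]|] b] /=; case: (st (scan s)) IH => [|[|[]]].
Qed.

(** Successful scans have the form empty, partial, full, partial, empty. This brings the order of
    the children found in a given word back to the canonical lists. *)
Lemma scan_shape s : ~~ bad (scan s) -> exists a l f r b,
  [/\ s = map Emp a ++ l ++ map Ful f ++ r ++ map Emp b, size l <= 1, size r <= 1,
      all (@is_par n) (l ++ r)
    & match st (scan s) with
      | 0 => [/\ l = [::], f = [::], r = [::] & b = [::]]
      | 1 => [/\ r = [::], b = [::] & 0 < size l + size f]
      | _ => True
      end].
Proof.
elim/last_ind: s => [|s x IH]; first by exists [::], [::], [::], [::], [::].
rewrite scan_rcons => nb; have := scan_st_le s => s2.
have nb' : ~~ bad (scan s).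
  by move: nb; case: x => [t|t|t [[e r]|] b] /=; case: (st (scan s)) s2 => [|[|[]]].
have [a [l [f [r [b [defs l1 r1 lr stE]]]]]] := IH nb'.
case: x nb => [t|t|t lin bd] nb.
- rewrite /=; case: (st (scan s)) s2 stE => [|[|[]]] //= _.
  + case=> ? ? ? ?; subst l f r b; exists (rcons a t), [::], [::], [::], [::].
    by split=> //; rewrite defs map_rcons /= !cats0.
  + case=> ? ? _; subst r b; exists a, l, f, [::], [:: t].
    by split=> //; rewrite defs /= !cats0 -cats1 -!catA.
  + by move=> _; exists a, l, f, r, (rcons b t); split=> //; rewrite defs map_rcons -!cats1 -!catA.
- move: nb; rewrite /=; case: (st (scan s)) s2 stE => [|[|[]]] //= _.
  + case=> ? ? ? ? _; subst l f r b; exists a, [::], [:: t], [::], [::].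
    by split=> //; rewrite defs /= !cats0 cats1.
  + case=> ? ? _ _; subst r b; exists a, l, (rcons f t), [::], [::].
    split=> //; first by rewrite defs /= !cats0 map_rcons -!cats1 -!catA.
    by rewrite size_rcons; split=> //; lia.
- move: nb; rewrite /=; case: lin => [[e g]|]; case: (st (scan s)) s2 stE => [|[|[]]] //= _.
  + case=> ? ? ? ? _; subst l f r b; exists a, [:: Par t (Some (e, g)) bd], [::], [::], [::].
    by split=> //; rewrite defs /= !cats0 cats1.
  + case=> ? ? _ _; subst r b; exists a, l, f, [:: Par t (Some (e, g)) bd], [::].
    split=> //; first by rewrite defs /= !cats0 -!cats1 -!catA.
    by rewrite cats0 in lr; rewrite all_cat lr.
Qed.

Lemma partition_items s :
  Permutation s (map Emp (emps s) ++ map Ful (fuls s) ++ pars s).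
Proof.
elim: s => [|x s IH]; first exact: Permutation.perm_nil.
case: x => [t|t|t lin b] /=; first exact: Permutation.perm_skip.
  exact: Perm_cons_cat.
by rewrite catA; apply: Perm_cons_cat; rewrite -catA.
Qed.

Lemma trees_Emp E : trees (map Emp E) = E.
Proof. by elim: E => //= t E ->. Qed.

Lemma trees_Ful F : trees (map Ful F) = F.
Proof. by elim: F => //= t F ->. Qed.

Lemma partition_trees s : Permutation (trees s) (emps s ++ fuls s ++ trees (pars s)).
Proof.
have := Perm_map (@tree_of n) (partition_items s).
by rewrite -!/(trees _) !trees_cat trees_Emp trees_Ful.
Qed.

Lemma shape_parts a l f r b : all (@is_par n) (l ++ r) ->
  let s := map Emp a ++ l ++ map Ful f ++ r ++ map Emp b in
  [/\ emps s = a ++ b, fuls s = f & pars s = l ++ r].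
Proof.
rewrite all_cat => /andP[pl pr] /=.
have eE E : [/\ emps (map Emp E) = E, fuls (map Emp E) = [::] & pars (map Emp E) = [::]].
  by elim: E => //= t E [-> -> ->].
have eF F : [/\ emps (map Ful F) = [::], fuls (map Ful F) = F & pars (map Ful F) = [::]].
  by elim: F => //= t F [-> -> ->].
have eP p : all (@is_par n) p -> [/\ emps p = [::], fuls p = [::] & pars p = p].
  by elim: p => //= -[t|t|t lin bd] p IH //= /IH[-> -> ->].
have ec (p p' : seq (item n)) : [/\ emps (p ++ p') = emps p ++ emps p', fuls (p ++ p') = fuls p ++ fuls p'
    & pars (p ++ p') = pars p ++ pars p'].
  by rewrite /emps /fuls /pars !pmap_cat filter_cat.
have [a1 a2 a3] := eE a; have [b1 b2 b3] := eE b; have [f1 f2 f3] := eF f.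
have [l1 l2 l3] := eP _ pl; have [r1 r2 r3] := eP _ pr.
have := ec (map Emp a) (l ++ map Ful f ++ r ++ map Emp b).
have := ec l (map Ful f ++ r ++ map Emp b).
have := ec (map Ful f) (r ++ map Emp b); have := ec r (map Emp b).
do 4![case=> -> -> ->].
by rewrite a1 a2 a3 b1 b2 b3 f1 f2 f3 l1 l2 l3 r1 r2 r3 /= !cats0.
Qed.

Lemma wf_parts s : wf s -> [/\ all (good_e X) (emps s), all (good_f X) (fuls s) & wf (pars s)].
Proof.
elim=> {s} [|x s wx _ [ge gf wp]]; first by split=> //; constructor.
by case: x wx => [t|t|t lin bd] wx /=; split=> //; rewrite /= ?ge ?gf ?[good_e _ _]wx ?[good_f _ _]wx //;
  constructor.
Qed.

Lemma wf_perm s s' : Permutation s s' -> wf s -> wf s'.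
Proof. exact: Permutation_Forall. Qed.

Definition ctxP E u v : Prop := exists a b, [/\ Permutation E (a ++ b), langs a u & langs b v].

Lemma ctxP_rev E u v : ctxP E u v -> ctxP E (rev v) (rev u).
Proof.
case=> a [b [Eab la lb]]; exists (rev b), (rev a); split; try (by apply/langs_rev; rewrite revK).
by rewrite -rev_cat; apply: Permutation_trans Eab _; apply: Permutation_sym; apply: perm_rev_seq.
Qed.

Lemma ctxP_good E u v : all (good_e X) E -> ctxP E u v -> ~~ has X u /\ ~~ has X v.
Proof.
move=> ge [a [b [Eab la lb]]]; move: ge; rewrite (all_seq_perm _ Eab) all_cat => /andP[ga gb].
by split; [apply: langs_good_e la|apply: langs_good_e lb].
Qed.

Lemma lang_P_hole E T ts w : Permutation ts (T :: E) ->
  lang (PNode ts) w <-> exists u c v, [/\ w = u ++ c ++ v, ctxP E u v & lang T c].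
Proof.
move=> tsE; rewrite lang_PP; split=> [[us tu lu]|[u [c [v [-> [a [b [Eab la lb]]] lc]]]]].
  have Tus : Permutation (T :: E) us by apply: Permutation_trans (Permutation_sym tsE) tu.
  have [a [b defus]] := in_split_cat (Permutation_in T Tus (or_introl erefl)).
  rewrite defus in Tus lu; have Eab := Perm_cons_cat_inv Tus.
  move/langs_cat: lu => [u [v [-> la /langs_consP[c [v' [-> lc lb]]]]]].
  by exists u, c, v'; split=> //; exists a, b.
exists (a ++ T :: b).
  by apply: Permutation_trans tsE _; apply: Perm_cons_cat.
apply/langs_cat; exists u, (c ++ v); split=> //; exact: langs_cons.
Qed.

Lemma lang_frameP E T w :
  lang (plug (if nilp E then [::] else [:: (false, E, [::])]) T) w <->
  exists u c v, [/\ w = u ++ c ++ v, ctxP E u v & lang T c].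
Proof.
case: E => [|t E] /=.
  split=> [lw|[u [c [v [-> [a [b [/Permutation_nil]]]]]]]].
    exists [::], w, [::]; rewrite cats0; split=> //; exists [::], [::].
    by split=> //; apply: langs_nil.
  by case: a => //=; case: b => //= _ /langs0-> /langs0-> ?; rewrite cats0.
rewrite lang_mkP; apply: lang_P_hole.
apply: Permutation_trans (Perm_catC _ _) _ => /=; apply: Permutation.perm_skip.
exact: perm_rev_seq.
Qed.

Lemma langs_block ts w : (exists2 f, Permutation ts f & langs f w) <->
  langs (if nilp ts then [::] else [:: mkP ts]) w.
Proof.
case: ts => [|t ts] /=; last by rewrite langs1 (lang_mkP (t :: ts)) lang_PP.
split=> [[f /Permutation_nil->//]|lw]; by exists [::].
Qed.

Lemma trees_full_item F : trees (full_item F) = if nilp F then [::] else [:: mkP F].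
Proof. by rewrite /full_item; case: ifP. Qed.

Lemma trees_empty_item E : trees (empty_item E) = if nilp E then [::] else [:: mkP E].
Proof. by rewrite /empty_item; case: ifP. Qed.

Lemma wf_root_list s : wf s -> wf (root_list false s).
Proof.
case/wf_parts=> _ gf wp; rewrite /root_list.
apply/List.Forall_app; split.
  case: (pars s) wp => [|x p] H /=; first by constructor.
  by rewrite take0; inversion H; subst; constructor=> //; constructor.
apply/List.Forall_app; split; last first.
  by case: (pars s) wp => [|x p] H /=; [constructor|inversion H].
rewrite /full_item; case: ifP => [_|/negbT F0]; first by constructor.
by constructor=> //; apply: good_f_mkP.
Qed.

Lemma wf_rev s : wf s -> wf (rev s).
Proof. by apply: wf_perm; apply: Permutation_sym; apply: perm_rev_seq. Qed.

Lemma wf_lin_list s : wf s -> wf (lin_list false s).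
Proof.
case/wf_parts=> ge gf wp; rewrite /lin_list.
apply/List.Forall_app; split.
  rewrite /empty_item; case: ifP => [_|/negbT E0]; first by constructor.
  by constructor=> //; apply: good_e_mkP.
apply/List.Forall_app; split; first exact: wf_rev.
rewrite /full_item; case: ifP => [_|/negbT F0]; first by constructor.
by constructor=> //; apply: good_f_mkP.
Qed.

Lemma special_root_list s : special (root_list false s) = special s.
Proof.
have pp : all (@is_par n) (pars s) by apply: filter_all.
have -> : root_list false s = map Emp [::] ++ take 1 (pars s) ++
    map Ful (if nilp (fuls s) then [::] else [:: mkP (fuls s)]) ++
    behead (pars s) ++ map Emp [::].
  by rewrite /root_list /full_item cats0; case: ifP.
have [|_ fE pE] := @shape_parts [::] (take 1 (pars s))
    (if nilp (fuls s) then [::] else [:: mkP (fuls s)]) (behead (pars s)) [::].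
  by case: (pars s) pp => //= x p; rewrite take0.
rewrite /special fE pE; case: (pars s) => [|x p] /=; rewrite ?take0 /=; by case: (nilp (fuls s)).
Qed.

Lemma lang_trees_P s w : lang (PNode (trees s)) w <->
  exists2 s', Permutation s s' & langs (trees s') w.
Proof.
rewrite lang_PP; split=> [[us tu lu]|[s' ss' ls']]; last first.
  by exists (trees s') => //; apply: Perm_map.
have [s' eus ss'] := Perm_map_inv (Permutation_sym tu).
by exists s'; rewrite // /trees -eus.
Qed.

Lemma aut_scan s w : wf s -> langs (trees s) w -> aut X 0 w != 3 -> ~~ special s ->
  ~~ bad (scan s) /\ langs (scan_out (scan s)) w.
Proof.
move=> ws lw ne ns; have := scan_complete (scan_okP ws) lw ne.
by case=> [[nb _ lo]|[sp]] //; rewrite sp in ns.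
Qed.

Lemma special_perm s s' : Permutation s s' -> special s = special s'.
Proof.
move=> ss'; have := perm_size_seq (perm_filter_seq (@is_par n) ss').
have := perm_size_seq (perm_pmap_seq (@fult n) ss').
by rewrite /special /nilp /fuls /pars => -> ->.
Qed.

(** An admissible order of the children has the shape of [scan_shape]. Its middle part consists of
    all full and partial trees and fits [root_list] up to reversal; the Q-node built from the scan
    takes care of the reversal, and the empty trees stay free on both sides. *)
Lemma comb_rootP s w : wf s -> ~~ special s ->
  let c := scan (root_list false s) in
  lang (PNode (trees s)) w /\ aut X 0 w != 3 <->
  ~~ bad c /\ exists u z v, [/\ w = u ++ z ++ v, ctxP (emps s) u v & lang (mkQ (scan_out c)) z].
Proof.
move=> ws ns c; have wA := wf_root_list ws; have [ge gf wp] := wf_parts ws.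
have okA := scan_okP wA; rewrite -/c in okA.
have nsA : ~~ special (root_list false s) by rewrite special_root_list.
split.
  case=> /lang_trees_P[s' ss' lw] ne; have ws' := wf_perm ss' ws.
  have ns' : ~~ special s' by rewrite -(special_perm ss').
  have [nb' _] := aut_scan ws' lw ne ns'.
  have [a [l [f [r [b [defs' l1 r1 lr _]]]]]] := scan_shape nb'.
  have [es' fs' ps'] := @shape_parts a l f r b lr; rewrite -defs' in es' fs' ps'.
  have pE : Permutation (emps s) (a ++ b) by rewrite -es'; apply: perm_pmap_seq.
  have pF : Permutation (fuls s) f by rewrite -fs'; apply: perm_pmap_seq.
  have pP : Permutation (pars s) (l ++ r) by rewrite -ps'; apply: perm_filter_seq.
  move: lw; rewrite defs' !trees_cat !trees_Emp trees_Ful => /langs_cat[u [w1 [dw lu]]].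
  case/langs_cat=> wl [w2 [dw1 ll]] /langs_cat[wz [w3 [dw2 lf]]] /langs_cat[wr [v [dw3 lrr lv]]].
  have wE : w = u ++ (wl ++ wz ++ wr) ++ v by rewrite dw dw1 dw2 dw3 -!catA.
  have cE : ctxP (emps s) u v by exists a, b.
  have [hu hv] := ctxP_good ge cE.
  have neZ : aut X 0 (wl ++ wz ++ wr) != 3 by rewrite -(aut_pad _ hu hv) -wE.
  have lF : langs (trees (full_item (fuls s))) wz.
    by rewrite trees_full_item; apply/langs_block; exists f.
  have lF' : langs (trees (full_item (fuls s))) (rev wz).
    by apply/langs_rev; rewrite trees_full_item in lF *; move: lF; case: nilp.
  have revT (p : seq (item n)) (z : seq 'I_n) : size p <= 1 -> langs (trees p) z -> langs (trees p) (rev z).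
    by case: p => [|x [|]] //= _ lz; apply/langs_rev.
  (* The head of [pars s] may occur on either side of the full trees, which decides between the
     block and its mirror image. *)
  have : langs (trees (root_list false s)) (wl ++ wz ++ wr) \/
         langs (trees (root_list false s)) (rev (wl ++ wz ++ wr)).
    rewrite /root_list !trees_cat; case: l r l1 r1 {lr ps' defs'} pP ll lrr
      => [|p [|//]] [|p' [|//]] _ _ /= pP.
    - rewrite (Permutation_nil (Permutation_sym pP)) /= => ll lrr; left.
      by move/langs0: ll => ->; move/langs0: lrr => ->; rewrite /= !cats0.
    - rewrite (Permutation_length_1_inv (Permutation_sym pP)) /= => ll lrr; right.
      move/langs0: ll => ->; rewrite /= rev_cat; apply: (@langs_cat _ [:: _] _ _).2.
      exists (rev wr), (rev wz); split; [by []|exact: (revT [:: p'] wr isT)|by rewrite ?cats0].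
    - rewrite (Permutation_length_1_inv (Permutation_sym pP)) /= => ll lrr; left.
      move/langs0: lrr => ->; rewrite /= !cats0; apply: (@langs_cat _ [:: _] _ _).2.
      by exists wl, wz.
    - have [->|->] := Permutation_length_2_inv (Permutation_sym pP) => /= ll lrr.
        left; apply: (@langs_cat _ [:: _] _ _).2; exists wl, (wz ++ wr); split=> //.
        by apply/langs_cat; exists wz, wr.
      right; rewrite !rev_cat -catA; apply: (@langs_cat _ [:: _] _ _).2.
      exists (rev wr), (rev wz ++ rev wl); split; [by []|exact: (revT [:: p'] wr isT)|].
      by apply/langs_cat; exists (rev wz), (rev wl); split=> //; apply: (revT [:: p] wl isT).
  case=> lA.
    have [nb lo] := aut_scan wA lA neZ nsA; split=> //.
    by exists u, (wl ++ wz ++ wr), v; split=> //; apply/lang_mkQ; apply: lang_Q.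
  rewrite -(aut0_rev X) in neZ; have [nb lo] := aut_scan wA lA neZ nsA; split=> //.
  by exists u, (wl ++ wz ++ wr), v; split=> //; apply/lang_mkQ; apply: lang_Qr; apply/langs_rev.
have fwd u z v : ~~ bad c -> ctxP (emps s) u v -> langs (scan_out c) z ->
    lang (PNode (trees s)) (u ++ z ++ v) /\ aut X 0 (u ++ z ++ v) != 3.
  move=> nb cE lo; have [hu hv] := ctxP_good ge cE; have [a [b [pE lu lv]]] := cE.
  have [lA sA] := scan_sound okA nb lo.
  split; last by rewrite aut_pad // sA; have := scan_st okA; lia.
  move: lA; rewrite /root_list !trees_cat => /langs_cat[z1 [z2 [-> l1 /langs_cat[z3 [z4 [-> l3 l4]]]]]].
  move: l3; rewrite trees_full_item => /langs_block[f pF lf].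
  apply: (@lang_P _ _ (a ++ (trees (take 1 (pars s)) ++ f ++ trees (behead (pars s))) ++ b)).
    apply: Permutation_trans (partition_trees s) _.
    apply: Permutation_trans (Perm_cat pE (Perm_cat pF (Permutation_refl _))) _.
    rewrite -catA; apply: Perm_cat (Permutation_refl _) _.
    apply: Permutation_trans (Perm_catC _ _) _; apply: Perm_cat _ (Permutation_refl _).
    have -> : trees (pars s) = trees (take 1 (pars s)) ++ trees (behead (pars s)).
      by rewrite -trees_cat; case: (pars s) => //= x p; rewrite take0.
    exact: Perm_catCA.
  apply/langs_cat; exists u, ((z1 ++ z3 ++ z4) ++ v); split=> //.
  apply/langs_cat; exists (z1 ++ z3 ++ z4), v; split=> //.
  apply/langs_cat; exists z1, (z3 ++ z4); split=> //.
  by apply/langs_cat; exists z3, z4.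
case=> nb [u [z [v [-> cE /lang_mkQ/lang_QP[lo|/langs_rev lo]]]]]; first exact: fwd.
have [lr ne] := fwd _ _ _ nb (ctxP_rev cE) lo.
have rE : u ++ z ++ v = rev (rev v ++ rev z ++ rev u) by rewrite !rev_cat !revK catA.
by rewrite rE aut0_rev; split=> //; apply: lang_rev.
Qed.

Lemma comb_linP s w : wf s -> let c := scan (lin_list false s) in
  lang (PNode (trees s)) w /\ aut X 0 w = 1 <->
  [/\ st c = 1, ~~ bad c & langs (scan_out c) w].
Proof.
move=> ws c; have wB := wf_lin_list ws; have [ge gf wp] := wf_parts ws.
have okB := scan_okP wB; rewrite -/c in okB.
split.
  case=> /lang_trees_P[s' ss' lw] w1; have ws' := wf_perm ss' ws.
  have := scan_complete (scan_okP ws') lw; rewrite w1 => /(_ isT)[[nb' st1 _]|[]//].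
  have [a [l [f [r [b [defs' l1 r1 lr]]]]]] := scan_shape nb'.
  rewrite -st1 => -[r0 b0 _]; subst r b.
  have [es' fs' ps'] := @shape_parts a l f [::] [::] lr; rewrite -defs' !cats0 in es' fs' ps'.
  have pE : Permutation (emps s) a by rewrite -es'; apply: perm_pmap_seq.
  have pF : Permutation (fuls s) f by rewrite -fs'; apply: perm_pmap_seq.
  have pP : Permutation (pars s) l by rewrite -ps'; apply: perm_filter_seq.
  have lB : langs (trees (lin_list false s)) w.
    move: lw; rewrite defs' !trees_cat !trees_Emp trees_Ful !cats0 => /langs_cat[u [w2 [-> lu]]].
    case/langs_cat=> wl [wz [-> ll lf]].
    rewrite ?/lin_list ?trees_cat trees_full_item trees_empty_item.
    apply/langs_cat; exists u, (wl ++ wz); split=> //; first by apply/langs_block; exists a.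
    apply/langs_cat; exists wl, wz; split=> //; last by apply/langs_block; exists f.
    (* At most one partial tree is left here, so the reversal in [lin_list] is invisible. *)
    have -> : rev (pars s) = l; last by [].
    case: l l1 pP {ll ps' lr defs'} => [|p [|//]] _ pP.
      by rewrite (Permutation_nil (Permutation_sym pP)).
    by rewrite (Permutation_length_1_inv (Permutation_sym pP)).
  have := scan_complete okB lB; rewrite w1 => /(_ isT)[[nb -> lo]|[]//].
  by split.
case=> st1 nb lo; have [lB sB] := scan_sound okB nb lo; rewrite st1 in sB; split=> //.
move: lB; rewrite /lin_list !trees_cat trees_full_item trees_empty_item.
case/langs_cat=> u [w2 [-> /langs_block[a pE lu] /langs_cat[wl [wz [-> ll /langs_block[f pF lf]]]]]].
apply: (@lang_P _ _ (a ++ trees (rev (pars s)) ++ f)).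
  apply: Permutation_trans (partition_trees s) _; apply: Perm_cat pE _.
  apply: Permutation_trans (Perm_catC _ _) _; apply: Perm_cat _ pF.
  by rewrite trees_rev; apply: Permutation_sym; apply: perm_rev_seq.
apply/langs_cat; exists u, (wl ++ wz); split=> //.
by apply/langs_cat; exists wl, wz.
Qed.

Lemma comb_rootQ s w : wf s -> ~~ special s -> let c := scan s in
  lang (QNode (trees s)) w /\ aut X 0 w != 3 <->
  ~~ bad c /\ lang (mkQ (scan_out c)) w.
Proof.
move=> ws ns c; have okc := scan_okP ws; rewrite lang_mkQ; split.
  case=> /lang_QP[lw|/langs_rev lw] ne.
    by have [nb lo] := aut_scan ws lw ne ns; split=> //; apply: lang_Q.
  rewrite -aut0_rev in ne; have [nb lo] := aut_scan ws lw ne ns; split=> //.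
  by apply: lang_Qr; apply/langs_rev.
case=> nb /lang_QP[lo|/langs_rev lo]; have [lw sw] := scan_sound okc nb lo.
  by split; [apply: lang_Q|rewrite sw; have := scan_st okc; lia].
split; first by apply: lang_Qr; apply/langs_rev.
by rewrite -aut0_rev sw; have := scan_st okc; lia.
Qed.

Lemma scan_out1 s : wf s -> st (scan s) = 1 ->
  scan_out (scan s) = scan_left (scan s) ++ rev (rf (scan s)).
Proof.
move=> ws s1; have [|e1 e2] := scan_st1 (scan_okP ws); first by rewrite s1.
by rewrite /scan_out /scan_left e1 e2 /= cats0 catA.
Qed.

(** At least two children, not all of them full, cannot have the colour last in both orientations,
    so the first successful scan accounts for all words. *)
Lemma comb_linQ s w : wf s -> 1 < size s -> ~~ (nilp (emps s) && nilp (pars s)) ->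
  let c := if (st (scan s) == 1) && ~~ bad (scan s) then scan s else scan (rev s) in
  lang (QNode (trees s)) w /\ aut X 0 w = 1 <->
  [/\ st c = 1, ~~ bad c & langs (scan_out c) w].
Proof.
move=> ws s2 nf c; have wr := wf_rev ws.
have excl : st (scan s) = 1 -> ~~ bad (scan s) -> st (scan (rev s)) = 1 ->
    ~~ bad (scan (rev s)) -> False.
  move=> s1 nb s1' nb'.
  have [a [l [f [r [b [defs l1 _ lr]]]]]] := scan_shape nb; rewrite s1 => -[r0 b0 lf].
  have [a' [l' [f' [r' [b' [defr l1' _ lr']]]]]] := scan_shape nb'; rewrite s1' => -[r0' b0' lf'].
  subst r b r' b'; rewrite /= !cats0 in defs defr.
  have revs : rev s = rev (map Ful f) ++ rev l ++ rev (map Emp a).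
    by rewrite defs !rev_cat catA.
  case/lastP: f lf defs revs => [|f tf] lf defs revs.
    case: l l1 lr lf defs revs => [|p [|//]] //= _ /andP[pp _] _ defs revs.
    move: revs; rewrite defr /=; case: a' defr => [|y a'] defr /=; last by case=> ep; rewrite -ep in pp.
    case: l' l1' lr' lf' defr => [|p' [|//]] //= _ lr' lf' defr.
      by case: f' lf' defr => //= y f' _ _ [ep]; rewrite -ep in pp.
    case=> _; case: f' {lf'} defr => [|y f'] defr.
      by move=> ra; move: s2; rewrite -size_rev defr.
    by case/lastP: a defs => [|a z] //= defs; rewrite map_rcons rev_rcons.
  rewrite map_rcons rev_rcons /= in revs.
  move: revs; rewrite defr; case: a' defr => //= defr.
  case: l' l1' lr' lf' defr => [|p' [|//]] /= _ lr' lf' defr; last by case=> ep; rewrite ep in lr'.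
  move=> _; have [ee _ pe] := @shape_parts [::] [::] f' [::] [::] isT; rewrite /= !cats0 -defr in ee pe.
  move/negP: nf; apply; rewrite /nilp -(perm_size_seq (perm_pmap_seq (@empt n) (perm_rev_seq s))).
  rewrite -(perm_size_seq (perm_filter_seq (@is_par n) (perm_rev_seq s))).
  by rewrite -/(emps _) -/(pars _) ee pe.
have ok := scan_okP ws; have okr := scan_okP wr.
have compl s0 z : wf s0 -> langs (trees s0) z -> aut X 0 z = 1 ->
    [/\ st (scan s0) = 1, ~~ bad (scan s0) & langs (scan_out (scan s0)) z].
  move=> w0 lz z1; have := scan_complete (scan_okP w0) lz; rewrite z1.
  by case=> // [[nb -> lo]|[]].
split.
  case=> /lang_QP[] lw w1; last rewrite -trees_rev in lw.
    by have [s1 nb lo] := compl _ _ ws lw w1; rewrite /c s1 eqxx nb.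
  have [s1 nb lo] := compl _ _ wr lw w1; rewrite /c; case: ifP => // /andP[/eqP s1' nb'].
  by case: (excl s1' nb' s1 nb).
rewrite /c; case: ifP => _ [s1 nb lo].
  by have [lw sw] := scan_sound ok nb lo; rewrite sw s1; split=> //; apply: lang_Q.
have [lw sw] := scan_sound okr nb lo; rewrite sw s1; split=> //.
by apply: lang_Qr; rewrite -trees_rev.
Qed.

End Combination.

(** * Correctness of the reduction *)

Section RedCorrect.
Variables (n : nat) (X : pred 'I_n).
Local Notation tree := (pqtree n).
Local Notation wf := (List.Forall (wf_item X)).
Implicit Types (t T : tree) (ts E F : seq tree) (x : item n) (s : seq (item n)) (w u v : seq 'I_n).

Lemma all_Emp s : fuls s = [::] -> pars s = [::] -> s = map Emp (emps s).
Proof. by elim: s => //= -[t|t|t lin b] s IH //= fs ps; rewrite -IH. Qed.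

Lemma all_Ful s : emps s = [::] -> pars s = [::] -> s = map Ful (fuls s).
Proof. by elim: s => //= -[t|t|t lin b] s IH //= fs ps; rewrite -IH. Qed.

Lemma frontier_node q ts : frontier (node q ts) = frontiers ts.
Proof. by case: q. Qed.

Lemma proper_node (q : bool) ts : 1 < size ts -> (q -> 2 < size ts) -> all (@proper_arities n) ts ->
  proper_arities (node q ts).
Proof. by case: q => [_ /(_ isT)|+ _] /= => -> ->. Qed.

Lemma wf_proper s : wf s -> all (@proper_arities n) (trees s).
Proof. by elim=> //= {s} [[t|t|t lin b] s]; [move=> /andP[-> _]..|case=> ->]. Qed.

Lemma wf_has s : wf s -> ~~ (nilp (fuls s) && nilp (pars s)) -> has X (frontiers (trees s)).
Proof.
rewrite has_frontiers; elim=> //= {s} [[t|t|t lin b] s] /=.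
- by move=> _ _ IH /IH->; rewrite orbT.
- by move=> /andP[/frontier_gt0 t0 at_] _ _ _; case: (frontier t) t0 at_ => //= i w _ /andP[->].
- by case=> _ [-> _].
Qed.

Lemma wf_notall s : wf s -> ~~ (nilp (emps s) && nilp (pars s)) -> ~~ all X (frontiers (trees s)).
Proof.
rewrite all_frontiers; elim=> //= {s} [[t|t|t lin b] s] /=.
- move=> /andP[/frontier_gt0 t0 ht] _ _ _.
  by case: (frontier t) t0 ht => //= i w _; rewrite negb_or => /andP[/negbTE->].
- by move=> _ _ IH /IH H; rewrite negb_and H orbT.
- by case=> _ [_ /negbTE->].
Qed.

Definition ctxQ (a b : seq tree) u v : Prop :=
  langs a u /\ langs b v \/ langs (rev b) u /\ langs (rev a) v.

Lemma lang_Q_hole a T b w : lang (QNode (a ++ T :: b)) w <->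
  exists u z v, [/\ w = u ++ z ++ v, ctxQ a b u v & lang T z].
Proof.
rewrite lang_QP rev_cat rev_cons cat_rcons; split.
  case=> /langs_cat[u [v' [-> lu /langs_consP[z [v [-> lz lv]]]]]]; exists u, z, v; split=> //.
    by left.
  by right.
case=> u [z [v [-> [[lu lv]|[lu lv]] lz]]]; [left|right]; apply/langs_cat;
  by exists u, (z ++ v); split=> //; apply: langs_cons.
Qed.

Lemma ctxQ_good a b u v : all (good_e X) a -> all (good_e X) b -> ctxQ a b u v ->
  ~~ has X u /\ ~~ has X v.
Proof.
by move=> ga gb [[lu lv]|[lu lv]]; split;
  [apply: langs_good_e lu|apply: langs_good_e lv
  |apply: langs_good_e lu; rewrite all_rev|apply: langs_good_e lv; rewrite all_rev].
Qed.

Lemma special_split s x : fuls s = [::] -> pars s = [:: x] ->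
  exists a b, s = map Emp a ++ x :: map Emp b.
Proof.
elim: s => //= -[t|t|t lin bd] s IH //= fs.
  by case/(IH fs)=> a [b ->]; exists (t :: a), b.
by case=> <- ps; exists [::], (emps s); rewrite /= -all_Emp.
Qed.

(** True also when the scan is marked as failed for want of a [lin] form: the two accumulators still
    separate the siblings of the partial child. *)
Lemma scan_special a x b : is_par x ->
  let c := scan (map Emp a ++ x :: map Emp b) in acc c = rev a /\ esR c = rev b.
Proof.
move=> px /=; rewrite /scan foldl_cat /=.
have emp0 (c : scanner n) : st c = 0 -> let c' := foldl (@scan_step n) c (map Emp a) in
    [/\ acc c' = rev a ++ acc c, esR c' = esR c & st c' = 0].
  elim: a c => //= t a IH c c0; have [] := IH (scan_step c (Emp t)); rewrite /= c0 //= => -> -> ->.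
  by rewrite rev_cons cat_rcons.
have emp1 (c : scanner n) : st c != 0 -> let c' := foldl (@scan_step n) c (map Emp b) in
    acc c' = acc c /\ esR c' = rev b ++ esR c.
  elim: b c => //= t b IH c c0; have [] := IH (scan_step c (Emp t)); rewrite /=.
    by case: (st c) c0.
  by case: (st c) c0 => //= k _ -> ->; rewrite rev_cons cat_rcons.
have [] := emp0 scan0 erefl; rewrite /= cats0; set c1 := foldl _ _ _ => a1 r1 s1.
have [] := emp1 (scan_step c1 x).
  by case: x px => // t [[e r]|] bd _; rewrite /= s1.
by case: x px => // t [[e r]|] bd _; rewrite /= s1 /= a1 r1 cats0.
Qed.

(** Letters outside the colour on both sides do not affect contiguity, so the form of the child is
    inherited behind one more frame. The context is abstract in order to serve both kinds of
    node. *)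
Lemma special_body_ok (N t : tree) (W : tree -> tree) (ctx : seq 'I_n -> seq 'I_n -> Prop)
    (fr : frame n) lin bd :
  (forall w, lang N w <-> exists u z v, [/\ w = u ++ z ++ v, ctx u v & lang t z]) ->
  (forall T w, lang (wrap fr T) w <-> exists u z v, [/\ w = u ++ z ++ v, ctx u v & lang T z]) ->
  (forall u v, ctx u v -> ~~ has X u /\ ~~ has X v) -> frame_ok X fr ->
  wf_item X (Par t lin bd) ->
  body_ok X N (if bd is Some (frs, co) then Some (fr :: frs, co) else None).
Proof.
move=> lN lW good okf [_ _ _]; case: bd => [[frs co] [okfs okc lT]|bdn] /=.
  split=> // [|w]; first by rewrite okf.
  rewrite lW lN; split.
    case=> u [z [v [-> cx /lT[lz nz]]]]; have [hu hv] := good u v cx.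
    by rewrite aut_pad //; split=> //; exists u, z, v.
  case=> -[u [z [v [-> cx lz]]]] nz; have [hu hv] := good u v cx.
  by rewrite aut_pad // in nz; exists u, z, v; split=> //; apply/lT.
move=> w /lN[u [z [v [-> cx lz]]]]; have [hu hv] := good u v cx.
by apply/eqP; rewrite aut_pad // bdn.
Qed.

Lemma core_seq_scan (c : scanner n) : core_seq (scan_core c) = scan_out c.
Proof. by rewrite /core_seq /scan_out /= /scan_left -!catA. Qed.

Lemma scan_core_ok s : wf s -> ~~ nilp s -> ~~ bad (scan s) -> core_ok X (scan_core (scan s)).
Proof.
move=> ws s0 nb; have ok := scan_okP ws; have := scan_e ok; have := scan_f ok.
rewrite /core_ok core_seq_scan /= /scan_left !all_cat all_rev.
case/andP=> -> -> /and3P[-> -> ->] /=; apply/negP=> /nilP out0.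
have [|l0 _] := scan_sound ok nb (_ : langs _ [::]); first by rewrite out0; apply: langs_nil.
by have := langs_size (wf_proper ws) l0; rewrite size_map; case: (s) s0.
Qed.

Lemma comb_lin_some s : wf s -> all (good_e X) (scan_left (scan s)) /\ all (good_f X) (rf (scan s)).
Proof.
move=> ws; have ok := scan_okP ws; have := scan_e ok; have := scan_f ok.
by rewrite /scan_left !all_cat all_rev => /andP[-> _] /and3P[-> -> _].
Qed.

Lemma wf_comb (q : bool) s : wf s -> 1 < size s -> (q -> 2 < size s) ->
  wf_item X (comb q s) /\ forall w, lang (node q (trees s)) w <-> lang (tree_of (comb q s)) w.
Proof.
move=> ws s2 q2; have [ge gf wp] := wf_parts ws; rewrite /comb.
have szt : size (trees s) = size s by rewrite size_map.
case: ifP => [/andP[/nilP fs /nilP ps]|notE].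
  have sE := all_Emp fs ps; have tE : trees s = emps s by rewrite {1}sE trees_Emp.
  rewrite -tE; split=> [|//]; apply/andP; split.
    by apply: proper_node; rewrite ?szt // wf_proper.
  rewrite frontier_node; apply: (langs_good_e (ts := trees s)); last exact: langs_frontiers.
  by rewrite tE.
case: ifP => [/andP[/nilP es /nilP ps]|notF].
  have sE := all_Ful es ps; have tE : trees s = fuls s by rewrite {1}sE trees_Ful.
  rewrite -tE; split=> [|//]; apply/andP; split.
    by apply: proper_node; rewrite ?szt // wf_proper.
  rewrite frontier_node; apply: (langs_good_f (ts := trees s)); last exact: langs_frontiers.
  by rewrite tE.
move/negbT: notE => notE; move/negbT: notF => notF.
split=> [/=|//]; split.
- by apply: proper_node; rewrite ?szt // wf_proper.
- by rewrite frontier_node wf_has ?wf_notall.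
- rewrite /comb_lin; case: q q2 => q2; rewrite /root_list /lin_list /= -/(trees s).
    have lQ w := comb_linQ w ws s2 notF.
    case: ifP lQ => [/andP[/eqP s1 nb] lQ|_ lQ].
      have [g1 g2] := comb_lin_some ws; split=> // w; rewrite lQ -(scan_out1 ws s1).
      by split=> [lo|[]] //.
    have wr := wf_rev ws; case: ifP => [/andP[/eqP s1 nb]|nb].
      have [g1 g2] := comb_lin_some wr; split=> // w; rewrite lQ -(scan_out1 wr s1).
      by split=> [lo|[]] //.
    by move=> w lw w1; have [] := (lQ w).1 (conj lw w1) => s1 nb' _; rewrite s1 nb' in nb.
  have lP w := comb_linP w ws; have wl := wf_lin_list ws; rewrite /= /lin_list in lP wl.
  case: ifP => [/andP[/eqP s1 nb]|nb].
    have [g1 g2] := comb_lin_some wl; split=> // w; rewrite lP -(scan_out1 wl s1).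
    by split=> [lo|[]] //.
  by move=> w lw w1; have [] := (lP w).1 (conj lw w1) => s1 nb' _; rewrite s1 nb' in nb.
- rewrite /comb_body; case: ifP => [/andP[/nilP fs /eqP ps1]|/negbT ns].
    case Ps: (pars s) ps1 => [|x [|//]] //= _.
    have px : is_par x by have := filter_all (@is_par n) s; rewrite -/(pars s) Ps /= andbT.
    have wx : wf_item X x by rewrite Ps in wp; inversion wp.
    case: x px wx Ps => // t lin bd _ wx Ps.
    have [a [b sE]] := special_split fs Ps.
    have [eE _ _] := @shape_parts _ a [:: Par t lin bd] [::] [::] b isT; rewrite /= -sE in eE.
    have tE : trees s = a ++ t :: b by rewrite sE trees_cat /= trees_Emp -/(trees _) trees_Emp.
    have ab : 0 < size a + size b by move: s2; rewrite sE size_cat /= !size_map; lia.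
    have /andP[ga gb] : all (good_e X) a && all (good_e X) b by rewrite -all_cat -eE.
    case: q q2 => q2 /=; rewrite -/(trees s).
      have [-> ->] : acc (scan s) = rev a /\ esR (scan s) = rev b.
        by rewrite {1 2}sE; apply: scan_special.
      rewrite tE; have := @special_body_ok (QNode (a ++ t :: b)) t id (ctxQ a b)
        (true, rev a, rev b) lin bd; case: bd wx {Ps sE} => [[frs co]|] wx; apply=> //.
      + by move=> w; apply: lang_Q_hole.
      + by move=> T w; rewrite /= !revK lang_mkQ; apply: lang_Q_hole.
      + by move=> u v; apply: ctxQ_good.
      + by rewrite /= !all_rev !size_rev ga gb ab.
      + by move=> w; apply: lang_Q_hole.
      + by move=> T w; rewrite /= !revK lang_mkQ; apply: lang_Q_hole.
      + by move=> u v; apply: ctxQ_good.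
      + by rewrite /= !all_rev !size_rev ga gb ab.
    have E0 : ~~ nilp (emps s) by rewrite eE /nilp size_cat -lt0n.
    have hole w : lang (PNode (trees s)) w <->
        exists u z v, [/\ w = u ++ z ++ v, ctxP (emps s) u v & lang t z].
      apply: lang_P_hole; rewrite tE eE; apply: Permutation_sym; exact: Perm_cons_cat.
    have hole' T w := lang_frameP (emps s) T w; rewrite (negbTE E0) /= in hole'.
    have gE : all (good_e X) (emps s) by rewrite eE all_cat ga.
    have := @special_body_ok (PNode (trees s)) t id (ctxP (emps s))
      (false, emps s, [::]) lin bd; case: bd wx {Ps sE} => [[frs co]|] wx; apply=> //.
    + by move=> u v; apply: ctxP_good.
    + by rewrite /= gE addn0 lt0n; move: E0; rewrite /nilp => ->.
    + by move=> u v; apply: ctxP_good.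
    + by rewrite /= gE addn0 lt0n; move: E0; rewrite /nilp => ->.
  case: q q2 => q2 /=; rewrite -/(trees s).
    have rQ w := comb_rootQ w ws ns; case: ifP rQ => [bd rQ w lw|/negbT nb rQ].
      by apply/eqP/contraT=> ne; have [] := (rQ w).1 (conj lw ne); rewrite bd.
    split=> //; first by apply: scan_core_ok => //; rewrite /nilp -lt0n ltnW.
    move=> w; rewrite core_seq_scan rQ /=; split=> [lo|[]] //; split=> //.
  have wr := wf_root_list ws; rewrite /root_list in wr.
  have rP w := comb_rootP w ws ns; rewrite /= /root_list in rP.
  case: ifP rP => [bd rP w lw|/negbT nb rP].
    by apply/eqP/contraT=> ne; have [] := (rP w).1 (conj lw ne).
  split.
  + by case: ifP => [//|/negbT E0]; rewrite /= ge addn0 andbT lt0n; move: E0; rewrite /nilp => ->.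
  + apply: scan_core_ok => //; move: notE; rewrite /full_item /nilp !size_cat.
    by case: (fuls s) => [|t f]; case: (pars s) => [|p p'] //=; rewrite take0.
  + move=> w; rewrite core_seq_scan lang_frameP rP; split=> [lo|[]] //; split=> //.
Qed.

Lemma langs_map_eq (g : tree -> tree) ts :
  (forall t, List.In t ts -> forall w, lang t w <-> lang (g t) w) ->
  forall w, langs ts w <-> langs (map g ts) w.
Proof.
elim: ts => [|t ts IH] eqg w /=; first by split.
have {}IH := IH (fun t1 t_in => eqg t1 (or_intror t_in)).
rewrite !langs_consP; split=> -[u [v [-> lu lv]]]; exists u, v; split=> //.
- exact: (eqg _ (or_introl erefl) _).1.
- exact: (IH _).1.
- exact: (eqg _ (or_introl erefl) _).2.
- exact: (IH _).2.
Qed.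

Lemma lang_node_map (q : bool) (g : tree -> tree) ts :
  (forall t, List.In t ts -> forall w, lang t w <-> lang (g t) w) ->
  forall w, lang (node q ts) w <-> lang (node q (rev (map g ts))) w.
Proof.
move=> eqg w; case: q => /=.
  have eqr : forall t, List.In t (rev ts) -> forall w, lang t w <-> lang (g t) w.
    by move=> t tr; apply: eqg; apply: Permutation_in tr; apply: perm_rev_seq.
  by rewrite !lang_QP revK -map_rev -(langs_map_eq eqg) -(langs_map_eq eqr); tauto.
rewrite !lang_PP; split=> -[us tu lu].
  exists (map g us); last first.
    apply: (langs_map_eq _ _).1 => // t tin; apply: eqg; apply: Permutation_in tin.
    exact: Permutation_sym.
  by apply: Permutation_trans (perm_rev_seq _) _; apply: Perm_map.
have ug : Permutation us (map g ts).
  by apply: Permutation_sym; apply: Permutation_trans tu; apply: Permutation_sym; apply: perm_rev_seq.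
have [vs eus tv] := Perm_map_inv ug; exists vs => //.
apply: (langs_map_eq (g := g) _ _).2; last by rewrite -eus.
by move=> t tin; apply: eqg; apply: Permutation_in tin; apply: Permutation_sym.
Qed.

(** The stored tree has its children reversed at every inner node, hence agreement of languages
    instead of equality. *)
Lemma red_ok t : proper_arities t ->
  wf_item X (red X t) /\ forall w, lang t w <-> lang (tree_of (red X t)) w.
Proof.
elim/pqtree_nested_ind: t => [i|ts IH|ts IH] /=.
- by move=> _; case Xi: (X i); split=> //=; rewrite /good_e /good_f /= Xi.
- case/andP=> sz pts.
  have ok t1 : List.In t1 ts -> wf_item X (red X t1) /\ forall w, lang t1 w <-> lang (tree_of (red X t1)) w.
    move=> uin; apply: IH => //; elim: ts pts uin {sz} => //= t ts IHts /andP[pt pts].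
    by case=> [<-|/(IHts pts)].
  have ws : wf (rev (map (red X) ts)).
    apply: wf_rev; elim: ts ok {IH sz pts} => [|t ts IHts] ok /=; constructor.
      by have [] := ok t (or_introl erefl).
    by apply: IHts => u uin; apply: ok; right.
  have [|//|wc lc] := @wf_comb false _ ws; first by rewrite size_rev size_map.
  split=> // w; rewrite -lc trees_rev /trees -map_comp.
  have := @lang_node_map false (@tree_of n \o red X) ts; apply=> t1 t1_in.
  exact: (ok t1 t1_in).2.
- case/andP=> sz pts.
  have ok t1 : List.In t1 ts -> wf_item X (red X t1) /\ forall w, lang t1 w <-> lang (tree_of (red X t1)) w.
    move=> uin; apply: IH => //; elim: ts pts uin {sz} => //= t ts IHts /andP[pt pts].
    by case=> [<-|/(IHts pts)].
  have ws : wf (rev (map (red X) ts)).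
    apply: wf_rev; elim: ts ok {IH sz pts} => [|t ts IHts] ok /=; constructor.
      by have [] := ok t (or_introl erefl).
    by apply: IHts => u uin; apply: ok; right.
  have [||wc lc] := @wf_comb true _ ws; [by rewrite size_rev size_map; lia|by rewrite size_rev size_map|].
  split=> // w; rewrite -lc trees_rev /trees -map_comp.
  have := @lang_node_map true (@tree_of n \o red X) ts; apply=> t1 t1_in.
  exact: (ok t1 t1_in).2.
Qed.

Lemma red_body t : proper_arities t -> body_ok X t (body_of (red X t)).
Proof.
move=> pt; have [wr lr] := red_ok pt; case: (red X t) wr lr => [t'|t'|t' lin bd] /=.
- move=> ge lt; split=> //; first by rewrite /core_ok /= ge.
  move=> w; rewrite lt; split=> [lw|[]//]; split=> //.
  by have [/negbTE hw _] := lang_good_e ge lw; have /eqP-> : aut X 0 w == 0 by rewrite aut0_empty hw.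
- move=> gf lt; split=> //; first by rewrite /core_ok /= gf.
  move=> w; rewrite lt; split=> [lw|[]//]; split=> //.
  by have [hw w0] := lang_good_f gf lw; rewrite (aut_f hw w0).
- case=> _ _ _; case: bd => [[frs co] [okf okc lb]|bdn] lt /=.
    by split=> // w; rewrite lb lt.
  by move=> w /lt; apply: bdn.
Qed.

Fixpoint ctx (frs : seq (frame n)) u v : Prop :=
  if frs is (q, l, r) :: frs' then
    exists u1 u2 v1 v2, [/\ u = u1 ++ u2, v = v2 ++ v1, ctx frs' u2 v2
      & if q then ctxQ (rev l) (rev r) u1 v1 else ctxP (rev l ++ rev r) u1 v1]
  else u = [::] /\ v = [::].

Lemma lang_plug frs T w : lang (plug frs T) w <->
  exists u z v, [/\ w = u ++ z ++ v, ctx frs u v & lang T z].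
Proof.
elim: frs w => [|[[q l] r] frs IH] w /=.
  split=> [lw|[u [z [v [-> [-> ->] lz]]]]]; last by rewrite cats0.
  by exists [::], w, [::]; rewrite cats0.
have hole U : lang (mk q (rev l ++ U :: rev r)) w <-> exists u z v, [/\ w = u ++ z ++ v,
    (if q then ctxQ (rev l) (rev r) u v else ctxP (rev l ++ rev r) u v) & lang U z].
  case: q => /=; first by rewrite lang_mkQ; apply: lang_Q_hole.
  by rewrite lang_mkP; apply: lang_P_hole; apply: Permutation_sym; apply: Perm_cons_cat.
rewrite hole; split.
  case=> u1 [z' [v1 [-> c1 /IH[u2 [z [v2 [-> c2 lz]]]]]]].
  exists (u1 ++ u2), z, (v2 ++ v1); split=> //; first by rewrite -!catA.
  by exists u1, u2, v1, v2.
case=> u [z [v [-> [u1 [u2 [v1 [v2 [-> -> c2 c1]]]]] lz]]].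
exists u1, (u2 ++ z ++ v2), v1; split=> //; first by rewrite -!catA.
by apply/IH; exists u2, z, v2.
Qed.

Lemma ctx_good frs u v : all (frame_ok X) frs -> ctx frs u v -> ~~ has X u /\ ~~ has X v.
Proof.
elim: frs u v => [|[[q l] r] frs IH] u v /=; first by move=> _ [-> ->].
case/andP=> /and3P[_ gl gr] /IH{}IH [u1 [u2 [v1 [v2 [-> -> /IH[h1 h2]]]]]].
rewrite !has_cat (negbTE h1) (negbTE h2) /= orbF; case: q => cx.
  by apply: ctxQ_good cx; rewrite all_rev.
by apply: ctxP_good cx; rewrite all_cat !all_rev gl.
Qed.

(* Bounds the work of plugging: every frame has a nonempty context. *)
Lemma ctx_size frs u v : all (frame_ok X) frs -> ctx frs u v ->
  size frs <= size u + size v /\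
  \sum_(fr <- frs) (size fr.1.2 + size fr.2) <= size u + size v.
Proof.
elim: frs u v => [|[[q l] r] frs IH] u v /=; first by rewrite big_nil.
case/andP=> /and3P[lr0 gl gr] /IH{}IH [u1 [u2 [v1 [v2 [-> -> /IH[h1 h2] cx]]]]].
have : size l + size r <= size u1 + size v1.
  have pl := good_e_proper gl; have pr := good_e_proper gr.
  case: q cx => /=.
    have prl : all (@proper_arities n) (rev l) by rewrite all_rev.
    have prr : all (@proper_arities n) (rev r) by rewrite all_rev.
    rewrite /ctxQ !revK => -[[/(langs_size prl) a /(langs_size prr) b]|[/(langs_size pr) a /(langs_size pl) b]];
      by rewrite ?size_rev in a b; lia.
  case=> a [b [pab /langs_size la /langs_size lb]].
  have := all_seq_perm (@proper_arities n) pab; rewrite !all_cat !all_rev pl pr /=.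
  case/esym/andP=> /la sa /lb sb; have := perm_size_seq pab; rewrite !size_cat !size_rev; lia.
by rewrite big_cons !size_cat /=; lia.
Qed.

End RedCorrect.

(** * Permutation sets as sets of words *)

Lemma perm_eq_Perm (T : eqType) (s s' : seq T) : perm_eq s s' <-> Permutation s s'.
Proof.
split; last first.
  elim=> {s s'} //= [x s s' _|x y s|s1 s2 s3 _ p1 _ p2]; first by rewrite perm_cons.
    by apply/seq.permP=> a /=; rewrite addnCA.
  exact: seq.perm_trans p1 p2.
elim: s s' => [|x s IH] s' pss'.
  by move/perm_size: pss' => /esym/size0nil->; apply: Permutation.perm_nil.
have xs' : x \in s' by rewrite -(perm_mem pss') mem_head.
case/splitPr: s' / xs' pss' => a b pss'; apply: Perm_cons_cat; apply: IH.
by rewrite -(perm_cons x) (seq.perm_trans pss') // -cat_rcons -cats1 -catA perm_catCA.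
Qed.

Section Words.
Variable n : nat.
Implicit Types (p q : 'S_n) (X : {set 'I_n}) (w a b x y : seq 'I_n) (i : 'I_n).

(** Since [p] sends elements to positions, listing the elements by position is the one-line notation
    of the inverse, which explains the inverse in [consistent_inv]. *)
Definition word p : seq 'I_n := [seq p^-1%g i | i <- enum 'I_n].

Lemma size_word p : size (word p) = n.
Proof. by rewrite size_map size_enum_ord. Qed.

Lemma nth_word p i0 i : nth i0 (word p) i = p^-1%g i.
Proof. by rewrite (nth_map i) ?size_enum_ord // nth_ord_enum. Qed.

Lemma perm_word p : perm_eq (word p) (enum 'I_n).
Proof.
apply: uniq_perm; rewrite ?enum_uniq ?(map_inj_uniq perm_inj) ?enum_uniq // => i.
by rewrite mem_enum -{1}(permK p i) map_f ?mem_enum.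
Qed.

Lemma word_of w : perm_eq w (enum 'I_n) -> exists p, word p = w.
Proof.
move=> pw; have sw : size w = n by rewrite (perm_size pw) size_enum_ord.
have uw : uniq w by rewrite (perm_uniq pw) enum_uniq.
have f_inj : injective (fun i : 'I_n => nth i w i).
  move=> i j; rewrite (set_nth_default j) ?sw // => /eqP.
  by rewrite nth_uniq ?sw // => /eqP/val_inj.
exists (perm f_inj)^-1%g; rewrite /word invgK.
case: n w pw sw uw f_inj => [|n'] w' pw sw uw f_inj.
  by rewrite enum_ord0 /=; apply/esym/size0nil.
apply: (@eq_from_nth _ ord0); rewrite size_map size_enum_ord // => i lt_i.
rewrite (nth_map ord0) ?size_enum_ord // permE (set_nth_default ord0) ?sw //.
by rewrite -[i]/(nat_of_ord (Ordinal lt_i)) nth_ord_enum.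
Qed.

Lemma consistent_invE t p : consistent_inv t p <-> lang t (word p).
Proof. exact: consistentE. Qed.

Local Notation inX X := (fun i : 'I_n => i \in X).

Lemma nth_word_in p i X : (p^-1%g i \in X) = (i \in p @: X).
Proof. by rewrite -{2}(permKV p i) mem_imset //; apply: perm_inj. Qed.

Lemma word_split p c d : c <= d -> d <= n -> p @: [set: 'I_n] = setT ->
  word p = take c (word p) ++ take (d - c) (drop c (word p)) ++ drop d (word p).
Proof.
move=> cd dn _; rewrite -{1}(cat_take_drop c (word p)) -{1}(cat_take_drop (d - c) (drop c _)).
by rewrite drop_drop subnK.
Qed.

Lemma consecutive_word p X : consecutive (p @: X) = (aut (inX X) 0 (word p) != 3).
Proof.
have inE_ i0 k (lt_k : k < n) : (nth i0 (word p) k \in X) = (Ordinal lt_k \in p @: X).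
  by rewrite -nth_word_in -(nth_word p i0 (Ordinal lt_k)).
apply/consecutiveP/idP=> [[a [b pX]]|].
  (* The given ends may lie beyond [n], or in the wrong order when the interval is empty; the
     clamped ones can serve as cutting points. *)
  pose d := minn b n; pose c := minn a d; have cd : c <= d by rewrite geq_minr.
  have dn : d <= n by rewrite geq_minr.
  have colour i0 k : k < n -> (nth i0 (word p) k \in X) = (c <= k < d).
    by move=> lt_k; rewrite (inE_ i0 k lt_k) pX inE /= /c /d; lia.
  rewrite (word_split cd dn); last by apply/setP=> i; rewrite !inE -(permKV p i) mem_imset ?inE //; apply: perm_inj.
  apply: aut0_join.
  - apply/hasP=> -[z /(nthP z)[k]]; rewrite size_take size_word => lt_k.
    rewrite nth_take; last by move: lt_k; case: ifP; lia.
    by move=> <-; rewrite colour; move: lt_k; case: ifP; lia.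
  - apply/allP=> z /(nthP z)[k]; rewrite size_take size_drop size_word => lt_k.
    have lt_k' : k < d - c by move: lt_k; case: ifP; lia.
    rewrite nth_take // nth_drop => <-; rewrite colour; lia.
  - apply/hasP=> -[z /(nthP z)[k]]; rewrite size_drop size_word => lt_k.
    by rewrite nth_drop => <-; rewrite colour; lia.
case/aut0_split=> u [v [z [wE hu av hz]]].
exists (size u), (size u + size v); apply/setP=> i; rewrite -nth_word_in -(nth_word p i i) wE inE.
have := congr1 size wE; rewrite size_word !size_cat => sE; have := ltn_ord i; rewrite [X in _ < X]sE.
rewrite nth_cat nth_cat; case: (ltnP i (size u)) => [lt_i _|le_i] /=.
  by apply/negbTE; apply: contra hu => Xi; apply/hasP; exists (nth i u i); rewrite ?mem_nth.
have [lt_v _|le_v lt_n] := ltnP (i - size u) (size v).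
  by rewrite (allP av) ?mem_nth //; lia.
have lt_z : i - size u - size v < size z by lia.
rewrite [RHS](_ : _ = false); last by lia.
by apply/negbTE; apply: contra hz => Xi; apply/hasP; eexists; [exact: mem_nth lt_z|exact: Xi].
Qed.

Lemma expandP p X (Pi : {set 'S_n}) : p \in expand X Pi <->
  exists2 q, q \in Pi & perm_on (q @: X) (q^-1 * p)%g.
Proof.
split=> [/imset2P[q s qP]|[q qP sX]]; first by rewrite inE => sX ->; exists q; rewrite ?mulKg.
by apply/imset2P; exists q (q^-1 * p)%g; rewrite ?inE ?mulKVg.
Qed.

(** A permutation of the positions of [X], multiplied on the right, rearranges the block of [X] and
    keeps the letters around it; this is the expansion step in terms of words. *)
Lemma perm_on_word p q X a y b : word q = a ++ y ++ b -> ~~ has (inX X) a -> all (inX X) y ->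
  ~~ has (inX X) b ->
  perm_on (q @: X) (q^-1 * p)%g <-> exists2 x, word p = a ++ x ++ b & perm_eq x y.
Proof.
move=> wq ha ay hb; have := congr1 size wq; rewrite size_word !size_cat => sE.
have out (i : 'I_n) : i \notin q @: X = (i < size a) || (size a + size y <= i).
  rewrite -nth_word_in -(nth_word q i i) wq nth_cat nth_cat; have lt_n := ltn_ord i.
  rewrite {2}sE in lt_n.
  case: (ltnP i (size a)) => [lt_i|le_i] /=.
    by apply: contra ha => Xi; apply/hasP; exists (nth i a i); rewrite ?mem_nth.
  have [lt_y|le_y] := ltnP (i - size a) (size y).
    by rewrite (allP ay) ?mem_nth //=; lia.
  have lt_z : i - size a - size y < size b by lia.
  rewrite [RHS](_ : _ = true); last by lia.
  by apply: contra hb => Xi; apply/hasP; eexists; [exact: mem_nth lt_z|exact: Xi].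
split=> [sX|[x wp pxy]].
  pose c := size a; pose d := size a + size y.
  have same_out (i : 'I_n) : (i < c) || (d <= i) -> p^-1%g i = q^-1%g i.
    rewrite -out => /(out_perm sX); rewrite permM => e; by rewrite -{1}e permK.
  have cd : c <= d by rewrite leq_addr.
  have dn : d <= n by rewrite sE addnA leq_addr.
  have wE : word p = a ++ take (d - c) (drop c (word p)) ++ b.
    rewrite {1}(word_split cd dn); last by apply/setP=> i; rewrite !inE -(permKV p i) mem_imset ?inE //; apply: perm_inj.
    have -> : take c (word p) = a.
      have [n0|n0] := posnP n.
        have a0 : a = [::] by apply: size0nil; lia.
        by rewrite /c a0 take0.
      pose i0 : 'I_n := Ordinal n0.
      apply: (@eq_from_nth _ i0); rewrite size_take size_word; first by case: ifP; rewrite /c; lia.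
      move=> i lt_i; have lt_c : i < c by move: lt_i; case: ifP; lia.
      have lt_n : i < n by rewrite /c in lt_c; lia.
      have wi := nth_word p i0 (Ordinal lt_n); have wi' := nth_word q i0 (Ordinal lt_n).
      rewrite nth_take // [LHS]wi same_out /= ?lt_c // -wi' wq /= nth_cat.
      by rewrite -/c lt_c.
    have -> // : drop d (word p) = b.
      have [n0|n0] := posnP n.
        have b0 : b = [::] by apply: size0nil; lia.
        by rewrite b0 drop_oversize // size_word n0.
      pose i0 : 'I_n := Ordinal n0.
      apply: (@eq_from_nth _ i0); rewrite size_drop size_word; first by rewrite /d; lia.
      move=> i lt_i; have lt_n : d + i < n by lia.
      have wi := nth_word p i0 (Ordinal lt_n); have wi' := nth_word q i0 (Ordinal lt_n).
      rewrite nth_drop [LHS]wi same_out /= ?leq_addr ?orbT // -wi' wq /= catA nth_cat.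
      rewrite size_cat -/d ifF; last by lia.
      by rewrite addKn.
  move: wE; set x := take _ _ => wE; exists x => //.
  have := perm_word p; rewrite wE perm_sym => /(seq.perm_trans (perm_word q)).
  by rewrite wq perm_cat2l perm_cat2r perm_sym.
apply/subsetP=> i; rewrite inE; apply: contraR; rewrite out => oi; rewrite permM.
have -> : q^-1%g i = p^-1%g i; last by rewrite permKV.
have sx := perm_size pxy; have lt_n := ltn_ord i; rewrite {2}sE in lt_n.
rewrite -(nth_word q i i) -(nth_word p i i) wq wp !nth_cat sx.
case: (ltnP i (size a)) oi => //= le_i le_d.
by have -> : (i - size a < size y) = false by lia.
Qed.

(** Counting coloured letters gives the length of the block, and finding the first one gives its
    start. An empty block would leave the cut arbitrary. *)
Lemma colour_split_uniq (P : pred 'I_n) a y b a' y' b' :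
  ~~ has P a -> all P y -> ~~ has P b -> ~~ has P a' -> all P y' -> ~~ has P b' ->
  0 < size y -> a ++ y ++ b = a' ++ y' ++ b' -> [/\ a = a', y = y' & b = b'].
Proof.
have cnt c z d : ~~ has P c -> all P z -> ~~ has P d -> count P (c ++ z ++ d) = size z.
  rewrite !has_count -!leqNgt !leqn0 => /eqP hc + /eqP hd; rewrite all_count => /eqP az.
  by rewrite !count_cat hc hd az addn0.
have fnd c z d : ~~ has P c -> all P z -> 0 < size z -> find P (c ++ z ++ d) = size c.
  move=> hc az z0; rewrite find_cat (negbTE hc); case: z az z0 => //= i z /andP[-> _] _.
  by rewrite addn0.
move=> ha ay hb ha' ay' hb' y0 eqw.
have sy : size y = size y' by rewrite -(cnt a y b) // eqw cnt.
have sa : size a = size a' by rewrite -(fnd a y b) // eqw fnd // -sy.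
move/eqP: eqw; rewrite eqseq_cat // => /andP[/eqP-> ]; rewrite eqseq_cat // => /andP[/eqP-> /eqP->].
by split.
Qed.

(** * The reduced tree and the expanded tree *)

Definition root_tree (frs : seq (frame n)) (co : core n) : pqtree n := plug frs (mkQ (core_seq co)).

Definition block (xs : seq 'I_n) : seq (pqtree n) :=
  if nilp xs then [::] else [:: mkP (map Leaf xs)].

Definition exp_tree (frs : seq (frame n)) (co : core n) (xs : seq 'I_n) : pqtree n :=
  plug frs (mkQ (core_left co ++ block xs ++ rev (core_right co))).

Lemma langs_Leaf (ys w : seq 'I_n) : langs (map Leaf ys) w <-> w = ys.
Proof.
elim: ys w => [|i ys IH] w /=; first exact: langs0.
rewrite langs_consP; split=> [[u [v [-> /lang_LeafP-> /IH->]]]//|->].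
by exists [:: i], ys; split=> //; [apply: lang_leaf|apply/IH].
Qed.

Lemma lang_block (xs w : seq 'I_n) : langs (block xs) w <-> perm_eq w xs.
Proof.
have -> : block xs = if nilp (map (@Leaf n) xs) then [::] else [:: mkP (map Leaf xs)].
  by rewrite /block /nilp size_map.
rewrite -langs_block; split=> [[f]|pw].
  move/Permutation_sym/Perm_map_inv=> [ys -> pxy] /langs_Leaf->.
  by rewrite perm_sym; apply/perm_eq_Perm.
exists (map Leaf w); last exact/langs_Leaf.
by apply: Perm_map; apply/perm_eq_Perm; rewrite perm_sym.
Qed.

Section ExpRoot.
Variables (P : pred 'I_n) (frs : seq (frame n)) (co : core n) (xs : seq 'I_n).
Hypotheses (okf : all (frame_ok P) frs) (okc : core_ok P co).

Definition full_word : seq 'I_n := frontiers (rev (core_full co) ++ core_full' co).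

Lemma full_word_all : all P full_word.
Proof.
case/and5P: okc => _ gF gG _ _.
apply: (langs_good_f (ts := rev (core_full co) ++ core_full' co)); last exact: langs_frontiers.
by rewrite all_cat all_rev gF.
Qed.

(** Putting the full leaves back into the block has to respect the orientation of the core. [dir] is
    that orientation, and the last clause makes it visible in the word: it tells on which side of
    the block the leaves of [core_left] and [core_right] lie. *)
Lemma exp_to_root w : lang (exp_tree frs co xs) w -> exists a x b (dir : bool),
  [/\ w = a ++ x ++ b, perm_eq x xs, ~~ has P a /\ ~~ has P b,
      lang (root_tree frs co) (a ++ (if dir then full_word else rev full_word) ++ b)
    & if dir then {subset frontiers (core_left co) <= a} /\ {subset frontiers (core_right co) <= b}
      else {subset frontiers (core_left co) <= b} /\ {subset frontiers (core_right co) <= a}].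
Proof.
case/and5P: okc => gE gF gG gH _.
case/lang_plug=> u [z [v [-> cx /lang_mkQ/lang_QP lz]]].
have [hu hv] := ctx_good okf cx.
have key z' : langs (core_left co ++ block xs ++ rev (core_right co)) z' ->
    exists ze x zh, [/\ z' = ze ++ x ++ zh, perm_eq x xs, ~~ has P ze /\ ~~ has P zh,
      langs (core_seq co) (ze ++ full_word ++ zh)
    & ze =i frontiers (core_left co) /\ zh =i frontiers (core_right co)].
  case/langs_cat=> ze [z2 [-> le /langs_cat[x [zh [-> /lang_block px lh]]]]].
  exists ze, x, zh; split=> //.
  - by rewrite (langs_good_e gE le) (langs_good_e _ lh) // all_rev.
  - rewrite /core_seq catA -catA; apply/langs_cat; exists ze, (full_word ++ zh); split=> //.
    rewrite catA; apply/langs_cat; exists full_word, zh; split=> //; exact: langs_frontiers.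
  - split=> i; first exact: (perm_mem (langs_perm le)).
    rewrite (perm_mem (langs_perm lh)); apply: perm_mem; apply: perm_frontiers; exact: perm_rev_seq.
case: lz => [/key|/langs_rev/key] [ze [x [zh [zE px [he hh] lc [me mh]]]]].
  exists (u ++ ze), x, (zh ++ v), true; split=> //.
  - by rewrite zE -!catA.
  - by rewrite !has_cat (negbTE hu) (negbTE hv) (negbTE he) (negbTE hh).
  - apply/lang_plug; exists u, (ze ++ full_word ++ zh), v; split=> //; first by rewrite -!catA.
    by apply/lang_mkQ; apply: lang_Q.
  - by split=> i; rewrite mem_cat ?me ?mh => ->; rewrite ?orbT.
exists (u ++ rev zh), (rev x), (rev ze ++ v), false; split=> //.
- by rewrite -[z]revK zE !rev_cat -!catA.
- by rewrite perm_rev.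
- by rewrite !has_cat !has_rev (negbTE hu) (negbTE hv) (negbTE he) (negbTE hh).
- apply/lang_plug; exists u, (rev (ze ++ full_word ++ zh)), v; split=> //.
    by rewrite !rev_cat -!catA.
  by apply/lang_mkQ; apply: lang_Qr; apply/langs_rev; rewrite revK.
- by split=> i; rewrite mem_cat mem_rev ?me ?mh => ->; rewrite ?orbT.
Qed.

Lemma root_to_exp a y b x : lang (root_tree frs co) (a ++ y ++ b) ->
  ~~ has P a -> all P y -> ~~ has P b -> perm_eq y xs -> perm_eq x xs ->
  lang (exp_tree frs co xs) (a ++ x ++ b).
Proof.
case/and5P: okc => gE gF gG gH _ + ha ay hb py px.
case/lang_plug=> u [z [v [wE cx /lang_mkQ/lang_QP lz]]].
have [hu hv] := ctx_good okf cx.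
have key z' : langs (core_seq co) z' -> exists ze Y zh, [/\ z' = ze ++ Y ++ zh,
    langs (core_left co) ze, langs (rev (core_full co) ++ core_full' co) Y
    & langs (rev (core_right co)) zh].
  rewrite /core_seq => /langs_cat[ze [z2 [-> le]]]; rewrite catA => /langs_cat[Y [zh [-> lY lh]]].
  by exists ze, Y, zh.
have aY Y : langs (rev (core_full co) ++ core_full' co) Y -> all P Y.
  by apply: langs_good_f; rewrite all_cat all_rev gF.
have exp_in ze zh x' : langs (core_left co) ze -> langs (rev (core_right co)) zh ->
    perm_eq x' xs -> langs (core_left co ++ block xs ++ rev (core_right co)) (ze ++ x' ++ zh).
  move=> le lh px'; apply/langs_cat; exists ze, (x' ++ zh); split=> //.
  by apply/langs_cat; exists x', zh; split=> //; apply/lang_block.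
(* Without coloured letters the cut into [a] and [b] is arbitrary; the cuts provided by the tree are
   used instead. *)
have empty_case : size y = 0 -> lang (exp_tree frs co xs) (a ++ x ++ b).
  move=> y0; have xs0 : xs = [::] by apply: size0nil; rewrite -(perm_size py).
  have x0 : x = [::] by apply: size0nil; rewrite (perm_size px) xs0.
  rewrite x0 /=; have y0' : y = [::] by apply: size0nil.
  rewrite y0' /= in wE; rewrite wE; apply/lang_plug; exists u, z, v; split=> //.
  have noP : ~~ has P (u ++ z ++ v) by rewrite -wE has_cat negb_or ha.
  have full0 Y z' : langs (rev (core_full co) ++ core_full' co) Y -> {subset Y <= z'} ->
      ~~ has P z' -> Y = [::].
    move=> /aY; case: Y => // i Y /= /andP[Pi _] sub /hasPn/(_ i).
    by rewrite sub ?mem_head // Pi => /(_ isT).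
  have noz : ~~ has P z by move: noP; rewrite !has_cat !negb_or => /and3P[].
  apply/lang_mkQ; apply/lang_QP; case: lz => [lz|/langs_rev lz]; [left|right; apply/langs_rev].
    have [ze [Y [zh [zE le lY lh]]]] := key _ lz.
    have Y0 := full0 Y z lY; rewrite zE Y0 //; last by move=> i iY; rewrite zE !mem_cat iY orbT.
    by apply: (exp_in ze zh [::]); rewrite // xs0.
  have [ze [Y [zh [zE le lY lh]]]] := key _ lz.
  have Y0 := full0 Y (rev z) lY; rewrite zE Y0 ?has_rev //; last by move=> i iY; rewrite zE !mem_cat iY orbT.
  by apply: (exp_in ze zh [::]); rewrite // xs0.
have [y0|y0] := posnP (size y); first exact: empty_case.
apply/lang_plug; case: lz => [/key|/langs_rev/key] [ze [Y [zh [zE le lY lh]]]].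
  have := @colour_split_uniq P a y b (u ++ ze) Y (zh ++ v) ha ay hb.
  rewrite !has_cat (negbTE hu) (negbTE hv) (negbTE (langs_good_e gE le)).
  rewrite (negbTE (langs_good_e _ lh)) ?all_rev // (aY _ lY) => /(_ isT isT isT y0)[|-> _ ->].
    by rewrite wE zE -!catA.
  exists u, (ze ++ x ++ zh), v; split=> //; first by rewrite -!catA.
  by apply/lang_mkQ; apply: lang_Q; apply: exp_in.
have := @colour_split_uniq P a y b (u ++ rev zh) (rev Y) (rev ze ++ v) ha ay hb.
rewrite !has_cat !has_rev all_rev (negbTE hu) (negbTE hv) (negbTE (langs_good_e gE le)).
rewrite (negbTE (langs_good_e _ lh)) ?all_rev // (aY _ lY) => /(_ isT isT isT y0)[|-> _ ->].
  by rewrite wE -[z]revK zE !rev_cat -!catA.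
exists u, (rev zh ++ x ++ rev ze), v; split=> //; first by rewrite -!catA.
apply/lang_mkQ; apply: lang_Qr; apply/langs_rev; rewrite !rev_cat !revK -catA.
by apply: exp_in; rewrite ?perm_rev.
Qed.

Lemma proper_plug T : proper_arities T -> proper_arities (plug frs T).
Proof.
move=> pT; elim: frs okf => //= -[[q l] r] fs IH /andP[/and3P[lr gl gr] okfs].
have pall : all (@proper_arities n) (rev l ++ plug fs T :: rev r).
  by rewrite all_cat /= !all_rev (good_e_proper gl) (good_e_proper gr) IH.
by case: q; [apply: proper_mkQ|apply: proper_mkP]; rewrite ?size_cat //= addnS.
Qed.

Lemma proper_root : proper_arities (root_tree frs co).
Proof.
case/and5P: okc => gE gF gG gH c0; apply: proper_plug; apply: proper_mkQ; first by rewrite lt0n.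
by rewrite !all_cat !all_rev (good_e_proper gE) (good_f_proper gF) (good_f_proper gG) (good_e_proper gH).
Qed.

Lemma proper_exp : 0 < size (core_left co ++ block xs ++ rev (core_right co)) ->
  proper_arities (exp_tree frs co xs).
Proof.
case/and5P: okc => gE gF gG gH _ c0; apply: proper_plug; apply: proper_mkQ => //.
rewrite !all_cat !all_rev (good_e_proper gE) (good_e_proper gH) andbT /= /block.
case: ifP => //= /negbT x0; rewrite andbT; apply: proper_mkP; first by rewrite size_map lt0n.
by elim: (xs).
Qed.

End ExpRoot.

Lemma represents_root t (Pi : {set 'S_n}) X frs co : represents t Pi ->
  body_of (red (inX X) t) = Some (frs, co) ->
  represents (root_tree frs co) [set p in Pi | consecutive (p @: X)].
Proof.
case=> /andP[pt ft] rt bE; have := red_body (inX X) pt; rewrite bE => -[okf okc lr].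
split=> [|p]; last by rewrite consistent_invE lr -consistent_invE rt inE consecutive_word; split=> [[-> ->]|/andP].
apply/andP; split; first exact: (proper_root (P := inX X)).
have [/lang_perm pf _] := (lr _).1 (lang_frontier _).
exact: seq.perm_trans pf ft.
Qed.

Lemma represents_fail t (Pi : {set 'S_n}) X : represents t Pi ->
  body_of (red (inX X) t) = None -> [set p in Pi | consecutive (p @: X)] = set0.
Proof.
case=> /andP[pt ft] rt bE; have := red_body (inX X) pt; rewrite bE => dead.
apply/setP=> p; rewrite !inE consecutive_word; apply/andP=> -[/rt/consistent_invE/dead->].
by [].
Qed.

Lemma word_full_perm X a y b : perm_eq (a ++ y ++ b) (enum 'I_n) -> ~~ has (inX X) a ->
  all (inX X) y -> ~~ has (inX X) b -> perm_eq y (enum X).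
Proof.
move=> pw ha ay hb; have := perm_filter (inX X) pw; rewrite !filter_cat.
have nof z : ~~ has (inX X) z -> filter (inX X) z = [::].
  by rewrite has_filter negbK => /eqP.
rewrite (nof a) // (nof b) // (all_filterP ay) cats0 cat0s => pf.
apply: seq.perm_trans pf _; apply: uniq_perm; rewrite ?(filter_uniq _ (enum_uniq _)) ?enum_uniq // => i.
by rewrite mem_filter !mem_enum andbT.
Qed.

(** If [X] is empty, the core holds no full tree, because proper trees have letters; so one of its
    two sides is nonempty. *)
Lemma exp_list_gt0 X co : core_ok (inX X) co ->
  0 < size (core_left co ++ block (enum X) ++ rev (core_right co)).
Proof.
move=> okc.
case/and5P: (okc) => _ gF gG _ c0; rewrite lt0n; apply: contra c0 => e0; rewrite /nilp.
move: e0; rewrite /core_seq !size_cat !addn_eq0 => /and3P[-> b0 ->] /=; rewrite andbT.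
have X0 : enum X = [::] by move: b0; rewrite /block; case: ifP => // /nilP.
have := full_word_all okc.
have := langs_size (ts := rev (core_full co) ++ core_full' co) _ (langs_frontiers _).
rewrite -/(full_word co) all_cat all_rev (good_f_proper gF) (good_f_proper gG) => /(_ isT) le_s af.
have : full_word co = [::].
  case: (full_word co) af => //= i z /andP[iX _].
  by have := mem_enum X i; rewrite X0 iX.
by move=> f0; move: le_s; rewrite f0 size_cat /= leqn0 addn_eq0.
Qed.

Lemma represents_exp t (Pi : {set 'S_n}) X frs co : represents t Pi ->
  body_of (red (inX X) t) = Some (frs, co) ->
  represents (exp_tree frs co (enum X)) (expand X [set p in Pi | consecutive (p @: X)]).
Proof.
move=> rt bE; have [ovr rr] := represents_root rt bE.
case: (rt) => /andP[pt ft] _; have := red_body (inX X) pt; rewrite bE => -[okf okc _].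
have rperm w : lang (root_tree frs co) w -> perm_eq w (enum 'I_n).
  by move=> /lang_perm pw; apply: seq.perm_trans pw _; case/andP: ovr.
have eperm w : lang (exp_tree frs co (enum X)) w -> perm_eq w (enum 'I_n).
  case/(exp_to_root okf okc)=> a [x [b [dir [-> px [ha hb] lr _]]]].
  have pr := rperm _ lr; apply: (seq.perm_trans _ pr); rewrite perm_cat2l perm_cat2r.
  have af : all (inX X) (if dir then full_word co else rev (full_word co)).
    by case: dir {lr pr}; rewrite ?all_rev (full_word_all okc).
  by apply: seq.perm_trans px _; rewrite perm_sym (word_full_perm pr).
have exp0 := exp_list_gt0 okc.
split.
  apply/andP; split; first exact: (proper_exp (P := inX X)).
  exact: eperm (lang_frontier _).
move=> p; rewrite consistent_invE expandP; split.
  case/(exp_to_root okf okc)=> a [x [b [dir [wE px [ha hb] lr _]]]].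
  have af : all (inX X) (if dir then full_word co else rev (full_word co)).
    by case: dir {lr}; rewrite ?all_rev (full_word_all okc).
  have pr := rperm _ lr; have [q wq] := word_of pr.
  exists q; first by apply/rr; rewrite consistent_invE wq.
  apply/(perm_on_word p wq ha af hb); exists x => //.
  by apply: seq.perm_trans px _; rewrite perm_sym (word_full_perm pr).
case=> q qP sX; move: (qP); rewrite inE => /andP[_]; rewrite consecutive_word => /aut0_split.
case=> a [y [b [wq ha ay hb]]]; have [x -> pxy] := (perm_on_word p wq ha ay hb).1 sX.
have py : perm_eq y (enum X) by apply: (@word_full_perm X a y b); rewrite -?wq ?perm_word.
apply: (root_to_exp okf okc (y := y)) => //; first by rewrite -wq -consistent_invE; apply/rr.
exact: seq.perm_trans pxy py.
Qed.

End Words.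

(** * Nice instances *)

Section Nice.
Variables n m : nat.
Implicit Types (I : instance n m) (d : m.-tuple 'S_n).
Local Open Scope group_scope.

(* pi_1, .., pi_m with pi_(j+1) in S_(X_j) pi_j and X_j pi_j consecutive. *)
Definition pi_chain I (f : nat -> 'S_n) : Prop :=
  (forall j, 0 < j <= m -> consecutive (f j @: wset I j)) /\
  (forall j, 0 < j < m -> perm_on (wset I j) (f j.+1 * (f j)^-1)).

Lemma perm_on_conj (X : {set 'I_n}) (p s : 'S_n) :
  perm_on (p @: X) (p^-1 * s * p) = perm_on X s.
Proof.
apply/subsetP/subsetP=> H i; rewrite inE => ne.
  have := H (p i); rewrite inE !permM permK (inj_eq perm_inj) => /(_ ne).
  by rewrite mem_imset //; apply: perm_inj.
rewrite -(permKV p i) mem_imset; last exact: perm_inj.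
apply: H; rewrite inE; apply: contra ne => /eqP e.
by rewrite !permM e permKV.
Qed.

Lemma pi_chain_step I f j : pi_chain I f -> 0 < j < m ->
  perm_on (f j @: wset I j) ((f j)^-1 * f j.+1).
Proof.
move=> [_ st] /st; rewrite -(perm_on_conj _ (f j)) => H.
by rewrite -[f j.+1](mulgKV (f j)) mulgA in H *; rewrite !mulgA mulgKV in H *.
Qed.

Lemma pi_chain_Pi I f j : pi_chain I f -> 0 < j <= m -> f j \in Pi_ I j.
Proof.
move=> ch; elim: j => // j IHj lt_j; rewrite /= inE ch.1 // andbT; apply/expandP.
case: j IHj lt_j => [|j] IHj lt_j.
  exists (f 1%N); first by rewrite /= inE.
  by apply/subsetP=> i _; rewrite /wset /= -(permKV (f 1%N) i) mem_imset ?inE //; apply: perm_inj.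
exists (f j.+1); first by apply: IHj; lia.
by apply: pi_chain_step => //; lia.
Qed.

(** Unfolding membership from [m] down to 1 picks one predecessor per round; conjugation by it turns
    a condition on the moved set into one on [X_j] itself. *)
Lemma Pi_pi_chain I p : 0 < m -> p \in Pi_ I m -> exists2 f, pi_chain I f & f m = p.
Proof.
move=> m0; have gen j q : 0 < j -> q \in Pi_ I j -> exists2 f : nat -> 'S_n, f j = q &
    (forall k, 0 < k <= j -> consecutive (f k @: wset I k)) /\
    (forall k, 0 < k < j -> perm_on (wset I k) (f k.+1 * (f k)^-1)).
  elim: j q => // j IHj q _; rewrite inE => /andP[/expandP[q' q'P sX] cq].
  case: j IHj q'P sX cq => [|j] IHj q'P sX cq.
    exists (fun=> q) => //; split=> k; last by lia.
    by move=> kb; have -> : k = 1%N by lia.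
  have [//|f fq [cf sf]] := IHj q' _ q'P.
  exists (fun k => if k == j.+2 then q else f k); first by rewrite eqxx.
  split=> k kb; first by case: eqP => [->//|nk]; apply: cf; lia.
  have -> : (k == j.+2) = false by lia.
  case: (eqVneq k.+1 j.+2) => [[ek]|nk']; last by apply: sf; lia.
  by rewrite ek fq -(perm_on_conj _ q') -!mulgA mulVg mulg1.
by move=> /(gen m p m0)[f fp [cf sf]]; exists f.
Qed.

(** Chains in any order reduce to one permutation per set. A step at [j] moves only the sets behind
    [j], so [phi] is absorbed into their permutations; at index [j] the condition survives since
    [phi] acts on [X_j]. *)
Lemma nice_pi_chain I : nice I -> exists f, pi_chain I f.
Proof.
have setE (J : instance n m) j : 0 < j <= m -> exists k : 'I_m, k.+1 = j /\ wset J j = tnth (sets J) k.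
  case: j => // j lt_j; have lt_jm : j < m by lia.
  by exists (Ordinal lt_jm); rewrite /wset /= (tnth_nth set0).
elim=> {I} [I w0|I j phi /andP[le_j vX] _ [f [cf sf]]].
  exists (fun=> 1); split=> j jb; last by rewrite mulgV; apply/subsetP=> i; rewrite inE perm1 eqxx.
  by have [k [_ ->]] := setE I j jb; rewrite imset_perm1; apply: w0.
have setT_ k : 0 < k <= m -> wset (transform I j phi) k = if k <= j then wset I k else phi @: wset I k.
  move=> kb; have [k' [ek ->]] := setE (transform I j phi) k kb.
  have [k2 [ek2 ->]] := setE I k kb; have -> : k2 = k' by apply: val_inj; apply: succn_inj; rewrite ek ek2.
  rewrite /transform -ek; case: j {vX cf sf} le_j => [|j] le_j; rewrite tnth_mktuple //.
pose g k := if k <= j then f k else phi * f k; exists g; split=> k kb.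
  have := cf k kb; rewrite setT_ // /g; case: ifP => // _.
  by rewrite imset_permM.
have kb' : 0 < k <= m by lia.
have := sf k kb; rewrite setT_ // /g; case: (ltngtP k j) => [lt_kj|lt_jk|ejk] //.
- by rewrite -(perm_on_conj (wset I k) phi) invMg !mulgA mulVg mul1g -!mulgA mulVg mulg1.
- by move=> H; rewrite -mulgA perm_onM // ejk.
Qed.

(** The quotients telescope: the product of the first [k] entries is [f k]. Set [j] is moved by the
    first [j] steps only and ends where [f j] puts it. *)
Lemma pi_chain_descr I f : 0 < m -> pi_chain I f ->
  ascending_to_wppsg0 I [tuple if (i : nat) is k.+1 then (f i)^-1 * f i.+1 else f 1%N | i < m].
Proof.
move=> m0 ch; set d := [tuple _ | _ < _].
have dE k : k < m -> nth 1 d k = if k is _.+1 then (f k)^-1 * f k.+1 else f 1%N.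
  by move=> lt_k; rewrite -[k]/(nat_of_ord (Ordinal lt_k)) -tnth_nth tnth_mktuple.
have cumE k : k < m -> cumul d k.+1 = f k.+1.
  elim: k => [|k IHk] lt_k; first by rewrite cumulS /cumul big_nil mul1g dE.
  by rewrite cumulS IHk ?dE ?mulKVg //; lia.
have wE (J : instance n m) k (lt_k : k < m) : wset J k.+1 = tnth (sets J) (Ordinal lt_k).
  by rewrite /wset /= (tnth_nth set0).
split=> [j lt_j|j].
  rewrite /valid_step ltnW //=; case: j lt_j => [|j] lt_j.
    by apply/subsetP=> i _; rewrite /wset /= inE.
  have lt_j' : j < m := ltnW lt_j.
  have -> : wset (chain_instance I d j.+1) j.+1 = f j.+1 @: wset I j.+1.
    by rewrite !(wE _ _ lt_j') chain_sets [minn _ _]minnn cumE.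
  by rewrite dE //; apply: pi_chain_step.
rewrite chain_sets (minn_idPl _) // cumE //; have [cf _] := ch.
have := cf j.+1; rewrite (wE _ _ (ltn_ord j)) => H.
have -> : j = Ordinal (ltn_ord j) by apply: val_inj.
by apply: H; rewrite /= ltn_ord.
Qed.

Lemma ascending_nice I d : ascending_to_wppsg0 I d -> nice I.
Proof.
case=> asc w0; have gen k : k <= m -> nice (chain_instance I d (m - k)).
  elim: k => [|k IHk] lt_k; first by rewrite subn0; apply: nice_done.
  have lt_mk : m - k.+1 < m by lia.
  apply: nice_step (asc _ lt_mk) _.
  by have := IHk (ltnW lt_k); have -> : (m - k = (m - k.+1).+1)%N by lia.
by have := gen m (leqnn m); rewrite subnn.
Qed.

Lemma nice_Pi I : 0 < m -> nice I <-> exists p, p \in Pi_ I m.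
Proof.
move=> m0; split=> [/nice_pi_chain[f ch]|[p /(Pi_pi_chain m0)[f ch _]]].
  by exists (f m); apply: pi_chain_Pi; rewrite ?m0 /=.
exact: ascending_nice (pi_chain_descr m0 ch).
Qed.

End Nice.

(** * The reduction program *)

(** The empty list is the number 0, so testing a register tests a list for being nonempty. *)
Fixpoint vseq (l : seq datum) : datum := if l is x :: l' then VP x (vseq l') else VN 0.

Fixpoint vt n (t : pqtree n) : datum :=
  match t with
  | Leaf i => VP (VN 0) (VN i)
  | PNode ts => VP (VN 1) (vseq (map (@vt n) ts))
  | QNode ts => VP (VN 2) (vseq (map (@vt n) ts))
  end.

Section Values.
Variable n : nat.

Definition vs (ts : seq (pqtree n)) : datum := vseq (map (@vt n) ts).

Definition vframe (fr : frame n) : datum :=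
  let: (q, l, r) := fr in VP (VN (if q then 2 else 1)) (VP (vs l) (vs r)).

Definition vcore (co : core n) : datum :=
  VP (vs (core_left co)) (VP (vs (core_full co)) (VP (vs (core_full' co)) (vs (core_right co)))).

Definition vlin (lin : option (seq (pqtree n) * seq (pqtree n))) : datum :=
  if lin is Some (e, r) then VP (vs e) (vs r) else VN 0.

Definition vbody (body : option (seq (frame n) * core n)) : datum :=
  if body is Some (frs, co) then VP (vseq (map vframe frs)) (vcore co) else VN 0.

Definition vi (x : item n) : datum :=
  match x with
  | Emp t => VP (VN 0) (vt t)
  | Ful t => VP (VN 1) (vt t)
  | Par _ lin body => VP (VN 2) (VP (vlin lin) (vbody body))
  end.

Definition vis (s : seq (item n)) : datum := vseq (map vi s).

End Values.

Lemma truthy_vs n (ts : seq (pqtree n)) : truthy (vs ts) = ~~ nilp ts. Proof. by case: ts. Qed.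

(** Lists are joined by reversing one onto the other, at the cost of the first only. *)
Definition revapp : hc :=
  HWhile (XR 10) (HCons 11 (XFst (XR 10)) (XR 11) ;; HSet 10 (XSnd (XR 10))).

Definition mkP_cmd : hc :=
  HIf (XSnd (XR 11)) (HCons 12 (XC 1) (XR 11)) (HSet 12 (XFst (XR 11))).

Definition mkQ_cmd : hc :=
  HIf (XSnd (XR 11))
    (HIf (XSnd (XSnd (XR 11))) (HCons 12 (XC 2) (XR 11)) (HCons 12 (XC 1) (XR 11)))
    (HSet 12 (XFst (XR 11))).

(* Register 20 holds the items, registers 21-27 the fields of the scanner. *)
Definition scan_body : hc :=
  HSet 28 (XFst (XR 20)) ;; HSet 20 (XSnd (XR 20)) ;;
  HIf (XFst (XR 28))
    (HIf (XSub (XFst (XR 28)) (XC 1))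
      (HIf (XFst (XSnd (XR 28)))
         (HSet 29 (XFst (XFst (XSnd (XR 28)))) ;; HSet 30 (XSnd (XFst (XSnd (XR 28)))))
         (HSet 29 (XC 0) ;; HSet 30 (XC 0) ;; HSet 27 (XC 1)) ;;
       HIf (XR 26)
         (HIf (XSub (XR 26) (XC 1)) (HSet 27 (XC 1))
            (HSet 25 (XR 29) ;; HSet 24 (XR 30) ;; HSet 26 (XC 2)))
         (HSet 22 (XR 29) ;; HSet 23 (XR 30) ;; HSet 26 (XC 1)))
      (HIf (XSub (XR 26) (XC 1)) (HSet 27 (XC 1))
         (HCons 23 (XSnd (XR 28)) (XR 23) ;; HSet 26 (XC 1))))
    (HIf (XR 26) (HCons 25 (XSnd (XR 28)) (XR 25) ;; HSet 26 (XC 2))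
       (HCons 21 (XSnd (XR 28)) (XR 21))).

Definition scan_cmd : hc :=
  HSet 21 (XC 0) ;; HSet 22 (XC 0) ;; HSet 23 (XC 0) ;; HSet 24 (XC 0) ;; HSet 25 (XC 0) ;;
  HSet 26 (XC 0) ;; HSet 27 (XC 0) ;; HWhile (XR 20) scan_body.

Notation scan_regs := [:: 20; 21; 22; 23; 24; 25; 26; 27; 28; 29; 30].

(* Registers 13-16: the items of the children, their empty trees, their full
   trees, their partial items; register 17: the item of the grouped full trees. *)
Definition pop_cmd : hc :=
  HSet 31 (XFst (XR 6)) ;; HSet 6 (XSnd (XR 6)) ;; HCons 13 (XR 31) (XR 13) ;;
  HIf (XFst (XR 31))
    (HIf (XSub (XFst (XR 31)) (XC 1)) (HCons 16 (XR 31) (XR 16))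
       (HCons 15 (XSnd (XR 31)) (XR 15)))
    (HCons 14 (XSnd (XR 31)) (XR 14)).

(** Register 8 carries the tag of the node, 1 for P and 2 for Q, so that subtracting 1 tests for a
    Q-node here and below. *)
Definition listA_cmd : hc :=
  HIf (XSub (XR 8) (XC 1)) (HSet 20 (XR 13))
    (HSet 17 (XC 0) ;;
     HIf (XR 15) (HSet 11 (XR 15) ;; mkP_cmd ;; HCons 12 (XC 1) (XR 12) ;; HCons 17 (XR 12) (XC 0))
       HSkip ;;
     HIf (XR 16)
       (HSet 20 (XSnd (XR 16)) ;;
        HIf (XR 17) (HCons 20 (XFst (XR 17)) (XR 20)) HSkip ;;
        HCons 20 (XFst (XR 16)) (XR 20))
       (HSet 20 (XR 17))).

Definition listB_cmd : hc :=
  HIf (XSub (XR 8) (XC 1))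
    (HSet 10 (XR 13) ;; HSet 11 (XC 0) ;; revapp ;; HSet 20 (XR 11))
    (HSet 10 (XR 16) ;; HSet 11 (XR 17) ;; revapp ;; HSet 20 (XR 11) ;;
     HIf (XR 14) (HSet 11 (XR 14) ;; mkP_cmd ;; HCons 12 (XC 0) (XR 12) ;; HCons 20 (XR 12) (XR 20))
       HSkip).

Definition left_cmd : hc := HSet 10 (XR 21) ;; HSet 11 (XR 22) ;; revapp.

(** Register 33 computes [special] from the lists of full and partial children; 0 in register 19
    stands for failure. *)
Definition body_cmd : hc :=
  HSet 19 (XC 0) ;; HSet 33 (XC 0) ;;
  HIf (XR 15) HSkip
    (HIf (XR 16) (HIf (XSnd (XR 16)) HSkip (HSet 33 (XC 1))) HSkip) ;;
  HIf (XR 33)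
    (HSet 19 (XSnd (XSnd (XFst (XR 16)))) ;;
     HIf (XR 19)
       (HIf (XSub (XR 8) (XC 1)) (HCons 34 (XR 21) (XR 25)) (HCons 34 (XR 14) (XC 0)) ;;
        HCons 34 (XR 8) (XR 34) ;; HCons 34 (XR 34) (XFst (XR 19)) ;;
        HCons 19 (XR 34) (XSnd (XR 19)))
       HSkip)
    (HIf (XR 27) HSkip
       (left_cmd ;; HCons 34 (XR 24) (XR 25) ;; HCons 34 (XR 23) (XR 34) ;;
        HCons 34 (XR 11) (XR 34) ;; HSet 36 (XC 0) ;;
        HIf (XSub (XR 8) (XC 1)) HSkip
          (HIf (XR 14)
             (HCons 36 (XR 14) (XC 0) ;; HCons 36 (XR 8) (XR 36) ;; HCons 36 (XR 36) (XC 0))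
             HSkip) ;;
        HCons 19 (XR 36) (XR 34))).

Definition takelin_cmd : hc :=
  HIf (XR 27) HSkip
    (HIf (XR 26)
       (HIf (XSub (XR 26) (XC 1)) HSkip (left_cmd ;; HCons 18 (XR 11) (XR 23)))
       HSkip).

Definition par_cmd : hc :=
  listA_cmd ;; scan_cmd ;; body_cmd ;; HSet 18 (XC 0) ;;
  HIf (XSub (XR 8) (XC 1)) takelin_cmd HSkip ;;
  HIf (XR 18) HSkip (listB_cmd ;; scan_cmd ;; takelin_cmd) ;;
  HCons 31 (XR 18) (XR 19) ;; HCons 31 (XC 2) (XR 31).

Definition comb_cmd : hc :=
  HIf (XR 16) par_cmd
    (HIf (XR 15)
       (HIf (XR 14) par_cmd (HCons 12 (XR 8) (XR 15) ;; HCons 31 (XC 1) (XR 12)))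
       (HCons 12 (XR 8) (XR 14) ;; HCons 31 (XC 0) (XR 12))).

Notation comb_regs := [:: 10; 11; 12; 17; 18; 19; 20; 21; 22; 23; 24; 25; 26; 27; 28; 29; 30;
  31; 33; 34; 36].

Ltac hval ::= solve [hread; reflexivity | hread; rewrite /vis /vs /=; hread; reflexivity].

Ltac hfin := try (by hread); try hsame; try lia.

(** * Machine correctness of the operations at a node *)

Section Macros.
Variables (inp : seq nat) (n : nat).
Implicit Types (ts : seq (pqtree n)) (x : item n).

Lemma wp_revapp s t a b : hr s 10 = vseq a -> hr s 11 = vseq b ->
  wp inp revapp s t (fun s' t' => [/\ same [:: 10; 11] s s', ha s' = ha s,
    hr s' 10 = VN 0, hr s' 11 = vseq (rev a ++ b) & t' <= t + 9 * size a + 2]).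
Proof.
elim: a b s t => [|x a IH] b s t r10 r11; rewrite /revapp.
  by apply: wp_while_false; [hread|split=> //=; lia].
eapply wp_while_true; [hval|by []|]; do 3!hstep.
apply: (wp_conseq (IH (x :: b) _ _ _ _)); [by hread..|].
move=> s' t' [fr ea r10' r11' le_t].
by split=> //; [hsame|rewrite r11' rev_cons cat_rcons|rewrite /=; lia].
Qed.

Lemma wp_mkP s t ts : ~~ nilp ts -> hr s 11 = vs ts ->
  wp inp mkP_cmd s t (fun s' t' => [/\ same [:: 12] s s', ha s' = ha s,
    hr s' 12 = vt (mkP ts) & t' <= t + 10]).
Proof.
case: ts => [|x [|y ts]] // _ r11; rewrite /mkP_cmd; hstep; rewrite /=; hstep;
  by split=> //; hfin.
Qed.

Lemma wp_mkQ s t ts : ~~ nilp ts -> hr s 11 = vs ts ->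
  wp inp mkQ_cmd s t (fun s' t' => [/\ same [:: 12] s s', ha s' = ha s,
    hr s' 12 = vt (mkQ ts) & t' <= t + 14]).
Proof.
by case: ts => [|x [|y [|z ts]]] // _ r11; rewrite /mkQ_cmd; hstep; rewrite /=; do ?hstep;
  rewrite /=; do ?hstep; split=> //; hfin.
Qed.

Record holds_scan (s : hst) (c : scanner n) : Prop := HoldsScan {
  hold_acc : hr s 21 = vs (acc c);
  hold_es1 : hr s 22 = vs (es1 c);
  hold_rf : hr s 23 = vs (rf c);
  hold_rfR : hr s 24 = vs (rfR c);
  hold_esR : hr s 25 = vs (esR c);
  hold_st : hr s 26 = VN (st c);
  hold_bad : hr s 27 = VN (bad c)
}.

Lemma wp_scan_body s t x s0 c : hr s 20 = VP (vi x) s0 -> holds_scan s c -> st c <= 2 ->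
  wp inp scan_body s t (fun s' t' => [/\ same scan_regs s s', ha s' = ha s,
    hr s' 20 = s0, holds_scan s' (scan_step c x) & t' <= t + 60]).
Proof.
move=> r20 [r21 r22 r23 r24 r25 r26 r27] c2; rewrite /scan_body.
case: x r20 => [u|u|u lin bd] r20; do 5!hstep; rewrite /=.
- hstep; case q: (st c) r26 => [|q'] r26; rewrite /=; do ?hstep;
    by split; hfin; split; rewrite /= ?q; hread.
- hstep; rewrite /=; hstep.
  case q: (st c) c2 r26 => [|[|[]]] //= _ r26; rewrite /=; do ?hstep;
    by split; hfin; split; rewrite /= ?q; hread.
- hstep; rewrite /=; do 2!hstep.
  case: lin r20 => [[e r]|] r20; rewrite /=; do ?hstep;
  case q: (st c) c2 r26 => [|[|[]]] //= _ r26; rewrite /=; do ?hstep; rewrite /=; do ?hstep;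
    by split; hfin; split; rewrite /= ?q; hread.
Qed.

Lemma scan_step_st (c : scanner n) x : st c <= 2 -> st (scan_step c x) <= 2.
Proof. by case: x => [u|u|u [[e r]|] bd] /=; case: (st c) => [|[|[]]]. Qed.

Lemma wp_scan s t (l : seq (item n)) : hr s 20 = vis l ->
  wp inp scan_cmd s t (fun s' t' => [/\ same scan_regs s s', ha s' = ha s,
    holds_scan s' (scan l), st (scan l) <= 2 & t' <= t + 62 * size l + 20]).
Proof.
move=> r20; rewrite /scan_cmd; do 14!hstep.
have loop l0 c s1 t1 : hr s1 20 = vis l0 -> holds_scan s1 c -> st c <= 2 ->
    wp inp (HWhile (XR 20) scan_body) s1 t1 (fun s' t' => [/\ same scan_regs s1 s', ha s' = ha s1,
      holds_scan s' (foldl (@scan_step n) c l0), st (foldl (@scan_step n) c l0) <= 2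
    & t' <= t1 + 62 * size l0 + 2]).
  elim: l0 c s1 t1 => [|x l0 IH] c s1 t1 r h c2.
    by apply: wp_while_false; [hread|split=> //=; lia].
  eapply wp_while_true; [hval|by []|].
  apply: (wp_conseq (wp_scan_body _ (x := x) (s0 := vis l0) (c := c) _ _ _)) => //.
  move=> s2 t2 [fr2 ea2 r2 h2 le2].
  apply: (wp_conseq (IH (scan_step c x) _ _ _ _ _)) => //; first exact: scan_step_st.
  by move=> s3 t3 [fr3 ea3 h3 c3 le3]; split=> //; [hsame|rewrite ea3|rewrite /= in le2 le3 *; lia].
apply: (wp_conseq (loop l scan0 _ _ _ _ _)) => //.
by move=> s' t' [fr ea h c2 le_t]; split=> //; [hsame|lia].
Qed.

Lemma wp_left s t c : holds_scan s c ->
  wp inp left_cmd s t (fun s' t' => [/\ same [:: 10; 11] s s', ha s' = ha s,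
    hr s' 11 = vs (scan_left c) & t' <= t + 9 * size (acc c) + 10]).
Proof.
case=> r21 r22 _ _ _ _ _; rewrite /left_cmd; do 4!hstep.
apply: (wp_conseq (wp_revapp _ (a := map (@vt n) (acc c)) (b := map (@vt n) (es1 c)) _ _)).
- by hread.
- by hread.
move=> s' t' [fr ea _ r11 le_t]; split=> //; [hsame| |by rewrite size_map in le_t; lia].
by rewrite r11 /vs /scan_left map_cat map_rev.
Qed.

Definition node_regs (s : hst) (q : bool) (l : seq (item n)) : Prop :=
  [/\ hr s 8 = VN (if q then 2 else 1), hr s 13 = vis l, hr s 14 = vs (emps l),
      hr s 15 = vs (fuls l) & hr s 16 = vis (pars l)].

Lemma node_regs_same s s' q l m : same m s s' -> 8 \notin m -> 13 \notin m -> 14 \notin m ->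
  15 \notin m -> 16 \notin m -> node_regs s q l -> node_regs s' q l.
Proof. by move=> fr h8 h13 h14 h15 h16 [? ? ? ? ?]; split; rewrite fr. Qed.

Lemma wp_listA s t q l : node_regs s q l ->
  wp inp listA_cmd s t (fun s' t' => [/\ same [:: 11; 12; 17; 20] s s', ha s' = ha s,
    hr s' 20 = vis (root_list q l), ~~ q -> hr s' 17 = vis (full_item (fuls l)) & t' <= t + 70]).
Proof.
case=> r8 r13 r14 r15 r16; rewrite /listA_cmd; case: q r8 => r8; hstep;
  rewrite /=; hstep; first by split=> //; hfin.
rewrite /root_list; hstep.
have cont s1 t1 : same [:: 11; 12; 17; 20] s s1 -> ha s1 = ha s ->
    hr s1 17 = vis (full_item (fuls l)) -> t1 <= t + 40 ->
    wp inp (HIf (XR 16) (HSet 20 (XSnd (XR 16)) ;;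
        HIf (XR 17) (HCons 20 (XFst (XR 17)) (XR 20)) HSkip ;; HCons 20 (XFst (XR 16)) (XR 20))
       (HSet 20 (XR 17))) s1 t1 (fun s' t' => [/\ same [:: 11; 12; 17; 20] s s', ha s' = ha s,
    hr s' 20 = vis (take 1 (pars l) ++ full_item (fuls l) ++ behead (pars l)),
    ~~ false -> hr s' 17 = vis (full_item (fuls l)) & t' <= t + 70]).
  move=> fr1 ea1 r17 le1; case: (pars l) r16 => [|p ps] r16; hstep; rewrite /=.
    by hstep; split; hfin; hread; rewrite cats0.
  do 4!hstep; rewrite /full_item in r17 *; case: (nilp (fuls l)) r17 => r17; rewrite /=;
    do ?hstep; split; hfin; by rewrite /= take0 /=; hread.
hstep; hstep; rewrite truthy_vs /full_item in cont *; case F0: (nilp (fuls l)) cont => cont /=; hstep.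
  by apply: cont; hfin.
do 2!hstep; apply: (wp_conseq (wp_mkP _ (ts := fuls l) _ _)); [by rewrite F0|by hread|].
move=> s1 t1 [fr1 ea1 r12 le1]; do 3!hstep.
by apply: cont; hfin.
Qed.

Lemma wp_listB s t q l : node_regs s q l -> (~~ q -> hr s 17 = vis (full_item (fuls l))) ->
  wp inp listB_cmd s t (fun s' t' => [/\ same [:: 10; 11; 12; 20] s s', ha s' = ha s,
    hr s' 20 = vis (lin_list q l) & t' <= t + 9 * size l + 70]).
Proof.
case=> r8 r13 r14 r15 r16 r17; rewrite /listB_cmd; case: q r8 r17 => r8 r17; hstep;
  rewrite /=; do 5!hstep.
  apply: (wp_conseq (wp_revapp _ (a := map (@vi n) l) (b := [::]) _ _)); [by hread..|].
  move=> s1 t1 [fr1 ea1 _ r11 le1]; hstep; rewrite size_map in le1.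
  by split; hfin; hread; rewrite /lin_list /vis map_rev cats0.
have {}r17 := r17 isT.
apply: (wp_conseq (wp_revapp _ (a := map (@vi n) (pars l)) (b := map (@vi n) (full_item (fuls l))) _ _));
  [by hread..|].
move=> s1 t1 [fr1 ea1 _ r11 le1]; rewrite size_map in le1.
have szp : size (pars l) <= size l by rewrite size_filter count_size.
do 3!hstep; rewrite truthy_vs /lin_list /empty_item; case E0: (nilp (emps l)) => /=; hstep.
  by split; hfin; hread; rewrite /vis map_cat map_rev.
hstep; hstep; apply: (wp_conseq (wp_mkP _ (ts := emps l) _ _)); [by rewrite E0|by hread|].
move=> s2 t2 [fr2 ea2 r12 le2]; do ?hstep.
by split; hfin; hread; rewrite /vis /= map_cat map_rev.
Qed.

Lemma wp_takelin s t c : holds_scan s c -> st c <= 2 -> hr s 18 = VN 0 ->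
  wp inp takelin_cmd s t (fun s' t' => [/\ same [:: 10; 11; 18] s s', ha s' = ha s,
    hr s' 18 = vlin (if (st c == 1) && ~~ bad c then Some (scan_left c, rf c) else None)
    & t' <= t + 9 * size (acc c) + 30]).
Proof.
move=> h c2 r18; have [r21 r22 r23 r24 r25 r26 r27] := h; rewrite /takelin_cmd; hstep.
case: (bad c) => /=; hstep; first by rewrite andbF; split; hfin.
case q: (st c) c2 r26 => [|[|[]]] //= _ r26.
- by hstep; split; hfin.
- hstep; rewrite /=; hstep; apply: (wp_conseq (wp_left _ (c := c) h)).
  by move=> s1 t1 [fr1 ea1 r11 le1]; hstep; split; hfin.
- by hstep; rewrite /=; hstep; split; hfin.
Qed.

Lemma wp_body s t q l c : node_regs s q l -> holds_scan s c -> c = scan (root_list q l) ->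
  wp inp body_cmd s t (fun s' t' => [/\ same [:: 10; 11; 19; 33; 34; 36] s s', ha s' = ha s,
    hr s' 19 = vbody (comb_body q l c) & t' <= t + 9 * size (acc c) + 100]).
Proof.
move=> nr h cE; have [r8 r13 r14 r15 r16] := nr; have [r21 r22 r23 r24 r25 r26 r27] := h.
rewrite /body_cmd; do 5!hstep.
have cont s1 t1 : same [:: 10; 11; 19; 33; 34; 36] s s1 -> ha s1 = ha s -> hr s1 19 = VN 0 ->
    hr s1 33 = VN (special l) -> t1 <= t + 25 ->
    wp inp (HIf (XR 33)
    (HSet 19 (XSnd (XSnd (XFst (XR 16)))) ;;
     HIf (XR 19)
       (HIf (XSub (XR 8) (XC 1)) (HCons 34 (XR 21) (XR 25)) (HCons 34 (XR 14) (XC 0)) ;;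
        HCons 34 (XR 8) (XR 34) ;; HCons 34 (XR 34) (XFst (XR 19)) ;;
        HCons 19 (XR 34) (XSnd (XR 19)))
       HSkip)
    (HIf (XR 27) HSkip
       (left_cmd ;; HCons 34 (XR 24) (XR 25) ;; HCons 34 (XR 23) (XR 34) ;;
        HCons 34 (XR 11) (XR 34) ;; HSet 36 (XC 0) ;;
        HIf (XSub (XR 8) (XC 1)) HSkip
          (HIf (XR 14)
             (HCons 36 (XR 14) (XC 0) ;; HCons 36 (XR 8) (XR 36) ;; HCons 36 (XR 36) (XC 0))
             HSkip) ;;
        HCons 19 (XR 36) (XR 34)))) s1 t1
    (fun s' t' => [/\ same [:: 10; 11; 19; 33; 34; 36] s s', ha s' = ha s,
    hr s' 19 = vbody (comb_body q l c) & t' <= t + 9 * size (acc c) + 100]).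
  move=> fr1 ea1 r19 r33 le1; rewrite /comb_body; hstep; case sp: (special l); rewrite /=.
    case/andP: sp => _; case Ps: (pars l) r16 => [|p [|//]] //= r16 _.
    have : is_par p by have := filter_all (@is_par n) l; rewrite -/(pars l) Ps /= andbT.
    case: p r16 {Ps} => // u lin bd r16 _; do 3!hstep; case: bd r16 => [[frs co]|] r16; rewrite /=;
      hstep; last by split; hfin.
    by case: q r8 {nr cE} => r8; hstep; rewrite /=; do ?hstep; split; hfin.
  hstep; case: (bad c) => /=; hstep; first by split; hfin.
  have h1 : holds_scan s1 c by split; hread.
  apply: (wp_conseq (wp_left _ (c := c) h1)) => s2 t2 [fr2 ea2 r11 le2]; do 9!hstep.
  case: q r8 {nr cE} => r8; hstep; rewrite /=; do ?hstep; first by split; hfin.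
  by rewrite truthy_vs; case E0: (nilp (emps l)) => /=; do ?hstep; split; hfin.
hstep; rewrite truthy_vs; case F0: (nilp (fuls l)) => /=; last first.
  by hstep; apply: cont; hfin; rewrite /special F0; hread.
hstep; case Ps: (pars l) r16 => [|p [|p' ps]] r16; rewrite /=.
- by hstep; apply: cont; hfin; rewrite /special F0 Ps; hread.
- by hstep; rewrite /=; hstep; apply: cont; hfin; rewrite /special F0 Ps; hread.
- by hstep; rewrite /=; hstep; apply: cont; hfin; rewrite /special F0 Ps; hread.
Qed.

Lemma size_acc_scan (l : seq (item n)) : size (acc (scan l)) <= size l.
Proof.
elim/last_ind: l => // l x IH; rewrite scan_rcons size_rcons.
case: x => [u|u|u [[e r]|] bd] /=; case: (st (scan l)) => [|[|[|k]]] //=; exact: leqW.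
Qed.

Lemma size_root_list q (l : seq (item n)) : size (root_list q l) <= size l + 1.
Proof.
have szp : size (pars l) <= size l by rewrite size_filter count_size.
case: q; rewrite /root_list ?leq_addr // /full_item !size_cat.
by case: (pars l) szp => [|p ps] /=; rewrite ?take0; case: ifP => _ /=; lia.
Qed.

Lemma size_lin_list q (l : seq (item n)) : size (lin_list q l) <= size l + 2.
Proof.
have szp : size (pars l) <= size l by rewrite size_filter count_size.
case: q; rewrite /lin_list ?size_rev ?leq_addr // /full_item /empty_item !size_cat size_rev.
by case: ifP => _; case: ifP => _ /=; lia.
Qed.

Lemma wp_par s t q l u : node_regs s q l ->
  wp inp par_cmd s t (fun s' t' => [/\ same comb_regs s s', ha s' = ha s,
    hr s' 31 = vi (Par u (comb_lin q (scan (root_list q l)) (scan (lin_list q l)))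
                       (comb_body q l (scan (root_list q l)))) & t' <= t + 200 * size l + 900]).
Proof.
move=> nr; rewrite /par_cmd; hstep.
apply: (wp_conseq (wp_listA _ (q := q) (l := l) nr)) => s1 t1 [fr1 ea1 r20 r17 le1]; hstep.
apply: (wp_conseq (wp_scan _ r20)) => s2 t2 [fr2 ea2 h2 c2 le2]; hstep.
have nr2 : node_regs s2 q l by apply: node_regs_same fr2 _ _ _ _ _ (node_regs_same fr1 _ _ _ _ _ nr).
apply: (wp_conseq (wp_body _ nr2 h2 erefl)) => s3 t3 [fr3 ea3 r19 le3]; do 3!hstep.
have nr3 := node_regs_same fr3 isT isT isT isT isT nr2; have [r8 _ _ _ _] := nr3.
have szA := size_root_list q l; have szB := size_lin_list q l.
have saA := size_acc_scan (root_list q l); have saB := size_acc_scan (lin_list q l).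
set ca := scan (root_list q l) in h2 c2 r19 saA le3 *; set cb := scan (lin_list q l) in saB *.
have fin s4 t4 : same comb_regs s s4 -> ha s4 = ha s -> hr s4 19 = vbody (comb_body q l ca) ->
    (~~ q -> hr s4 17 = vis (full_item (fuls l))) ->
    (if [&& q, st ca == 1 & ~~ bad ca] then hr s4 18 = vlin (Some (scan_left ca, rf ca))
     else hr s4 18 = VN 0) -> t4 <= t + 90 * size l + 500 ->
    wp inp (HIf (XR 18) HSkip (listB_cmd ;; scan_cmd ;; takelin_cmd) ;;
      HCons 31 (XR 18) (XR 19) ;; HCons 31 (XC 2) (XR 31)) s4 t4
    (fun s' t' => [/\ same comb_regs s s', ha s' = ha s,
      hr s' 31 = vi (Par u (comb_lin q ca cb) (comb_body q l ca)) & t' <= t + 200 * size l + 900]).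
  move=> fr4 ea4 r19' r17' r18 le4; hstep; rewrite /comb_lin.
  case: ifP r18 => _ r18; hstep; rewrite /=.
    by do ?hstep; split; hfin.
  have nr4 : node_regs s4 q l by apply: node_regs_same fr4 _ _ _ _ _ nr.
  hstep; apply: (wp_conseq (wp_listB _ nr4 r17')) => s5 t5 [fr5 ea5 r20' le5]; hstep.
  apply: (wp_conseq (wp_scan _ r20')) => s6 t6 [fr6 ea6 h6 c6 le6].
  have r186 : hr s6 18 = VN 0 by hread.
  apply: (wp_conseq (wp_takelin _ h6 c6 r186)) => s7 t7 [fr7 ea7 r187 le7].
  by do ?hstep; rewrite -/cb in r187 le6 le7; split; hfin.
have h3 : holds_scan (HSt (upd (hr s3) 18 (VN 0)) (ha s3)) ca by case: h2 => *; split; hread.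
case: q r8 {nr nr2 nr3} r17 @ca @cb fin h2 h3 c2 r19 szA szB saA saB r20 le2 le3
  => r8 r17 ca cb fin h2 h3 c2 r19 szA szB saA saB r20 le2 le3; hstep; rewrite /=.
  apply: (wp_conseq (wp_takelin _ h3 c2 _)) => [|s4 t4 [fr4 ea4 r18 le4]]; first by hread.
  by apply: fin; hfin; rewrite /=; move: r18; case: ifP.
by have {}r17 := r17 isT; hstep; apply: fin; hfin; move=> _; hread.
Qed.

Lemma wp_comb s t q l : node_regs s q l ->
  wp inp comb_cmd s t (fun s' t' => [/\ same comb_regs s s', ha s' = ha s,
    hr s' 31 = vi (comb q l) & t' <= t + 200 * size l + 920]).
Proof.
move=> nr; have [r8 r13 r14 r15 r16] := nr; rewrite /comb_cmd /comb.
have par t1 : t1 <= t + 10 -> wp inp par_cmd s t1 (fun s' t' => [/\ same comb_regs s s', ha s' = ha s,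
    hr s' 31 = vi (Par (node q (map (@tree_of n) l))
      (comb_lin q (scan (root_list q l)) (scan (lin_list q l)))
      (comb_body q l (scan (root_list q l)))) & t' <= t + 200 * size l + 920]).
  move=> le1; apply: (wp_conseq (wp_par _ (node q (map (@tree_of n) l)) nr)) => s' t' [fr ea r31 le']; split=> //; lia.
hstep; case P0: (pars l) r16 => [|p ps] r16; rewrite /=; last first.
  by rewrite !andbF; apply: par; lia.
hstep; rewrite truthy_vs !andbT; case F0: (nilp (fuls l)) => /=.
  by do ?hstep; split; hfin; case: q r8 {nr par} => r8; hread.
hstep; rewrite truthy_vs; case E0: (nilp (emps l)) => /=; last by apply: par; lia.
by do ?hstep; split; hfin; case: q r8 {nr par} => r8; hread.
Qed.

(** Tokens are read from the end of the preorder listing. When a node is reached, the items of its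
    children are already on the stack in register 6, which replaces recursion. Register 7 is the
    number of children or the leaf, register 8 the tag. *)
Definition parse_body : hc :=
  HSet 7 (XFst (XR 5)) ;; HSet 8 (XFst (XSnd (XR 5))) ;; HSet 5 (XSnd (XSnd (XR 5))) ;;
  HIf (XR 8)
    (HSet 13 (XC 0) ;; HSet 14 (XC 0) ;; HSet 15 (XC 0) ;; HSet 16 (XC 0) ;;
     down 7 pop_cmd ;; comb_cmd ;; HCons 6 (XR 31) (XR 6))
    (HCons 12 (XC 0) (XR 7) ;;
     HIf (XIn (XR 2) (XR 7)) (HCons 31 (XC 1) (XR 12)) (HCons 31 (XC 0) (XR 12)) ;;
     HCons 6 (XR 31) (XR 6)).

Notation parse_regs := [:: 5; 6; 7; 8; 10; 11; 12; 13; 14; 15; 16; 17; 18; 19; 20; 21; 22; 23; 24;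
  25; 26; 27; 28; 29; 30; 31; 33; 34; 36].

Lemma wp_pops s t (xs : seq (item n)) l : hr s 7 = VN (size xs) -> hr s 6 = vseq (map (@vi n) xs ++ l) ->
  hr s 13 = VN 0 -> hr s 14 = VN 0 -> hr s 15 = VN 0 -> hr s 16 = VN 0 ->
  wp inp (down 7 pop_cmd) s t (fun s' t' => [/\ same [:: 6; 7; 13; 14; 15; 16; 31] s s', ha s' = ha s,
    hr s' 6 = vseq l,
    [/\ hr s' 13 = vis (rev xs), hr s' 14 = vs (emps (rev xs)),
        hr s' 15 = vs (fuls (rev xs)) & hr s' 16 = vis (pars (rev xs))]
    & t' <= t + 50 * size xs + 2]).
Proof.
move=> r7 r6 r13 r14 r15 r16.
apply: (wp_down (k := size xs) (Inv := fun j s' t' => [/\ same [:: 6; 7; 13; 14; 15; 16; 31] s s',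
  ha s' = ha s, hr s' 6 = vseq (map (@vi n) (drop (size xs - j) xs) ++ l),
  let p := rev (take (size xs - j) xs) in
    [/\ hr s' 13 = vis p, hr s' 14 = vs (emps p), hr s' 15 = vs (fuls p) & hr s' 16 = vis (pars p)]
  & t' <= t + 50 * (size xs - j)])) => //.
- by rewrite subnn drop0 take0; split=> //; lia.
- move=> j s1 t1 lt_j r7' [fr ea r6' [r13' r14' r15' r16'] le_t].
  have lt_k : size xs - j.+1 < size xs by lia.
  have kE : size xs - j = (size xs - j.+1).+1 by lia.
  case dx: (drop (size xs - j.+1) xs) r6' => [|x0 ds] r6'.
    by have := size_drop (size xs - j.+1) xs; rewrite dx /=; lia.
  have x0E : nth x0 xs (size xs - j.+1) = x0 by rewrite -[size xs - _]addn0 -nth_drop dx.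
  have dsE : drop (size xs - j) xs = ds.
    by rewrite kE -addn1 addnC -drop_drop dx /= drop0.
  have tE : rev (take (size xs - j) xs) = x0 :: rev (take (size xs - j.+1) xs).
    by rewrite kE (take_nth x0) // rev_rcons x0E.
  rewrite /pop_cmd dsE tE /= in r6' *; do 6!hstep.
  by case: x0 r6' {dx x0E tE} => [u|u|u lin bd] r6'; hstep; rewrite /=; do ?hstep; rewrite /=; do ?hstep;
    (split; first by hread); split; hfin; split; hread.
- move=> s1 t1 _ [fr ea r6' rr le_t]; rewrite subn0 take_size drop_size in r6' rr le_t.
  by split=> //; lia.
Qed.

Lemma wp_parse_leaf s t i b R S (X : pred 'I_n) : hr s 5 = vseq [:: VN (nat_of_ord i), VN 0 & R] ->
  hr s 6 = S -> hr s 2 = VN b -> nth 0 inp (b + i) = X i ->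
  wp inp parse_body s t (fun s' t' => [/\ same parse_regs s s', ha s' = ha s, hr s' 5 = vseq R,
    hr s' 6 = VP (vi (red X (Leaf i))) S & t' <= t + 50]).
Proof.
move=> r5 r6 r2 iX; rewrite /parse_body; do 7!hstep; rewrite /=; do 4!hstep; rewrite iX.
by rewrite /=; case: (X i); rewrite /=; do ?hstep; split; hfin.
Qed.

Lemma wp_parse_node s t q (xs : seq (item n)) R l :
  hr s 5 = vseq [:: VN (size xs), VN (if q then 2 else 1) & R] ->
  hr s 6 = vseq (map (@vi n) xs ++ l) ->
  wp inp parse_body s t (fun s' t' => [/\ same parse_regs s s', ha s' = ha s, hr s' 5 = vseq R,
    hr s' 6 = VP (vi (comb q (rev xs))) (vseq l) & t' <= t + 250 * size xs + 1000]).
Proof.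
move=> r5 r6; rewrite /parse_body; do 7!hstep.
have -> : truthy (VN (if q then 2 else 1)) by case: q {r5}.
do 9!hstep.
apply: (wp_conseq (wp_pops _ (xs := xs) (l := l) _ _ _ _ _ _)); [by hread..|].
move=> s1 t1 [fr1 ea1 r6' [r13 r14 r15 r16] le1]; hstep.
have nr : node_regs s1 q (rev xs) by split=> //; hread.
apply: (wp_conseq (wp_comb _ nr)) => s2 t2 [fr2 ea2 r31 le2]; hstep; rewrite size_rev in le2.
by split; hfin.
Qed.

End Macros.

(** * Listing, parsing and rebuilding whole trees *)

Definition parse_cmd : hc := HWhile (XR 5) parse_body.

Definition vtoks (l : seq nat) : datum := vseq (map VN l).

(** Register 51 is a stack of forests still to be listed. The listing is consed up and thus comes
    out reversed, the form that [parse_cmd] reads. *)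
Definition ser_body : hc :=
  HSet 52 (XFst (XR 51)) ;;
  HIf (XR 52)
    (HSet 53 (XFst (XR 52)) ;; HCons 51 (XSnd (XR 52)) (XSnd (XR 51)) ;;
     HCons 5 (XFst (XR 53)) (XR 5) ;;
     HIf (XFst (XR 53))
       (HSet 54 (XC 0) ;; HSet 55 (XSnd (XR 53)) ;;
        HWhile (XR 55) (HSet 55 (XSnd (XR 55)) ;; HSet 54 (XInc (XR 54))) ;;
        HCons 5 (XR 54) (XR 5) ;; HCons 51 (XSnd (XR 53)) (XR 51))
       (HCons 5 (XSnd (XR 53)) (XR 5)))
    (HSet 51 (XSnd (XR 51))).

Definition ser_cmd : hc :=
  HCons 51 (XR 12) (XC 0) ;; HCons 51 (XR 51) (XC 0) ;; HSet 5 (XC 0) ;;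
  HWhile (XR 51) ser_body.

Notation ser_regs := [:: 5; 51; 52; 53; 54; 55].

Definition block_cmd : hc :=
  HSet 11 (XC 0) ;; HSet 3 (XR 0) ;;
  down 3 (HIf (XIn (XR 2) (XR 3)) (HCons 12 (XC 0) (XR 3) ;; HCons 11 (XR 12) (XR 11)) HSkip) ;;
  HIf (XR 11) (mkP_cmd ;; HSet 9 (XR 12)) (HSet 9 (XC 0)).

Definition topbody_cmd : hc :=
  HSet 31 (XFst (XR 6)) ;;
  HIf (XFst (XR 31))
    (HIf (XSub (XFst (XR 31)) (XC 1)) (HSet 19 (XSnd (XSnd (XR 31))))
       (HCons 12 (XSnd (XR 31)) (XC 0) ;; HCons 34 (XC 0) (XC 0) ;; HCons 34 (XR 12) (XR 34) ;;
        HCons 34 (XC 0) (XR 34) ;; HCons 19 (XC 0) (XR 34)))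
    (HCons 12 (XSnd (XR 31)) (XC 0) ;; HCons 34 (XC 0) (XC 0) ;; HCons 34 (XC 0) (XR 34) ;;
     HCons 34 (XR 12) (XR 34) ;; HCons 19 (XC 0) (XR 34)).

Definition wrap_cmd (r : nat) : hc :=
  HSet 10 (XSnd (XSnd (XR 50))) ;; HSet 11 (XC 0) ;; revapp ;; HCons 11 (XR r) (XR 11) ;;
  HSet 10 (XFst (XSnd (XR 50))) ;; revapp ;;
  HIf (XSub (XFst (XR 50)) (XC 1)) mkQ_cmd mkP_cmd ;; HSet r (XR 12).

Definition split_cmd : hc :=
  HSet 44 (XFst (XR 19)) ;; HSet 40 (XFst (XSnd (XR 19))) ;;
  HSet 41 (XFst (XSnd (XSnd (XR 19)))) ;; HSet 42 (XFst (XSnd (XSnd (XSnd (XR 19))))) ;;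
  HSet 43 (XSnd (XSnd (XSnd (XSnd (XR 19))))) ;;
  HSet 10 (XR 43) ;; HSet 11 (XC 0) ;; revapp ;; HSet 45 (XR 11) ;;
  HSet 10 (XR 41) ;; HSet 11 (XR 42) ;; revapp ;; HSet 46 (XR 11) ;;
  HSet 10 (XR 40) ;; HSet 11 (XC 0) ;; revapp ;; HSet 47 (XR 11).

(** The two trees differ only in the core, so they are wrapped together in the same frames. Register
    44 is reversed beforehand because the innermost frame comes last in the list. *)
Definition trees_cmd : hc :=
  HSet 10 (XR 46) ;; HSet 11 (XC 0) ;; revapp ;; HSet 10 (XR 11) ;; HSet 11 (XR 45) ;; revapp ;;
  HSet 10 (XR 47) ;; revapp ;; mkQ_cmd ;; HSet 48 (XR 12) ;;
  HSet 11 (XR 45) ;; HIf (XR 9) (HCons 11 (XR 9) (XR 11)) HSkip ;;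
  HSet 10 (XR 47) ;; revapp ;; mkQ_cmd ;; HSet 49 (XR 12) ;;
  HSet 10 (XR 44) ;; HSet 11 (XC 0) ;; revapp ;; HSet 44 (XR 11) ;;
  HWhile (XR 44)
    (HSet 50 (XFst (XR 44)) ;; HSet 44 (XSnd (XR 44)) ;; wrap_cmd 48 ;; wrap_cmd 49).

Definition step_cmd : hc :=
  block_cmd ;; HSet 6 (XC 0) ;; parse_cmd ;; topbody_cmd ;;
  HIf (XR 19) (split_cmd ;; trees_cmd) HSkip.

Notation step_regs := [:: 3; 5; 6; 7; 8; 9; 10; 11; 12; 13; 14; 15; 16; 17; 18; 19; 20; 21; 22; 23;
  24; 25; 26; 27; 28; 29; 30; 31; 33; 34; 36; 40; 41; 42; 43; 44; 45; 46; 47; 48; 49; 50].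

Notation parse_mods := [:: 5; 6; 7; 8; 10; 11; 12; 13; 14; 15; 16; 17; 18; 19; 20; 21; 22; 23; 24;
  25; 26; 27; 28; 29; 30; 31; 33; 34; 36].

Ltac hfin2 := hfin; try (by rewrite /vtoks /=; hread).

Section Steps.
Variables (inp : seq nat) (n : nat).
Implicit Types (ts : seq (pqtree n)).

Lemma rev_enc_node q ts : rev (enc_tree (node q ts)) =
  rev (flatten (map (@enc_tree n) ts)) ++ [:: size ts; if q then 2 else 1].
Proof. by case: q; rewrite /= !rev_cons -!cats1 -catA. Qed.

Lemma size_enc_node q ts : size (enc_tree (node q ts)) =
  (size (flatten (map (@enc_tree n) ts))).+2.
Proof. by case: q. Qed.

(** Stated with a continuation, since the loop does not stop between subtrees. The 250 units left
    over for each tree pay for taking it up at its parent. *)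
Lemma wp_parse (t : pqtree n) (X : pred 'I_n) b : (forall i : 'I_n, nth 0 inp (b + i) = X i) ->
  forall s tm R l Q, hr s 5 = vseq (map VN (rev (enc_tree t)) ++ R) -> hr s 6 = vseq l ->
  hr s 2 = VN b ->
  (forall s' t', same parse_mods s s' -> ha s' = ha s -> hr s' 5 = vseq R ->
     hr s' 6 = VP (vi (red X t)) (vseq l) -> t' + 250 <= tm + 700 * size (enc_tree t) ->
     wp inp parse_cmd s' t' Q) ->
  wp inp parse_cmd s tm Q.
Proof.
move=> iX; elim/pqtree_nested_ind: t => [i|ts IH|ts IH] s tm R l Q r5 r6 r2 fin.
- eapply wp_while_true; [hval|by []|].
  apply: (wp_conseq (wp_parse_leaf _ (i := i) (R := R) r5 r6 r2 (iX i))).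
  move=> s' t' [fr ea r5' r6' le_t]; apply: fin => //; rewrite /= in le_t *; lia.
all: have forest us : (forall u, List.In u us -> List.In u ts) ->
    forall s0 tm0 R0 l0 Q0, hr s0 5 = vseq (map VN (rev (flatten (map (@enc_tree n) us))) ++ R0) ->
    hr s0 6 = vseq l0 -> hr s0 2 = VN b ->
    (forall s' t', same parse_mods s0 s' -> ha s' = ha s0 -> hr s' 5 = vseq R0 ->
      hr s' 6 = vseq (map (@vi n) (map (red X) us) ++ l0) ->
      t' + 250 * size us <= tm0 + 700 * size (flatten (map (@enc_tree n) us)) ->
      wp inp parse_cmd s' t' Q0) -> wp inp parse_cmd s0 tm0 Q0.
1,3: elim: us => [|u us IHus] sub s0 tm0 R0 l0 Q0 r50 r60 r20 fin0;
  [by apply: fin0 => //=; lia|];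
  apply: (IHus _ s0 tm0 (map VN (rev (enc_tree u)) ++ R0) l0 Q0) => //;
  [by move=> v vin; apply: sub; right|by rewrite r50 /= rev_cat map_cat catA|];
  move=> s1 t1 fr1 ea1 r51 r61 le1;
  apply: (IH u (sub u (or_introl erefl)) s1 t1 R0 _ Q0 r51 r61); first (by hread);
  move=> s2 t2 fr2 ea2 r52 r62 le2;
  by apply: fin0 => //; [hsame|rewrite ea2|rewrite /= size_cat; lia].
- apply: (forest ts _ s tm [:: VN (size ts), VN 1 & R] l Q) => //.
    by rewrite r5 (rev_enc_node false) map_cat -catA.
  move=> s1 t1 fr1 ea1 r51 r61 le1; eapply wp_while_true; [hval|by []|].
  rewrite -{1}(size_map (red X) ts) in r51.
  apply: (wp_conseq (wp_parse_node inp _ (q := false) r51 r61)) => s2 t2 [fr2 ea2 r52 r62 le2].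
  apply: fin => //; [hsame|by rewrite ea2|].
  by rewrite (size_enc_node false) size_map /= in le2 *; lia.
- apply: (forest ts _ s tm [:: VN (size ts), VN 2 & R] l Q) => //.
    by rewrite r5 (rev_enc_node true) map_cat -catA.
  move=> s1 t1 fr1 ea1 r51 r61 le1; eapply wp_while_true; [hval|by []|].
  rewrite -{1}(size_map (red X) ts) in r51.
  apply: (wp_conseq (wp_parse_node inp _ (q := true) r51 r61)) => s2 t2 [fr2 ea2 r52 r62 le2].
  apply: fin => //; [hsame|by rewrite ea2|].
  by rewrite (size_enc_node true) size_map /= in le2 *; lia.
Qed.

Lemma wp_count s t l k : hr s 54 = VN k -> hr s 55 = vseq l ->
  wp inp (HWhile (XR 55) (HSet 55 (XSnd (XR 55)) ;; HSet 54 (XInc (XR 54)))) s t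
    (fun s' t' => [/\ same [:: 54; 55] s s', ha s' = ha s, hr s' 54 = VN (k + size l)
      & t' <= t + 8 * size l + 2]).
Proof.
elim: l s t k => [|x l IH] s t k r54 r55.
  by apply: wp_while_false; [hread|rewrite addn0; split=> //=; lia].
eapply wp_while_true; [hval|by []|]; do 3!hstep.
apply: (wp_conseq (IH _ _ k.+1 _ _)); [by hread..|].
by move=> s' t' [fr ea r le_t]; split=> //; [hsame|rewrite r /= addnS|rewrite /= in le_t *; lia].
Qed.

(** As in [wp_parse], the loop runs on after the tree; the 10 units left over pay for counting it
    among the children of its parent. *)
Lemma wp_ser_tree (t : pqtree n) : forall s tm ts S L Q, hr s 51 = VP (vs (t :: ts)) S -> hr s 5 = vtoks L ->
  (forall s' t', same ser_regs s s' -> ha s' = ha s -> hr s' 51 = VP (vs ts) S ->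
     hr s' 5 = vtoks (rev (enc_tree t) ++ L) -> t' + 10 <= tm + 50 * size (enc_tree t) ->
     wp inp (HWhile (XR 51) ser_body) s' t' Q) ->
  wp inp (HWhile (XR 51) ser_body) s tm Q.
Proof.
elim/pqtree_nested_ind: t => [i|us IH|us IH] s tm ts S L Q r51 r5 fin.
- eapply wp_while_true; [hval|by []|]; rewrite /ser_body; do 3!hstep; rewrite /=.
  do 7!hstep; rewrite /=; hstep; by apply: fin; hfin2; rewrite /=; lia.
all: have forest vs0 : (forall u, List.In u vs0 -> List.In u us) ->
    forall s0 tm0 S0 L0 Q0, hr s0 51 = VP (vs vs0) S0 -> hr s0 5 = vtoks L0 ->
    (forall s' t', same ser_regs s0 s' -> ha s' = ha s0 -> hr s' 51 = S0 ->
      hr s' 5 = vtoks (rev (flatten (map (@enc_tree n) vs0)) ++ L0) ->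
      t' + 10 * size vs0 <= tm0 + 50 * size (flatten (map (@enc_tree n) vs0)) + 11 ->
      wp inp (HWhile (XR 51) ser_body) s' t' Q0) -> wp inp (HWhile (XR 51) ser_body) s0 tm0 Q0.
1,3: elim: vs0 => [|u vs0 IHvs] sub s0 tm0 S0 L0 Q0 r510 r50 fin0;
  [eapply wp_while_true; [hval|by []|]; rewrite /ser_body; do 3!hstep; rewrite /=; hstep;
   by apply: fin0; hfin2; rewrite /=; lia|];
  apply: (IH u (sub u (or_introl erefl)) s0 tm0 vs0 S0 L0 Q0 r510 r50);
  move=> s1 t1 fr1 ea1 r511 r51' le1;
  apply: (IHvs _ s1 t1 S0 _ Q0 r511 r51'); [by move=> v vin; apply: sub; right|];
  move=> s2 t2 fr2 ea2 r512 r52 le2;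
  by apply: fin0 => //; [hsame|rewrite ea2|rewrite r52 /= rev_cat catA|rewrite /= size_cat; lia].
all: eapply wp_while_true; [hval|by []|]; rewrite /ser_body; do 3!hstep; rewrite /=;
  do 7!hstep; rewrite /=; do 5!hstep;
  apply: (wp_conseq (wp_count _ (l := map (@vt n) us) (k := 0) _ _)); [by hread|by hread|];
  move=> s1 t1 [fr1 ea1 r54 le1]; rewrite size_map add0n in r54; rewrite size_map in le1; do 3!hstep.
- apply: (forest us _ _ _ (VP (vs ts) S) [:: size us, 1 & L] Q) => //; [by hread..|].
  move=> s2 t2 fr2 ea2 r512 r52 le2; apply: fin => //; [hsame|by rewrite ea2| |].
    by rewrite r52 (rev_enc_node false) -catA.
  by rewrite /= in le1 le2 *; lia.
- apply: (forest us _ _ _ (VP (vs ts) S) [:: size us, 2 & L] Q) => //; [by hread..|].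
  move=> s2 t2 fr2 ea2 r512 r52 le2; apply: fin => //; [hsame|by rewrite ea2| |].
    by rewrite r52 (rev_enc_node true) -catA.
  by rewrite /= in le1 le2 *; lia.
Qed.

Lemma wp_ser s tm (t : pqtree n) : hr s 12 = vt t ->
  wp inp ser_cmd s tm (fun s' t' => [/\ same ser_regs s s', ha s' = ha s,
    hr s' 5 = vtoks (rev (enc_tree t)) & t' <= tm + 50 * size (enc_tree t) + 30]).
Proof.
move=> r12; rewrite /ser_cmd; do 6!hstep.
apply: (@wp_ser_tree t _ _ [::] (VN 0) [::]); [by hread..|].
move=> s1 t1 fr1 ea1 r51 r5 le1; rewrite cats0 in r5.
eapply wp_while_true; [hval|by []|]; rewrite /ser_body; do 3!hstep; rewrite /=; hstep.
apply: wp_while_false; first by hread.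
split; hfin; by rewrite /= in le1 *; lia.
Qed.

Lemma wp_block s tm (X : pred 'I_n) b : hr s 0 = VN n -> hr s 2 = VN b ->
  (forall i : 'I_n, nth 0 inp (b + i) = X i) ->
  wp inp block_cmd s tm (fun s' t' => [/\ same [:: 3; 9; 11; 12] s s', ha s' = ha s,
    hr s' 9 = (let xs := [seq i <- enum 'I_n | X i] in
      if nilp xs then VN 0 else vt (mkP (map Leaf xs))) & t' <= tm + 25 * n + 40]).
Proof.
move=> r0 r2 iX; rewrite /block_cmd; do 5!hstep.
apply: (wp_down (k := n) (Inv := fun j s' t' => [/\ same [:: 3; 9; 11; 12] s s', ha s' = ha s,
  hr s' 11 = vs (map Leaf [seq i <- drop j (enum 'I_n) | X i]), j <= n & t' <= tm + 6 + 25 * (n - j)])).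
- by hread.
- by split; hfin; rewrite drop_oversize ?size_enum_ord //; hread.
- move=> j s1 t1 lt_j r3 [fr ea r11 _ le_t]; pose jo := Ordinal lt_j.
  have dE : drop j (enum 'I_n) = jo :: drop j.+1 (enum 'I_n).
    by rewrite (drop_nth jo) ?size_enum_ord // -[j]/(nat_of_ord jo) nth_ord_enum.
  have ij : nth 0 inp (b + j) = X jo := iX jo.
  rewrite dE; hstep; rewrite ij /=; case: (X jo) => /=; do ?hstep; (split; first by hread);
    by split; hfin.
move=> s1 t1 _ [fr ea r11 _ le_t]; rewrite drop0 in r11; hstep; rewrite truthy_vs /nilp size_map.
case X0: (size _ == 0) => /=; hstep; first by split; hfin; rewrite /nilp X0; hread.
apply: (wp_conseq (wp_mkP _ _ _ r11)); first by rewrite /nilp size_map X0.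
by move=> s2 t2 [fr2 ea2 r12 le2]; hstep; split; hfin; rewrite /nilp X0; hread.
Qed.

Lemma wp_topbody s tm x S : hr s 6 = VP (@vi n x) S ->
  wp inp topbody_cmd s tm (fun s' t' => [/\ same [:: 12; 19; 31; 34] s s', ha s' = ha s,
    hr s' 19 = vbody (body_of x) & t' <= tm + 60]).
Proof.
move=> r6; rewrite /topbody_cmd; do 2!hstep.
by case: x r6 => [u|u|u lin bd] r6; hstep; rewrite /=; do ?hstep; rewrite /=; do ?hstep; split; hfin.
Qed.

Lemma wp_revvs s tm a b : hr s 10 = @vs n a -> hr s 11 = vs b ->
  wp inp revapp s tm (fun s' t' => [/\ same [:: 10; 11] s s', ha s' = ha s,
    hr s' 11 = vs (rev a ++ b) & t' <= tm + 9 * size a + 2]).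
Proof.
move=> r10 r11; apply: (wp_conseq (wp_revapp _ _ r10 r11)) => s' t' [fr ea _ r le_t].
by split=> //; [rewrite r /vs map_cat map_rev|rewrite size_map in le_t].
Qed.

Lemma wp_wrap s tm r fr (t : pqtree n) : r \in [:: 48; 49] -> hr s 50 = @vframe n fr -> hr s r = vt t ->
  wp inp (wrap_cmd r) s tm (fun s' t' => [/\ same [:: 10; 11; 12; r] s s', ha s' = ha s,
    hr s' r = vt (wrap fr t) & t' <= tm + 9 * (size fr.1.2 + size fr.2) + 50]).
Proof.
case: fr => [[q l] r'] /=; rewrite !inE => /orP[]/eqP-> r50 rt; rewrite /wrap_cmd; do 5!hstep.
all: apply: (wp_conseq (wp_revvs _ (a := r') (b := [::]) _ _)); [by hread..|];
  rewrite cats0; move=> s1 t1 [fr1 ea1 r11 le1]; do 5!hstep;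
  apply: (wp_conseq (wp_revvs _ (a := l) (b := t :: rev r') _ _)); [by hread|by hread|];
  move=> s2 t2 [fr2 ea2 r112 le2]; hstep;
  have ne : ~~ nilp (rev l ++ t :: rev r') by (rewrite /nilp size_cat /= addnS).
all: case: q r50 => r50; hstep; rewrite /=;
  [apply: (wp_conseq (wp_mkQ _ _ ne r112))|apply: (wp_conseq (wp_mkP _ _ ne r112))];
  by move=> s3 t3 [fr3 ea3 r12 le3]; hstep; split; hfin.
Qed.

Lemma wp_split s tm frs co : hr s 19 = vbody (Some (frs, co) : option (seq (frame n) * core n)) ->
  wp inp split_cmd s tm (fun s' t' => [/\ same [:: 10; 11; 40; 41; 42; 43; 44; 45; 46; 47] s s',
    ha s' = ha s,
    [/\ hr s' 44 = vseq (map (@vframe n) frs), hr s' 40 = vs (core_left co)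
      & hr s' 43 = vs (core_right co)],
    [/\ hr s' 45 = vs (rev (core_right co)),
        hr s' 46 = vs (rev (core_full co) ++ core_full' co) & hr s' 47 = vs (rev (core_left co))]
    & t' <= tm + 9 * size (core_seq co) + 100]).
Proof.
move=> r19; rewrite /= in r19; rewrite /split_cmd; do 15!hstep.
apply: (wp_conseq (wp_revvs _ (a := core_right co) (b := [::]) _ _)); [by hread..|].
rewrite cats0 => s1 t1 [fr1 ea1 r11 le1]; do 7!hstep.
apply: (wp_conseq (wp_revvs _ (a := core_full co) (b := core_full' co) _ _)); [by hread..|].
move=> s2 t2 [fr2 ea2 r112 le2]; do 7!hstep.
apply: (wp_conseq (wp_revvs _ (a := core_left co) (b := [::]) _ _)); [by hread..|].
rewrite cats0 => s3 t3 [fr3 ea3 r113 le3]; hstep.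
rewrite /core_seq !size_cat !size_rev.
by split; hfin; split; hread.
Qed.

Lemma wp_frames s tm frs (T U : pqtree n) : hr s 44 = vseq (map (@vframe n) (rev frs)) ->
  hr s 48 = vt T -> hr s 49 = vt U ->
  wp inp (HWhile (XR 44)
    (HSet 50 (XFst (XR 44)) ;; HSet 44 (XSnd (XR 44)) ;; wrap_cmd 48 ;; wrap_cmd 49)) s tm
   (fun s' t' => [/\ same [:: 10; 11; 12; 44; 48; 49; 50] s s', ha s' = ha s,
     hr s' 48 = vt (plug frs T), hr s' 49 = vt (plug frs U)
   & t' <= tm + 18 * \sum_(fr <- frs) (size fr.1.2 + size fr.2) + 120 * size frs + 2]).
Proof.
elim/last_ind: frs s tm T U => [|frs fr IH] s tm T U r44 r48 r49.
  by apply: wp_while_false; [hread|rewrite /=; split=> //; rewrite big_nil; lia].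
rewrite rev_rcons /= in r44; eapply wp_while_true; [hval|by []|]; do 5!hstep.
apply: (wp_conseq (wp_wrap _ (r := 48) (fr := fr) (t := T) _ _ _)) => //; [by hread..|].
move=> s1 t1 [fr1 ea1 r481 le1].
apply: (wp_conseq (wp_wrap _ (r := 49) (fr := fr) (t := U) _ _ _)) => //; [by hread..|].
move=> s2 t2 [fr2 ea2 r492 le2].
apply: (wp_conseq (IH _ _ (wrap fr T) (wrap fr U) _ _ _)); [by hread|by hread|by []|].
move=> s3 t3 [fr3 ea3 r483 r493 le3].
rewrite /plug !foldr_rcons; split; hfin.
by rewrite size_rcons -cats1 big_cat big_seq1 /=; rewrite /= in le1 le2 le3; lia.
Qed.

Lemma wp_trees s tm frs co xs :
  [/\ hr s 44 = vseq (map (@vframe n) frs), hr s 40 = vs (core_left co)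
    & hr s 43 = vs (core_right co)] ->
  [/\ hr s 45 = vs (rev (core_right co)),
      hr s 46 = vs (rev (core_full co) ++ core_full' co) & hr s 47 = vs (rev (core_left co))] ->
  hr s 9 = (if nilp xs then VN 0 else vt (mkP (map (@Leaf n) xs))) ->
  ~~ nilp (core_seq co) -> 0 < size (core_left co ++ block xs ++ rev (core_right co)) ->
  wp inp trees_cmd s tm (fun s' t' => [/\ same [:: 10; 11; 12; 44; 48; 49; 50] s s', ha s' = ha s,
    hr s' 48 = vt (root_tree frs co), hr s' 49 = vt (exp_tree frs co xs)
    & t' <= tm + 40 * size (core_seq co) + 18 * \sum_(fr <- frs) (size fr.1.2 + size fr.2)
        + 140 * size frs + 200]).
Proof.
case=> r44 r40 r43 [r45 r46 r47] r9 c0 e0; rewrite /trees_cmd; do 5!hstep.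
set mid := rev (core_full co) ++ core_full' co in r46.
apply: (wp_conseq (wp_revvs _ (a := mid) (b := [::]) _ _)); [by hread..|].
rewrite cats0 => s1 t1 [fr1 ea1 r11 le1]; do 5!hstep.
apply: (wp_conseq (wp_revvs _ (a := rev mid) (b := rev (core_right co)) _ _)); [by hread..|].
rewrite revK => s2 t2 [fr2 ea2 r112 le2]; do 3!hstep.
apply: (wp_conseq (wp_revvs _ (a := rev (core_left co)) (b := mid ++ rev (core_right co)) _ _)); [by hread..|].
rewrite revK => s3 t3 [fr3 ea3 r113 le3]; hstep.
have cE : core_left co ++ mid ++ rev (core_right co) = core_seq co by rewrite /core_seq /mid -!catA.
rewrite cE in r113; apply: (wp_conseq (wp_mkQ _ _ c0 r113)) => s4 t4 [fr4 ea4 r12 le4]; do 6!hstep.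
have szE : size (core_seq co) = size (core_left co) + size mid + size (core_right co).
  by rewrite -cE !size_cat !size_rev; lia.
have cont s5 t5 : same [:: 10; 11; 12; 44; 48; 49; 50] s s5 -> hr s5 44 = vseq (map (@vframe n) frs) ->
    ha s5 = ha s ->
    hr s5 48 = vt (mkQ (core_seq co)) -> hr s5 11 = vs (block xs ++ rev (core_right co)) ->
    t5 <= t4 + 20 ->
    wp inp (HSet 10 (XR 47) ;; revapp ;; mkQ_cmd ;; HSet 49 (XR 12) ;;
      HSet 10 (XR 44) ;; HSet 11 (XC 0) ;; revapp ;; HSet 44 (XR 11) ;;
      HWhile (XR 44)
        (HSet 50 (XFst (XR 44)) ;; HSet 44 (XSnd (XR 44)) ;; wrap_cmd 48 ;; wrap_cmd 49)) s5 t5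
     (fun s' t' => [/\ same [:: 10; 11; 12; 44; 48; 49; 50] s s', ha s' = ha s,
    hr s' 48 = vt (root_tree frs co), hr s' 49 = vt (exp_tree frs co xs)
    & t' <= tm + 40 * size (core_seq co) + 18 * \sum_(fr <- frs) (size fr.1.2 + size fr.2)
        + 140 * size frs + 200]).
  move=> fr5 r445 ea5 r48 r115 le5.
  do 3!hstep.
  apply: (wp_conseq (wp_revvs _ (a := rev (core_left co)) (b := block xs ++ rev (core_right co)) _ _)); [by hread..|].
  rewrite revK => s6 t6 [fr6 ea6 r116 le6]; hstep.
  have e0' : ~~ nilp (core_left co ++ block xs ++ rev (core_right co)) by rewrite /nilp -lt0n.
  apply: (wp_conseq (wp_mkQ _ _ e0' r116)) => s7 t7 [fr7 ea7 r127 le7]; do 5!hstep; do 2?hstep.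
  apply: (wp_conseq (wp_revapp _ _ (a := map (@vframe n) frs) (b := [::]) _ _)); [by hread|by hread|].
  move=> s8 t8 [fr8 ea8 _ r118 le8]; rewrite cats0 -map_rev in r118; rewrite size_map in le8; do 2!hstep.
  apply: (wp_conseq (wp_frames _ (frs := frs) (T := mkQ (core_seq co))
    (U := mkQ (core_left co ++ block xs ++ rev (core_right co))) _ _ _)); [by hread..|].
  move=> s9 t9 [fr9 ea9 r489 r499 le9]; split; hfin.
  by rewrite ?size_rev /= in le1 le2 le3 le4 le5 le6 le7 le8 le9 *; lia.
rewrite /block in cont *; move: r9 cont; case: (nilp xs) => r9 cont.
  by rewrite /=; hstep; apply: cont; hfin.
have tr : truthy (vt (mkP (map (@Leaf n) xs))) = true by case: (mkP _).
by rewrite (tr : truthy (if false then VN 0 else vt (mkP (map (@Leaf n) xs))) = true); hstep; apply: cont; hfin.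
Qed.

Lemma wp_step s tm (t : pqtree n) (X : pred 'I_n) b : hr s 0 = VN n -> hr s 2 = VN b ->
  (forall i : 'I_n, nth 0 inp (b + i) = X i) -> hr s 5 = vtoks (rev (enc_tree t)) ->
  proper_arities t -> size (frontier t) = n ->
  (forall frs co, body_of (red X t) = Some (frs, co) ->
     0 < size (core_left co ++ block [seq i <- enum 'I_n | X i] ++ rev (core_right co))) ->
  wp inp step_cmd s tm (fun s' t' => [/\ same step_regs s s', ha s' = ha s,
    hr s' 19 = vbody (body_of (red X t)),
    forall frs co, body_of (red X t) = Some (frs, co) ->
      [/\ hr s' 48 = vt (root_tree frs co),
          hr s' 49 = vt (exp_tree frs co [seq i <- enum 'I_n | X i]),
          hr s' 46 = vs (rev (core_full co) ++ core_full' co),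
          hr s' 40 = vs (core_left co) & hr s' 43 = vs (core_right co)]
    & t' <= tm + 700 * size (enc_tree t) + 400 * n + 500]).
Proof.
move=> r0 r2 iX r5 pt szt e0; rewrite /step_cmd; hstep.
apply: (wp_conseq (wp_block _ r0 r2 iX)) => s1 t1 [fr1 ea1 r9 le1]; do 3!hstep.
apply: (@wp_parse t X b iX _ _ [::] [::]); [by rewrite cats0; hread|by hread|by hread|].
move=> s2 t2 fr2 ea2 r52 r62 le2; apply: wp_while_false; [by hread|hstep].
apply: (wp_conseq (wp_topbody _ r62)) => s3 t3 [fr3 ea3 r19 le3]; hstep.
case bE: (body_of (red X t)) r19 => [[frs co]|] r19; rewrite /=; last by hstep; split; hfin; rewrite /= in le1 le2 le3 *; lia.
hstep; apply: (wp_conseq (wp_split _ r19)) => s4 t4 [fr4 ea4 ra rb le4].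
have := red_body X pt; rewrite bE => -[okf okc lr].
have c0 : ~~ nilp (core_seq co) by case/and5P: okc.
have r94 : hr s4 9 = (if nilp [seq i <- enum 'I_n | X i] then VN 0
    else vt (mkP (map (@Leaf n) [seq i <- enum 'I_n | X i]))) by hread.
apply: (wp_conseq (wp_trees _ ra rb r94 c0 (e0 _ _ bE))) => s5 t5 [fr5 ea5 r48 r49 le5].
have [ra1 ra2 ra3] := ra; have [rb1 rb2 rb3] := rb.
have [lt_root _] := (lr _).1 (lang_frontier _).
have szr : size (frontier (plug frs (mkQ (core_seq co)))) = n by rewrite (perm_size (lang_perm lt_root)).
have [u [z [v [wE cx /lang_mkQ/lang_QP lz]]]] := (lang_plug _ _ _).1 (lang_frontier (plug frs (mkQ (core_seq co)))).
(* The frames are paid by the letters around the core, and the core by its own letters; together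
   these are the [n] letters of the word. *)
have [f1 f2] := ctx_size okf cx.
have pcore : all (@proper_arities n) (core_seq co).
  case/and5P: okc => gE gF gG gH _.
  by rewrite !all_cat !all_rev (good_e_proper gE) (good_f_proper gF) (good_f_proper gG) (good_e_proper gH).
have szc : size (core_seq co) <= size z.
  case: lz => [/(langs_size pcore)//|/langs_size]; rewrite all_rev size_rev; exact.
have nE : size u + (size z + size v) = n by move: (congr1 size wE); rewrite szr !size_cat; lia.
split; hfin; first by move=> frs' co' [<- <-]; split; hread.
by rewrite /= in le1 le2 le3 le4 le5 *; lia.
Qed.

End Steps.

(** * Computing the PQ-trees *)

(** Two tokens per node, and fewer inner nodes than leaves; the summand 2 expresses the strictness
    and carries the induction. *)
Lemma size_enc_tree n (t : pqtree n) : proper_arities t ->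
  size (enc_tree t) + 2 <= 4 * size (frontier t).
Proof.
elim/pqtree_nested_ind: t => [i|ts IH|ts IH] //=.
all: case/andP=> k2 pts.
all: have : size (flatten (map (@enc_tree n) ts)) + 2 * size ts <= 4 * size (flatten (map (@frontier n) ts)).
1,3: elim: ts IH pts {k2} => [|t ts IHts] //= IH /andP[pt pts]; rewrite !size_cat;
  have := IH t (or_introl erefl) pt; have := IHts (fun u h => IH u (or_intror h)) pts; lia.
all: lia.
Qed.

Lemma size_flatten_le (A : eqType) (f : A -> seq nat) s B : {in s, forall x, size (f x) <= B} ->
  size (flatten (map f s)) <= B * size s.
Proof.
elim: s => // x s IH le_B; rewrite /= size_cat mulnS leq_add ?le_B ?mem_head // IH // => y ys.
by rewrite le_B // inE ys orbT.
Qed.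

Lemma enc_trees_rcons n (T' T : nat -> pqtree n) k :
  enc_trees T' T 0 k.+1 = enc_trees T' T 0 k ++ enc_tree (T' k.+1) ++ enc_tree (T k.+1).
Proof.
have iotaE : index_iota 1 k.+2 = index_iota 1 k.+1 ++ [:: k.+1].
  by rewrite /index_iota !subSS !subn0 -[k.+1 in LHS]addn1 iotaD.
by rewrite /enc_trees iotaE map_cat flatten_cat /= cats0 catA.
Qed.

Lemma enum_colour n (X : {set 'I_n}) : [seq i <- enum 'I_n | i \in X] = enum X.
Proof. by rewrite enumT; apply: eq_filter. Qed.

Lemma represents_size n (t : pqtree n) (Pi : {set 'S_n}) : represents t Pi ->
  [/\ proper_arities t, size (frontier t) = n & size (enc_tree t) <= 4 * n].
Proof.
case=> /andP[pt pf] _; have sf : size (frontier t) = n by rewrite (perm_size pf) size_enum_ord.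
by split=> //; have := size_enc_tree pt; rewrite sf; lia.
Qed.

Section PQSequence.
Variables (n m : nat) (I : instance n m).
Hypotheses (n0 : 0 < n) (m0 : 0 < m).

(** For [n = 1] this is a leaf and not a P-node with one child. *)
Definition star : pqtree n := mkP (map Leaf (enum 'I_n)).

Lemma star_represents : represents star setT.
Proof.
split.
  apply/andP; split.
    apply: proper_mkP; first by rewrite size_map size_enum_ord.
    by elim: (enum 'I_n).
  by rewrite frontier_mkP /frontiers -map_comp (flatten_map1 id) map_id.
move=> p; rewrite consistent_invE inE; split=> // _.
have := (lang_block (enum 'I_n) (word p)).2 (perm_word p).
by rewrite /block /nilp size_enum_ord eqn0Ngt n0 => /langs1.
Qed.

Definition body (k : nat) (t : pqtree n) := body_of (red (fun i => i \in wset I k) t).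

(* [expanded k] is T'_(k+1) and [reduced k] is T_k. *)
Fixpoint expanded (k : nat) : option (pqtree n) :=
  if k is j.+1 then
    if expanded j is Some t then
      if body k t is Some (frs, co) then Some (exp_tree frs co (enum (wset I k))) else None
    else None
  else Some star.

Definition reduced (k : nat) : option (pqtree n) :=
  if k is j.+1 then
    if expanded j is Some t then
      if body k t is Some (frs, co) then Some (root_tree frs co) else None
    else None
  else Some star.

Lemma expandT : expand [set: 'I_n] [set: 'S_n] = setT.
Proof. by apply/setP=> p; rewrite inE; apply/expandP; exists p; rewrite ?inE // mulVg perm_on1. Qed.

Lemma expanded_represents k t : expanded k = Some t -> represents t (Pi'_ I k.+1).
Proof.
elim: k t => [|k IH] t /=.
  by case=> <-; have -> : Pi'_ I 1 = setT by [exact: expandT]; exact: star_represents.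
case E: (expanded k) => [u|] //; case B: (body _ _) => [[frs co]|] // [<-].
exact: represents_exp (IH _ E) B.
Qed.

Lemma reduced_represents k t : reduced k = Some t -> represents t (Pi_ I k).
Proof.
case: k => [|k] /=; first by case=> <-; exact: star_represents.
case E: (expanded k) => [u|] //; case B: (body _ _) => [[frs co]|] // [<-].
exact: represents_root (expanded_represents E) B.
Qed.

Lemma expanded_le j k t : j <= k -> expanded k = Some t ->
  expanded j <> None /\ reduced j <> None.
Proof.
elim: k t => [|k IH] t; first by rewrite leqn0 => /eqP->.
rewrite leq_eqVlt => /predU1P[->|]; rewrite /= ?ltnS.
  by case: (expanded k) => [u|] //; case: (body _ _) => [[frs co]|].
by move=> le_j; case E: (expanded k) => [u|] // _; exact: IH E.
Qed.

Lemma Pi_set0 j k : j <= k -> Pi_ I j = set0 -> Pi_ I k = set0.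
Proof.
elim: k => [|k IH]; first by rewrite leqn0 => /eqP->.
rewrite leq_eqVlt => /predU1P[->//|]; rewrite ltnS => le_j P0.
apply/setP=> p; rewrite /= !inE; apply/andP=> -[/expandP[q]].
by rewrite (IH le_j P0) inE.
Qed.

(** A failed reduction makes [Pi_ I k.+1] empty, and an empty set stays empty up to [m], where
    niceness demands an element. *)
Lemma stuck_not_nice k t : k < m -> expanded k = Some t -> body k.+1 t = None -> ~ nice I.
Proof.
move=> lt_k E B /(nice_Pi I m0)[p]; rewrite (Pi_set0 lt_k) ?inE //.
exact: represents_fail (expanded_represents E) B.
Qed.

Variable rest : seq nat.
Local Notation inp := (enc_instance I ++ rest).

Lemma inp_wset k (i : 'I_n) : k < m -> nth 0 inp (2 + k * n + i) = (i \in wset I k.+1).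
Proof. by move=> lt_k; rewrite (inp_set I rest (Ordinal lt_k)) (tnth_nth set0). Qed.

(** The linear term is [700 * 4 + 400] per letter, a listing having at most [4 * n] tokens. *)
Lemma wp_round s tm k t : k < m -> hr s 0 = VN n -> hr s 2 = VN (2 + k * n) ->
  expanded k = Some t -> hr s 5 = vtoks (rev (enc_tree t)) ->
  wp inp step_cmd s tm (fun s' t' => [/\ same step_regs s s', ha s' = ha s,
    hr s' 19 = vbody (body k.+1 t),
    forall frs co, body k.+1 t = Some (frs, co) ->
      [/\ hr s' 48 = vt (root_tree frs co),
          hr s' 49 = vt (exp_tree frs co (enum (wset I k.+1))),
          hr s' 46 = vs (rev (core_full co) ++ core_full' co),
          hr s' 40 = vs (core_left co) & hr s' 43 = vs (core_right co)]
    & t' <= tm + 3200 * n + 500]).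
Proof.
move=> lt_k r0 r2 E r5; have [pt szt le4] := represents_size (expanded_represents E).
apply: (wp_conseq (wp_step _ (X := fun i => i \in wset I k.+1) r0 r2 _ r5 pt szt _)).
- by move=> i; apply: inp_wset.
- move=> frs co B; rewrite enum_colour; apply: exp_list_gt0.
  by have := red_body (fun i => i \in wset I k.+1) pt; rewrite B => -[].
by rewrite enum_colour => s' t' [fr ea r19 regs le_t]; split=> //; clear m0; lia.
Qed.

End PQSequence.

(** * The program that lists all trees *)

Definition init_cmd : hc :=
  HSet 11 (XC 0) ;; HSet 3 (XR 0) ;;
  down 3 (HCons 12 (XC 0) (XR 3) ;; HCons 11 (XR 12) (XR 11)) ;; mkP_cmd.

Definition outapp : hc :=
  HSet 10 (XR 5) ;; HSet 11 (XC 0) ;; revapp ;; HSet 10 (XR 11) ;; HSet 11 (XR 56) ;; revapp ;;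
  HSet 56 (XR 11).

(** At the start of a round register 5 lists the expanded tree left by the previous one. It is
    emitted only now, which gives the order of [enc_trees] and leaves out the expanded tree of the
    last round. Register 57 drops to 0 once a reduction fails. *)
Definition pq_round : hc :=
  outapp ;; step_cmd ;;
  HIf (XR 19)
    (HSet 12 (XR 48) ;; ser_cmd ;; outapp ;; HSet 12 (XR 49) ;; ser_cmd ;; advance)
    (HSet 57 (XC 0)).

(** The output is held as a reversed list, hence it is counted first and written from the last cell
    downwards. *)
Definition emit_cmd : hc :=
  HSet 54 (XC 0) ;; HSet 55 (XR 56) ;;
  HWhile (XR 55) (HSet 55 (XSnd (XR 55)) ;; HSet 54 (XInc (XR 54))) ;;
  down 54 (HPut 0 (XR 54) (XC 0) (XFst (XR 56)) ;; HSet 56 (XSnd (XR 56))).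

Definition pq_prog : hc :=
  load_sizes ;; init_cmd ;; ser_cmd ;; HCons 56 (XC 1) (XC 0) ;; outapp ;; HSet 57 (XC 1) ;;
  HSet 58 (XR 1) ;; down 58 (HIf (XR 57) pq_round HSkip) ;;
  HIf (XR 57) HSkip (HCons 56 (XC 0) (XC 0)) ;; emit_cmd.

Section PQProgram.
Variable inp : seq nat.

Lemma wp_init n s tm : 0 < n -> hr s 0 = VN n ->
  wp inp init_cmd s tm (fun s' t' => [/\ same [:: 3; 11; 12] s s', ha s' = ha s,
    hr s' 12 = vt (star n) & t' <= tm + 25 * n + 40]).
Proof.
move=> n0 r0; rewrite /init_cmd; do 5!hstep.
apply: (wp_down (k := n) (Inv := fun j s' t' => [/\ same [:: 3; 11; 12] s s', ha s' = ha s,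
  hr s' 11 = vs (map Leaf (drop j (enum 'I_n))), j <= n & t' <= tm + 6 + 25 * (n - j)])).
- by hread.
- by split; hfin; rewrite drop_oversize ?size_enum_ord //; hread.
- move=> j s1 t1 lt_j r3 [fr ea r11 _ le_t]; pose jo := Ordinal lt_j.
  have dE : drop j (enum 'I_n) = jo :: drop j.+1 (enum 'I_n).
    by rewrite (drop_nth jo) ?size_enum_ord // -[j]/(nat_of_ord jo) nth_ord_enum.
  rewrite dE; do ?hstep; (split; first by hread); by split; hfin.
move=> s1 t1 _ [fr ea r11 _ le_t]; rewrite drop0 in r11.
apply: (wp_conseq (wp_mkP _ _ _ r11)); first by rewrite /nilp size_map size_enum_ord -lt0n.
by move=> s2 t2 [fr2 ea2 r12 le2]; split; hfin.
Qed.

Lemma wp_outapp s tm u L : hr s 5 = vtoks (rev u) -> hr s 56 = vtoks (rev L) ->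
  wp inp outapp s tm (fun s' t' => [/\ same [:: 10; 11; 56] s s', ha s' = ha s,
    hr s' 56 = vtoks (rev (L ++ u)) & t' <= tm + 18 * size u + 20]).
Proof.
move=> r5 r56; rewrite /outapp; do 5!hstep.
apply: (wp_conseq (wp_revapp _ _ (a := map VN (rev u)) (b := [::]) _ _)); [by hread|by hread|].
rewrite cats0 -map_rev revK => s1 t1 [fr1 ea1 _ r11 le1]; do 5!hstep.
apply: (wp_conseq (wp_revapp _ _ (a := map VN u) (b := map VN (rev L)) _ _)); [by hread|by hread|].
move=> s2 t2 [fr2 ea2 _ r112 le2]; rewrite -map_rev -map_cat -rev_cat in r112.
rewrite !size_map ?size_rev in le1 le2; hstep.
by split; hfin.
Qed.

Lemma wp_emit s tm out : hr s 56 = vtoks (rev out) ->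
  wp inp emit_cmd s tm (fun s' t' =>
    (forall i, i < size out -> ha s' 0 i = nth 0 out i) /\ t' <= tm + 30 * size out + 20).
Proof.
move=> r56; rewrite /emit_cmd; do 5!hstep.
apply: (wp_conseq (wp_count _ _ (l := map VN (rev out)) (k := 0) _ _)); [by hread|by hread|].
move=> s1 t1 [fr1 ea1 r54 le1]; rewrite size_map size_rev in r54 le1.
apply: (wp_down (k := size out) (Inv := fun j s' t' => [/\ hr s' 56 = vtoks (rev (take j out)),
  j <= size out, forall i, j <= i < size out -> ha s' 0 i = nth 0 out i
  & t' <= t1 + 20 * (size out - j)])) => //.
- by split=> //; [rewrite take_size; hread|move=> i; lia|lia].
- move=> j s2 t2 lt_j r542 [r562 _ done le2]; rewrite (take_nth 0 lt_j) rev_rcons in r562.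
  rewrite /vtoks /= in r562; do 3!hstep; split; first by hread.
  split; [by hread|by apply: ltnW| |lia] => i; rewrite /= /upd /= ?addn0; case: eqP => [->//|ne_i] lt_i.
  by apply: done; lia.
by move=> s2 t2 _ [_ _ done le2]; split=> [i lt_i|]; [apply: done; rewrite lt_i|lia].
Qed.

End PQProgram.

Section PQRun.
Variables (n m : nat) (I : instance n m).
Hypotheses (n0 : 0 < n) (m0 : 0 < m).
Local Notation inp := (enc_instance I).
Local Notation inp' := (enc_instance I ++ [::]).

(** The default makes the sequence total; after a successful last round every earlier tree exists by
    [expanded_le]. *)
Definition treeT' (j : nat) : pqtree n := odflt (star n) (expanded I j.-1).
Definition treeT (j : nat) : pqtree n := odflt (star n) (reduced I j).

Lemma size_treeT' j : size (enc_tree (treeT' j)) <= 4 * n.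
Proof.
rewrite /treeT'; case E: (expanded I _) => [t|] /=.
  by case: (represents_size (expanded_represents n0 E)).
by case: (represents_size (star_represents n0)).
Qed.

Lemma size_treeT j : size (enc_tree (treeT j)) <= 4 * n.
Proof.
rewrite /treeT; case E: (reduced I _) => [t|] /=.
  by case: (represents_size (reduced_represents n0 E)).
by case: (represents_size (star_represents n0)).
Qed.

Definition pq_inv (tm j : nat) (s : hst) (t : nat) : Prop :=
  [/\ hr s 0 = VN n, j <= m, t <= tm + 5000 * n * (m - j) &
    [/\ hr s 57 = VN 1, hr s 2 = VN (2 + (m - j) * n),
        hr s 56 = vtoks (rev (1 :: enc_trees treeT' treeT 0 (m - j))) &
        exists2 t, expanded I (m - j) = Some t & hr s 5 = vtoks (rev (enc_tree t))]
    \/ hr s 57 = VN 0 /\ ~ nice I].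

Lemma wp_pq_round tm j s t : j < m -> hr s 58 = VN j.+1 -> pq_inv tm j.+1 s t ->
  wp inp' (HIf (XR 57) pq_round HSkip) (HSt (upd (hr s) 58 (VN j)) (ha s)) (t + 7)
    (fun s' t' => hr s' 58 = VN j /\ pq_inv tm j s' t').
Proof.
move=> lt_j r58 [r0 le_j le_t st]; have kE : m - j = (m - j.+1).+1 by lia.
have timeE : 5000 * n * (m - j) = 5000 * n * (m - j.+1) + 5000 * n by rewrite kE mulnS addnC.
case: st => [[r57 r2 r56 [u E r5]]|[r57 nn]]; hstep; rewrite /=; last first.
  hstep; split; first by hread.
  by split; [hread|lia|rewrite timeE; lia|right; split; first by hread].
set k := m - j.+1 in kE E r2 r56 *; have lt_k : k < m by lia.
have [pu su le4] := represents_size (expanded_represents n0 E).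
rewrite /pq_round; hstep.
apply: (wp_conseq (wp_outapp _ _ (u := enc_tree u) (L := 1 :: enc_trees treeT' treeT 0 k) _ _)); [by hread|by hread|].
move=> s1 t1 [fr1 ea1 r561 le1]; hstep.
apply: (wp_conseq (wp_round n0 [::] _ lt_k (s := s1) (t := u) _ _ E _)); [by hread|by hread|by hread|].
move=> s2 t2 [fr2 ea2 r19 regs le2]; hstep.
case B: (body I k.+1 u) r19 => [[frs co]|] r19; rewrite /=; last first.
  hstep; split; first by hread.
  split; [by hread|lia|rewrite timeE /= in le_t le1 le2 *; lia|right; split; first by hread].
  exact: (stuck_not_nice n0 m0 lt_k E B).
have [r48 r49 _ _ _] := regs _ _ B.
have ER : reduced I k.+1 = Some (root_tree frs co) by rewrite /= E B.
have EE : expanded I k.+1 = Some (exp_tree frs co (enum (wset I k.+1))) by rewrite /= E B.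
have [_ _ leR] := represents_size (reduced_represents n0 ER).
have [_ _ leE] := represents_size (expanded_represents n0 EE).
do 3!hstep; apply: (wp_conseq (wp_ser _ _ (t := root_tree frs co) _)); first by hread.
move=> s3 t3 [fr3 ea3 r53 le3]; hstep.
apply: (wp_conseq (wp_outapp _ _ (u := enc_tree (root_tree frs co))
  (L := (1 :: enc_trees treeT' treeT 0 k) ++ enc_tree u) _ _)); [by hread|by hread|].
move=> s4 t4 [fr4 ea4 r564 le4']; do 3!hstep.
apply: (wp_conseq (wp_ser _ _ (t := exp_tree frs co (enum (wset I k.+1))) _)); first by hread.
move=> s5 t5 [fr5 ea5 r55 le5].
apply: (wp_conseq (wp_advance _ _ (n := n) (b := 2 + k * n) _ _)); [by hread|by hread|].
move=> s6 t6 [fr6 r26 ea6 le6].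
split; first by hread.
split; [by hread|lia|rewrite timeE; clear r2 r56 r561 r564 r26; lia|left].
split; [by hread|by rewrite r26 kE; congr VN; lia| |].
  have -> : hr s6 56 = vtoks (rev (((1 :: enc_trees treeT' treeT 0 k) ++ enc_tree u) ++ enc_tree (root_tree frs co))).
    by hread.
  have tT' : treeT' k.+1 = u by rewrite /treeT' /= E.
  have tT : treeT k.+1 = root_tree frs co by rewrite /treeT ER.
  by rewrite kE enc_trees_rcons tT' tT -catA.
by rewrite kE; exists (exp_tree frs co (enum (wset I k.+1))); [|hread].
Qed.

Lemma wp_pq : wp inp' pq_prog hinit 0 (fun s' t' => exists out,
  [/\ (~ nice I /\ out = [:: 0]) \/
      (nice I /\ exists T' T : nat -> pqtree n,
         [/\ forall j, j <= m -> represents (T j) (Pi_ I j),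
             forall j, 1 <= j <= m -> represents (T' j) (Pi'_ I j)
           & out = 1 :: enc_trees T' T 0 m]),
      forall i, i < size out -> ha s' 0 i = nth 0 out i, size out <= 13 * (m * n)
    & t' <= (2 * 4000) * (m * n)]).
Proof.
have nN : n <= m * n by rewrite leq_pmull.
have mN : m <= m * n by rewrite leq_pmulr.
have N1 : 1 <= m * n by rewrite muln_gt0 m0.
rewrite /pq_prog; hstep; apply: (wp_conseq (wp_load_sizes (n := n) (m := m) _ _ _ _)) => //.
move=> s1 t1 [fr1 ea1 [r0 r1] r2 ->]; hstep.
apply: (wp_conseq (wp_init _ _ n0 r0)) => s2 t2 [fr2 ea2 r12 le2]; hstep.
apply: (wp_conseq (wp_ser _ _ r12)) => s3 t3 [fr3 ea3 r5 le3]; do 3!hstep.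
have [_ _ le4] := represents_size (star_represents n0).
apply: (wp_conseq (wp_outapp _ _ (u := enc_tree (star n)) (L := [:: 1]) _ _)); [by hread|by hread|].
move=> s4 t4 [fr4 ea4 r56 le4']; do 5!hstep.
apply: (wp_down (k := m) (Inv := pq_inv (600 * n))).
- by hread.
- split; [by hread|by []| |left].
    by rewrite subnn muln0 /= in le2 le3 le4' *; lia.
  rewrite subnn mul0n addn0; split; [by hread|by hread| |by exists (star n); [|hread]].
  by hread; rewrite /enc_trees /index_iota subnn /= cats0.
- by move=> j s5 t5; apply: wp_pq_round.
move=> s5 t5 _ [r05 _ le5 st]; rewrite subn0 -mulnA [n * m]mulnC in le5.
hstep; hstep.
case: st => [[r57 r25 r565 [u E _]]|[r57 nn]]; rewrite r57 /=; hstep.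
- rewrite subn0 in r565 E.
  have sz : size (1 :: enc_trees treeT' treeT 0 m) <= 13 * (m * n).
    have le_fl : size (flatten [seq enc_tree (treeT' j) ++ enc_tree (treeT j) | j <- index_iota 1 m.+1])
        <= 8 * n * size (index_iota 1 m.+1).
      by apply: size_flatten_le => j _; rewrite size_cat; have := size_treeT' j; have := size_treeT j; lia.
    rewrite size_iota subn1 [m.+1.-1]/= -mulnA [n * m]mulnC in le_fl.
    by have := size_treeT 0; rewrite /enc_trees -cat1s !size_cat [size [:: 1]]/=; lia.
  apply: (wp_conseq (wp_emit _ _ r565)) => s6 t6 [out le6].
  exists (1 :: enc_trees treeT' treeT 0 m); split=> //; last first.
    by lia.
  right; split; last exists treeT', treeT; last first.
    split=> // j; first move=> le_j.
      have [_] := expanded_le le_j E; rewrite /treeT; case R: (reduced I j) => [v|] // _.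
      exact: (reduced_represents n0 R).
    case: j => // j /andP[_ lt_j]; have [+ _] := expanded_le (ltnW lt_j) E.
    by rewrite /treeT' /=; case R: (expanded I j) => [v|] // _; exact: (expanded_represents n0 R).
  (* The frontier of the last reduced tree is the word of an element of the final set, so that set
     is nonempty. *)
  apply/(nice_Pi I m0); have [_] := expanded_le (leqnn m) E.
  case R: (reduced I m) => [v|] // _; have [ovr rv] := reduced_represents n0 R.
  have [|p wp_] := @word_of n (frontier v); first by case/andP: ovr.
  by exists p; apply/rv; rewrite consistent_invE wp_; exact: lang_frontier.
- apply: (wp_conseq (wp_emit _ _ (out := [:: 0]) _)); first by hread.
  move=> s6 t6 [out le6]; exists [:: 0]; split=> //; [by left|by rewrite /=; lia|rewrite /= in le6; lia].
Qed.

End PQRun.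

Lemma pq_runs : exists (c : cmd) (C : nat), forall (n m : nat) (I : instance n m),
  0 < n -> 0 < m ->
  runs_within c C (m * n) (enc_instance I)
    (fun out =>
       (~ nice I /\ out = [:: 0]) \/
       (nice I /\ exists T' T : nat -> pqtree n,
          [/\ forall j, j <= m -> represents (T j) (Pi_ I j),
              forall j, 1 <= j <= m -> represents (T' j) (Pi'_ I j)
            & out = 1 :: enc_trees T' T 0 m])).
Proof.
have [C runs] := @compile_runs pq_prog 2 (2 * 4000) 5 isT.
exists (Then (prelude (2 * (5 + (2 * 4000))) 2) (hcomp pq_prog)), C.
move=> n m I n0 m0; have N0 : 0 < m * n by rewrite muln_gt0 m0.
have := wp_pq I n0 m0; rewrite cats0 => -[T [s' [ex [out [post outE sz le_T]]]]].
have nN := leq_pmull n m0.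
apply: (runs n m _ s' T out) => //.
- by apply: sub_all (enc_instance_bound I N0) => k; lia.
- by rewrite size_enc_instance; lia.
- by lia.
Qed.

(** * Computing an ascending chain *)

(** A reversed listing consists of pairs of value and tag, tag 0 marking leaves. Consing while
    reading backwards restores the order of the frontier. *)
Fixpoint leaf_values (l acc : seq nat) : seq nat :=
  if l is v :: tag :: l' then leaf_values l' (if tag == 0 then v :: acc else acc) else acc.

Section Tokens.
Variable n : nat.
Implicit Types (t : pqtree n) (ts : seq (pqtree n)).

Lemma leaf_values_enc t R acc :
  leaf_values (rev (enc_tree t) ++ R) acc = leaf_values R (map val (frontier t) ++ acc).
Proof.
elim/pqtree_nested_ind: t R acc => [i|ts IH|ts IH] R acc //.
all: have forest us : (forall u, List.In u us -> List.In u ts) -> forall R acc,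
    leaf_values (rev (flatten (map (@enc_tree n) us)) ++ R) acc =
    leaf_values R (map val (flatten (map (@frontier n) us)) ++ acc).
1,3: elim: us => [|u us IHus] sub R0 acc0 //=; rewrite rev_cat -catA IHus;
  [rewrite IH; [by rewrite map_cat -catA|by apply: sub; left]|by move=> v h; apply: sub; right].
- by rewrite (rev_enc_node false ts) -catA forest.
- by rewrite (rev_enc_node true ts) -catA forest.
Qed.

Lemma odd_enc_tree t : odd (size (enc_tree t)) = false.
Proof.
elim/pqtree_nested_ind: t => [i|ts IH|ts IH] //=; rewrite negbK.
all: elim: ts IH => [|u us IHus] //= IH; rewrite size_cat oddD IH ?IHus //; last by left.
all: by move=> v h; apply: IH; right.
Qed.

(** A preorder listing ends with a leaf, so the head of the reversed listing names a leaf of the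
    tree. *)
Lemma enc_tree_last t : proper_arities t ->
  exists (i : 'I_n) l, rev (enc_tree t) = nat_of_ord i :: l /\ i \in frontier t.
Proof.
elim/pqtree_nested_ind: t => [i|ts IH|ts IH].
  by exists i, [:: 0]; rewrite inE.
all: case/lastP: ts IH => [|ts u] IH //= /andP[_]; rewrite all_rcons => /andP[pu _].
all: have inu : List.In u (rcons ts u) by elim: ts {IH} => [|v ts IHts] /=; [left|right].
all: have [i [l [E iu]]] := IH u inu pu.
- exists i; eexists; split; last by rewrite map_rcons -cats1 flatten_cat mem_cat /= cats0 iu orbT.
  by rewrite (rev_enc_node false (rcons ts u)) map_rcons -cats1 flatten_cat /= cats0 rev_cat E.
- exists i; eexists; split; last by rewrite map_rcons -cats1 flatten_cat mem_cat /= cats0 iu orbT.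
  by rewrite (rev_enc_node true (rcons ts u)) map_rcons -cats1 flatten_cat /= cats0 rev_cat E.
Qed.

Lemma enc_tree_bound t B : proper_arities t -> size (frontier t) <= B ->
  all (fun k => k <= n + B + 2) (enc_tree t).
Proof.
elim/pqtree_nested_ind: t B => [i|ts IH|ts IH] B /=.
  by move=> _ _; have := ltn_ord i; rewrite andbT; lia.
all: case/andP=> _ pts le_B.
all: have := langs_size pts (langs_frontiers ts); rewrite /frontiers => le_ts.
all: have forest us : (forall u, List.In u us -> List.In u ts) -> all (@proper_arities n) us ->
    size (flatten (map (@frontier n) us)) <= B ->
    all (fun k => k <= n + B + 2) (flatten (map (@enc_tree n) us)).
1,3: elim: us => [|u us IHus] sub //= /andP[pu pus]; rewrite size_cat all_cat => le_u;
  apply/andP; split; [apply: IH => //; [by apply: sub; left|lia]|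
    apply: IHus => //; [by move=> v h; apply: sub; right|lia]].
all: by rewrite forest // andbT; apply/andP; split; lia.
Qed.

End Tokens.

Definition leaves_cmd : hc :=
  HSet 62 (XC 0) ;;
  HWhile (XR 5)
    (HSet 63 (XFst (XR 5)) ;; HSet 5 (XSnd (XR 5)) ;;
     HIf (XFst (XR 5)) HSkip (HCons 62 (XR 63) (XR 62)) ;; HSet 5 (XSnd (XR 5))).

(* A record consists of the row offset, the side (1: left, 2: right, 0: none)
   and the name of a leaf next to the full leaves, and the full leaves. *)
Definition record_cmd : hc :=
  HIf (XR 46) (HSet 11 (XR 46) ;; mkQ_cmd ;; ser_cmd ;; leaves_cmd) (HSet 62 (XC 0)) ;;
  HIf (XR 40) (HSet 12 (XFst (XR 40)) ;; ser_cmd ;; HSet 64 (XFst (XR 5)) ;; HSet 65 (XC 1))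
    (HIf (XR 43) (HSet 12 (XFst (XR 43)) ;; ser_cmd ;; HSet 64 (XFst (XR 5)) ;; HSet 65 (XC 2))
       (HSet 64 (XC 0) ;; HSet 65 (XC 0))) ;;
  HCons 64 (XR 64) (XR 62) ;; HCons 64 (XR 65) (XR 64) ;; HCons 64 (XR 4) (XR 64) ;;
  HCons 60 (XR 64) (XR 60).

Definition min_cmd : hc :=
  HWhile (XR 10)
    (HIf (XSub (XR 70) (XArr 1 (XC 0) (XFst (XR 10))))
       (HSet 70 (XArr 1 (XC 0) (XFst (XR 10)))) HSkip ;;
     HSet 10 (XSnd (XR 10))).

(** Register 70 runs over the positions of the block. The old position of a letter goes into the row
    of the quotient before array 1 receives the new one, so the quotient is obtained without
    inverting a permutation. *)
Definition relabel_cmd : hc :=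
  HWhile (XR 62)
    (HSet 10 (XFst (XR 62)) ;; HSet 62 (XSnd (XR 62)) ;;
     HPut 0 (XR 67) (XR 70) (XArr 1 (XC 0) (XR 10)) ;; HPut 1 (XC 0) (XR 10) (XR 70) ;;
     HSet 70 (XInc (XR 70))).

Definition side_cmd : hc :=
  HSet 71 (XC 0) ;;
  HIf (XR 68)
    (HIf (XSub (XR 70) (XArr 1 (XC 0) (XR 69)))
       (HIf (XSub (XR 68) (XC 1)) (HSet 71 (XC 1)) HSkip)
       (HIf (XSub (XR 68) (XC 1)) HSkip (HSet 71 (XC 1))))
    HSkip ;;
  HIf (XR 71) (HSet 10 (XR 62) ;; HSet 11 (XC 0) ;; revapp ;; HSet 62 (XR 11)) HSkip.

(** The least position of a full leaf, computed from the bound [n], is the start of the block. The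
    row is preset to the identity because [relabel_cmd] writes only the positions of the block. *)
Definition back_cmd : hc :=
  HSet 66 (XFst (XR 60)) ;; HSet 60 (XSnd (XR 60)) ;; HSet 67 (XFst (XR 66)) ;;
  HSet 68 (XFst (XSnd (XR 66))) ;; HSet 69 (XFst (XSnd (XSnd (XR 66)))) ;;
  HSet 62 (XSnd (XSnd (XSnd (XR 66)))) ;; HSet 70 (XR 0) ;; HSet 10 (XR 62) ;;
  min_cmd ;; side_cmd ;;
  HSet 3 (XR 0) ;; down 3 (HPut 0 (XR 67) (XR 3) (XR 3)) ;; relabel_cmd.

(** The walk back starts from a word of the tree expanded after the last reduction. The record of
    round [k] leads to row [k], so the row of round [m] falls behind the output; row 0, scratch
    space for the first relabelling, finally receives [pi_1]. *)
Definition chain_prog : hc :=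
  load_sizes ;; init_cmd ;; ser_cmd ;; HSet 60 (XC 0) ;; HSet 4 (XC 0) ;; HSet 58 (XR 1) ;;
  down 58 (step_cmd ;; bump 4 ;; record_cmd ;; HSet 12 (XR 49) ;; ser_cmd ;; advance) ;;
  leaves_cmd ;; HSet 67 (XC 0) ;; HSet 70 (XC 0) ;;
  HSet 3 (XR 0) ;; down 3 (HPut 0 (XR 67) (XR 3) (XR 3)) ;;
  HSet 3 (XR 0) ;; down 3 (HPut 1 (XC 0) (XR 3) (XR 3)) ;; relabel_cmd ;;
  HWhile (XR 60) back_cmd ;;
  HSet 3 (XR 0) ;; down 3 (HPut 0 (XC 0) (XR 3) (XArr 1 (XC 0) (XR 3))).

Definition vperm n (y : seq 'I_n) : datum := vtoks (map val y).

(** * One step back from the expanded tree to the reduced tree *)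

Section ChainSteps.
Variables (inp : seq nat) (n : nat).
Implicit Types (p q : 'S_n) (a b x y : seq 'I_n).

Lemma wp_leaves s tm (t : pqtree n) : hr s 5 = vtoks (rev (enc_tree t)) ->
  wp inp leaves_cmd s tm (fun s' t' => [/\ same [:: 5; 62; 63] s s', ha s' = ha s,
    hr s' 62 = vperm (frontier t) & t' <= tm + 10 * size (enc_tree t) + 10]).
Proof.
move=> r5; rewrite /leaves_cmd; do 2!hstep.
have loop N : forall l acc s0 t0, size l = N.*2 -> hr s0 5 = vtoks l -> hr s0 62 = vtoks acc ->
    wp inp (HWhile (XR 5)
    (HSet 63 (XFst (XR 5)) ;; HSet 5 (XSnd (XR 5)) ;;
     HIf (XFst (XR 5)) HSkip (HCons 62 (XR 63) (XR 62)) ;; HSet 5 (XSnd (XR 5)))) s0 t0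
    (fun s' t' => [/\ same [:: 5; 62; 63] s0 s', ha s' = ha s0,
      hr s' 62 = vtoks (leaf_values l acc) & t' <= t0 + 10 * size l + 2]).
  elim: N => [|N IH] [|v [|tag l]] acc s0 t0 //= sz r50 r62.
    by apply: wp_while_false; [hread|split=> //=; lia].
  rewrite /vtoks /= in r50; eapply wp_while_true; [hval|by []|]; do 6!hstep.
  have szl : size l = N.*2 by move: sz; rewrite doubleS; lia.
  case: tag r50 => [|tag] r50 /=; do 2!hstep.
    apply: (wp_conseq (IH l (v :: acc) _ _ szl _ _)); [by hread|by hread|].
    by move=> s' t' [fr ea r le_t]; split=> //; [hsame|lia].
  apply: (wp_conseq (IH l acc _ _ szl _ _)); [by hread|by hread|].
  by move=> s' t' [fr ea r le_t]; split=> //; [hsame|lia].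
have sz : size (rev (enc_tree t)) = (size (enc_tree t))./2.*2.
  by rewrite size_rev -{1}[size (enc_tree t)]odd_double_half odd_enc_tree.
apply: (wp_conseq (loop _ (rev (enc_tree t)) [::] _ _ sz _ _)); [by hread|by hread|].
move=> s' t' [fr ea r le_t]; rewrite size_rev in le_t.
split=> //; [hsame| |lia].
by rewrite r -[rev _]cats0 leaf_values_enc /= cats0.
Qed.

Definition hint_ok (co : core n) (side e : nat) : Prop :=
  [\/ side = 1 /\ (exists2 i : 'I_n, i \in frontiers (core_left co) & e = i),
      side = 2 /\ (exists2 i : 'I_n, i \in frontiers (core_right co) & e = i)
    | side = 0 /\ (core_left co = [::] /\ core_right co = [::])].

Definition vrecord (base side e : nat) (co : core n) : datum :=
  VP (VN base) (VP (VN side) (VP (VN e) (vperm (full_word co)))).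

Lemma wp_record s tm base (co : core n) D : hr s 46 = vs (rev (core_full co) ++ core_full' co) ->
  hr s 40 = vs (core_left co) -> hr s 43 = vs (core_right co) -> hr s 4 = VN base -> hr s 60 = D ->
  all (@proper_arities n) (core_seq co) -> size (frontiers (core_seq co)) <= n ->
  wp inp record_cmd s tm (fun s' t' =>
    [/\ same [:: 5; 11; 12; 51; 52; 53; 54; 55; 60; 62; 63; 64; 65] s s', ha s' = ha s,
      exists side e, hint_ok co side e /\ hr s' 60 = VP (vrecord base side e co) D
    & t' <= tm + 500 * n + 200]).
Proof.
move=> r46 r40 r43 r4 r60; rewrite /core_seq !all_cat !all_rev => /and4P[pE pF pG pH] sz0.
pose mid := rev (core_full co) ++ core_full' co; rewrite -/mid in r46.
have pM : all (@proper_arities n) mid by rewrite /mid all_cat all_rev pF.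
have sz : size (frontiers (core_left co)) + (size (frontiers mid) + size (frontiers (rev (core_right co)))) <= n.
  by move: sz0; rewrite /mid !frontiers_cat !size_cat; lia.
have cont s1 t1 : same [:: 5; 11; 12; 51; 52; 53; 54; 55; 62; 63] s s1 -> ha s1 = ha s ->
    hr s1 62 = vperm (full_word co) -> t1 <= tm + 250 * n + 80 ->
  wp inp (HIf (XR 40) (HSet 12 (XFst (XR 40)) ;; ser_cmd ;; HSet 64 (XFst (XR 5)) ;; HSet 65 (XC 1))
    (HIf (XR 43) (HSet 12 (XFst (XR 43)) ;; ser_cmd ;; HSet 64 (XFst (XR 5)) ;; HSet 65 (XC 2))
       (HSet 64 (XC 0) ;; HSet 65 (XC 0))) ;;
  HCons 64 (XR 64) (XR 62) ;; HCons 64 (XR 65) (XR 64) ;; HCons 64 (XR 4) (XR 64) ;;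
  HCons 60 (XR 64) (XR 60)) s1 t1 (fun s' t' =>
    [/\ same [:: 5; 11; 12; 51; 52; 53; 54; 55; 60; 62; 63; 64; 65] s s', ha s' = ha s,
      exists side e, hint_ok co side e /\ hr s' 60 = VP (vrecord base side e co) D
    & t' <= tm + 500 * n + 200]).
  move=> fr1 ea1 r62 le1; hstep; hstep.
  case lE: (core_left co) => [|u us]; rewrite /=; last first.
    rewrite lE in r40.
    have [pu _] : proper_arities u /\ true by move: pE; rewrite lE => /andP[].
    have [i [l [E iu]]] := enc_tree_last pu; have le_u := size_enc_tree pu.
    have ul : size (frontier u) <= n.
      by move: sz; rewrite lE /frontiers /= size_cat; lia.
    do 3!hstep; apply: (wp_conseq (wp_ser _ _ (t := u) _)); first by hread.
    move=> s2 t2 [fr2 ea2 r5 le2]; rewrite E /vtoks /= in r5; do 10!hstep.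
    split; [hsame|by hread| |rewrite /= in le2 *; lia].
    exists 1, i; split; last by hread.
    by constructor 1; split=> //; exists i => //; rewrite lE /frontiers /= mem_cat iu.
  hstep.
  case rE: (core_right co) => [|u us]; rewrite /=; last first.
    rewrite rE in r43.
    have [pu _] : proper_arities u /\ true by move: pH; rewrite rE => /andP[].
    have [i [l [E iu]]] := enc_tree_last pu; have le_u := size_enc_tree pu.
    have ul : size (frontier u) <= n.
      have := perm_size (perm_frontiers (perm_rev_seq (core_right co))).
      by move: sz; rewrite rE {2}/frontiers /= size_cat; lia.
    do 3!hstep; apply: (wp_conseq (wp_ser _ _ (t := u) _)); first by hread.
    move=> s2 t2 [fr2 ea2 r5 le2]; rewrite E /vtoks /= in r5; do 10!hstep.
    split; [hsame|by hread| |rewrite /= in le2 *; lia].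
    exists 2, i; split; last by hread.
    by constructor 2; split=> //; exists i => //; rewrite rE /frontiers /= mem_cat iu.
  do 10!hstep; split; [hsame|by hread| |lia].
  by exists 0, 0; split; [constructor 3|hread].
rewrite /record_cmd; hstep; hstep; rewrite truthy_vs; case m0: (nilp mid) => /=.
  move/nilP: m0 => m0; hstep; apply: cont; [hsame|by []| |lia].
  by rewrite /= /upd /= /full_word -/mid m0.
have m0' : ~~ nilp mid by rewrite m0.
do 3!hstep; apply: (wp_conseq (wp_mkQ _ _ m0' _)); first by hread.
move=> s1 t1 [fr1 ea1 r12 le1]; hstep; apply: (wp_conseq (wp_ser _ _ r12)) => s2 t2 [fr2 ea2 r5 le2].
have pq : proper_arities (mkQ mid) by apply: proper_mkQ => //; rewrite lt0n; exact: m0'.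
have le_q := size_enc_tree pq; rewrite frontier_mkQ in le_q.
apply: (wp_conseq (wp_leaves _ r5)) => s3 t3 [fr3 ea3 r62 le3]; rewrite frontier_mkQ in r62.
by apply: cont; [hsame|hread|by []|rewrite /= in le1 le2 le3 *; lia].
Qed.

Lemma word_index p v : index v (word p) = p v.
Proof.
rewrite -{1}(permK p v) -(nth_word p v (p v)) index_uniq ?size_word //.
by rewrite (perm_uniq (perm_word p)) enum_uniq.
Qed.

Lemma foldl_minE l r c : c <= r -> (forall v, v \in l -> c <= v) -> (c \in l) || (r == c) ->
  foldl minn r l = c.
Proof.
elim: l r => [|v l IH] r le_r le_l; first by rewrite in_nil => /eqP.
rewrite /=.
have le_v : c <= v by apply: le_l; rewrite mem_head.
rewrite inE => cl; apply: IH; [by rewrite leq_min le_r|by move=> u ul; apply: le_l; rewrite inE ul orbT|].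
by move: cl; case: (c \in l) => //=; rewrite ?orbT // orbF => /orP[]/eqP eqc; apply/eqP; lia.
Qed.

Lemma wp_min s tm p y r : hr s 10 = vperm y -> hr s 70 = VN r -> (forall v : 'I_n, ha s 1 v = p v) ->
  wp inp min_cmd s tm (fun s' t' => [/\ same [:: 10; 70] s s', ha s' = ha s,
    hr s' 70 = VN (foldl minn r [seq nat_of_ord (p v) | v <- y]) & t' <= tm + 25 * size y + 2]).
Proof.
elim: y s tm r => [|v y IH] s tm r r10 r70 pA.
  by apply: wp_while_false; [hread|split=> //=; lia].
rewrite /vperm /vtoks /= in r10; have pv : ha s 1 (0 + v) = p v := pA v.
eapply wp_while_true; [hval|by []|]; do 2!hstep; rewrite ?pv.
case E: (r - p v) => [|d] /=; do 2!hstep; rewrite ?pv.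
  have -> : minn r (p v) = r by lia.
  apply: (wp_conseq (IH _ _ r _ _ _)); [by hread|by hread|by []|].
  by move=> s' t' [fr ea r' le_t]; split=> //; [hsame|lia].
have -> : minn r (p v) = p v by lia.
apply: (wp_conseq (IH _ _ (p v) _ _ _)); [by hread|by hread; rewrite ?pv ?pA|by []|].
by move=> s' t' [fr ea r' le_t]; split=> //; [hsame|lia].
Qed.

(** Letters outside the block keep their positions, and positions outside the block keep their
    letters, so it suffices to touch the block. *)
Lemma wp_relabel s tm p a x y b base : word p = a ++ x ++ b -> perm_eq y x ->
  hr s 62 = vperm y -> hr s 70 = VN (size a) -> hr s 67 = VN base ->
  (forall v : 'I_n, ha s 1 v = p v) -> (forall i : 'I_n, ha s 0 (base + i) = i) ->
  wp inp relabel_cmd s tm (fun s' t' => exists q,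
    [/\ same [:: 10; 62; 70] s s', word q = a ++ y ++ b /\ (forall v : 'I_n, ha s' 1 v = q v),
        forall i : 'I_n, ha s' 0 (base + i) = (q^-1 * p)%g i,
        forall i, ~~ (base <= i < base + n) -> ha s' 0 i = ha s 0 i
      & t' <= tm + 40 * size y + 2]).
Proof.
move=> wp_ pyx r62 r70 r67 pA rowA; have sx := perm_size pyx.
have [q wq] : exists q, word q = a ++ y ++ b.
  apply: word_of; apply: seq.perm_trans (perm_word p); rewrite wp_ perm_cat2l perm_cat2r //.
have F1 v : v \notin y -> q v = p v :> nat.
  move=> vy; have vx : v \notin x by rewrite -(perm_mem pyx).
  by rewrite -!word_index wq wp_ !index_cat (negbTE vy) (negbTE vx) sx.
have F2 (i : 'I_n) : ~~ (size a <= i < size a + size y) -> (q^-1 * p)%g i = i.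
  move=> oi; rewrite permM; have -> : q^-1%g i = p^-1%g i; last by rewrite permKV.
  rewrite -(nth_word q i i) -(nth_word p i i) wq wp_ !nth_cat -sx.
  case: (ltnP i (size a)) oi => //= le_i oi.
  by have -> : (i - size a < size y) = false by lia.
have uq : uniq (a ++ y ++ b) by rewrite -wq (perm_uniq (perm_word q)) enum_uniq.
have F3 y1 v y2 : y = y1 ++ v :: y2 -> q v = size a + size y1 :> nat.
  move=> yE; move: uq; rewrite -word_index wq yE cat_uniq => /and3P[_ /hasPn ua uy].
  have va : v \notin a by apply: ua; rewrite mem_cat mem_cat mem_head orbT.
  move: uy; rewrite cat_uniq => /and3P[+ _ _]; rewrite cat_uniq => /and3P[_ /norP[vy1 _] _].
  by rewrite index_cat (negbTE va) index_cat mem_cat mem_head orbT index_cat (negbTE vy1) /= eqxx addn0.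
have loop y2 : forall y1 s0 t0, y = y1 ++ y2 -> hr s0 62 = vperm y2 -> hr s0 67 = VN base ->
    hr s0 70 = VN (size a + size y1) ->
    (forall v : 'I_n, ha s0 1 v = if v \in y1 then q v else p v) ->
    (forall i : 'I_n, ha s0 0 (base + i) =
       if size a <= i < size a + size y1 then (q^-1 * p)%g i else i) ->
    (forall i, ~~ (base <= i < base + n) -> ha s0 0 i = ha s 0 i) ->
    wp inp relabel_cmd s0 t0 (fun s' t' =>
    [/\ same [:: 10; 62; 70] s0 s', forall v : 'I_n, ha s' 1 v = q v,
        forall i : 'I_n, ha s' 0 (base + i) = (q^-1 * p)%g i,
        forall i, ~~ (base <= i < base + n) -> ha s' 0 i = ha s 0 i
      & t' <= t0 + 40 * size y2 + 2]).
  elim: y2 => [|v y2 IH] y1 s0 t0 yE r620 r670 r700 pA0 rowA0 out0.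
    apply: wp_while_false; first by hread.
    rewrite cats0 in yE; subst y1; split=> // [v|i|]; last by rewrite /=; lia.
    - by rewrite pA0; case: ifPn => // /F1.
    - by rewrite rowA0; case: ifPn => // /F2->.
  rewrite /vperm /vtoks /= in r620; have qv := F3 _ _ _ yE.
  have vy1 : v \notin y1.
    by move: uq; rewrite yE !cat_uniq => /and3P[_ _ /and3P[/and3P[_ /norP[]]]].
  have pv : ha s0 1 (0 + v) = p v by rewrite add0n pA0 (negbTE vy1).
  eapply wp_while_true; [hval|by []|]; do 9!hstep.
  apply: (wp_conseq (IH (rcons y1 v) _ _ _ _ _ _ _ _ _)).
  - by rewrite cat_rcons.
  - by hread.
  - by hread.
  - by hread; rewrite size_rcons addnS.
  - move=> u; rewrite /= /upd /= ?add0n mem_rcons inE pA0 -(inj_eq val_inj) /=.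
    by case: eqP => [/val_inj->|_] //=; rewrite qv.
  - move=> i; rewrite /= /upd /= eqn_add2l rowA0 size_rcons.
    case: eqP => [iE|ne_i].
      rewrite ifT; last by lia.
      have -> : i = q v by apply: val_inj; rewrite /= qv.
      by rewrite permM permK ?pv; hread; rewrite ?pv ?pA0 ?(negbTE vy1).
    by have -> : (size a <= i < size a + (size y1).+1) = (size a <= i < size a + size y1) by lia.
  - move=> i oi; rewrite /= /upd /= ifF ?out0 //; apply/eqP=> iE; move: oi; rewrite iE.
    by have := ltn_ord (q v); rewrite qv; lia.
  by move=> s' t' [fr pA' row' out' le_t]; split=> //; [hsame|rewrite /= in le_t *; lia].
apply: (wp_conseq (loop y [::] s tm erefl r62 r67 _ _ _ _)) => //.
- by rewrite addn0.
- by move=> i; rewrite addn0 rowA ifF //; lia.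
by move=> s' t' [fr pA' row' out' le_t]; exists q.
Qed.

(** With nothing beside the block in the core there is no orientation to respect: the full leaves
    fit in their own order. *)
Lemma exp_to_root_free (P : pred 'I_n) frs co xs w : core_left co = [::] -> core_right co = [::] ->
  all (frame_ok P) frs -> lang (exp_tree frs co xs) w -> exists a x b,
  [/\ w = a ++ x ++ b, perm_eq x xs, ~~ has P a /\ ~~ has P b
    & lang (root_tree frs co) (a ++ full_word co ++ b)].
Proof.
move=> l0 r0 okf; rewrite /exp_tree l0 r0 cats0 cat0s.
case/lang_plug=> u [z [v [-> cx /lang_mkQ/lang_QP lz]]].
exists u, z, v; split=> //; last 2 first.
- exact: ctx_good okf cx.
- apply/lang_plug; exists u, (full_word co), v; split=> //.
  apply/lang_mkQ/lang_QP; left; rewrite /core_seq l0 r0 cats0 cat0s; exact: langs_frontiers.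
by case: lz => [/lang_block//|/langs_rev/lang_block]; rewrite perm_rev.
Qed.

(** Here [r] is the start of the block and [pe] the position of the recorded leaf. A leaf of the
    left side found before the block means an upright core, found behind it a reversed one; for the
    right side it is the opposite. *)
Definition reversed (side pe r : nat) : bool :=
  if side is k.+1 then (if 0 < r - pe then 0 < k else k == 0) else false.

(** The last clause of [exp_to_root] places the recorded leaf before or behind the block according
    to [dir], so comparing its position with the start of the block reveals the orientation. *)
Lemma back_split (X : {set 'I_n}) frs co p side e : all (frame_ok (fun i => i \in X)) frs ->
  core_ok (fun i => i \in X) co ->
  (forall w, lang (root_tree frs co) w -> perm_eq w (enum 'I_n)) ->
  lang (exp_tree frs co (enum X)) (word p) -> hint_ok co side e ->
  forall pe r : nat, (forall i : 'I_n, e = i -> pe = p i) ->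
  r = foldl minn n [seq nat_of_ord (p v) | v <- full_word co] ->
  exists a x b, [/\ word p = a ++ x ++ b, perm_eq x (full_word co),
    ~~ has (fun i => i \in X) a /\ ~~ has (fun i => i \in X) b, r = size a
    & lang (root_tree frs co)
        (a ++ (if reversed side pe r then rev (full_word co) else full_word co) ++ b)].
Proof.
move=> okf okc rperm lw hint pe r peE rdef; have af := full_word_all okc.
have perm_full a b (dir : bool) : ~~ has (fun i => i \in X) a -> ~~ has (fun i => i \in X) b ->
    lang (root_tree frs co) (a ++ (if dir then full_word co else rev (full_word co)) ++ b) ->
    perm_eq (full_word co) (enum X).
  move=> ha hb /rperm pw; have := word_full_perm pw ha _ hb.
  by case: dir {pw} => /(_ _); rewrite ?all_rev ?perm_rev; apply.
have [a [x [b [dir [wE px [ha hb] lr sub]]]]] := exp_to_root okf okc lw.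
have pf := perm_full _ _ _ ha hb lr.
(* Without full leaves the minimum keeps its initial value [n], which corresponds to an empty block
   at the end of the word. *)
case: (posnP (size (full_word co))) => [/size0nil f0|f_gt0].
  have x0 : x = [::].
    apply/nilP; rewrite /nilp (perm_size px) -(perm_size pf) f0 //.
  exists (word p), [::], [::]; rewrite rdef f0 !cats0 size_word; split=> //.
    by rewrite wE x0 has_cat (negbTE ha) (negbTE hb).
  by move: lr; rewrite f0 wE x0 !(if_same, cats0) /=; case: (dir) => /=; case: (reversed _ _ _).
have uw : uniq (word p) by rewrite (perm_uniq (perm_word p)) enum_uniq.
have rE a' x' b' : word p = a' ++ x' ++ b' -> perm_eq x' (full_word co) -> r = size a'.
  move=> wE' px'; have := uw; rewrite wE' cat_uniq => /and3P[_ /hasPn na _].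
  have pv v : v \in full_word co -> p v = size a' + index v x' :> nat.
    rewrite -(perm_mem px') => vx; rewrite -word_index wE' index_cat index_cat vx ifN //.
    by apply: na; rewrite mem_cat vx.
  rewrite rdef; apply: foldl_minE.
  - by have := congr1 size wE'; rewrite size_word size_cat; lia.
  - by move=> _ /mapP[v vf ->]; rewrite pv // leq_addr.
  - apply/orP; left; case: x' px' pv {wE' na} => [|v x'] px' pv.
      by have := perm_size px'; move: f_gt0 => /= + E; rewrite -E.
    apply/mapP; exists v; first by rewrite -(perm_mem px') mem_head.
    by rewrite pv /= ?eqxx ?addn0 // -(perm_mem px') mem_head.
have pxf : perm_eq x (full_word co) by rewrite (seq.perm_trans px) // perm_sym.
have := uw; rewrite wE cat_uniq => /and3P[_ /hasPn na ub].
have ra := rE _ _ _ wE pxf.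
have in_a i : i \in a -> p i < r.
  by move=> ia; rewrite ra -word_index wE index_cat ia index_mem.
have in_b i : i \in b -> r <= p i.
  move=> ib; rewrite ra -word_index wE index_cat ifN ?leq_addr //.
  by apply: na; rewrite mem_cat ib orbT.
case: hint => -[-> ]; last first.
  case=> l0 r0; have [a' [x' [b' [wE' px' [ha' hb'] lr']]]] := exp_to_root_free l0 r0 okf lw.
  exists a', x', b'; have pxf' : perm_eq x' (full_word co) by rewrite (seq.perm_trans px') // perm_sym.
  by split; [exact: etrans (esym wE) wE'|exact: pxf'|split|exact: (rE _ _ _ wE' pxf')|exact: lr'].
all: case=> i i_in /peE peI; exists a, x, b; split=> //; rewrite peI /reversed /=.
- case: dir sub lr => -[subl subr] lr.
    by have := in_b i (subr i i_in); rewrite -subn_eq0 => /eqP->.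
  by have := in_a i (subr i i_in); rewrite -subn_gt0 => ->.
- case: dir sub lr => -[subl subr] lr.
    by have := in_a i (subl i i_in); rewrite -subn_gt0 => ->.
  by have := in_b i (subl i i_in); rewrite -subn_eq0 => /eqP->.
Qed.

Lemma wp_side s tm side e r y : hr s 68 = VN side -> hr s 69 = VN e -> hr s 70 = VN r ->
  hr s 62 = vperm y ->
  wp inp side_cmd s tm (fun s' t' => [/\ same [:: 10; 11; 62; 71] s s', ha s' = ha s,
    hr s' 62 = vperm (if reversed side (ha s 1 e) r then rev y else y)
    & t' <= tm + 10 * size y + 60]).
Proof.
move=> r68 r69 r70 r62; rewrite /side_cmd; do 3!hstep.
have cont s1 t1 (rv : bool) : same [:: 71] s s1 -> ha s1 = ha s -> hr s1 71 = VN rv -> t1 <= tm + 40 ->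
  wp inp (HIf (XR 71) (HSet 10 (XR 62) ;; HSet 11 (XC 0) ;; revapp ;; HSet 62 (XR 11)) HSkip) s1 t1
   (fun s' t' => [/\ same [:: 10; 11; 62; 71] s s', ha s' = ha s,
    hr s' 62 = vperm (if rv then rev y else y) & t' <= tm + 10 * size y + 60]).
  move=> fr1 ea1 r71 le1; hstep; case: rv r71 => r71 /=; last first.
    by hstep; split; [hsame|by []|by hread|lia].
  do 5!hstep; apply: (wp_conseq (wp_revapp _ _ (a := map VN (map val y)) (b := [::]) _ _)); [by hread|by hread|].
  rewrite cats0 -!map_rev !size_map => s2 t2 [fr2 ea2 _ r11 le2]; hstep.
  by split; [hsame|by hread|by hread|rewrite /= ?size_map in le2 *; lia].
hstep; case: side r68 => [|k] r68 /=.
  by hstep; apply: (cont _ _ false); [hsame|by []|by hread|lia].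
hstep; rewrite ?add0n; case E: (r - ha s 1 e) => [|d] /=; hstep; rewrite ?subn1 /=; case: k r68 => [|k] r68 /=; hstep.
- by apply: (cont _ _ true); [hsame|by []|by hread|lia].
- by apply: (cont _ _ false); [hsame|by []|by hread|lia].
- by apply: (cont _ _ false); [hsame|by []|by hread|lia].
- by apply: (cont _ _ true); [hsame|by []|by hread|lia].
Qed.

Lemma wp_row s tm base : hr s 3 = VN n -> hr s 67 = VN base ->
  wp inp (down 3 (HPut 0 (XR 67) (XR 3) (XR 3))) s tm
   (fun s' t' => [/\ same [:: 3] s s', forall i, ha s' 1 i = ha s 1 i,
      forall i, i < n -> ha s' 0 (base + i) = i,
      forall i, ~~ (base <= i < base + n) -> ha s' 0 i = ha s 0 i & t' <= tm + 20 * n + 10]).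
Proof.
move=> r3 r67.
apply: (wp_down (k := n) (Inv := fun j s' t' => [/\ same [:: 3] s s', forall i, ha s' 1 i = ha s 1 i,
  forall i, j <= i < n -> ha s' 0 (base + i) = i,
  forall i, ~~ (base <= i < base + n) -> ha s' 0 i = ha s 0 i & j <= n /\ t' <= tm + 2 + 20 * (n - j)])) => //.
- by split=> //; [move=> i; lia|lia].
- move=> j s1 t1 lt_j r31 [fr a1 row out [_ le_t]]; hstep; split; first by hread.
  split; [hsame|by []| | |lia] => i.
    rewrite /= /upd /= eqn_add2l; case: eqP => [->//|ne] lt_i; apply: row; lia.
  by move=> oi; rewrite /= /upd /= ifF ?out //; apply/eqP=> iE; move: oi; rewrite iE; lia.
move=> s1 t1 _ [fr a1 row out [_ le_t]].
have row' i : i < n -> ha s1 0 (base + i) = i by move=> lt_i; apply: row.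
by split=> //; lia.
Qed.

Lemma wp_ident s tm : hr s 3 = VN n ->
  wp inp (down 3 (HPut 1 (XC 0) (XR 3) (XR 3))) s tm
   (fun s' t' => [/\ same [:: 3] s s', forall i, ha s' 0 i = ha s 0 i,
      forall i, i < n -> ha s' 1 i = i & t' <= tm + 20 * n + 10]).
Proof.
move=> r3.
apply: (wp_down (k := n) (Inv := fun j s' t' => [/\ same [:: 3] s s', forall i, ha s' 0 i = ha s 0 i,
  forall i, j <= i < n -> ha s' 1 i = i & j <= n /\ t' <= tm + 2 + 20 * (n - j)])) => //.
- by split=> //; [move=> i; lia|lia].
- move=> j s1 t1 lt_j r31 [fr a1 row [_ le_t]]; hstep; split; first by hread.
  split; [hsame|by []| |lia] => i.
  by rewrite /= /upd /= ?add0n; case: eqP => [->//|ne] lt_i; apply: row; lia.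
move=> s1 t1 _ [fr a1 row [_ le_t]].
have row' i : i < n -> ha s1 1 i = i by move=> lt_i; apply: row.
by split=> //; lia.
Qed.

Lemma wp_copy s tm : hr s 3 = VN n ->
  wp inp (down 3 (HPut 0 (XC 0) (XR 3) (XArr 1 (XC 0) (XR 3)))) s tm
   (fun s' t' => [/\ forall i, i < n -> ha s' 0 i = ha s 1 i,
      forall i, n <= i -> ha s' 0 i = ha s 0 i & t' <= tm + 20 * n + 10]).
Proof.
move=> r3.
apply: (wp_down (k := n) (Inv := fun j s' t' => [/\ forall i, ha s' 1 i = ha s 1 i,
  forall i, j <= i < n -> ha s' 0 i = ha s 1 i, forall i, n <= i -> ha s' 0 i = ha s 0 i
  & j <= n /\ t' <= tm + 2 + 20 * (n - j)])) => //.
- by split=> //; [move=> i; lia|lia].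
- move=> j s1 t1 lt_j r31 [a1 row out [_ le_t]]; hstep; split; first by hread.
  split; [by []| | |lia] => i.
    by rewrite /= /upd /= ?add0n; case: eqP => [->//|ne] lt_i; apply: row; lia.
  by move=> le_i; rewrite /= /upd /= ?add0n ifF ?out //; apply/eqP; lia.
move=> s1 t1 _ [a1 row out [_ le_t]].
have row' i : i < n -> ha s1 0 i = ha s 1 i by move=> lt_i; apply: row.
by split=> //; lia.
Qed.

Lemma wp_back (X : {set 'I_n}) frs co p side e base D s tm :
  all (frame_ok (fun i => i \in X)) frs -> core_ok (fun i => i \in X) co ->
  (forall w, lang (root_tree frs co) w -> perm_eq w (enum 'I_n)) ->
  lang (exp_tree frs co (enum X)) (word p) -> hint_ok co side e ->
  hr s 60 = VP (vrecord base side e co) D -> hr s 0 = VN n ->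
  (forall v : 'I_n, ha s 1 v = p v) ->
  wp inp back_cmd s tm (fun s' t' => exists q,
    [/\ same [:: 3; 10; 11; 60; 62; 66; 67; 68; 69; 70; 71] s s',
        hr s' 60 = D /\ lang (root_tree frs co) (word q),
        perm_on (q @: X) (q^-1 * p)%g /\ (forall v : 'I_n, ha s' 1 v = q v),
        (forall i : 'I_n, ha s' 0 (base + i) = (q^-1 * p)%g i) /\
        (forall i, ~~ (base <= i < base + n) -> ha s' 0 i = ha s 0 i)
      & t' <= tm + 200 * n + 200]).
Proof.
move=> okf okc rperm lw hint r60 r0 pA; rewrite /vrecord in r60; rewrite /back_cmd; do 17!hstep.
apply: (wp_conseq (wp_min _ (p := p) (y := full_word co) (r := n) _ _ _)); [by hread|by hread|by []|].
move=> s1 t1 [fr1 ea1 r70 le1]; hstep.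
apply: (wp_conseq (wp_side _ (side := side) (e := e) (y := full_word co) _ _ r70 _)); [by hread|by hread|by hread|].
move=> s2 t2 [fr2 ea2 r62 le2].
have pe (i : 'I_n) : e = i -> ha s1 1 e = p i by move=> ->; rewrite ea1 /=; exact: pA.
have [a [x [b [wE px [na nb] rE lr]]]] := back_split okf okc rperm lw hint pe erefl.
move: r62 lr; set y := (if _ then rev _ else _) => r62 lr.
have sy : size y = size (full_word co) by rewrite /y; case: (reversed _ _ _); rewrite ?size_rev.
have ay : all (fun i => i \in X) y.
  by rewrite /y; case: (reversed _ _ _); rewrite ?all_rev (full_word_all okc).
have pyx : perm_eq y x by rewrite /y; case: (reversed _ _ _); rewrite ?perm_rev perm_sym.
have szf : size (full_word co) <= n.
  have := congr1 size wE; rewrite size_word !size_cat (perm_size px) => sE.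
  by apply: leq_trans (eq_leq (esym sE)); rewrite addnCA leq_addr.
do 3!hstep.
apply: (wp_conseq (wp_row _ (base := base) _ _)); [by hread|by hread|].
move=> s3 t3 [fr3 a3 row3 out3 le3].
apply: (wp_conseq (wp_relabel _ wE pyx (base := base) _ _ _ _ _)).
- by hread.
- by hread; rewrite rE.
- by hread.
- by move=> v; rewrite a3 /= ea2 ea1 /=; exact: pA.
- by move=> i; apply: row3.
move=> s4 t4 [q [fr4 [wq a4] row4 out4 le4]]; exists q; split.
- by hsame.
- by split; [hread|rewrite wq].
- split=> //; apply: (perm_on_word p wq na ay nb).2; exists x => //; by rewrite perm_sym.
- by split=> // i oi; rewrite out4 // out3 //= ea2 ea1.
by rewrite sy in le4; lia.
Qed.

End ChainSteps.

(** * The forward pass with its records, and the walk back *)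

Section ChainRun.
Variables (n m : nat) (I : instance n m) (rest : seq nat).
Hypotheses (n0 : 0 < n) (m0 : 0 < m).
Local Notation inp := (enc_instance I ++ rest).

Fixpoint records_ok (k : nat) (D : datum) : Prop :=
  if k is j.+1 then
    exists t frs co side e D',
      [/\ expanded I j = Some t, body I k t = Some (frs, co), hint_ok co side e,
          D = VP (vrecord (k * n) side e co) D' & records_ok j D']
  else D = VN 0.

Lemma core_bound (X : {set 'I_n}) (Pi : {set 'S_n}) frs co : core_ok (fun i => i \in X) co ->
  represents (root_tree frs co) Pi ->
  all (@proper_arities n) (core_seq co) /\ size (frontiers (core_seq co)) <= n.
Proof.
move=> okc rt; have [_ sz _] := represents_size rt; split.
  case/and5P: okc => gE gF gG gH _.
  by rewrite !all_cat !all_rev (good_e_proper gE) (good_f_proper gF) (good_f_proper gG) (good_e_proper gH).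
have [u [z [v [wE _ lz]]]] := (lang_plug _ _ _).1 (lang_frontier (root_tree frs co)).
have := congr1 size wE; rewrite sz !size_cat (perm_size (lang_perm lz)) frontier_mkQ => E.
apply: leq_trans (eq_leq (esym E)); by rewrite addnCA leq_addr.
Qed.

Definition forward_inv (tm j : nat) (s : hst) (t : nat) : Prop :=
  [/\ hr s 0 = VN n, hr s 2 = VN (2 + (m - j) * n), hr s 4 = VN ((m - j) * n),
      j <= m /\ t <= tm + 4800 * n * (m - j)
    & records_ok (m - j) (hr s 60) /\
      exists2 u, expanded I (m - j) = Some u & hr s 5 = vtoks (rev (enc_tree u))].

Lemma wp_forward tm j s t : nice I -> j < m -> hr s 58 = VN j.+1 -> forward_inv tm j.+1 s t ->
  wp inp (step_cmd ;; bump 4 ;; record_cmd ;; HSet 12 (XR 49) ;; ser_cmd ;; advance)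
    (HSt (upd (hr s) 58 (VN j)) (ha s)) (t + 7)
    (fun s' t' => hr s' 58 = VN j /\ forward_inv tm j s' t').
Proof.
move=> nI lt_j r58 [r0 r2 r4 [le_j le_t] [rec [u E r5]]]; have kE : m - j = (m - j.+1).+1 by lia.
have timeE : 4800 * n * (m - j) = 4800 * n * (m - j.+1) + 4800 * n by rewrite kE mulnS addnC.
have lt_k : m - j.+1 < m by lia.
move: (m - j.+1) kE timeE lt_k le_t r2 r4 rec E => k kE timeE lt_k le_t r2 r4 rec E.
have [pu su le4] := represents_size (expanded_represents n0 E).
hstep; apply: (wp_conseq (wp_round n0 rest _ lt_k (t := u) _ _ E _)); [by hread|by hread|by hread|].
move=> s2 t2 [fr2 ea2 r19 regs le2]; hstep.
(* Niceness excludes a failed reduction, which is why the program goes on without testing for it. *)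
case B: (body I k.+1 u) regs => [[frs co]|] regs; last by case: (stuck_not_nice n0 m0 lt_k E B).
have [r48 r49 r46 r40 r43] := regs _ _ erefl.
have := red_body (fun i => i \in wset I k.+1) pu; rewrite [body_of _]B => -[okf okc _].
have ER : reduced I k.+1 = Some (root_tree frs co) by rewrite /= E B.
have EE : expanded I k.+1 = Some (exp_tree frs co (enum (wset I k.+1))) by rewrite /= E B.
have [pcore szcore] := core_bound okc (reduced_represents n0 ER).
have [_ _ leE] := represents_size (expanded_represents n0 EE).
apply: (wp_conseq (wp_bump _ _ (r := 4) (n := n) (b := k * n) _ _ _)); [by []|by hread|by hread|].
move=> s3 t3 [fr3 r43' ea3 le3]; hstep.
apply: (wp_conseq (wp_record _ _ (base := k.+1 * n) (co := co) (D := hr s 60) _ _ _ _ _ pcore szcore));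
  [by hread|by hread|by hread|by rewrite mulSn addnC|by hread|].
move=> s4 t4 [fr4 ea4 [side [e [hint r60]]] le4']; do 3!hstep.
apply: (wp_conseq (wp_ser _ _ (t := exp_tree frs co (enum (wset I k.+1))) _)); first by hread.
move=> s5 t5 [fr5 ea5 r55 le5].
apply: (wp_conseq (wp_advance _ _ (n := n) (b := 2 + k * n) _ _)); [by hread|by hread|].
move=> s6 t6 [fr6 r26 ea6 le6]; split; first by hread.
rewrite /forward_inv timeE kE; split.
- by hread.
- by rewrite r26; congr VN; lia.
- by hread; congr VN; lia.
- by split; [lia|clear r2 r4 r26 r43'; lia].
split; last by exists (exp_tree frs co (enum (wset I k.+1))); [|hread].
exists u, frs, co, side, e, (hr s 60); split=> //.
by rewrite (fr6 60 isT) (fr5 60 isT).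
Qed.

Definition chain_row (f : nat -> 'S_n) (j : nat) : 'S_n := ((f j)^-1 * f j.+1)%g.

(** The permutations are found from the last to the first: [f] is settled from index [k + 1] on, and
    each round overrides its value at [k], leaving the later quotients as they are. *)
Lemma wp_backs k : forall s tm f u, records_ok k (hr s 60) -> hr s 0 = VN n -> k <= m ->
  expanded I k = Some u -> lang u (word (f k.+1)) ->
  (forall v : 'I_n, ha s 1 v = f k.+1 v) ->
  (forall j, k < j <= m -> consecutive (f j @: wset I j) /\ perm_on (f j @: wset I j) (chain_row f j)) ->
  (forall j, k < j <= m -> forall i : 'I_n, ha s 0 (j * n + i) = chain_row f j i) ->
  wp inp (HWhile (XR 60) back_cmd) s tm (fun s' t' => exists g : nat -> 'S_n,
    [/\ hr s' 0 = VN n, forall v : 'I_n, ha s' 1 v = g 1 v,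
        forall j, 0 < j <= m -> consecutive (g j @: wset I j) /\ perm_on (g j @: wset I j) (chain_row g j),
        forall j, 0 < j <= m -> forall i : 'I_n, ha s' 0 (j * n + i) = chain_row g j i
      & t' <= tm + 500 * n * k + 2]).
Proof.
elim: k => [|k IH] s tm f u rec r0 le_k E lw pA ok rows.
  rewrite /= in rec; apply: wp_while_false; first by rewrite /= rec.
  by exists f; split=> //=; lia.
case: rec => t [frs [co [side [e [D [Et B hint r60 rec]]]]]].
have uE : u = exp_tree frs co (enum (wset I k.+1)) by move: E; rewrite /= Et B => -[].
rewrite uE in lw; eapply wp_while_true; [hval|by []|].
have rt := expanded_represents n0 Et; have [pt _ _] := represents_size rt.
have := red_body (fun i => i \in wset I k.+1) pt; rewrite [body_of _]B => -[okf okc _].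
have rr := represents_root rt B.
have rperm w : lang (root_tree frs co) w -> perm_eq w (enum 'I_n).
  by move=> /lang_perm pw; apply: seq.perm_trans pw _; case: rr => /andP[].
apply: (wp_conseq (wp_back _ _ okf okc rperm lw hint r60 r0 pA)).
move=> s1 t1 [q [fr1 [r601 lq] [qX pA1] [row1 out1] le1]].
have [qP qc] : q \in Pi'_ I k.+1 /\ consecutive (q @: wset I k.+1).
  by have := (rr.2 q).1 ((consistent_invE _ _).2 lq); rewrite inE => /andP.
have lt_q : lang t (word q) by apply/consistent_invE; apply/(rt.2 q).
pose g i := if i == k.+1 then q else f i.
have gk : g k.+1 = q by rewrite /g eqxx.
have gj j : k.+1 < j -> g j = f j by move=> lt; rewrite /g ifF //; apply/eqP; lia.
have rowk : chain_row g k.+1 = (q^-1 * f k.+2)%g by rewrite /chain_row gk gj.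
have rowj j : k.+1 < j -> chain_row g j = chain_row f j by move=> lt; rewrite /chain_row !gj //; lia.
apply: (wp_conseq (IH s1 t1 g t _ _ _ Et _ _ _ _)).
- by rewrite r601.
- by rewrite fr1.
- exact: ltnW.
- by rewrite gk.
- by rewrite gk.
- move=> j /andP[]; rewrite leq_eqVlt => /predU1P[<- _|lt_j le_j]; first by rewrite rowk gk.
  by rewrite rowj // gj //; apply: ok; rewrite lt_j.
- move=> j /andP[]; rewrite leq_eqVlt => /predU1P[<- _|lt_j le_j] i; first by rewrite rowk.
  rewrite rowj // out1 ?rows ?lt_j // mulSn.
  have : k.+2 * n <= j * n by rewrite leq_mul2r lt_j orbT.
  by rewrite !mulSn; lia.
move=> s2 t2 [g' [r02 pA2 ok2 rows2 le2]]; exists g'; split=> //.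
by rewrite mulnS; rewrite /= in le1; lia.
Qed.

Lemma wp_chain : nice I -> wp inp chain_prog hinit 0 (fun s' t' => exists d : m.-tuple 'S_n,
  [/\ ascending_to_wppsg0 I d,
      forall i, i < size (enc_description d) -> ha s' 0 i = nth 0 (enc_description d) i
    & t' <= 2 * 4000 * (m * n)]).
Proof.
move=> nI; have nN : n <= m * n by rewrite leq_pmull.
have mN : m <= m * n by rewrite leq_pmulr.
rewrite /chain_prog; hstep; apply: (wp_conseq (wp_load_sizes (n := n) (m := m) _ _ _ _)) => //.
move=> s1 t1 [fr1 ea1 [r0 r1] r2 ->]; hstep.
apply: (wp_conseq (wp_init _ _ n0 r0)) => s2 t2 [fr2 ea2 r12 le2]; hstep.
apply: (wp_conseq (wp_ser _ _ r12)) => s3 t3 [fr3 ea3 r5 le3]; do 7!hstep.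
have [_ _ le4] := represents_size (star_represents n0).
apply: (wp_down (k := m) (Inv := forward_inv (600 * n))).
- by hread.
- rewrite /forward_inv subnn muln0 mul0n !addn0; split; [by hread|by hread|by hread|by split=> //; lia|].
  by split=> //; exists (star n); [|hread].
- by move=> j s4 t4; apply: wp_forward.
rewrite /forward_inv subn0 => s4 t4 _ [r04 _ _ [_ le_t4] [rec [u E r54]]].
have {le_t4} le_t4 : t4 <= 600 * n + 4800 * (m * n) by rewrite -mulnA [n * m]mulnC in le_t4.
have [_ su le_u] := represents_size (expanded_represents n0 E).
hstep; apply: (wp_conseq (wp_leaves _ _ r54)) => s5 t5 [fr5 ea5 r62 le5]; do 7!hstep.
apply: (wp_conseq (wp_row _ _ (n := n) (base := 0) _ _)); [by hread|by hread|].
move=> s6 t6 [fr6 a6 row6 _ le6]; do 3!hstep.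
apply: (wp_conseq (wp_ident _ _ (n := n) _)); [by hread|].
move=> s7 t7 [fr7 a7 row7 le7]; hstep.
have w1 : word 1%g = [::] ++ enum 'I_n ++ [::].
  by rewrite cats0 /= /word invg1 (eq_map (@perm1 _)) map_id.
have pu : perm_eq (frontier u) (enum 'I_n) by case: (expanded_represents n0 E) => /andP[].
apply: (wp_conseq (wp_relabel _ _ w1 pu (base := 0) _ _ _ _ _)).
- by hread.
- by hread.
- by hread.
- by move=> v; rewrite row7 // perm1.
- by move=> i; rewrite a7 row6.
move=> s8 t8 [p [fr8 [wp_ a8] _ _ le8]]; rewrite cats0 /= in wp_; hstep.
(* Only the value at [m + 1] counts at the outset; the conditions on the rows up to [m] are still
   vacuous. *)
apply: (wp_conseq (@wp_backs m s8 t8 (fun=> p) u _ _ (leqnn m) E _ a8 _ _)).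
- by rewrite (fr8 60 isT) (fr7 60 isT) /= /upd /= (fr6 60 isT) /= /upd /= (fr5 60 isT).
- by hread.
- by rewrite wp_; exact: lang_frontier.
- by move=> j; lia.
- by move=> j; lia.
move=> s9 t9 [f [r09 pA9 ok9 rows9 le9]]; do 2!hstep.
apply: (wp_conseq (wp_copy _ _ (n := n) _)); first by hread.
move=> s10 t10 [row0 out le10].
have chain : pi_chain I f.
  split=> j lt_j; first by case: (ok9 j lt_j).
  have [|_] := ok9 j; first by lia.
  by rewrite -(perm_on_conj (wset I j) (f j) (f j.+1 * (f j)^-1)%g) mulgA mulgKV.
eexists; split; [exact: pi_chain_descr m0 chain| |].
- move=> i; rewrite size_enc_description => lt_i.
  have lt_k : i %/ n < m by rewrite ltn_divLR.
  have lt_r : i %% n < n by rewrite ltn_mod.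
  rewrite [in RHS](divn_eq i n) (nth_flatten_rows 1%g) ?size_tuple //; last by move=> q _; apply: size_enc_perm.
  rewrite -[i %% n]/(nat_of_ord (Ordinal lt_r)) nth_enc_perm -(tnth_nth _ _ (Ordinal lt_k)) tnth_mktuple /=.
  (* Row 0 is the final copy of [pi_1]; the other rows were written as quotients during the walk
     back. *)
  have := divn_eq i n; case: (i %/ n) lt_k => [|k] lt_k iE.
    have lt_i0 : i < n by move: iE; rewrite mul0n add0n => ->.
    rewrite row0 // -pA9; congr (ha s9 1 _); by rewrite /= modn_small.
  rewrite {1}iE out; last by rewrite mulSn; lia.
  by rewrite /= -(rows9 k.+1) // (ltnW lt_k).
have le9' : t9 <= t8 + 2 + 500 * (m * n) + 2 by move: le9; rewrite -mulnA [n * m]mulnC; lia.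
by rewrite su in le8; lia.
Qed.

End ChainRun.

Lemma chain_runs : exists (c : cmd) (C : nat), forall (n m : nat) (I : instance n m)
    (T' T : nat -> pqtree n),
  0 < n -> 0 < m -> nice I ->
  (forall j, 1 <= j <= m -> represents (T j) (Pi_ I j)) ->
  (forall j, 2 <= j <= m -> represents (T' j) (Pi'_ I j)) ->
  runs_within c C (m * n) (enc_instance I ++ enc_trees T' T 1 m)
    (fun out => exists d : m.-tuple 'S_n,
       ascending_to_wppsg0 I d /\ out = enc_description d).
Proof.
have [C runs] := @compile_runs chain_prog 2 (2 * 4000) 20 isT.
exists (Then (prelude (2 * (20 + 2 * 4000)) 2) (hcomp chain_prog)), C.
move=> n m I T' T n0 m0 nI rT rT'; have N0 : 0 < m * n by rewrite muln_gt0 m0.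
have nN := leq_pmull n m0.
have tree_ok t (Pi : {set 'S_n}) : represents t Pi ->
    size (enc_tree t) <= 4 * n /\ all (fun k => k <= 20 * (m * n)) (enc_tree t).
  move=> rt; have [pt sf le4] := represents_size rt; split=> //.
  by apply: sub_all (enc_tree_bound pt (leqnn _)) => k; rewrite sf; lia.
have ok1 := tree_ok _ _ (rT 1 m0).
have okj j : j \in index_iota 2 m.+1 ->
    size (enc_tree (T' j) ++ enc_tree (T j)) <= 8 * n /\
    all (fun k => k <= 20 * (m * n)) (enc_tree (T' j) ++ enc_tree (T j)).
  rewrite mem_index_iota ltnS => lt_j.
  have [|s1 a1] := tree_ok (T j) (Pi_ I j); first by apply: rT; lia.
  have [|s2 a2] := tree_ok (T' j) (Pi'_ I j); first exact: rT'.
  by rewrite size_cat all_cat a1 a2; split=> //; lia.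
have [T0 [s' [ex [d [asc out le_T]]]]] := wp_chain (enc_trees T' T 1 m) n0 m0 nI.
apply: (runs n m _ s' T0 (enc_description d)) => //.
- rewrite all_cat; apply/andP; split.
    by apply: sub_all (enc_instance_bound I N0) => k; lia.
  rewrite all_cat; apply/andP; split; first by case: ok1.
  apply/allP=> k /flattenP[_ /mapP[j /okj[_ /allP aj] ->]]; exact: aj.
- have le_fl : size (flatten [seq enc_tree (T' j) ++ enc_tree (T j) | j <- index_iota 2 m.+1]) <= 8 * (m * n).
    apply: leq_trans (size_flatten_le (fun j jin => (okj j jin).1)) _.
    by rewrite size_iota -mulnA leq_pmul2l // [m * n]mulnC leq_mul2l; apply/orP; right; lia.
  by rewrite size_cat size_enc_instance /enc_trees size_cat; case: ok1 => le1 _; lia.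
- by rewrite size_enc_description; lia.
- by exists d.
Qed.

Theorem theorem6p6 :
  [/\ (* (1) *)
      exists (c : cmd) (C : nat), forall (n m : nat) (I : instance n m),
        0 < n -> 0 < m ->
        runs_within c C (m * n) (enc_instance I)
          (fun out =>
             (~ nice I /\ out = [:: 0]) \/
             (nice I /\ exists T' T : nat -> pqtree n,
                [/\ forall j, j <= m -> represents (T j) (Pi_ I j),
                    forall j, 1 <= j <= m -> represents (T' j) (Pi'_ I j)
                  & out = 1 :: enc_trees T' T 0 m])),
      (* (2) *)
      exists (c : cmd) (C : nat), forall (n m : nat) (I : instance n m)
          (T' T : nat -> pqtree n),
        0 < n -> 0 < m -> nice I ->
        (forall j, 1 <= j <= m -> represents (T j) (Pi_ I j)) ->
        (forall j, 2 <= j <= m -> represents (T' j) (Pi'_ I j)) ->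
        runs_within c C (m * n) (enc_instance I ++ enc_trees T' T 1 m)
          (fun out => exists d : m.-tuple 'S_n,
             ascending_to_wppsg0 I d /\ out = enc_description d),
      (* (3) *)
      exists (c : cmd) (C : nat), forall (n m : nat) (I : instance n m)
          (d : m.-tuple 'S_n),
        0 < n -> 0 < m -> ascending_to_wppsg0 I d ->
        runs_within c C (m * n) (enc_instance I ++ enc_description d)
          (fun out => out = enc_instance (chain_instance I d m))
    & (* (4) *)
      exists (c : cmd) (C : nat), forall (n m : nat) (I : instance n m)
          (d : m.-tuple 'S_n),
        0 < n -> 0 < m -> ascending_to_wppsg0 I d ->
        runs_within c C (m * n) (enc_instance (chain_instance I d m))
          (fun out => exists b : bool,
             (b <-> yes_instance (chain_instance I d m)) /\
             out = [:: nat_of_bool b])].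
Proof.
split; [exact: pq_runs|exact: chain_runs| | ].
- by have [c [C run]] := follow_runs; exists c, C => n m I d n0 m0 _; exact: run.
- have [c [C run]] := decide_runs; exists c, C => n m I d n0 m0 asc.
  by apply: run => //; exact: asc.2.
Qed.
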